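(* Let $q$ be a prime power, $n\ge 2$, and let $\mathcal{L}$ be a non-empty set of lines of $\mathrm{PG}(n,q)$. Then $\mathcal{L}$ is the line set of a naturally embedded split Cayley hexagon $\mathbf{H}(q)$ in $\mathrm{PG}(6,q)$ if and only if $\mathcal{L}$ satisfies all of the following: (Pt) every point of $\mathrm{PG}(n,q)$ is incident with either $0$ or $q+1$ elements of $\mathcal{L}$; (Pl) every plane of $\mathrm{PG}(n,q)$ contains either $0$, $1$ or $q+1$ elements of $\mathcal{L}$; (Sd) every solid ($3$-dimensional subspace) of $\mathrm{PG}(n,q)$ contains either $0$, $1$, $q+1$ or $2q+1$ elements of $\mathcal{L}$; (Hp') every $5$-dimensional subspace of $\mathrm{PG}(n,q)$ contains at most $q^4-q^3+3q^2+2q$ elements of $\mathcal{L}$; (To) $|\mathcal{L}|\le q^5+q^4+q^3+q^2+q+1$.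
   Context: A line is said to be contained in (incident with) a subspace if it is a subset of it. The natural embedding of the split Cayley hexagon $\mathbf{H}(q)$ in $\mathrm{PG}(6,q)$ with homogeneous coordinates $(x_0,\dots,x_6)$: its points are the points of the parabolic quadric $\mathbf{Q}(6,q)$ given by $x_0x_4+x_1x_5+x_2x_6=x_3^2$, and its lines are those lines of $\mathbf{Q}(6,q)$ whose Grassmann coordinates $p_{ij}=x_iy_j-x_jy_i$ (for a line spanned by points $x,y$) satisfy $p_{12}=p_{34}$, $p_{54}=p_{32}$, $p_{20}=p_{35}$, $p_{65}=p_{30}$, $p_{01}=p_{36}$, $p_{46}=p_{31}$. ''$\mathcal{L}$ is the line set of a naturally embedded split Cayley hexagon in $\mathrm{PG}(6,q)$'' means that $\mathcal{L}$ spans a $6$-dimensional subspace of $\mathrm{PG}(n,q)$ and, up to a projectivity, $\mathcal{L}$ is exactly the line set of this natural embedding of $\mathbf{H}(q)$. *)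

(* Defs.v *)
(* PG(n,q) = projective geometry of the vector space 'rV[F]_(n.+1)
   over a finite field F with #|F| = q. A projective k-dimensional subspace is
   represented canonically by the square matrix <<A>>%MS of rank k+1. *)
From HB Require Import structures.
From mathcomp Require Import all_boot all_order all_algebra.
Set Implicit Arguments. Unset Strict Implicit. Unset Printing Implicit Defensive.
Import Order.TTheory GRing.Theory Num.Theory.
Local Open Scope ring_scope.

Definition proj_sub (F : fieldType) (m k : nat) (A : 'M[F]_m) : bool :=
  (\rank A == k.+1)%N && (<<A>>%MS == A).

Definition cd (F : fieldType) (v : 'rV[F]_7) (i : nat) : F := v 0 (inord i).

Definition Q6 (F : fieldType) (v : 'rV[F]_7) : F :=
  cd v 0%N * cd v 4%N + cd v 1%N * cd v 5%N + cd v 2%N * cd v 6%N - cd v 3%N ^+ 2.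

Definition pg (F : fieldType) (x y : 'rV[F]_7) (i j : nat) : F :=
  cd x i * cd y j - cd x j * cd y i.

Definition hex_grassmann (F : fieldType) (x y : 'rV[F]_7) : Prop :=
  pg x y 1%N 2%N = pg x y 3%N 4%N /\ pg x y 5%N 4%N = pg x y 3%N 2%N /\ pg x y 2%N 0%N = pg x y 3%N 5%N /\
  pg x y 6%N 5%N = pg x y 3%N 0%N /\ pg x y 0%N 1%N = pg x y 3%N 6%N /\ pg x y 4%N 6%N = pg x y 3%N 1%N.

Definition hex_line (F : fieldType) (l : 'M[F]_7) : Prop :=
  [/\ proj_sub 1 l,
      (forall v : 'rV[F]_7, (v <= l)%MS -> Q6 v = 0) &
      (exists x y : 'rV[F]_7, (col_mx x y == l)%MS /\ hex_grassmann x y)].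

(* L is the line set of a naturally embedded split Cayley hexagon in a PG(6,q)
   inside PG(n,q): L spans a 6-dimensional subspace and, up to a projectivity
   (injective linear map F^7 -> F^(n+1)), equals the line set of H(q). *)
Definition is_hexagon_lineset (F : finFieldType) (n : nat) (L : {set 'M[F]_n.+1}) : Prop :=
  \rank (\sum_(l in L) l)%MS = 7%N /\
  exists M : 'M[F]_(7, n.+1), row_free M /\
    (forall l : 'M[F]_n.+1, l \in L <->
       exists h : 'M[F]_7, hex_line h /\ l = <<h *m M>>%MS).

Definition nb_in (F : finFieldType) (m : nat) (L : {set 'M[F]_m}) (S : 'M[F]_m) : nat :=
  #|[set l in L | (l <= S)%MS]|.

(* Main.v *)
(** Points are nonzero vectors up to scalars. By (Pt), (Pl) and (Sd), the lines of
L through a covered point x fill a plane [perp x], a solid contains at most two such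
planes, and there are no triangles or quadrangles. Fix l in L. The cosets y + l of
points y far from l are analysed through the solids spanned by l, y and a line
through y; if y has two distinct points of l at distance two (a pentagon), then all
of y + l is covered and the planes at its points lie in one common 5-space H. By (To),
double counting the paths from l to far points then yields a coset with so many
directions that H contains more lines than (Hp') allows. Hence there are no
pentagons, and L is the line set of a generalized hexagon of order q.

The points at distance at most two from w span a hyperplane [tspace w] of the 6-space
spanned by L. An apartment a1, b2, a3, b1, a2, b3 together with a point e of the six
hyperplanes of its vertices is a basis in which (0, 0, b) lies in [perp (a, 0, 0)] iff
a.b = 0; writing perp (a, 0, b) = <(a, 0, 0), (0, 0, b), (c, 1, d)> one gets a x c = k1 b
and b x d = k2 a with constants k1, k2, and rescaling the basis turns these into
the Grassmann equations of H(q). Equality follows since |L| is at least the number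
of lines of H(q).

Conversely, two points of H(q) are collinear iff their product as traceless split
octonions vanishes. A chart of the plane of points collinear with x gives (Pt) and (Pl);
totally singular subspaces have rank at most 3 and alternativity makes two opposite lines
span a regulus of lines, which gives (Sd); a point whose plane lies in a hyperplane is an
eigenvector of left multiplication by a fixed octonion, with at most two eigenvalues, which
bounds the lines in that hyperplane. *)
Require Import Defs.
From HB Require Import structures.
From mathcomp Require Import all_boot all_order all_algebra.
From mathcomp Require Import zify ring.
Set Implicit Arguments. Unset Strict Implicit. Unset Printing Implicit Defensive.
Import Order.TTheory GRing.Theory Num.Theory.
Local Open Scope ring_scope.

(** * Row spaces over a field *)

Ltac in_span :=
  first [ done | exact: submx_refl | exact: sub0mx
  | lazymatch goal with
    | |- is_true (@submx _ _ _ _ (@addsmx _ _ _ _ _ _) _) =>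
        rewrite addsmx_sub; apply/andP; split; in_span
    end
  | lazymatch goal with
    | |- is_true (@submx _ _ _ _ ?X (@addsmx _ _ _ _ ?A ?B)) =>
        first [ solve [apply: (@submx_trans _ _ _ _ _ X B _ _ (addsmxSr A B)); in_span]
              | solve [apply: (@submx_trans _ _ _ _ _ X A _ _ (addsmxSl A B)); in_span] ]
    end
  | lazymatch goal with
    | |- is_true (@submx _ _ _ _ (GRing.add _ _) _) => apply: addmx_sub; in_span
    | |- is_true (@submx _ _ _ _ (GRing.scale _ _) _) => apply: scalemx_sub; in_span
    | |- is_true (@submx _ _ _ _ (GRing.opp _) _) => rewrite eqmx_opp; in_span
    end
  | idtac ].

Ltac rV_ring := apply/rowP => ?; rewrite !mxE; ring.

Section RowSpaces.
Variables (F : fieldType) (N : nat).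
Implicit Types (u v w : 'rV[F]_N) (a b c d : F).

Lemma rank_rV1 v : v != 0 -> \rank v = 1%N.
Proof. by move=> v0; rewrite rank_rV v0. Qed.

Lemma submx_rank_leq m1 m2 (A : 'M[F]_(m1, N)) (B : 'M_(m2, N)) :
  (A <= B)%MS -> (\rank B <= \rank A)%N -> (B <= A)%MS.
Proof. by move=> sAB rBA; have [_ <-] := mxrank_leqif_sup sAB; rewrite eqn_leq mxrankS. Qed.

Lemma submx_rank_eq m1 m2 (A : 'M[F]_(m1, N)) (B : 'M_(m2, N)) :
  (A <= B)%MS -> \rank A = \rank B -> (B <= A)%MS.
Proof. by move=> AB e; rewrite submx_rank_leq ?e. Qed.

Lemma ltn_rank_cap m1 m2 (A : 'M[F]_(m1, N)) (B : 'M_(m2, N)) :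
  ~~ (A <= B)%MS -> (\rank (A :&: B)%MS < \rank A)%N.
Proof.
rewrite ltnNge; apply: contra => rA.
exact: submx_trans (submx_rank_leq (capmxSl A B) rA) (capmxSr A B).
Qed.

Lemma leq_rank_cap m1 m2 m3 (A : 'M[F]_(m1, N)) (B : 'M_(m2, N)) (C : 'M_(m3, N)) :
  (A <= C)%MS -> (B <= C)%MS -> (\rank A + \rank B <= \rank C + \rank (A :&: B)%MS)%N.
Proof.
move=> AC BC; have := mxrank_sum_cap A B.
have : (\rank (A + B)%MS <= \rank C)%N by apply: mxrankS; in_span.
lia.
Qed.

Lemma cap_nonzero_vec m1 m2 m3 (A : 'M[F]_(m1, N)) (B : 'M_(m2, N)) (C : 'M_(m3, N)) :
  (A <= C)%MS -> (B <= C)%MS -> (\rank C < \rank A + \rank B)%N ->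
  exists v : 'rV_N, [/\ v != 0, (v <= A)%MS & (v <= B)%MS].
Proof.
move=> AC BC rC; have : (0 < \rank (A :&: B)%MS)%N by have := leq_rank_cap AC BC; lia.
rewrite lt0n mxrank_eq0 => /rowV0Pn[v vAB v0].
by exists v; split=> //; rewrite (submx_trans vAB) ?capmxSl ?capmxSr.
Qed.

Lemma rank_adds_disjoint m1 m2 (A : 'M[F]_(m1, N)) (B : 'M_(m2, N)) :
  (forall v, (v <= A)%MS -> (v <= B)%MS -> v = 0) -> \rank (A + B)%MS = (\rank A + \rank B)%N.
Proof.
move=> AB0; have := mxrank_sum_cap A B.
suff -> : (A :&: B)%MS = 0 by rewrite mxrank0 addn0.
by apply/eqP/rowV0P => v; rewrite sub_capmx => /andP[]; exact: AB0.
Qed.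

Lemma notsub_neq0 v m (A : 'M[F]_(m, N)) : ~~ (v <= A)%MS -> v != 0.
Proof. by apply: contraNneq => ->; rewrite sub0mx. Qed.

Lemma submx_vec_sym u v : u != 0 -> (u <= v)%MS -> (v <= u)%MS.
Proof. by move=> u0 uv; apply: submx_rank_leq uv _; rewrite (rank_rV1 u0) rank_leq_row. Qed.

Lemma notsub_vec_sym u v : u != 0 -> ~~ (v <= u)%MS -> ~~ (u <= v)%MS.
Proof. by move=> u0; apply: contra; apply: submx_vec_sym. Qed.

Lemma rank_adds_notin m (A : 'M[F]_(m, N)) v :
  ~~ (v <= A)%MS -> \rank (A + v)%MS = (\rank A).+1.
Proof.
move=> vA; have v0 := notsub_neq0 vA.
rewrite rank_adds_disjoint ?rank_rV1 ?addn1 // => w wA wv; apply/eqP; apply: contraNT vA => w0.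
exact: submx_trans (submx_vec_sym w0 wv) wA.
Qed.

Lemma rank_adds_vec m (A : 'M[F]_(m, N)) v : (\rank (A + v)%MS <= (\rank A).+1)%N.
Proof.
apply: leq_trans (mxrank_adds_leqif A v).1 _.
by rewrite -[X in (_ <= X)%N]addn1 leq_add2l rank_leq_row.
Qed.

Lemma adds_vec_exchange m (A : 'M[F]_(m, N)) u v :
  (v <= A + u)%MS -> ~~ (v <= A)%MS -> (u <= A + v)%MS.
Proof.
move=> vAu vA; have AvAu : (A + v <= A + u)%MS by in_span.
apply: submx_trans (addsmxSr A u) (submx_rank_leq AvAu _).
by rewrite (rank_adds_notin vA) rank_adds_vec.
Qed.

Lemma sub_adds_vec_cap k1 k2 (A : 'M[F]_(k1, N)) (B : 'M[F]_(k2, N)) u v :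
  (u <= A + v)%MS -> (u <= B)%MS -> ~~ (v <= A + B)%MS -> (u <= A)%MS.
Proof.
move=> uAv uB nvAB; apply: contraT => nuA; case/negP: nvAB.
by apply: submx_trans (adds_vec_exchange uAv nuA) _; in_span.
Qed.

Lemma rank_span2 u v : u != 0 -> ~~ (v <= u)%MS -> \rank (u + v)%MS = 2%N.
Proof. by move=> u0 vu; rewrite rank_adds_notin // rank_rV1. Qed.

Lemma eqmx_span2 m (A : 'M[F]_(m, N)) u v : \rank A = 2%N -> u != 0 -> ~~ (v <= u)%MS ->
  (u <= A)%MS -> (v <= A)%MS -> (A :=: u + v)%MS.
Proof.
move=> rA u0 vu uA vA; have uvA : (u + v <= A)%MS by in_span.
by apply/eqmxP; rewrite uvA andbT submx_rank_eq // rank_span2.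
Qed.

Lemma exists_notin m1 m2 (A : 'M[F]_(m1, N)) (B : 'M_(m2, N)) :
  (\rank A < \rank B)%N -> exists v : 'rV_N, (v <= B)%MS /\ ~~ (v <= A)%MS.
Proof.
move=> rAB; have : ~~ (B <= A)%MS by apply: contraL rAB => /mxrankS; rewrite -leqNgt.
by case/row_subPn => i ni; exists (row i B); rewrite row_sub.
Qed.

Lemma exists_nonzero m (A : 'M[F]_(m, N)) :
  (0 < \rank A)%N -> exists v : 'rV_N, v != 0 /\ (v <= A)%MS.
Proof. by rewrite lt0n mxrank_eq0 => /rowV0Pn[v vA v0]; exists v. Qed.

Lemma exists_span2 m (A : 'M[F]_(m, N)) : \rank A = 2%N ->
  exists u v, [/\ u != 0, ~~ (v <= u)%MS & (A :=: u + v)%MS].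
Proof.
move=> rA; have [|u [u0 uA]] := @exists_nonzero _ A; first by rewrite rA.
have [|v [vA vu]] := @exists_notin _ _ u A; first by rewrite rank_rV1 // rA.
by exists u, v; split=> //; apply: eqmx_span2.
Qed.

Lemma sub_adds_rVP m1 m2 (A : 'M[F]_(m1, N)) (B : 'M_(m2, N)) v :
  (v <= A + B)%MS -> exists u w, [/\ (u <= A)%MS, (w <= B)%MS & v = u + w].
Proof.
case/sub_addsmxP => -[X Y] /= ->.
by exists (X *m A), (Y *m B); rewrite !submxMl.
Qed.

Lemma sub_adds_vecP m (A : 'M[F]_(m, N)) u v :
  (v <= A + u)%MS -> exists w c, (w <= A)%MS /\ v = w + c *: u.
Proof. by case/sub_adds_rVP => w [b [wA /sub_rVP[c ->] ->]]; exists w, c. Qed.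

Lemma sub_span2P u w v :
  (v <= u + w)%MS -> exists c d, v = c *: u + d *: w.
Proof. by case/sub_adds_vecP => a [d [/sub_rVP[c ->] ->]]; exists c, d. Qed.

Lemma sub_span3P u w t v :
  (v <= u + w + t)%MS -> exists a b c, v = a *: u + b *: w + c *: t.
Proof. by case/sub_adds_vecP => s [e [/sub_span2P[c [d ->]] ->]]; exists c, d, e. Qed.

Lemma addmx_subl u v m (A : 'M[F]_(m, N)) : (u <= A)%MS -> ((u + v)%R <= A)%MS = (v <= A)%MS.
Proof.
move=> uA; apply/idP/idP => [uvA|]; last exact: addmx_sub.
by rewrite -(addKr u v); in_span.
Qed.

Lemma addmx_subr u v m (A : 'M[F]_(m, N)) : (v <= A)%MS -> ((u + v)%R <= A)%MS = (u <= A)%MS.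
Proof. by rewrite addrC; exact: addmx_subl. Qed.

Lemma scalemx_sub_eq c v m (A : 'M[F]_(m, N)) : c != 0 -> (c *: v <= A)%MS = (v <= A)%MS.
Proof. by move=> c0; rewrite (eqmx_scale _ c0). Qed.

Lemma submx_of_lincomb c u v w m (A : 'M[F]_(m, N)) : c != 0 -> w = c *: u + v ->
  (w <= A)%MS -> (v <= A)%MS -> (u <= A)%MS.
Proof.
by move=> c0 e wA vA; move: wA; rewrite e addmx_subr // scalemx_sub_eq.
Qed.

Lemma scale_injl (z : 'rV[F]_N) : z != 0 -> injective (fun c => c *: z).
Proof.
move=> z0 c d /eqP; rewrite -subr_eq0 -scalerBl scaler_eq0 (negbTE z0) orbF subr_eq0.
by move/eqP.
Qed.

Lemma affine_line_inj (y z : 'rV[F]_N) : z != 0 -> injective (fun c => y + c *: z).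
Proof. by move=> z0 c d /addrI; apply: scale_injl. Qed.

Lemma sub_affine_line_slope v (z : 'rV[F]_N) a b c : z != 0 -> ~~ (v <= z)%MS ->
  ((a *: v + b *: z)%R <= (v + c *: z)%R)%MS -> b = a * c.
Proof.
move=> z0 nvz /sub_rVP[k e]; have {}e : (a - k) *: v = (k * c - b) *: z.
  by apply/eqP; rewrite -subr_eq0 -(subrr (k *: (v + c *: z))) -{1}e; apply/eqP; rV_ring.
have ak : a = k.
  apply/eqP; rewrite -subr_eq0; apply: contraNT nvz => ak.
  by rewrite -(scalemx_sub_eq _ _ ak) e scalemx_sub.
move/esym/eqP: e; rewrite ak subrr scale0r scaler_eq0 (negbTE z0) orbF subr_eq0.
by move/eqP.
Qed.

Lemma affine_line_notsub v (z : 'rV[F]_N) c d :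
  z != 0 -> ~~ (v <= z)%MS -> c != d -> ~~ ((v + c *: z)%R <= (v + d *: z)%R)%MS.
Proof.
move=> z0 vz cd; apply/negP => /sub_rVP[k e].
have {}e : (1 - k) *: v + (c - k * d) *: z = 0 by rewrite -(subrr (v + c *: z)) {2}e; rV_ring.
have [k1|k1] := eqVneq k 1.
  move/eqP: e; rewrite k1 subrr scale0r add0r mul1r scaler_eq0 subr_eq0.
  by rewrite (negbTE cd) (negbTE z0).
case/negP: vz; apply: (@submx_of_lincomb (1 - k) v ((c - k * d) *: z) 0); rewrite ?e //; try in_span.
by rewrite subr_eq0 eq_sym.
Qed.

Lemma mul_rV_additive_fun m (f : 'rV[F]_m -> 'rV[F]_N) :
  (forall x y, f (x + y) = f x + f y) -> (forall k x, f (k *: x) = k *: f x) ->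
  forall x, x *m (\matrix_i f (delta_mx 0 i)) = f x.
Proof.
move=> fD fZ x; have f0 : f 0 = 0 by have := fZ 0 0; rewrite !scale0r.
rewrite [in RHS](row_sum_delta x) (big_morph f fD f0) mulmx_sum_row.
by apply: eq_bigr => i _; rewrite rowK fZ.
Qed.

End RowSpaces.

Lemma sub_sums_closed (F : finFieldType) N (K : pred 'rV[F]_N) v : K 0 ->
  (forall x y, K x -> K y -> K (x + y)) -> (forall c x, K x -> K (c *: x)) ->
  (v <= \sum_(y | K y) <<y>>)%MS = K v.
Proof.
move=> K0 KD KZ; apply/idP/idP => [/sub_sumsmxP[u ->]|Kv]; last first.
  by apply: (@sumsmx_sup _ _ v) => //; rewrite genmxE.
apply: (big_ind K) => // i Ki.
have : ((u i *m <<i>>%MS)%R <= i)%MS by apply: submx_trans (submxMl _ _) _; rewrite genmxE.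
by case/sub_rVP => c ->; apply: KZ.
Qed.

(** * Counting *)

Lemma expnS_subn n k : (n ^ k.+1 - n ^ k = n ^ k * n.-1)%N.
Proof. by rewrite expnSr -{2}[(n ^ k)%N]muln1 -mulnBr subn1. Qed.

Lemma sqrn_sub1 n : (0 < n)%N -> (n ^ 2 - 1 = n.-1 * n.+1)%N.
Proof. by move=> n0; rewrite -{2}(exp1n 2) subn_sqr subn1 addn1. Qed.

Lemma double_counting (T1 T2 : finType) (A : {set T1}) (B : {set T2}) (r : T1 -> T2 -> bool) :
  (\sum_(x in A) #|[set y in B | r x y]| = \sum_(y in B) #|[set x in A | r x y]|)%N.
Proof.
have card_sum (S1 S2 : finType) (C : {set S1}) (D : {set S2}) (p : S1 -> S2 -> bool) :
  (\sum_(x in C) #|[set y in D | p x y]| = \sum_(x in C) \sum_(y in D) p x y)%N.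
  apply: eq_bigr => x _; rewrite -sum1_card big_mkcond [RHS]big_mkcond.
  by apply: eq_bigr => y _; rewrite inE; case: (y \in D); case: (p x y).
by rewrite card_sum exchange_big (card_sum _ _ B A (fun y x => r x y)).
Qed.

Lemma leq_double_counting (T1 T2 : finType) (A : {set T1}) (B : {set T2}) (r : T1 -> T2 -> bool) m n :
  (forall x, x \in A -> m <= #|[set y in B | r x y]|)%N ->
  (forall y, y \in B -> #|[set x in A | r x y]| <= n)%N -> (#|A| * m <= #|B| * n)%N.
Proof.
move=> Am Bn; rewrite -!sum_nat_const.
apply: (@leq_trans (\sum_(x in A) #|[set y in B | r x y]|)%N); first exact: leq_sum.
by rewrite double_counting; apply: leq_sum.
Qed.

Lemma eq_double_counting (T1 T2 : finType) (A : {set T1}) (B : {set T2}) (r : T1 -> T2 -> bool) m n :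
  (forall x, x \in A -> #|[set y in B | r x y]| = m) ->
  (forall y, y \in B -> #|[set x in A | r x y]| = n) -> (#|A| * m = #|B| * n)%N.
Proof. by move=> Am Bn; rewrite -!sum_nat_const -(eq_bigr _ Am) -(eq_bigr _ Bn) double_counting. Qed.

Lemma leq_card_fibres (T1 T2 : finType) (f : T1 -> T2) (A : {set T1}) n :
  (forall x, x \in A -> #|[set y in A | f y == f x]| <= n)%N -> (#|A| <= #|f @: A| * n)%N.
Proof.
move=> An; rewrite -[#|A|]muln1; apply: (leq_double_counting (r := fun x s => f x == s)) => [x Ax|_ /imsetP[x Ax ->]].
  by apply/card_gt0P; exists (f x); rewrite inE imset_f /=.
exact: An.
Qed.

Lemma eq_of_leq_sum (T : finType) (A : {set T}) (f g : T -> nat) :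
  (forall x, x \in A -> f x <= g x)%N -> (\sum_(x in A) g x <= \sum_(x in A) f x)%N ->
  forall x, x \in A -> f x = g x.
Proof.
move=> fg sum_gf x Ax; have [sum_fg] := leqif_sum (fun i Ai => leqif_eq (fg i Ai)).
by rewrite eqn_leq sum_fg sum_gf => /esym/forall_inP/(_ x Ax)/eqP.
Qed.

Lemma eq_of_leq_sum_fibres (T1 T2 : finType) (h : T1 -> T2) (A : {set T1}) (f g : T1 -> nat) :
  (forall x, x \in A -> \sum_(y in A | h y == h x) f y <= \sum_(y in A | h y == h x) g y)%N ->
  (\sum_(x in A) g x <= \sum_(x in A) f x)%N ->
  forall x, x \in A -> (\sum_(y in A | h y == h x) f y = \sum_(y in A | h y == h x) g y)%N.
Proof.
move=> fg; rewrite !(partition_big_imset h) => sum_gf x Ax.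
by apply: (eq_of_leq_sum (A := h @: A) _ sum_gf); [move=> _ /imsetP[y Ay ->]; apply: fg | apply: imset_f].
Qed.

Lemma leq_card_setU3 (T : finType) (A B C D : {set T}) :
  A \subset D -> B \subset D -> C \subset D ->
  (#|A :&: B| <= 1)%N -> (#|A :&: C| <= 1)%N -> (#|B :&: C| <= 1)%N ->
  (#|A| + #|B| + #|C| <= #|D| + 3)%N.
Proof.
move=> AD BD CD AB AC BC.
have /subset_leq_card : (A :|: B :|: C) \subset D by rewrite !subUset AD BD CD.
have := cardsUI (A :|: B) C; have := cardsUI A B; rewrite setIUl.
have := cardsUI (A :&: C) (B :&: C); lia.
Qed.

Section CardSpaces.
Variables (F : finFieldType) (N : nat).
Local Notation q := #|F|.

Definition vset m (A : 'M[F]_(m, N)) := [set v : 'rV[F]_N | (v <= A)%MS].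

Lemma card_vset m (A : 'M[F]_(m, N)) : #|vset A| = (q ^ \rank A)%N.
Proof.
have -> : vset A = [set u *m row_base A | u : 'rV[F]_(\rank A)].
  apply/setP => v; rewrite inE -(eq_row_base A).
  by apply/submxP/imsetP => [[u ->]|[u _ ->]]; exists u.
rewrite card_imset ?card_mx ?mul1n //.
exact: row_free_inj (row_base_free A).
Qed.

Lemma card_vsetD m1 m2 (A : 'M[F]_(m1, N)) (B : 'M[F]_(m2, N)) : (A <= B)%MS ->
  #|vset B :\: vset A| = (q ^ \rank B - q ^ \rank A)%N.
Proof.
move=> AB; rewrite cardsD (setIidPr _) ?card_vset //.
by apply/subsetP => v; rewrite !inE => /submx_trans->.
Qed.

Lemma card_nonzero_vset m (A : 'M[F]_(m, N)) :
  #|[set x : 'rV[F]_N | (x <= A)%MS && (x != 0)]| = (q ^ \rank A - 1)%N.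
Proof.
rewrite -card_vset (cardsD1 0 (vset A)) inE sub0mx add1n subn1 /=.
by apply: eq_card => x; rewrite !inE andbC.
Qed.

Lemma card_nonzero_rV (z : 'rV[F]_N) :
  z != 0 -> #|[set t : 'rV[F]_N | (t <= z)%MS && (t != 0)]| = q.-1.
Proof. by move=> z0; rewrite card_nonzero_vset rank_rV1 // expn1 subn1. Qed.

Lemma card_field_gt1 : (1 < q)%N.
Proof. by rewrite (cardD1 0) (cardD1 1) !inE oner_neq0. Qed.

Lemma card_field_pred_gt0 : (0 < q.-1)%N.
Proof. by rewrite -ltnS prednK ?card_field_gt1 // ltnW ?card_field_gt1. Qed.

(* The spaces between E and U of corank 2 correspond to the q + 1 points of a projective line. *)
Lemma card_intermediate_spaces (E U : 'M[F]_N) (D : {set 'M[F]_N}) :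
  (E <= U)%MS -> \rank U = (\rank E).+2 ->
  (forall S, S \in D -> [/\ <<S>>%MS = S, (E <= S)%MS, (S <= U)%MS & \rank S = (\rank E).+1]) ->
  (#|D| <= q.+1)%N.
Proof.
move=> EU rU DP; set e := \rank E in rU DP.
have card_off : #|vset U :\: vset E| = (q.+1 * (q ^ e * q.-1))%N.
  rewrite card_vsetD // rU -[(e.+2)%N]addn2 expnD -/e -{2}[(q ^ e)%N]muln1 -mulnBr.
  by rewrite sqrn_sub1 ?(ltnW card_field_gt1) // mulnA mulnC.
have pos : (0 < q ^ e * q.-1)%N by rewrite muln_gt0 expn_gt0 card_field_pred_gt0 (ltnW card_field_gt1).
rewrite -(leq_pmul2r pos) -card_off -[X in (_ <= X)%N]muln1.
apply: (leq_double_counting (r := fun S v => (v <= S)%MS)) => [S /DP[_ ES SU rS]|v].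
  rewrite -expnS_subn -rS -card_vsetD //; apply: subset_leq_card; apply/subsetP => v.
  by rewrite !inE => /andP[-> vS]; rewrite vS (submx_trans vS).
rewrite !inE => /andP[nvE _]; apply/card_le1_eqP => S1 S2.
have spanE S : S \in D -> (v <= S)%MS -> S = <<(E + v)%MS>>%MS.
  move=> /DP[eS ES _ rS] vS; rewrite -eS; apply/genmxP; rewrite andbC.
  have EvS : (E + v <= S)%MS by in_span.
  by rewrite EvS submx_rank_eq // rank_adds_notin // rS.
by rewrite !inE => /andP[D1 v1] /andP[D2 v2]; rewrite (spanE S1) // (spanE S2).
Qed.

End CardSpaces.

(** * Vectors of length three and seven *)

Section DotCross.
Variable F : fieldType.
Implicit Types (a b c d u v w : 'rV[F]_3) (k : F).

Definition i0 : 'I_3 := ord0.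
Definition i1 : 'I_3 := @Ordinal 3 1 isT.
Definition i2 : 'I_3 := @Ordinal 3 2 isT.

Definition v3 (x y z : F) : 'rV[F]_3 := \row_i nth 0 [:: x; y; z] i.
Definition dot u v := u 0 i0 * v 0 i0 + u 0 i1 * v 0 i1 + u 0 i2 * v 0 i2.
Definition cross u v := v3 (u 0 i1 * v 0 i2 - u 0 i2 * v 0 i1)
  (u 0 i2 * v 0 i0 - u 0 i0 * v 0 i2) (u 0 i0 * v 0 i1 - u 0 i1 * v 0 i0).

Lemma sum_ord3 (V : nmodType) (f : 'I_3 -> V) : \sum_i f i = f i0 + f i1 + f i2.
Proof.
rewrite !big_ord_recl big_ord0 addr0 addrA.
by congr (_ + f _ + f _); apply: val_inj.
Qed.

Lemma forall_ord3 (P : 'I_3 -> Prop) : P i0 -> P i1 -> P i2 -> forall i, P i.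
Proof.
move=> P0 P1 P2 [[|[|[|//]]] ltk3].
- by rewrite (_ : Ordinal ltk3 = i0) //; apply: val_inj.
- by rewrite (_ : Ordinal ltk3 = i1) //; apply: val_inj.
- by rewrite (_ : Ordinal ltk3 = i2) //; apply: val_inj.
Qed.

Lemma rV3_eq u v : u 0 i0 = v 0 i0 -> u 0 i1 = v 0 i1 -> u 0 i2 = v 0 i2 -> u = v.
Proof. by move=> e0 e1 e2; apply/rowP; apply: forall_ord3. Qed.

Lemma dotE u v : dot u v = (u *m v^T) 0 0.
Proof. by rewrite mxE sum_ord3 !mxE. Qed.

End DotCross.

Ltac rV3_ring := apply: rV3_eq; rewrite /cross /v3 /dot !mxE /=; ring.

Section DotCrossTheory.
Variable F : fieldType.
Implicit Types (a b c d u v w z : 'rV[F]_3) (k : F).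

Lemma dotC u v : dot u v = dot v u. Proof. by rewrite /dot; ring. Qed.
Lemma dotDl u v w : dot (u + v) w = dot u w + dot v w. Proof. by rewrite /dot !mxE; ring. Qed.
Lemma dotDr u v w : dot w (u + v) = dot w u + dot w v. Proof. by rewrite /dot !mxE; ring. Qed.
Lemma dotZl k u w : dot (k *: u) w = k * dot u w. Proof. by rewrite /dot !mxE; ring. Qed.
Lemma dotZr k u w : dot w (k *: u) = k * dot w u. Proof. by rewrite /dot !mxE; ring. Qed.
Lemma dotBr u v w : dot w (u - v) = dot w u - dot w v. Proof. by rewrite /dot !mxE; ring. Qed.
Lemma dot0l w : dot 0 w = 0 :> F. Proof. by rewrite /dot !mxE; ring. Qed.
Lemma dot0r w : dot w 0 = 0 :> F. Proof. by rewrite /dot !mxE; ring. Qed.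
Lemma crossDl u v w : cross (u + v) w = cross u w + cross v w. Proof. by rV3_ring. Qed.
Lemma crossDr u v w : cross w (u + v) = cross w u + cross w v. Proof. by rV3_ring. Qed.
Lemma crossZl k u w : cross (k *: u) w = k *: cross u w. Proof. by rV3_ring. Qed.
Lemma crossZr k u w : cross w (k *: u) = k *: cross w u. Proof. by rV3_ring. Qed.
Lemma crossBr u v w : cross w (u - v) = cross w u - cross w v. Proof. by rV3_ring. Qed.
Lemma crossvv u : cross u u = 0. Proof. by rV3_ring. Qed.
Lemma cross0l u : cross 0 u = 0. Proof. by rV3_ring. Qed.
Lemma cross0r u : cross u 0 = 0. Proof. by rV3_ring. Qed.
Lemma crossC u v : cross u v = - cross v u. Proof. by rV3_ring. Qed.

Lemma dot_crossl u v : dot u (cross u v) = 0.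
Proof. by rewrite /dot !mxE /=; ring. Qed.

Lemma dot_crossr u v : dot v (cross u v) = 0.
Proof. by rewrite /dot !mxE /=; ring. Qed.

Lemma dot_cross_rot u v w : dot u (cross v w) = dot w (cross u v).
Proof. by rewrite /dot !mxE /=; ring. Qed.

Lemma cross_crossl u v w : cross (cross u v) w = dot u w *: v - dot v w *: u.
Proof. by rV3_ring. Qed.

Lemma cross_crossr u v w : cross u (cross v w) = dot u w *: v - dot u v *: w.
Proof. by rV3_ring. Qed.

Lemma dot_cross4 u v w z :
  dot w (cross v z) *: u = dot u w *: cross v z + dot u v *: cross z w + dot u z *: cross w v.
Proof. by rV3_ring. Qed.

Lemma exists_dot_neq0 a : a != 0 -> exists b, dot a b != 0.
Proof.
move=> a0; have [e0|n0] := eqVneq (a 0 i0) 0; last first.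
  by exists (v3 1 0 0); rewrite /dot !mxE /= !mulr0 mulr1 !addr0.
have [e1|n1] := eqVneq (a 0 i1) 0; last first.
  by exists (v3 0 1 0); rewrite /dot !mxE /= !mulr0 mulr1 addr0 add0r.
exists (v3 0 0 1); rewrite /dot !mxE /= !mulr0 mulr1 !add0r.
by apply: contraNneq a0 => e2; apply/eqP; apply: rV3_eq; rewrite mxE.
Qed.

Lemma exists_dot1 a : a != 0 -> exists w, dot a w = 1.
Proof. by move=> /exists_dot_neq0[b n]; exists ((dot a b)^-1 *: b); rewrite dotZr mulVf. Qed.

Lemma dot_eq0_cross a b : a != 0 -> dot a b = 0 -> exists w, b = cross a w.
Proof.
move=> /exists_dot1[w aw] ab; exists (cross b w).
by rewrite cross_crossr aw ab scale1r scale0r subr0.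
Qed.

Lemma cross_eq0P a c : a != 0 -> cross a c = 0 -> exists k, c = k *: a.
Proof.
move=> /exists_dot1[w aw] ac; exists (dot c w); apply/eqP.
by rewrite -subr_eq0 -{1}[c]scale1r -aw -cross_crossl ac cross0l.
Qed.

Lemma cross_neq0l a b : cross a b != 0 -> a != 0.
Proof. by apply: contraNneq => ->; rewrite cross0l. Qed.

Lemma cross_neq0r a b : cross a b != 0 -> b != 0.
Proof. by apply: contraNneq => ->; rewrite cross0r. Qed.

Lemma cross_neq0_add a b : cross a b != 0 -> a + b != 0.
Proof.
apply: contraNneq => /eqP; rewrite addr_eq0 => /eqP ->.
by rewrite -scaleN1r crossZl crossvv scaler0.
Qed.

Lemma cross_dot0 a b c : b != 0 -> dot a b = 0 -> dot c b = 0 -> exists k, cross a c = k *: b.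
Proof.
move=> b0 ab cb; apply: cross_eq0P => //.
by rewrite crossC cross_crossl ab cb !scale0r subr0 oppr0.
Qed.

Lemma dot_cross_eq0_span u v z :
  cross u v != 0 -> dot z (cross u v) = 0 -> exists m n, z = m *: u + n *: v.
Proof.
move=> uv z_uv; have [k ek] := cross_dot0 uv (dot_crossl u v) z_uv.
have [m em] : exists m, z - k *: v = m *: u.
  by apply: (cross_eq0P (cross_neq0l uv)); rewrite crossBr crossZr ek subrr.
by exists m, k; rewrite -em subrK.
Qed.

Lemma lincomb2_inj a b (k1 k2 m1 m2 : F) :
  cross a b != 0 -> k1 *: a + k2 *: b = m1 *: a + m2 *: b -> k1 = m1 /\ k2 = m2.
Proof.
move=> ab e; split; apply: (scale_injl ab).
  by have := congr1 (fun u => cross u b) e; rewrite !crossDl !crossZl crossvv !scaler0 !addr0.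
by have := congr1 (cross a) e; rewrite !crossDr !crossZr crossvv !scaler0 !add0r.
Qed.

Lemma exists_dot0 b : exists2 a, a != 0 & dot a b = 0.
Proof.
have [b0|b0] := eqVneq (b 0 i0) 0.
  exists (v3 1 0 0); last by rewrite /dot !mxE /= b0; ring.
  by apply/eqP => /rowP/(_ i0); rewrite !mxE /= => /eqP; rewrite oner_eq0.
exists (v3 (- b 0 i1) (b 0 i0) 0); last by rewrite /dot !mxE /=; ring.
by apply: contraNneq b0 => /rowP/(_ i1); rewrite !mxE /= => ->.
Qed.

Lemma exists_dot0_cross a b :
  a != 0 -> b != 0 -> dot a b = 0 -> exists2 d, dot a d = 0 & cross b d != 0.
Proof.
move=> a0 /exists_dot_neq0[w bw] ab; exists (cross a w); first exact: dot_crossl.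
by rewrite cross_crossr [dot b a]dotC ab scale0r subr0 scaler_eq0 negb_or bw.
Qed.

End DotCrossTheory.

Section FrameCoordinates.
Variables (F : fieldType) (N : nat).

Definition mat3 (x y z : 'rV[F]_N) : 'M[F]_(3, N) := \matrix_(i < 3) nth 0 [:: x; y; z] i.

Lemma mul_row3 (a : 'rV[F]_3) (A : 'M[F]_(3, N)) :
  a *m A = a 0 i0 *: row i0 A + a 0 i1 *: row i1 A + a 0 i2 *: row i2 A.
Proof. by rewrite mulmx_sum_row sum_ord3. Qed.

Lemma mul_mat3 (a : 'rV[F]_3) x y z : a *m mat3 x y z = a 0 i0 *: x + a 0 i1 *: y + a 0 i2 *: z.
Proof. by rewrite mul_row3 !rowK. Qed.

Definition hcoord (A B : 'M[F]_(3, N)) (e : 'rV[F]_N) a t b := a *m A + t *: e + b *m B.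

Variables (A B : 'M[F]_(3, N)) (e : 'rV[F]_N).
Local Notation P := (hcoord A B e).

Lemma hcoordD a t b a' t' b' : P a t b + P a' t' b' = P (a + a') (t + t') (b + b').
Proof. by rewrite /hcoord !mulmxDl scalerDl addrACA [X in X + _]addrACA. Qed.

Lemma hcoordZ k a t b : k *: P a t b = P (k *: a) (k * t) (k *: b).
Proof. by rewrite /hcoord !scalerDr !scalemxAl scalerA. Qed.

Lemma hcoordN a t b : - P a t b = P (- a) (- t) (- b).
Proof. by rewrite -scaleN1r hcoordZ !scaleN1r mulN1r. Qed.

Lemma hcoord0 : P 0 0 0 = 0. Proof. by rewrite /hcoord !mul0mx scale0r !addr0. Qed.
Lemma hcoordA a : P a 0 0 = a *m A. Proof. by rewrite /hcoord scale0r mul0mx !addr0. Qed.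
Lemma hcoordB b : P 0 0 b = b *m B. Proof. by rewrite /hcoord scale0r mul0mx !add0r. Qed.
Lemma hcoordE : P 0 1 0 = e. Proof. by rewrite /hcoord !mul0mx scale1r add0r addr0. Qed.

Lemma hcoord_swap a t b : hcoord B A e b t a = P a t b.
Proof. by rewrite /hcoord addrC [b *m B + _]addrC addrA. Qed.

End FrameCoordinates.

Ltac hcoord_eq :=
  rewrite ?(hcoordZ, hcoordN, hcoordD); congr (hcoord _ _ _ _ _ _); first [rV_ring | ring].

Section SevenCoordinates.
Variable F : fieldType.
Implicit Types (a b c d : 'rV[F]_3) (t k : F) (v x y : 'rV[F]_7).

Definition mk7 a t b : 'rV[F]_7 :=
  \row_i nth 0 [:: a 0 i0; a 0 i1; a 0 i2; t; b 0 i0; b 0 i1; b 0 i2] i.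
Definition partA v : 'rV[F]_3 := v3 (cd v 0%N) (cd v 1%N) (cd v 2%N).
Definition partB v : 'rV[F]_3 := v3 (cd v 4%N) (cd v 5%N) (cd v 6%N).

Lemma cd_mk7 a t b (k : nat) : (k < 7)%N ->
  cd (mk7 a t b) k = nth 0 [:: a 0 i0; a 0 i1; a 0 i2; t; b 0 i0; b 0 i1; b 0 i2] k.
Proof. by move=> k7; rewrite /cd mxE inordK. Qed.

Lemma partA_mk7 a t b : partA (mk7 a t b) = a.
Proof. by apply: rV3_eq; rewrite mxE /= cd_mk7. Qed.

Lemma partB_mk7 a t b : partB (mk7 a t b) = b.
Proof. by apply: rV3_eq; rewrite mxE /= cd_mk7. Qed.

Lemma cd3_mk7 a t b : cd (mk7 a t b) 3 = t.
Proof. by rewrite cd_mk7. Qed.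

Definition parts_mk7 := (partA_mk7, partB_mk7, cd3_mk7).

Lemma mk7K v : mk7 (partA v) (cd v 3%N) (partB v) = v.
Proof.
apply/rowP => i; rewrite mxE /partA /partB !mxE /= /cd.
by case: i => -[|[|[|[|[|[|[|//]]]]]]] p /=; congr (v 0 _); apply: val_inj; rewrite /= inordK.
Qed.

Lemma rV7_eq x y : partA x = partA y -> cd x 3 = cd y 3 -> partB x = partB y -> x = y.
Proof. by move=> eA e3 eB; rewrite -(mk7K x) -(mk7K y) eA e3 eB. Qed.

Lemma mk7_inj a t b a' t' b' : mk7 a t b = mk7 a' t' b' -> [/\ a = a', t = t' & b = b'].
Proof.
move=> e; split.
- by rewrite -(partA_mk7 a t b) e partA_mk7.
- by rewrite -(cd3_mk7 a t b) e cd3_mk7.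
- by rewrite -(partB_mk7 a t b) e partB_mk7.
Qed.

Lemma cdD x y i : cd (x + y) i = cd x i + cd y i. Proof. by rewrite /cd mxE. Qed.
Lemma cdZ k x i : cd (k *: x) i = k * cd x i. Proof. by rewrite /cd mxE. Qed.
Lemma cd0 i : cd (0 : 'rV[F]_7) i = 0. Proof. by rewrite /cd mxE. Qed.
Lemma partAD x y : partA (x + y) = partA x + partA y. Proof. by apply: rV3_eq; rewrite !mxE /= cdD. Qed.
Lemma partAZ k x : partA (k *: x) = k *: partA x. Proof. by apply: rV3_eq; rewrite !mxE /= cdZ. Qed.
Lemma partBD x y : partB (x + y) = partB x + partB y. Proof. by apply: rV3_eq; rewrite !mxE /= cdD. Qed.
Lemma partBZ k x : partB (k *: x) = k *: partB x. Proof. by apply: rV3_eq; rewrite !mxE /= cdZ. Qed.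
Lemma partA0 : partA 0 = 0 :> 'rV[F]_3. Proof. by apply: rV3_eq; rewrite !mxE /= cd0. Qed.
Lemma partB0 : partB 0 = 0 :> 'rV[F]_3. Proof. by apply: rV3_eq; rewrite !mxE /= cd0. Qed.

Definition partsD := (partAD, partBD, cdD).
Definition partsZ := (partAZ, partBZ, cdZ).
Definition parts0 := (partA0, partB0, cd0).

Lemma mk7D a t b a' t' b' : mk7 a t b + mk7 a' t' b' = mk7 (a + a') (t + t') (b + b').
Proof. by apply: rV7_eq; rewrite partsD !parts_mk7. Qed.

Lemma mk7Z k a t b : k *: mk7 a t b = mk7 (k *: a) (k * t) (k *: b).
Proof. by apply: rV7_eq; rewrite partsZ !parts_mk7. Qed.

Lemma mk70 : mk7 0 0 0 = 0.
Proof. by apply: rV7_eq; rewrite parts_mk7 parts0. Qed.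

Lemma Q6_mk7 a t b : Q6 (mk7 a t b) = dot a b - t ^+ 2.
Proof. by rewrite /Q6 !cd_mk7. Qed.

Lemma Q6E x : Q6 x = dot (partA x) (partB x) - cd x 3 ^+ 2.
Proof. by rewrite -{1}(mk7K x) Q6_mk7. Qed.

Lemma hex_grassmann_mk7 a t b a' t' b' : hex_grassmann (mk7 a t b) (mk7 a' t' b') <->
  cross a a' = t *: b' - t' *: b /\ cross b b' = t' *: a - t *: a'.
Proof.
have opp_eq (x y x' y' : F) : x = - x' -> y = - y' -> x = y -> x' = y'.
  by move=> -> -> /oppr_inj.
rewrite /hex_grassmann /pg !cd_mk7 //=; split.
  move=> [g12 [g54 [g20 [g65 [g01 g46]]]]]; split; apply: rV3_eq; rewrite !mxE /= ?g12 ?g20 ?g01; try ring.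
  - by apply: opp_eq g65; ring.
  - by apply: opp_eq g46; ring.
  - by apply: opp_eq g54; ring.
case=> /rowP crossA /rowP crossB.
move: (crossA i0) (crossA i1) (crossA i2) (crossB i0) (crossB i1) (crossB i2); rewrite !mxE /=.
move=> g12 g20 g01 g65 g46 g54; repeat split.
- by rewrite g12; ring.
- by apply: opp_eq g54; ring.
- by rewrite g20; ring.
- by apply: opp_eq g65; ring.
- by rewrite g01; ring.
- by apply: opp_eq g46; ring.
Qed.

Definition mat7 N (A B : 'M[F]_(3, N)) (e : 'rV[F]_N) : 'M[F]_(7, N) :=
  \matrix_(i < 7) nth 0 [:: row i0 A; row i1 A; row i2 A; e; row i0 B; row i1 B; row i2 B] i.

Lemma mul_mat7 N (A B : 'M[F]_(3, N)) e a t b : mk7 a t b *m mat7 A B e = hcoord A B e a t b.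
Proof.
rewrite mulmx_sum_row !big_ord_recl big_ord0 addr0 /mat7 !rowK !mxE /= /hcoord.
by rewrite !mul_row3 !addrA.
Qed.

Lemma mat7_sub N m (A B : 'M[F]_(3, N)) e (V : 'M[F]_(m, N)) :
  (A <= V)%MS -> (e <= V)%MS -> (B <= V)%MS -> (mat7 A B e <= V)%MS.
Proof.
move=> AV eV BV; have rowsV (C : 'M[F]_(3, N)) i : (C <= V)%MS -> (row i C <= V)%MS.
  exact: submx_trans (row_sub i C).
by apply/row_subP => -[[|[|[|[|[|[|[|//]]]]]]] p]; rewrite rowK //=; apply: rowsV.
Qed.

Lemma mat7_free N (A B : 'M[F]_(3, N)) e :
  (forall a t b, hcoord A B e a t b = 0 -> [/\ a = 0, t = 0 & b = 0]) -> row_free (mat7 A B e).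
Proof.
by move=> inj; apply: inj_row_free => v; rewrite -[v]mk7K mul_mat7 => /inj[-> -> ->]; exact: mk70.
Qed.

End SevenCoordinates.

(** * The plane of lines through a point *)

Section LineSet.
Variables (F : finFieldType) (N : nat) (L : {set 'M[F]_N}).
Local Notation q := #|F|.
Implicit Types (x y z u v w s r e p : 'rV[F]_N) (l m n S E U H V : 'M[F]_N).

Definition lines_thru x := [set l in L | (x <= l)%MS].
Definition lines_in S := [set l in L | (l <= S)%MS].
Definition covered x := (x != 0) && (lines_thru x != set0).

(* The plane of all points collinear with x, once [flat] is assumed. *)
Definition perp x : 'M[F]_N := (\sum_(l in lines_thru x) l)%MS.

Record flat : Prop := Flat {
  flat_rank : forall l, l \in L -> \rank l = 2%N;
  flat_genmx : forall l, l \in L -> <<l>>%MS = l;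
  flat_lines_thru : forall x, covered x -> #|lines_thru x| = q.+1;
  flat_plane : forall S, \rank S = 3%N -> nb_in L S \in [:: 0%N; 1%N; q.+1];
  flat_solid : forall S, \rank S = 4%N -> nb_in L S \in [:: 0%N; 1%N; q.+1; (2 * q).+1] }.

Hypothesis flatL : flat.

Let q_gt1 : (1 < q)%N := card_field_gt1 F.

Definition rank_line := flat_rank flatL.
Definition genmx_line := flat_genmx flatL.
Definition card_lines_thru := flat_lines_thru flatL.

Lemma lines_thruP x l : reflect (l \in L /\ (x <= l)%MS) (l \in lines_thru x).
Proof. by rewrite inE; apply: andP. Qed.

Lemma covered_neq0 x : covered x -> x != 0.
Proof. by case/andP. Qed.

#[local] Hint Extern 0 (is_true (_ != 0)) => (apply: covered_neq0; assumption) : core.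

Lemma line_covered l x : l \in L -> x != 0 -> (x <= l)%MS -> covered x.
Proof. by move=> Ll x0 xl; rewrite /covered x0; apply/set0Pn; exists l; rewrite inE Ll. Qed.

Lemma card_line_off_point l x : l \in L -> x != 0 -> (x <= l)%MS ->
  #|vset l :\: vset x| = (q ^ 2 - q)%N.
Proof. by move=> Ll x0 xl; rewrite card_vsetD // rank_line // rank_rV1 // expn1. Qed.

Lemma line_eq l m : l \in L -> m \in L -> (l <= m)%MS -> l = m.
Proof.
move=> Ll Lm lm; rewrite -(genmx_line Ll) -(genmx_line Lm); apply/genmxP.
by rewrite lm submx_rank_eq // !rank_line.
Qed.

Lemma line_span l u v : l \in L -> u != 0 -> ~~ (v <= u)%MS -> (u <= l)%MS -> (v <= l)%MS ->
  (l :=: u + v)%MS.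
Proof. by move=> Ll; apply: eqmx_span2; apply: rank_line. Qed.

Lemma line_span_eq l u v : l \in L -> u != 0 -> ~~ (v <= u)%MS -> (u <= l)%MS -> (v <= l)%MS ->
  l = <<(u + v)%MS>>%MS.
Proof. by move=> Ll u0 vu ul vl; rewrite -{1}(genmx_line Ll); apply: eq_genmx; exact: line_span. Qed.

Lemma card_lines_thru_cap x y : y != 0 -> ~~ (x <= y)%MS ->
  (#|lines_thru x :&: lines_thru y| <= 1)%N.
Proof.
move=> y0 xy; apply/card_le1_eqP => l m /setIP[/lines_thruP[Ll xl] /lines_thruP[_ yl]].
case/setIP => /lines_thruP[Lm xm] /lines_thruP[_ ym].
by rewrite (line_span_eq Ll y0 xy) // (line_span_eq Lm y0 xy).
Qed.

Lemma card_lines_in_cap (A B m : 'M[F]_N) : m \in L -> (A :&: B <= m)%MS ->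
  (#|lines_in A :&: lines_in B| <= 1)%N.
Proof.
move=> Lm ABm; rewrite -(cards1 m); apply: subset_leq_card; apply/subsetP => k.
rewrite !inE => /andP[/andP[Lk kA] /andP[_ kB]]; apply/eqP/line_eq => //.
by apply: submx_trans ABm; rewrite sub_capmx kA.
Qed.

Lemma lines_inS (A B : 'M[F]_N) : (A <= B)%MS -> lines_in A \subset lines_in B.
Proof. by move=> AB; apply/subsetP => l; rewrite !inE => /andP[-> /submx_trans->]. Qed.

Lemma rank_add_lines l m x : l \in L -> m \in L -> l != m -> x != 0 ->
  (x <= l)%MS -> (x <= m)%MS -> \rank (l + m)%MS = 3%N.
Proof.
move=> Ll Lm lm x0 xl xm; have := mxrank_sum_cap l m.
have : (1 <= \rank (l :&: m)%MS)%N by rewrite -(rank_rV1 x0) mxrankS // sub_capmx xl.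
have : (\rank (l :&: m)%MS < \rank l)%N by apply: ltn_rank_cap; apply: contra lm => /line_eq ->.
rewrite (rank_line Ll) (rank_line Lm); lia.
Qed.

Lemma card_lines_in_plane S l m : \rank S = 3%N -> l \in L -> m \in L ->
  l != m -> (l <= S)%MS -> (m <= S)%MS -> #|lines_in S| = q.+1.
Proof.
move=> rS Ll Lm lm lS mS; have := flat_plane flatL rS.
have : (2 <= #|lines_in S|)%N.
  have <- : #|[set l; m]| = 2%N by rewrite cards2 lm.
  by apply: subset_leq_card; apply/subsetP => k; rewrite !inE => /orP[]/eqP->; rewrite ?Ll ?Lm.
by rewrite /nb_in -/(lines_in S) !inE => two /or3P[]/eqP e; rewrite e in two *.
Qed.

Lemma card_lines_in_solid S : \rank S = 4%N -> (#|lines_in S| <= (2 * q).+1)%N.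
Proof.
move=> rS; have := flat_solid flatL rS.
by rewrite /nb_in -/(lines_in S) !inE => /or4P[]/eqP->; lia.
Qed.

Lemma cap_planes_line l m n : \rank l = 2%N -> \rank (l + n)%MS = 3%N -> ~~ (n <= l + m)%MS ->
  ((l + m) :&: (l + n) <= l)%MS.
Proof.
move=> rl rln nlm; apply: submx_rank_leq; first by rewrite sub_capmx !addsmxSl.
rewrite capmxC rl -ltnS -rln; apply: ltn_rank_cap; apply: contra nlm.
exact: submx_trans (addsmxSr l n).
Qed.

(* Three non-coplanar lines through x would give three planes of q + 1 lines in one solid. *)
Lemma lines_thru_coplanar l m n x : x != 0 -> l \in lines_thru x -> m \in lines_thru x ->
  l != m -> n \in lines_thru x -> (n <= l + m)%MS.
Proof.
move=> x0 /lines_thruP[Ll xl] /lines_thruP[Lm xm] lm /lines_thruP[Ln xn].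
apply: contraT => nlm.
have ln : l != n by apply: contraNneq nlm => <-; exact: addsmxSl.
have mn : m != n by apply: contraNneq nlm => <-; exact: addsmxSr.
have rlm := rank_add_lines Ll Lm lm x0 xl xm.
have rln := rank_add_lines Ll Ln ln x0 xl xn.
have rmn := rank_add_lines Lm Ln mn x0 xm xn.
have rS : \rank (l + m + n)%MS = 4%N.
  have := mxrank_sum_cap (l + m)%MS n; rewrite rlm (rank_line Ln).
  have : (1 <= \rank ((l + m) :&: n)%MS)%N.
    by rewrite -(rank_rV1 x0) mxrankS // sub_capmx xn (submx_trans xl) ?addsmxSl.
  by have := ltn_rank_cap nlm; rewrite capmxC (rank_line Ln); clear; lia.
have nml : ~~ (n <= m + l)%MS by rewrite addsmxC.
have lnm : ~~ (l <= n + m)%MS.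
  apply: contra nlm => lnm; apply: submx_trans (addsmxSl n m) _.
  by apply: submx_rank_eq; [in_span | rewrite rlm addsmxC].
have cap_l : (#|lines_in (l + m)%MS :&: lines_in (l + n)%MS| <= 1)%N.
  exact: card_lines_in_cap Ll (cap_planes_line (rank_line Ll) rln nlm).
have cap_m : (#|lines_in (l + m)%MS :&: lines_in (m + n)%MS| <= 1)%N.
  by rewrite addsmxC; exact: card_lines_in_cap Lm (cap_planes_line (rank_line Lm) rmn nml).
have cap_n : (#|lines_in (l + n)%MS :&: lines_in (m + n)%MS| <= 1)%N.
  rewrite setIC addsmxC [(l + n)%MS]addsmxC; apply: (card_lines_in_cap Ln).
  by apply: (cap_planes_line (rank_line Ln) _ lnm); rewrite addsmxC.
have [lmS lnS mnS] : [/\ (l + m <= l + m + n)%MS, (l + n <= l + m + n)%MS & (m + n <= l + m + n)%MS].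
  by split; in_span.
have := leq_card_setU3 (lines_inS lmS) (lines_inS lnS) (lines_inS mnS) cap_l cap_m cap_n.
rewrite (card_lines_in_plane rlm Ll Lm lm (addsmxSl _ _) (addsmxSr _ _)).
rewrite (card_lines_in_plane rln Ll Ln ln (addsmxSl _ _) (addsmxSr _ _)).
rewrite (card_lines_in_plane rmn Lm Ln mn (addsmxSl _ _) (addsmxSr _ _)).
by have := card_lines_in_solid rS; clear -q_gt1; lia.
Qed.

Lemma two_lines_thru x : covered x ->
  exists l m, [/\ l \in lines_thru x, m \in lines_thru x & l != m].
Proof.
move=> Px; have : (1 < #|lines_thru x|)%N by rewrite card_lines_thru // ltnS; lia.
by case/card_gt1P => l [m [xl xm lm]]; exists l, m.
Qed.

Lemma perp_span x l m : covered x -> l \in lines_thru x -> m \in lines_thru x -> l != m ->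
  (perp x :=: l + m)%MS.
Proof.
move=> Px xl xm lm; apply/eqmxP/andP; split.
  by apply/sumsmx_subP => n xn; apply: (lines_thru_coplanar _ xl).
by rewrite addsmx_sub /perp (sumsmx_sup l) // (sumsmx_sup m).
Qed.

Lemma rank_perp x : covered x -> \rank (perp x) = 3%N.
Proof.
move=> Px; have [l [m [xl xm lm]]] := two_lines_thru Px; rewrite (perp_span Px xl xm lm).
case/lines_thruP: xl => Ll xl; case/lines_thruP: xm => Lm xm.
exact: rank_add_lines Ll Lm lm (covered_neq0 Px) xl xm.
Qed.

Lemma lines_thru_perp x l : l \in lines_thru x -> (l <= perp x)%MS.
Proof. by move=> xl; rewrite /perp (sumsmx_sup l). Qed.

Lemma lines_in_perp x : covered x -> lines_in (perp x) = lines_thru x.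
Proof.
move=> Px; have [l [m [xl xm lm]]] := two_lines_thru Px.
apply/esym/eqP; rewrite eqEcard card_lines_thru //; apply/andP; split.
  by apply/subsetP => n xn; rewrite inE lines_thru_perp // andbT; case/lines_thruP: xn.
have [[Ll _] [Lm _]] := (lines_thruP _ _ xl, lines_thruP _ _ xm).
by rewrite (card_lines_in_plane (rank_perp Px) Ll Lm) ?lines_thru_perp.
Qed.

Lemma mem_line_perp x l : covered x -> l \in L -> (l <= perp x)%MS -> (x <= l)%MS.
Proof.
move=> Px Ll lx; have : l \in lines_in (perp x) by rewrite inE Ll.
by rewrite lines_in_perp // => /lines_thruP[].
Qed.

Lemma mem_perp x : covered x -> (x <= perp x)%MS.
Proof.
move=> Px; have [l [_ [xl _ _]]] := two_lines_thru Px.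
by apply: submx_trans (lines_thru_perp xl); case/lines_thruP: xl.
Qed.

#[local] Hint Extern 0 (is_true (_ <= perp _)%MS) => (apply: mem_perp; assumption) : core.

(* The q + 1 lines of L through x cover q^3 - q vectors of [perp x] off x, that is, all of them. *)
Lemma perp_line x y : covered x -> (y <= perp x)%MS -> ~~ (y <= x)%MS -> <<(x + y)%MS>>%MS \in L.
Proof.
move=> Px yx nyx; suff [l /lines_thruP[Ll xl] yl] : exists2 l, l \in lines_thru x & (y <= l)%MS.
  by rewrite -(line_span_eq Ll _ nyx xl yl).
apply/exists_inP; apply: contraT; rewrite negb_exists_in => /forall_inP no_line.
pose off_x := vset (perp x) :\: vset x.
have card_off : #|off_x| = (q ^ 3 - q)%N by rewrite card_vsetD // rank_perp // rank_rV1 // expn1.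
have := @leq_double_counting _ _ (lines_thru x) (off_x :\ y) (fun l v => (v <= l)%MS) (q ^ 2 - q) 1.
rewrite card_lines_thru // muln1 => /(_ _ _)/leq_trans le_off.
have : (q.+1 * (q ^ 2 - q) < #|off_x|)%N.
  rewrite (cardsD1 y) !inE nyx yx add1n ltnS; apply: le_off (leqnn _) => [l xl|v].
    have [Ll sxl] := lines_thruP _ _ xl.
    rewrite -(card_line_off_point Ll (covered_neq0 Px) sxl).
    apply: subset_leq_card; apply/subsetP => v; rewrite !inE => /andP[nvx vl]; rewrite nvx vl andbT.
    rewrite (submx_trans vl (lines_thru_perp xl)) !andbT.
    by apply: contraTneq vl => ->; apply: no_line.
  rewrite !inE => /and3P[_ nvx _].
  have -> : [set l in lines_thru x | (v <= l)%MS] = lines_thru v :&: lines_thru x.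
    by apply/setP => l; rewrite !inE; case: (l \in L); rewrite //= andbC.
  exact: card_lines_thru_cap.
by rewrite card_off !expnS expn0; nia.
Qed.

Lemma perp_covered x y : covered x -> (y <= perp x)%MS -> y != 0 -> covered y.
Proof.
move=> Px yx y0; have [yx1|nyx] := boolP (y <= x)%MS.
  case: (two_lines_thru Px) => l [_ [/lines_thruP[Ll xl] _ _]].
  exact: line_covered Ll y0 (submx_trans yx1 xl).
by apply: line_covered (perp_line Px yx nyx) y0 _; rewrite genmxE addsmxSr.
Qed.

Lemma perp_sym x y : covered x -> (y <= perp x)%MS -> y != 0 -> (x <= perp y)%MS.
Proof.
move=> Px yx y0; have Py := perp_covered Px yx y0.
have [/(submx_vec_sym y0) xy|nyx] := boolP (y <= x)%MS; first exact: submx_trans xy (mem_perp Py).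
have xyL : <<(x + y)%MS>>%MS \in lines_thru y by rewrite inE (perp_line Px) //= genmxE addsmxSr.
by apply: submx_trans (lines_thru_perp xyL); rewrite genmxE addsmxSl.
Qed.

Lemma no_triangle x y z : covered x -> (y <= perp x)%MS -> (z <= perp x)%MS -> y != 0 ->
  (z <= perp y)%MS -> ~~ (y <= x)%MS -> (z <= x + y)%MS.
Proof.
move=> Px yx zx y0 zy nyx; have Py := perp_covered Px yx y0.
have [/submx_trans -> //|nzy] := boolP (z <= y)%MS; first exact: addsmxSr.
have yzL := perp_line Py zy nzy; have : (<<(y + z)%MS>> <= perp x)%MS by rewrite genmxE; in_span.
move/(mem_line_perp Px yzL); rewrite genmxE => xyz.
by rewrite addsmxC; apply: adds_vec_exchange xyz _; apply: notsub_vec_sym nyx.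
Qed.

Lemma exists_line_thru_off x v : covered x -> ~~ (v <= x)%MS ->
  exists2 l, l \in lines_thru x & ~~ (v <= l)%MS.
Proof.
move=> Px nvx; have [l [m [xl xm lm]]] := two_lines_thru Px.
have [vl|nvl] := boolP (v <= l)%MS; last by exists l.
exists m => //; apply: contra lm => vm; have [[Ll _] [Lm _]] := (lines_thruP _ _ xl, lines_thruP _ _ xm).
apply/eqP/(card_le1_eqP (card_lines_thru_cap (covered_neq0 Px) nvx)).
  by rewrite inE xm inE Lm vm.
by rewrite inE xl inE Ll vl.
Qed.

Lemma perp_eqmx x y : (x :=: y)%MS -> perp x = perp y.
Proof. by move=> e; rewrite /perp; apply: eq_bigl => l; rewrite !inE e. Qed.

Lemma perp_eq_vec x y : x != 0 -> (x <= y)%MS -> perp x = perp y.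
Proof. by move=> x0 xy; apply: perp_eqmx; apply/eqmxP; rewrite xy submx_vec_sym. Qed.

Lemma perp_scale (k : F) x : k != 0 -> perp (k *: x) = perp x.
Proof. by move=> k0; apply: perp_eqmx; apply: eqmx_scale. Qed.

Lemma covered_scale (k : F) x : k != 0 -> covered (k *: x) = covered x.
Proof.
move=> k0; rewrite /covered scaler_eq0 (negbTE k0) /=; congr (_ && (_ != _)).
by apply/setP => l; rewrite !inE scalemx_sub_eq.
Qed.

Lemma solid_two_perps S a b c : \rank S = 4%N -> covered a -> covered b -> covered c ->
  (perp a <= S)%MS -> (perp b <= S)%MS -> (perp c <= S)%MS ->
  [|| (a <= b)%MS, (a <= c)%MS | (b <= c)%MS].
Proof.
move=> rS Pa Pb Pc aS bS cS; apply: contraT; rewrite !negb_or => /and3P[ab ac bc].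
have thru_in x : covered x -> (perp x <= S)%MS -> lines_thru x \subset lines_in S.
  by move=> Px /lines_inS; rewrite lines_in_perp.
have := leq_card_setU3 (thru_in a Pa aS) (thru_in b Pb bS) (thru_in c Pc cS)
  (card_lines_thru_cap (covered_neq0 Pb) ab) (card_lines_thru_cap (covered_neq0 Pc) ac)
  (card_lines_thru_cap (covered_neq0 Pc) bc).
by rewrite !card_lines_thru //; have := card_lines_in_solid rS; clear -q_gt1; lia.
Qed.

Lemma perp_span3 x y z : covered x -> (y <= perp x)%MS -> (z <= perp x)%MS ->
  ~~ (y <= x)%MS -> ~~ (z <= x + y)%MS -> (perp x <= x + y + z)%MS.
Proof.
move=> Px yx zx nyx nzxy; have xx := mem_perp Px.
apply: submx_rank_eq; first by in_span.
by rewrite rank_perp // rank_adds_notin // rank_span2.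
Qed.

Lemma perp_sub3 x y z k (S : 'M[F]_(k, N)) : covered x -> (y <= perp x)%MS -> (z <= perp x)%MS ->
  ~~ (y <= x)%MS -> ~~ (z <= x + y)%MS -> (x <= S)%MS -> (y <= S)%MS -> (z <= S)%MS ->
  (perp x <= S)%MS.
Proof.
move=> Px yx zx nyx nzxy xS yS zS; apply: submx_trans (perp_span3 Px yx zx nyx nzxy) _; in_span.
Qed.

Lemma exists_perp_basis x : covered x ->
  exists y z, [/\ (y <= perp x)%MS, (z <= perp x)%MS, ~~ (y <= x)%MS & ~~ (z <= x + y)%MS].
Proof.
move=> Px; have [|y [yx nyx]] := @exists_notin _ _ _ _ x (perp x).
  by rewrite rank_perp // rank_rV1.
have [|z [zx nzxy]] := @exists_notin _ _ _ _ (x + y)%MS (perp x); last by exists y, z.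
by rewrite rank_perp // rank_span2.
Qed.

(* Otherwise the solid spanned by a, b, c, d contains the planes of a, b and c: there are no quadrangles. *)
Lemma midpoint_uniq a c (b d : 'rV[F]_N) : covered a -> covered c -> ~~ (c <= perp a)%MS ->
  b != 0 -> d != 0 -> (b <= perp a)%MS -> (b <= perp c)%MS -> (d <= perp a)%MS ->
  (d <= perp c)%MS -> (b <= d)%MS.
Proof.
move=> Pa Pc nca b0 d0 ba bc da dc; apply: contraT => nbd.
have nac : ~~ (a <= perp c)%MS by apply: contra nca => ac; apply: perp_sym ac _.
have Pb := perp_covered Pa ba b0; have ab := perp_sym Pa ba b0; have cb := perp_sym Pc bc b0.
have na : ~~ (a <= b + d)%MS by apply: contra nac => abd; apply: submx_trans abd _; in_span.
have nc : ~~ (c <= b + d)%MS by apply: contra nca => cbd; apply: submx_trans cbd _; in_span.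
have ndb : ~~ (d <= b)%MS by apply: notsub_vec_sym nbd.
have base x : covered x -> ~~ (x <= b + d)%MS -> ~~ (b <= x)%MS /\ ~~ (d <= x + b)%MS.
  move=> Px nx; split; last by apply: contra nx; rewrite addsmxC => /adds_vec_exchange; apply.
  by apply: contra nx => bx; apply: submx_trans (submx_vec_sym b0 bx) (addsmxSl b d).
have [[nba ndab] [nbc ndcb]] := (base a Pa na, base c Pc nc).
have aS := perp_span3 Pa ba da nba ndab.
have ncS : ~~ (c <= a + b + d)%MS.
  by apply: contra nca => cS; apply: submx_trans cS _; have aa := mem_perp Pa; in_span.
have rS : \rank (a + b + d + c)%MS = 4%N.
  by rewrite !rank_adds_notin // rank_rV1.
have nab : ~~ (a <= b)%MS by apply: notsub_vec_sym nba.
have ncb : ~~ (c <= b)%MS by apply: notsub_vec_sym nbc.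
have bS : (perp b <= a + b + d + c)%MS.
  apply: (perp_sub3 Pb ab cb) => //; try by in_span.
  by apply: contra ncS => cba; apply: submx_trans cba _; in_span.
have cS : (perp c <= a + b + d + c)%MS by apply: (perp_sub3 Pc bc dc nbc ndcb); in_span.
case/or3P: (solid_two_perps rS Pa Pb Pc (submx_trans aS (addsmxSl _ _)) bS cS) => [|ac|].
- by rewrite (negbTE nab).
- by case/negP: nac; apply: submx_trans ac (mem_perp Pc).
- by rewrite (negbTE nbc).
Qed.

Lemma rank_add_perps z u : covered z -> (u <= perp z)%MS -> ~~ (u <= z)%MS ->
  \rank (perp z + perp u)%MS = 4%N.
Proof.
move=> Pz uz nuz; have u0 := notsub_neq0 nuz; have Pu := perp_covered Pz uz u0.
have := mxrank_sum_cap (perp z) (perp u); rewrite !rank_perp //.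
suff -> : \rank (perp z :&: perp u)%MS = 2%N by clear; lia.
rewrite -(rank_span2 (covered_neq0 Pz) nuz); apply/eqmx_rank/andP; split.
  apply/rV_subP => s; rewrite sub_capmx => /andP[sz su]; exact: no_triangle Pz uz sz u0 su nuz.
have [zz uu] := (mem_perp Pz, mem_perp Pu); have zu := perp_sym Pz uz u0.
by rewrite sub_capmx; apply/andP; split; in_span.
Qed.

(* The q + 1 solids of U through the plane [perp z] contain at most one further plane [perp u] each. *)
Lemma card_perps_in_rank5 U z (D : {set 'rV[F]_N}) : \rank U = 5%N -> covered z -> (perp z <= U)%MS ->
  (forall u, u \in D -> [/\ (u <= perp z)%MS, ~~ (u <= z)%MS & (perp u <= U)%MS]) ->
  {in D &, forall u v, u != v -> ~~ (u <= v)%MS} -> (#|D| <= q.+1)%N.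
Proof.
move=> rU Pz zU DP Dpar; have rz := rank_perp Pz.
have covD u : u \in D -> covered u by move=> /DP[uz /notsub_neq0 u0 _]; apply: perp_covered uz u0.
pose solid u := <<(perp z + perp u)%MS>>%MS.
have rank_solid u : u \in D -> \rank (perp z + perp u)%MS = 4%N by move=> /DP[uz nuz _]; apply: rank_add_perps.
rewrite -(card_in_imset (f := solid)) => [|u v Du Dv /genmxP/andP[uv _]].
  apply: (@card_intermediate_spaces _ _ (perp z) U) => //; first by rewrite rU rz.
  move=> _ /imsetP[u Du ->]; have [_ _ uU] := DP u Du.
  by split; rewrite ?genmx_id ?genmxE ?addsmxSl ?rank_solid ?rz // addsmx_sub zU.
have [[_ nu _] [_ nv _]] := (DP u Du, DP v Dv).
have := solid_two_perps (rank_solid v Dv) (covD u Du) (covD v Dv) Pz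
  (submx_trans (addsmxSr _ _) uv) (addsmxSr _ _) (addsmxSl _ _).
by rewrite (negbTE nu) (negbTE nv) !orbF; apply: contraTeq; apply: Dpar.
Qed.

Lemma no_perps_in_rank5 U z (f : F -> 'rV[F]_N) u1 u2 : \rank U = 5%N -> covered z -> (perp z <= U)%MS ->
  (forall k, [/\ (f k <= perp z)%MS, ~~ (f k <= z)%MS & (perp (f k) <= U)%MS]) ->
  (u1 <= perp z)%MS -> ~~ (u1 <= z)%MS -> (perp u1 <= U)%MS ->
  (u2 <= perp z)%MS -> ~~ (u2 <= z)%MS -> (perp u2 <= U)%MS ->
  (forall k k', k != k' -> ~~ (f k <= f k')%MS) ->
  (forall k, ~~ (f k <= u1)%MS) -> (forall k, ~~ (f k <= u2)%MS) -> (u1 <= u2)%MS.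
Proof.
move=> rU Pz zU fz u1z nu1 u1U u2z nu2 u2U f_par fu1 fu2; apply: contraT => nu12.
have f_inj : injective f.
  by move=> k k' e; apply/eqP; apply: contraT => /f_par; rewrite e submx_refl.
have fneq u k : ~~ (f k <= u)%MS -> u != f k by apply: contraNneq => ->; exact: submx_refl.
pose D := u1 |: (u2 |: [set f k | k : F]).
have card_D : #|D| = q.+2.
  have u12 : u1 != u2 by apply: contraNneq nu12 => ->; exact: submx_refl.
  have nin u : (forall k, ~~ (f k <= u)%MS) -> u \notin [set f k | k : F].
    by move=> nfu; apply/imsetP => -[k _ /eqP]; apply/negP; apply: fneq.
  by rewrite !cardsU1 !inE (negbTE u12) !nin // card_imset.
have := @card_perps_in_rank5 U z D rU Pz zU; rewrite card_D ltnn => -> //.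
  by move=> u /setU1P[->//|/setU1P[->//|/imsetP[k _ ->]]].
have [n1 n2] := (notsub_neq0 nu1, notsub_neq0 nu2).
have f0 k : f k != 0 by have [_ /notsub_neq0] := fz k.
move=> u v /setU1P[->|/setU1P[->|/imsetP[k _ ->]]] /setU1P[->|/setU1P[->|/imsetP[k' _ ->]]];
  rewrite ?eqxx //= => ne; try exact: notsub_vec_sym.
by apply: f_par; apply: contraNneq ne => ->.
Qed.

(** * Points far from a line *)

(* In the hexagon, [far l y] says that y is at incidence distance at least 5 from l, and [dist2 z y]
   that y is at incidence distance at most 4 from z. *)
Definition far l y := covered y && ((perp y :&: l)%MS == 0).
Definition midpoint z w y := [&& w != 0, (w <= perp z)%MS & (y <= perp w)%MS].
Definition dist2 z y := [exists w, midpoint z w y].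

Definition coset l y := [set x : 'rV[F]_N | ((x - y)%R <= l)%MS].
Definition touching l y m :=
  [set x in coset l y | covered x && (1 < \rank (perp x :&: (l + m))%MS)%N].

Lemma midpointI z w y : w != 0 -> (w <= perp z)%MS -> (y <= perp w)%MS -> midpoint z w y.
Proof. by move=> w0 wz yw; apply/and3P. Qed.

Lemma midpoint_covered z w y : covered z -> midpoint z w y -> covered w.
Proof. by move=> Pz /and3P[w0 wz _]; apply: perp_covered wz w0. Qed.

Lemma midpoint_sym z w y : covered z -> y != 0 -> midpoint z w y -> midpoint y w z.
Proof.
move=> Pz y0 mid; have Pw := midpoint_covered Pz mid; case/and3P: mid => w0 wz yw.
by apply: midpointI => //; apply: perp_sym.
Qed.

Lemma dist2I z w y : midpoint z w y -> dist2 z y.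
Proof. by move=> mid; apply/existsP; exists w. Qed.

Lemma dist2_sym z y : covered z -> y != 0 -> dist2 z y -> dist2 y z.
Proof. by move=> Pz y0 /existsP[w /(midpoint_sym Pz y0)/dist2I]. Qed.

Lemma perp_dist2 x y : covered x -> (y <= perp x)%MS -> dist2 x y.
Proof. by move=> Px yx; apply: (@dist2I _ x); apply: midpointI. Qed.

Lemma midpoint_shift z w y (k : F) : covered z -> midpoint z w y -> midpoint z w (y + k *: z).
Proof.
move=> Pz /and3P[w0 wz yw]; apply: midpointI => //.
by have zw := perp_sym Pz wz w0; in_span.
Qed.

Lemma dist2_shift z y (k : F) : covered z -> dist2 z y -> dist2 z (y + k *: z).
Proof. by move=> Pz /existsP[w /(midpoint_shift k Pz)/dist2I]. Qed.

Lemma dist2_covered z y : covered z -> y != 0 -> dist2 z y -> covered y.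
Proof.
move=> Pz y0 /existsP[w mid]; have Pw := midpoint_covered Pz mid; case/and3P: mid => _ _ yw.
exact: perp_covered Pw yw y0.
Qed.

Lemma dist2_par z z' y : z' != 0 -> (z' <= z)%MS -> dist2 z' y -> dist2 z y.
Proof. by move=> z0 zz; rewrite /dist2 /midpoint (perp_eq_vec z0 zz). Qed.

Lemma far_covered l y : far l y -> covered y.
Proof. by case/andP. Qed.

Lemma far_notin_perp l y z : far l y -> z != 0 -> (z <= l)%MS -> ~~ (z <= perp y)%MS.
Proof.
case/andP => _ /eqP cap0 z0 zl; apply: contra z0 => zy.
by rewrite -submx0 -cap0 sub_capmx zy.
Qed.

Lemma farI l y : covered y -> (forall z, z != 0 -> (z <= l)%MS -> ~~ (z <= perp y)%MS) -> far l y.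
Proof.
move=> Py notin; rewrite /far Py; apply/rowV0P => z; rewrite sub_capmx => /andP[zy zl].
by apply/eqP; apply: contraT => z0; move: (notin z z0 zl); rewrite zy.
Qed.

Section FixedLine.
Variables (l : 'M[F]_N) (Ll : l \in L).
Let rank_l : \rank l = 2%N := rank_line Ll.

Lemma line_perp z : z != 0 -> (z <= l)%MS -> (l <= perp z)%MS.
Proof. by move=> z0 zl; apply: lines_thru_perp; rewrite inE Ll. Qed.

Lemma line_other z : z != 0 -> exists v, (v <= l)%MS /\ ~~ (v <= z)%MS.
Proof. by move=> z0; apply: exists_notin; rewrite rank_l rank_rV1. Qed.

Lemma far_perp_notin y z : far l y -> z != 0 -> (z <= l)%MS -> ~~ (y <= perp z)%MS.
Proof.
move=> fy z0 zl; apply: contra (far_notin_perp fy z0 zl) => yz.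
exact: perp_sym (line_covered Ll z0 zl) yz (covered_neq0 (far_covered fy)).
Qed.

Lemma far_notin y : far l y -> ~~ (y <= l)%MS.
Proof.
move=> fy; have Py := far_covered fy; apply/negP => yl.
by have := far_notin_perp fy (covered_neq0 Py) yl; rewrite mem_perp.
Qed.

Lemma rank_line_far y : far l y -> \rank (l + y)%MS = 3%N.
Proof. by move=> fy; rewrite rank_adds_notin ?far_notin // rank_l. Qed.

Lemma far_disjoint y m : far l y -> (m <= perp y)%MS -> \rank (l + m)%MS = (2 + \rank m)%N.
Proof.
move=> fy my; rewrite rank_adds_disjoint ?rank_l // => v vl vm.
apply/eqP; apply: contraT => v0; case/negP: (far_notin_perp fy v0 vl); exact: submx_trans vm my.
Qed.

Lemma rank_line_perp y : far l y -> \rank (l + perp y)%MS = 5%N.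
Proof. by move=> fy; rewrite (far_disjoint fy (submx_refl _)) rank_perp // (far_covered fy). Qed.

Lemma rank_line_far_line y m : far l y -> m \in lines_thru y -> \rank (l + m)%MS = 4%N.
Proof.
move=> fy my; rewrite (far_disjoint fy (lines_thru_perp my)) rank_line //.
by case/lines_thruP: my.
Qed.

Lemma far_shift y v : far l y -> (v <= l)%MS -> covered (y + v) -> far l (y + v).
Proof.
move=> fy vl Pyv; apply: farI => // z z0 zl; apply: contra (far_perp_notin fy z0 zl) => zyv.
by rewrite -(addmx_subr _ (submx_trans vl (line_perp z0 zl))); apply: perp_sym.
Qed.

Lemma cap_far_plane y : far l y -> (perp y :&: (l + y) <= y)%MS.
Proof.
move=> fy; have Py := far_covered fy.
apply: submx_rank_leq; first by rewrite sub_capmx mem_perp // addsmxSr.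
have := mxrank_sum_cap (perp y) (l + y)%MS; rewrite rank_perp // (rank_line_far fy) rank_rV1 //.
have : (\rank (l + perp y)%MS <= \rank (perp y + (l + y))%MS)%N by apply: mxrankS; in_span.
by rewrite (rank_line_perp fy); clear; lia.
Qed.

Lemma rank_cap_far_plane y : far l y -> (\rank (perp y :&: (l + y))%MS <= 1)%N.
Proof. by move=> fy; apply: leq_trans (mxrankS (cap_far_plane fy)) (rank_leq_row _). Qed.

Lemma far_perp_notsub_solid y S : far l y -> \rank S = 4%N -> (l <= S)%MS -> ~~ (perp y <= S)%MS.
Proof.
move=> fy rS lS; apply/negP => yS; have lyS : (l + perp y <= S)%MS by in_span.
by have := mxrankS lyS; rewrite (rank_line_perp fy) rS.
Qed.

Lemma cosetP x y : reflect (exists2 v, (v <= l)%MS & x = y + v) (x \in coset l y).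
Proof.
rewrite inE; apply: (iffP idP) => [xyl|[v vl ->]]; last by rewrite addrC addKr.
by exists (x - y); rewrite // addrC subrK.
Qed.

Lemma coset_shift y v : (v <= l)%MS -> y + v \in coset l y.
Proof. by move=> vl; apply/cosetP; exists v. Qed.

Lemma mem_touching x y m : (x \in touching l y m) =
  [&& x \in coset l y, covered x & (1 < \rank (perp x :&: (l + m))%MS)%N].
Proof. by rewrite inE. Qed.

Lemma card_coset y : #|coset l y| = (q ^ 2)%N.
Proof.
have -> : coset l y = [set y + v | v in vset l].
  by apply/setP => x; apply/cosetP/imsetP => -[v vl ->]; exists v; move: vl; rewrite ?inE.
by rewrite (card_imset _ (addrI y)) card_vset rank_l.
Qed.

Lemma far_in_coset x y : far l y -> x \in coset l y -> covered x -> far l x.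
Proof. by move=> fy /cosetP[v vl ->]; apply: far_shift. Qed.

Section Midpoint.
Variables y z w : 'rV[F]_N.
Hypotheses (fy : far l y) (z0 : z != 0) (zl : (z <= l)%MS) (mid : midpoint z w y).
Let Pz : covered z := line_covered Ll z0 zl.
Let Py : covered y := far_covered fy.
Let w0 : w != 0. Proof. by case/and3P: mid. Qed.
Let wz : (w <= perp z)%MS. Proof. by case/and3P: mid. Qed.
Let yw : (y <= perp w)%MS. Proof. by case/and3P: mid. Qed.
Let Pw : covered w := midpoint_covered Pz mid.

Lemma midpoint_perp : (w <= perp y)%MS.
Proof. exact: perp_sym Pw yw (covered_neq0 Py). Qed.

Lemma midpoint_notin_line : ~~ (w <= l)%MS.
Proof. by apply/negP => wl; have := far_perp_notin fy w0 wl; rewrite yw. Qed.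

Lemma line_notin_perp_midpoint v : (v <= l)%MS -> ~~ (v <= z)%MS -> ~~ (v <= perp w)%MS.
Proof.
move=> vl vz; apply: contra midpoint_notin_line => vw.
apply: (mem_line_perp Pw Ll); rewrite (line_span Ll z0 vz zl vl).
by have zw := perp_sym Pz wz w0; in_span.
Qed.

Lemma perp_sub_line_midpoint : (perp z <= l + w)%MS.
Proof.
apply: submx_rank_eq; first by have lz := line_perp z0 zl; in_span.
by rewrite rank_adds_notin ?midpoint_notin_line // rank_l rank_perp.
Qed.

Lemma midpoint_notin_plane : ~~ (w <= l + y)%MS.
Proof.
apply: contra (far_perp_notin fy z0 zl) => wly.
have wy : (w <= y)%MS by apply: submx_trans (cap_far_plane fy); rewrite sub_capmx wly perp_sym.
exact: submx_trans (submx_vec_sym w0 wy) wz.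
Qed.

Lemma rank_midpoint_solid : \rank (l + y + w)%MS = 4%N.
Proof. by rewrite rank_adds_notin ?midpoint_notin_plane // rank_line_far. Qed.

Lemma perp_end_sub_solid : (perp z <= l + y + w)%MS.
Proof. by apply: submx_trans perp_sub_line_midpoint _; in_span. Qed.

Lemma perp_sub_solid_of S t : (t <= perp z)%MS -> t != 0 -> ~~ (t <= l)%MS -> (y <= perp t)%MS ->
  (l <= S)%MS -> (y <= S)%MS -> (t <= S)%MS -> (perp t <= S)%MS.
Proof.
move=> tz t0 tl yt lS yS tS; have Pt := perp_covered Pz tz t0.
apply: (perp_sub3 Pt (perp_sym Pz tz t0) yt) => //; last exact: submx_trans zl lS.
  by apply: contra tl => zt; apply: submx_trans zl; apply: submx_vec_sym zt.
apply: contra (far_perp_notin fy z0 zl) => ytz; apply: submx_trans ytz _.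
by have zz := mem_perp Pz; in_span.
Qed.

Lemma perp_midpoint_sub : (perp w <= l + y + w)%MS.
Proof. by apply: perp_sub_solid_of => //; [exact: midpoint_notin_line | in_span..]. Qed.

End Midpoint.

(* The plane of y + v would meet the plane of z in a point w', and the solid spanned by l, y and w
   contains the planes of z, w and w'; so w' is w. *)
Lemma touching_direction y z w v : far l y -> z != 0 -> (z <= l)%MS -> midpoint z w y ->
  (v <= l)%MS -> covered (y + v) -> (1 < \rank (perp (y + v)%R :&: (l + y + w))%MS)%N ->
  (v <= z)%MS.
Proof.
move=> fy z0 zl mid vl Pyv rcap.
have Pz := line_covered Ll z0 zl; have Pw := midpoint_covered Pz mid.
have fyv := far_shift fy vl Pyv; have rS := rank_midpoint_solid fy z0 zl mid.
have zS := perp_end_sub_solid fy z0 zl mid.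
have [w' [w'0 + w'z]] : exists w', [/\ w' != 0, (w' <= perp (y + v)%R :&: (l + y + w))%MS & (w' <= perp z)%MS].
  by apply: cap_nonzero_vec (capmxSr _ _) zS _; rewrite rS rank_perp // addn3 !ltnS.
rewrite sub_capmx => /andP[w'yv w'S].
have mid' : midpoint z w' (y + v) by apply: midpointI => //; apply: perp_sym.
have w'l := midpoint_notin_line fyv mid'; have Pw' := midpoint_covered Pz mid'.
have yvw' := perp_sym Pyv w'yv w'0; have yvS : ((y + v)%R <= l + y + w)%MS by in_span.
have w'pS : (perp w' <= l + y + w)%MS.
  by apply: (perp_sub_solid_of fyv z0 zl) => //; in_span.
have [wl zw zw'] : [/\ ~~ (w <= l)%MS, ~~ (z <= w)%MS & ~~ (z <= w')%MS].
  have wl := midpoint_notin_line fy mid.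
  by split=> //; [apply: contra wl | apply: contra w'l] => zw; apply: submx_trans zl; apply: submx_vec_sym zw.
have := solid_two_perps rS Pz Pw Pw' zS (perp_midpoint_sub fy z0 zl mid) w'pS.
rewrite (negbTE zw) (negbTE zw') /= => ww'; apply: contraT => nvz.
case/negP: (line_notin_perp_midpoint fy z0 zl mid vl nvz); case/and3P: mid => w0 _ yw.
by rewrite -(addmx_subl v yw) (perp_eq_vec w0 ww').
Qed.

Lemma touching_midpoint_line y z w m (k : F) : far l y -> z != 0 -> (z <= l)%MS -> midpoint z w y ->
  m \in lines_thru y -> (w <= m)%MS -> y + k *: z \in touching l y m.
Proof.
move=> fy z0 zl mid /lines_thruP[Lm ym] wm; have Pz := line_covered Ll z0 zl.
have Pw := midpoint_covered Pz mid.
case/and3P: (mid) => w0 wz yw; have zw := perp_sym Pz wz w0.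
have xw : ((y + k *: z)%R <= perp w)%MS by in_span.
have nxz : ~~ ((y + k *: z)%R <= perp z)%MS.
  by rewrite addmx_subr ?(far_perp_notin fy z0 zl) //; have zz := mem_perp Pz; in_span.
have x0 := notsub_neq0 nxz; have Px := perp_covered Pw xw x0.
rewrite mem_touching coset_shift ?scalemx_sub // Px /=.
have nwx : ~~ (w <= (y + k *: z)%R)%MS.
  by apply: contra nxz => wx; apply: submx_trans wz; apply: submx_vec_sym wx.
rewrite -(rank_span2 x0 nwx) mxrankS // sub_capmx; apply/andP; split.
  by have xx := mem_perp Px; have wx := perp_sym Pw xw x0; in_span.
by have zS := submx_trans zl (addsmxSl l m); in_span.
Qed.

Lemma line_meets_coset y n S : far l y -> \rank S = 4%N -> (l <= S)%MS -> (y <= S)%MS ->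
  n \in L -> (n <= S)%MS -> (forall v, v != 0 -> (v <= l)%MS -> ~~ (v <= n)%MS) ->
  exists2 x, x \in coset l y & (x <= n)%MS.
Proof.
move=> fy rS lS yS Ln nS disj.
have lyS : (l + y <= S)%MS by in_span.
have [|t [t0 tn]] := cap_nonzero_vec nS lyS.
  by rewrite rS (rank_line Ln) rank_line_far.
case/sub_adds_vecP => a [c [al e]].
have c0 : c != 0.
  by apply: contraL tn => /eqP c0; apply: disj => //; rewrite e c0 scale0r addr0.
exists (c^-1 *: t); last by in_span.
apply/cosetP; exists (c^-1 *: a); first by in_span.
by rewrite e scalerDr scalerA mulVf // scale1r addrC.
Qed.

Lemma card_other_lines_in_solid y m : far l y -> m \in lines_thru y ->
  (q <= #|lines_in (l + m)%MS :\ l|)%N.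
Proof.
move=> fy my; have := flat_solid flatL (rank_line_far_line fy my); case/lines_thruP: my => Lm ym.
have lm : l != m by apply: contraTneq ym => <-; exact: far_notin.
have : (0 < #|lines_in (l + m)%MS :\ l|)%N.
  by apply/card_gt0P; exists m; rewrite !inE Lm addsmxSr eq_sym lm.
rewrite /nb_in -/(lines_in (l + m)%MS) (cardsD1 l (lines_in _)) !inE Ll addsmxSl add1n.
by move: #|_ :\ _| #|F|; clear => k j k0; case/or4P => /eqP; lia.
Qed.

(* If no plane at a point of l lies in the solid S spanned by l and m, each further line of L in S
   contains exactly one vector of y + l. *)
Lemma card_touching_geq_disjoint y m : far l y -> m \in lines_thru y ->
  (forall z, z != 0 -> (z <= l)%MS -> ~~ (perp z <= l + m)%MS) -> (q <= #|touching l y m|)%N.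
Proof.
move=> fy my no_perp; have rS := rank_line_far_line fy my.
have yS : (y <= l + m)%MS by case/lines_thruP: my => _ ym; in_span.
apply: leq_trans (card_other_lines_in_solid fy my) _; set X := _ :\ _.
have XP n : n \in X -> [/\ n != l, n \in L & (n <= l + m)%MS] by rewrite !inE => /and3P[].
have X_coset n : n \in X -> exists x, (x \in coset l y) && (x <= n)%MS.
  move=> /XP[nl Ln nS]; have [v v0 vl|x xy xn] := line_meets_coset fy rS (addsmxSl l m) yS Ln nS.
    apply: contra (no_perp v v0 vl) => vn.
    rewrite (@perp_span v l n) ?inE ?Ll ?Ln //; [by in_span | exact: line_covered v0 vl | by rewrite eq_sym].
  by exists x; rewrite xy.
pose f n := odflt 0 [pick x | (x \in coset l y) && (x <= n)%MS].
have fP n : n \in X -> [/\ f n \in coset l y, (f n <= n)%MS & far l (f n)].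
  move=> Xn; have [_ Ln _] := XP n Xn; rewrite /f; case: pickP => [x /andP[xy xn]|none]; last first.
    by have [x] := X_coset n Xn; rewrite none.
  split=> //; apply: (far_in_coset fy xy); apply: line_covered Ln _ xn.
  by apply: contraNneq (far_notin fy) => x0; move: xy; rewrite /= inE x0 sub0r eqmx_opp.
have f_inj : {in X &, injective f}.
  move=> n1 n2 X1 X2 e; have [_ f1 ff] := fP _ X1; have [_ f2 _] := fP _ X2; rewrite -e in f2.
  have [[_ L1 S1] [_ L2 S2]] := (XP _ X1, XP _ X2).
  apply: contraNeq (far_perp_notsub_solid ff rS (addsmxSl _ _)) => n12.
  rewrite (perp_span (far_covered ff) _ _ n12) ?inE ?L1 ?L2 //; in_span.
rewrite -(card_in_imset f_inj); apply: subset_leq_card; apply/subsetP => _ /imsetP[n Xn ->].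
have [fy_n fn /far_covered Pf] := fP _ Xn; have [_ Ln nS] := XP n Xn.
rewrite mem_touching fy_n Pf /= -(rank_line Ln) mxrankS // sub_capmx nS andbT.
by apply: lines_thru_perp; rewrite inE Ln.
Qed.

Lemma card_touching_geq y m : far l y -> m \in lines_thru y -> (q <= #|touching l y m|)%N.
Proof.
move=> fy my; have rS := rank_line_far_line fy my; have [Lm ym] := lines_thruP _ _ my.
have [/existsP[z /and3P[z0 zl zS]]|none] :=
   boolP [exists z, [&& z != 0, (z <= l)%MS & (perp z <= l + m)%MS]]; last first.
  apply: card_touching_geq_disjoint => // z z0 zl; apply: contra none => zS.
  by apply/existsP; exists z; rewrite z0 zl.
have Pz := line_covered Ll z0 zl.
have [w [w0 wm wz]] : exists w, [/\ w != 0, (w <= m)%MS & (w <= perp z)%MS].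
  by apply: cap_nonzero_vec (addsmxSr l m) zS _; rewrite rS rank_perp // (rank_line Lm).
have mid : midpoint z w y.
  apply: midpointI => //; apply: submx_trans ym (lines_thru_perp _).
  by rewrite inE Lm.
rewrite -(card_imset _ (affine_line_inj (y := y) z0)); apply: subset_leq_card.
by apply/subsetP => _ /imsetP[c _ ->]; apply: touching_midpoint_line mid my wm.
Qed.
Definition isolated y := [forall v, [==> (v <= l)%MS, v != 0, covered (y + v) =>
   ~~ (perp (y + v)%R <= l + perp y)%MS]].

Lemma isolatedP y : reflect (forall v, (v <= l)%MS -> v != 0 -> covered (y + v) ->
  ~~ (perp (y + v)%R <= l + perp y)%MS) (isolated y).
Proof.
by apply: (iffP forallP) => iso v; [move/implyP: (iso v) => + vl v0 Pv => /(_ vl)/implyP/(_ v0)/implyP; apply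
  | apply/implyP => vl; apply/implyP => v0; apply/implyP; apply: iso].
Qed.

Lemma not_isolatedP y : ~~ isolated y -> exists v,
  [/\ (v <= l)%MS, v != 0, covered (y + v) & (perp (y + v)%R <= l + perp y)%MS].
Proof.
case/forallPn => v; rewrite !negb_imply andbT => /and4P[vl v0 Pyv yvU].
by exists v.
Qed.

Lemma dist2_of_perp_sub y v : far l y -> (v <= l)%MS -> v != 0 -> covered (y + v) ->
  (perp (y + v)%R <= l + perp y)%MS -> dist2 v y.
Proof.
move=> fy vl v0 Pyv yvU; have Py := far_covered fy.
have [|t [t0 tyv ty]] := cap_nonzero_vec yvU (addsmxSr l (perp y)).
  by rewrite (rank_line_perp fy) !rank_perp.
have Pt := perp_covered Py ty t0; have yt := perp_sym Py ty t0.
have vt : (v <= perp t)%MS by rewrite -(addmx_subl v yt); apply: perp_sym.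
by apply: (@dist2I _ t); apply: midpointI => //; apply: perp_sym.
Qed.

Lemma isolated_no_dir y : far l y ->
  (forall z, z != 0 -> (z <= l)%MS -> ~~ dist2 z y) -> isolated y.
Proof.
move=> fy no_dir; apply/isolatedP => v vl v0 Pyv.
by apply: contra (no_dir v v0 vl); apply: dist2_of_perp_sub.
Qed.

(* Each of the directions z1, z2 forces v to be a multiple of it. *)
Lemma isolated_two_dirs y z1 z2 : far l y -> z1 != 0 -> z2 != 0 -> (z1 <= l)%MS -> (z2 <= l)%MS ->
  ~~ (z1 <= z2)%MS -> dist2 z1 y -> dist2 z2 y -> isolated y.
Proof.
move=> fy z10 z20 z1l z2l n12 dir1 dir2; apply/isolatedP => v vl v0 Pyv; apply: contra n12 => yvU.
have v_dir z : z != 0 -> (z <= l)%MS -> dist2 z y -> (v <= z)%MS.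
  move=> z0 zl /existsP[w mid]; apply: (touching_direction fy z0 zl mid vl Pyv).
  have Py := far_covered fy; have yy := mem_perp Py.
  have := midpoint_sym (line_covered Ll z0 zl) (covered_neq0 Py) mid; case/and3P => _ wy _.
  have SU : (l + y + w <= l + perp y)%MS by in_span.
  have := leq_rank_cap yvU SU.
  by rewrite rank_perp // (rank_line_perp fy) (rank_midpoint_solid fy z0 zl mid); clear; lia.
exact: submx_trans (submx_vec_sym v0 (v_dir z1 z10 z1l dir1)) (v_dir z2 z20 z2l dir2).
Qed.

Section Isolated.
Variable y : 'rV[F]_N.
Hypotheses (fy : far l y) (iso : isolated y).
Let Py : covered y := far_covered fy.

(* If x touches two of the solids spanned by l and a line through y, its plane lies in their span. *)
Lemma isolated_touching_uniq x m1 m2 : x != y -> m1 \in lines_thru y -> m2 \in lines_thru y ->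
  x \in touching l y m1 -> x \in touching l y m2 -> m1 = m2.
Proof.
move=> xy ym1 ym2; rewrite !mem_touching => /and3P[xc Px r1] /and3P[_ _ r2].
apply/eqP; apply: contraT => m12; have fx := far_in_coset fy xc Px.
case/cosetP: xc => v vl ex; have v0 : v != 0 by apply: contraNneq xy => v0; rewrite ex v0 addr0.
have := isolatedP _ iso v vl v0; rewrite -ex => /(_ Px)/negP[].
have solid_sub m : m \in lines_thru y -> (l + m <= l + perp y)%MS.
  by move=> /lines_thru_perp my; in_span.
have x_in m : m \in lines_thru y -> (x <= l + m)%MS.
  by case/lines_thruP=> _ ym; rewrite ex; in_span.
have [x1 x2] := (x_in _ ym1, x_in _ ym2).
have rS := rank_line_far_line fy.
have cap_sub : ((l + m1) :&: (l + m2) <= l + x)%MS.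
  apply: submx_rank_leq; first by rewrite sub_capmx; apply/andP; split; in_span.
  rewrite (rank_line_far fx); have := mxrank_sum_cap (l + m1)%MS (l + m2)%MS; rewrite !rS //.
  have : (5 <= \rank (l + m1 + (l + m2))%MS)%N.
    by rewrite -(rank_line_perp fy) mxrankS // addsmx_sub (perp_span Py ym1 ym2 m12); apply/andP; split; in_span.
  by clear; lia.
pose A := (perp x :&: (l + m1))%MS; pose B := (perp x :&: (l + m2))%MS.
have rAB : (\rank (A :&: B)%MS <= 1)%N.
  apply: leq_trans (rank_cap_far_plane fx); apply: mxrankS; rewrite sub_capmx; apply/andP; split.
    exact: submx_trans (capmxSl _ _) (capmxSl _ _).
  by apply: submx_trans cap_sub; apply: capmxS; apply: capmxSr.
have rA_B : (3 <= \rank (A + B)%MS)%N.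
  by have := mxrank_sum_cap A B; move: rAB r1 r2; rewrite -/A -/B; clear; lia.
apply: (@submx_trans _ _ _ _ _ _ (A + B)%MS).
  by apply: submx_rank_leq; rewrite ?addsmx_sub ?capmxSl // rank_perp.
by rewrite addsmx_sub; apply/andP; split; apply: submx_trans (capmxSr _ _) (solid_sub _ _).
Qed.

Let touched x := [set m in lines_thru y | x \in touching l y m].

Lemma sum_card_touching :
  (\sum_(m in lines_thru y) #|touching l y m| = \sum_(x in coset l y) #|touched x|)%N.
Proof.
rewrite -(double_counting (lines_thru y) (coset l y) (fun m x => x \in touching l y m)).
apply: eq_bigr => m _; apply: eq_card => x; rewrite [RHS]inE mem_touching.
by case: (x \in coset l y).
Qed.

Lemma card_touched_leq1 x : x != y -> (#|touched x| <= 1)%N.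
Proof.
by move=> xy; apply/card_le1_eqP => m1 m2 /setIdP[ym1 x1] /setIdP[ym2 x2];
  exact: (isolated_touching_uniq xy ym2 ym1 x2 x1).
Qed.

Let coset_off := coset l y :\ y.

Lemma sum_card_touched : (\sum_(x in coset l y) #|touched x| = #|touched y| + \sum_(x in coset_off) #|touched x|)%N.
Proof.
rewrite (bigD1 y) ?inE ?subrr ?sub0mx //=; congr (_ + _)%N; apply: eq_bigl => x.
by rewrite !inE andbC.
Qed.

Lemma card_coset_off : #|coset_off| = (q ^ 2 - 1)%N.
Proof. by rewrite -(card_coset y) (cardsD1 y (coset l y)) !inE subrr sub0mx add1n subn1. Qed.

Lemma card_touched_self : (#|touched y| <= q.+1)%N.
Proof. by rewrite -(card_lines_thru Py); apply: subset_leq_card; apply/subsetP => m /setIdP[]. Qed.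

Lemma sum_card_touching_geq : (q.+1 * q <= \sum_(m in lines_thru y) #|touching l y m|)%N.
Proof.
rewrite -(card_lines_thru Py) -sum_nat_const; apply: leq_sum => m ym.
exact: card_touching_geq.
Qed.

Lemma sum_card_touched_off : (\sum_(x in coset_off) #|touched x| <= \sum_(x in coset_off) 1)%N.
Proof. by apply: leq_sum => x /setD1P[xy _]; apply: card_touched_leq1. Qed.

Lemma isolated_card_touching m : m \in lines_thru y -> #|touching l y m| = q.
Proof.
move=> ym; apply/esym; apply: (eq_of_leq_sum (f := fun=> q) (g := fun n => #|touching l y n|) _ _ ym) => [m' ym'|].
  exact: card_touching_geq.
rewrite sum_nat_const card_lines_thru // sum_card_touching sum_card_touched.
apply: leq_trans (leq_add card_touched_self sum_card_touched_off) _.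
by rewrite sum1_card card_coset_off; move: q_gt1; clear; rewrite expnS expn1; nia.
Qed.

Lemma isolated_touched x : x \in coset l y -> x != y ->
  exists2 m, m \in lines_thru y & x \in touching l y m.
Proof.
move=> xc xy; have : #|touched x| = 1%N.
  apply: (eq_of_leq_sum (A := coset_off) (f := fun t => #|touched t|) (g := fun=> 1%N)); last by rewrite in_setD1 xy.
    by move=> t /setD1P[ty _]; apply: card_touched_leq1.
  rewrite sum1_card card_coset_off; have := sum_card_touching_geq.
  rewrite sum_card_touching sum_card_touched; move: card_touched_self q_gt1; clear.
  by rewrite expnS expn1; nia.
by move=> card1; have /card_gt0P[m /setIdP[ym xm]] : (0 < #|touched x|)%N; [rewrite card1 | exists m].
Qed.

Lemma isolated_covered v : (v <= l)%MS -> covered (y + v).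
Proof.
move=> vl; have [->|v0] := eqVneq v 0; first by rewrite addr0.
have [|m _] := isolated_touched (coset_shift y vl); last by rewrite mem_touching => /and3P[].
by rewrite -subr_eq0 addrC addKr.
Qed.

Lemma isolated_rank_cap v : (v <= l)%MS -> v != 0 ->
  \rank (perp (y + v)%R :&: (l + perp y))%MS = 2%N.
Proof.
move=> vl v0; have Pyv := isolated_covered vl.
have [|m ym] := isolated_touched (coset_shift y vl); first by rewrite -subr_eq0 addrC addKr.
rewrite mem_touching => /and3P[_ _ r2]; apply/eqP; rewrite eqn_leq; apply/andP; split.
  by rewrite -ltnS -(rank_perp Pyv); apply: ltn_rank_cap; apply: (isolatedP _ iso).
by apply: leq_trans r2 (mxrankS (capmxS _ _)) => //; have := lines_thru_perp ym => ?; in_span.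
Qed.

Lemma isolated_far v : (v <= l)%MS -> far l (y + v).
Proof. by move=> vl; apply: far_shift => //; apply: isolated_covered. Qed.

End Isolated.

Lemma cap_line_thru x (A : 'M[F]_N) : covered x -> (A <= perp x)%MS -> \rank A = 2%N -> (x <= A)%MS ->
  <<A>>%MS \in lines_thru x.
Proof.
move=> Px Ax rA xA; have [s [sA nsx]] : exists s, (s <= A)%MS /\ ~~ (s <= x)%MS.
  by apply: exists_notin; rewrite rA rank_rV1.
have -> : <<A>>%MS = <<(x + s)%MS>>%MS.
  by apply: eq_genmx; apply: eqmx_span2.
by rewrite inE (perp_line Px (submx_trans sA Ax) nsx) /= genmxE addsmxSl.
Qed.

Lemma dist2_coset z y v : far l y -> z != 0 -> (z <= l)%MS -> (v <= l)%MS -> covered (y + v) ->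
  dist2 z y -> dist2 z (y + v) -> (v <= z)%MS.
Proof.
move=> fy z0 zl vl Pyv /existsP[w mid] /existsP[w' mid'].
have fyv := far_shift fy vl Pyv; have Pw' := midpoint_covered (line_covered Ll z0 zl) mid'.
apply: (touching_direction fy z0 zl mid vl Pyv); case/and3P: (mid') => w'0 w'z yw'.
have nw'y : ~~ (w' <= (y + v)%R)%MS.
  apply: contra (far_perp_notin fyv z0 zl) => w'y; apply: submx_trans w'z; exact: submx_vec_sym.
rewrite -(rank_span2 (covered_neq0 Pyv) nw'y) mxrankS // sub_capmx.
have yy := mem_perp Pyv; have w'y := perp_sym Pw' yw' (covered_neq0 Pyv).
have w'S := submx_trans w'z (perp_end_sub_solid fy z0 zl mid).
by apply/andP; split; in_span.
Qed.

Lemma dist2_common y z z' v : (v <= l)%MS -> z != 0 -> (z <= l)%MS -> z' != 0 -> (z' <= l)%MS ->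
  ~~ (z' <= z)%MS -> dist2 z y -> dist2 z' (y + v) ->
  exists k : F, [/\ dist2 z (y + k *: z), dist2 z' (y + k *: z) & ((v - k *: z)%R <= z')%MS].
Proof.
move=> vl z0 zl z'0 z'l nz'z dz dz'.
have /sub_span2P[k [k' e]] : (v <= z + z')%MS by rewrite -(line_span Ll z0 nz'z).
exists k; rewrite e [k *: z + _]addrC addrK scalemx_sub //.
split=> //; first by apply: dist2_shift (line_covered Ll z0 zl) dz.
rewrite (_ : y + k *: z = y + v + (- k') *: z').
  by apply: dist2_shift (line_covered Ll z'0 z'l) dz'.
by rewrite e scaleNr -addrA addrK.
Qed.

Lemma touching_perp_notsub H y m t : far l y -> m \in lines_thru y -> ~~ (m <= H)%MS ->
  (l <= H)%MS -> (y <= H)%MS -> t \in touching l y m -> ~~ (perp t <= H)%MS.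
Proof.
move=> fy ym nmH lH yH; rewrite mem_touching => /and3P[ty Pt]; apply: contraL => tH; rewrite -leqNgt.
have ft := far_in_coset fy ty Pt; have [_ sym] := lines_thruP _ _ ym.
have [tS tH'] : (t <= l + m)%MS /\ (t <= H)%MS.
  by case/cosetP: ty => v vl ->; have vH := submx_trans vl lH; split; in_span.
have cap_sub : (H :&: (l + m) <= l + t)%MS.
  apply: submx_rank_leq; first by rewrite sub_capmx; apply/andP; split; in_span.
  rewrite (rank_line_far ft) -ltnS -(rank_line_far_line fy ym) capmxC.
  by apply: ltn_rank_cap; apply: contra nmH; apply: submx_trans; apply: addsmxSr.
apply: leq_trans (rank_cap_far_plane ft); apply: mxrankS; rewrite sub_capmx capmxSl /=.
by apply: submx_trans cap_sub; apply: capmxS.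
Qed.

(* Let m be a line through x + v outside the span H of l, perp x and perp (x + v1). Each of the q
   points of (x + v) + l touching m has its plane outside H, so it touches the line of x in the plane
   [perp x :&: (l + perp (x + v1))]; but the latter is also touched by x. *)
Section IsolatedPair.
Variables x v1 : 'rV[F]_N.
Hypotheses (fx : far l x) (ix : isolated x) (v1l : (v1 <= l)%MS) (v10 : v1 != 0).
Hypothesis ix1 : isolated (x + v1).
Local Notation H := (l + perp x + perp (x + v1)%R)%MS.
Let Px : covered x := far_covered fx.
Let fx1 : far l (x + v1) := isolated_far fx ix v1l.
Let subH : (l <= H)%MS /\ (x <= H)%MS.
Proof. by have xx := mem_perp Px; split; in_span. Qed.

Lemma rank_isolated_pair : \rank H = 6%N.
Proof.
have := mxrank_sum_cap (l + perp x)%MS (perp (x + v1)); rewrite (rank_line_perp fx).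
by rewrite rank_perp ?(far_covered fx1) // capmxC (isolated_rank_cap fx ix) //; clear; lia.
Qed.

Lemma rank_isolated_pair_cap : \rank ((l + perp x) :&: (l + perp (x + v1)%R))%MS = 4%N.
Proof.
have := mxrank_sum_cap (l + perp x)%MS (l + perp (x + v1)%R)%MS; rewrite !rank_line_perp //.
have -> : \rank (l + perp x + (l + perp (x + v1)%R))%MS = 6%N.
  by rewrite -rank_isolated_pair; apply/eqmx_rank/andP; split; in_span.
by clear; lia.
Qed.

Definition pair_line := <<(perp x :&: (l + perp (x + v1)%R))%MS>>%MS.

Lemma rank_pair_line : \rank pair_line = 2%N.
Proof.
rewrite genmxE -{1}(addrK v1 x).
by apply: (isolated_rank_cap fx1 ix1); rewrite ?eqmx_opp ?oppr_eq0.
Qed.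

Lemma pair_line_thru : pair_line \in lines_thru x.
Proof.
apply: cap_line_thru => //; [exact: capmxSl | by rewrite -rank_pair_line genmxE |].
by rewrite sub_capmx mem_perp //= -{1}(addrK v1 x); have := mem_perp (far_covered fx1) => ?; in_span.
Qed.

Lemma pair_cap_sub_solid : ((l + perp x) :&: (l + perp (x + v1)%R) <= l + pair_line)%MS.
Proof.
apply: submx_rank_eq; last by rewrite rank_isolated_pair_cap (rank_line_far_line fx pair_line_thru).
rewrite addsmx_sub !sub_capmx !addsmxSl /= /pair_line !genmxE capmxSr andbT.
by apply: submx_trans (capmxSl _ _) _; apply: addsmxSr.
Qed.

Lemma perp_meets_pair_solid v : (v <= l)%MS -> ~~ (perp (x + v)%R <= H)%MS ->
  (1 < \rank (perp (x + v)%R :&: (l + pair_line))%MS)%N.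
Proof.
move=> vl nH; have Pxv := isolated_covered fx ix vl.
have v0 : v != 0 by apply: contraNneq nH => ->; rewrite addr0; in_span.
have vv1 : v - v1 != 0.
  by rewrite subr_eq0; apply: contraNneq nH => ->; in_span.
have rank_cap1 : \rank (perp (x + v)%R :&: (l + perp (x + v1)%R))%MS = 2%N.
  have -> : x + v = x + v1 + (v - v1) by rewrite addrACA subrr addr0.
  by apply: (isolated_rank_cap fx1 ix1); rewrite // addmx_subl ?eqmx_opp.
have rank_capH : (\rank (perp (x + v)%R :&: H)%MS <= 2)%N.
  by rewrite -ltnS -(rank_perp Pxv); apply: ltn_rank_cap.
have capH_sub U : (U <= H)%MS -> \rank (perp (x + v)%R :&: U)%MS = 2%N ->
    (perp (x + v)%R :&: H <= U)%MS.
  move=> UH rU; apply: submx_trans (capmxSr (perp (x + v)) U).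
  by apply: submx_rank_leq; rewrite ?rU //; apply: capmxS.
have rank_cap0 := isolated_rank_cap fx ix vl v0.
rewrite -rank_cap0; apply: mxrankS; rewrite sub_capmx capmxSl /=.
apply: submx_trans pair_cap_sub_solid; rewrite sub_capmx capmxSr /=.
apply: submx_trans (capH_sub _ _ rank_cap1); last by in_span.
by apply: capmxS => //; in_span.
Qed.

Lemma touching_pair_line_self : x \in touching l x pair_line.
Proof.
rewrite mem_touching inE subrr sub0mx Px /= -rank_pair_line mxrankS // sub_capmx addsmxSr andbT.
exact: lines_thru_perp pair_line_thru.
Qed.

Lemma isolated_pair_perp_sub v : (v <= l)%MS -> (perp (x + v)%R <= H)%MS.
Proof.
move=> vl; apply: contraT => nH; have fy := isolated_far fx ix vl; have [lH xH] := subH.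
have [m ym nmH] : exists2 m, m \in lines_thru (x + v) & ~~ (m <= H)%MS.
  apply/exists_inP; apply: contraNT nH; rewrite negb_exists_in => /forall_inP thruH.
  by apply/sumsmx_subP => m /thruH; rewrite negbK.
have yH : ((x + v)%R <= H)%MS by in_span.
have sub : touching l (x + v) m \subset touching l x pair_line :\ x.
  apply/subsetP => t ty; have ntH := touching_perp_notsub fy ym nmH lH yH ty.
  move: ty; rewrite mem_touching => /and3P[/cosetP[u ul et] Pt _].
  have vul : ((v + u)%R <= l)%MS by in_span.
  rewrite in_setD1 mem_touching Pt et -addrA coset_shift //= perp_meets_pair_solid ?andbT //.
    by apply: contraNneq ntH => et'; rewrite et -addrA et'; in_span.
  by rewrite addrA -et.
have := subset_leq_card sub; have := card_touching_geq fy ym.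
have := isolated_card_touching fx ix pair_line_thru.
rewrite (cardsD1 x) touching_pair_line_self add1n => <- /leq_trans le /le.
by rewrite ltnn.
Qed.

End IsolatedPair.

End FixedLine.

(** * Isolated points and hyperplanes *)

Section AllDirections.
Variables (l : 'M[F]_N) (Ll : l \in L) (x : 'rV[F]_N).
Hypotheses (fx : far l x) (all_dir : forall z, z != 0 -> (z <= l)%MS -> dist2 z x).
Local Notation U := (l + perp x)%MS.
Let Px : covered x := far_covered fx.

Lemma perp_sub_span z : z != 0 -> (z <= l)%MS -> (perp z <= U)%MS.
Proof.
move=> z0 zl; have /existsP[w mid] := all_dir z0 zl; have wx := midpoint_perp Ll fx z0 zl mid.
by apply: submx_trans (perp_sub_line_midpoint Ll fx z0 zl mid) _; in_span.
Qed.

Section Side.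
Variables z w : 'rV[F]_N.
Hypotheses (z0 : z != 0) (zl : (z <= l)%MS) (mid : midpoint z w x).
Let Pz : covered z := line_covered Ll z0 zl.
Let Pw : covered w := midpoint_covered Pz mid.
Let wz : (w <= perp z)%MS. Proof. by case/and3P: mid. Qed.
Let xw : (x <= perp w)%MS. Proof. by case/and3P: mid. Qed.
Let wx : (w <= perp x)%MS := midpoint_perp Ll fx z0 zl mid.
Let zw : (z <= perp w)%MS := perp_sym Pz wz (covered_neq0 Pw).
Let nwl : ~~ (w <= l)%MS := midpoint_notin_line Ll fx mid.
Let nxz : ~~ (x <= perp z)%MS := far_perp_notin Ll fx z0 zl.

Lemma add_midpoint_notin_perp : ~~ ((x + w)%R <= perp z)%MS.
Proof. by rewrite addmx_subr. Qed.

Lemma far_add_midpoint : far l (x + w).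
Proof.
have rw : ((x + w)%R <= perp w)%MS by have ww := mem_perp Pw; in_span.
have r0 := notsub_neq0 add_midpoint_notin_perp; have Pr := perp_covered Pw rw r0.
apply: farI => // v v0 vl; apply/negP => vr; have lz := line_perp Ll z0 zl.
have [vz|nvz] := boolP (v <= z)%MS.
  by case/negP: add_midpoint_notin_perp; rewrite -(perp_eq_vec v0 vz); apply: perp_sym.
have wv := midpoint_uniq Pz Pr add_midpoint_notin_perp (covered_neq0 Pw) v0 wz (perp_sym Pw rw r0)
  (submx_trans vl lz) vr.
by case/negP: nwl; apply: submx_trans vl.
Qed.

Section Shift.
Variable u : 'rV[F]_N.
Hypotheses (ul : (u <= l)%MS) (nuz : ~~ (u <= z)%MS).
Let u0 : u != 0 := notsub_neq0 nuz.
Let Pu : covered u := line_covered Ll u0 ul.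
Let uz : (u <= perp z)%MS := submx_trans ul (line_perp Ll z0 zl).
Let zu : (z <= perp u)%MS := submx_trans zl (line_perp Ll u0 ul).
Let nuw : ~~ (u <= perp w)%MS := line_notin_perp_midpoint Ll fx z0 zl mid ul nuz.
Local Notation side := <<(w + x)%MS>>%MS.

Let nxw : ~~ (x <= w)%MS. Proof. by apply: contra nxz => xw1; apply: submx_trans wz. Qed.
Let sideL : side \in L := perp_line Pw xw nxw.

Lemma far_side : far side u.
Proof.
apply: farI => // v v0; rewrite genmxE => vwx; apply/negP => vu.
have vw : (v <= perp w)%MS by have ww := mem_perp Pw; apply: submx_trans vwx _; in_span.
have Pv := perp_covered Pw vw v0.
have [vz|nvz] := boolP (v <= perp z)%MS.
  have [k [k' e]] := sub_span2P vwx.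
  have vw1 : (v <= w)%MS.
    have [k0|k0] := eqVneq k' 0; first by rewrite e k0 scale0r addr0 scalemx_sub.
    case/negP: nxz; apply: (submx_of_lincomb k0 _ vz (scalemx_sub k wz)).
    by rewrite e addrC.
  by case/negP: nuw; rewrite -(perp_eq_vec v0 vw1); apply: perp_sym.
have := midpoint_uniq Pz Pv nvz (covered_neq0 Pw) u0 wz (perp_sym Pw vw v0) uz (perp_sym Pu vu v0).
by move=> wu; case/negP: nwl; apply: submx_trans ul.
Qed.

Lemma isolated_side : isolated side u.
Proof.
have /existsP[wu midu] := all_dir u0 ul.
apply: (isolated_two_dirs sideL far_side (z1 := x) (z2 := w)) => //; rewrite ?genmxE ?addsmxSl ?addsmxSr //.
  exact: dist2I (midpoint_sym Pu (covered_neq0 Px) midu).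
exact: dist2I (midpointI z0 zw uz).
Qed.

Let r_side : ((x + w)%R <= side)%MS. Proof. by rewrite genmxE; in_span. Qed.

Lemma covered_add_side : covered (x + w + u).
Proof. by rewrite addrC; exact: (isolated_covered sideL far_side isolated_side r_side). Qed.

Lemma far_add_side : far l (x + w + u).
Proof. exact: (far_shift Ll far_add_midpoint ul covered_add_side). Qed.

Lemma rank_add_side_cap : \rank (perp (x + w + u)%R :&: U)%MS = 2%N.
Proof.
have r0 := notsub_neq0 add_midpoint_notin_perp.
rewrite addrC -(isolated_rank_cap sideL far_side isolated_side r_side r0).
have sideU : (side + perp u <= U)%MS.
  by have pu := perp_sub_span u0 ul; have xx := mem_perp Px; rewrite addsmx_sub genmxE; apply/andP; split; in_span.
apply/eqmx_rank/andP; split; apply: capmxS => //; apply: submx_rank_eq => //.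
by rewrite (rank_line_perp Ll fx) (rank_line_perp sideL far_side).
Qed.

Lemma add_side_no_common_midpoint z' w' : z' != 0 -> (z' <= l)%MS -> midpoint z' w' x ->
  ~~ midpoint z' w' (x + w + u).
Proof.
move=> z'0 z'l mid'; apply/negP => /and3P[w'0 w'z' ruw']; case/and3P: (mid') => _ _ xw'.
have Pz' := line_covered Ll z'0 z'l; have Pw' := midpoint_covered Pz' mid'.
have wuw' : ((w + u)%R <= perp w')%MS by rewrite -(addmx_subl _ xw') addrA.
have [z'z|nz'z] := boolP (z' <= z)%MS.
  have w'w : (w' <= w)%MS.
    by rewrite (perp_eq_vec z'0 z'z) in w'z'; apply: (midpoint_uniq Pz Px nxz) => //; apply: perp_sym.
  by case/negP: nuw; rewrite -(addmx_subl u (mem_perp Pw)) -(perp_eq_vec w'0 w'w).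
have wuz : ((w + u)%R <= perp z)%MS by in_span.
have nw'z : ~~ (w' <= perp z)%MS.
  have nzz' := notsub_vec_sym z0 nz'z.
  apply: contra (line_notin_perp_midpoint Ll fx z'0 z'l mid' zl nzz') => w'z; exact: perp_sym.
have wu0 : w + u != 0.
  by apply: contraNneq nwl => /eqP; rewrite addr_eq0 => /eqP->; rewrite eqmx_opp.
have z'z : (z' <= perp z)%MS := submx_trans z'l (line_perp Ll z0 zl).
have := midpoint_uniq Pz Pw' nw'z wu0 z'0 wuz wuw' z'z (perp_sym Pz' w'z' w'0).
by move=> wuz'; case/negP: nwl; rewrite -(addmx_subr w ul); apply: submx_trans z'l.
Qed.

(* Otherwise the planes of the points of l and of two distinct midpoints all lie in U. *)
Lemma add_side_not_dist2 z' : z' != 0 -> (z' <= l)%MS -> ~~ dist2 z' (x + w + u).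
Proof.
move=> z'0 z'l; apply/negP => /existsP[w1 mid1]; have /existsP[w2 mid2] := all_dir z'0 z'l.
have Pz' := line_covered Ll z'0 z'l; have z'U := perp_sub_span z'0 z'l.
have [lU xU] : (l <= U)%MS /\ (x <= U)%MS by have xx := mem_perp Px; split; in_span.
have ruU : ((x + w + u)%R <= U)%MS by have uU := submx_trans ul lU; in_span.
have perpU y s : far l y -> (y <= U)%MS -> midpoint z' s y ->
    [/\ (s <= perp z')%MS, ~~ (s <= z')%MS, (perp s <= U)%MS & ~~ (s <= l)%MS].
  move=> fy yU mids; have nsl := midpoint_notin_line Ll fy mids; case/and3P: mids => s0 sz' ys.
  split=> //; first by apply: contra nsl => /submx_trans->.
  by apply: (perp_sub_solid_of Ll fy z'0 z'l) => //; apply: submx_trans sz' _.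
have [w1z' nw1z' w1U nw1l] := perpU _ _ far_add_side ruU mid1.
have [w2z' nw2z' w2U nw2l] := perpU _ _ fx xU mid2.
have w12 : ~~ (w2 <= w1)%MS.
  apply: contra (add_side_no_common_midpoint z'0 z'l mid2) => w21.
  case/and3P: mid1 => _ _ ruw1; case/and3P: mid2 => w20 _ _.
  by apply: midpointI; rewrite // (perp_eq_vec w20 w21).
have [v0 [v0l nv0]] := line_other Ll z'0.
have vl k : ((v0 + k *: z')%R <= l)%MS by in_span.
have nvz' k : ~~ ((v0 + k *: z')%R <= z')%MS by rewrite addmx_subr ?scalemx_sub.
have nvs k s : ~~ (s <= l)%MS -> ~~ ((v0 + k *: z')%R <= s)%MS.
  by apply: contra => /(submx_vec_sym (notsub_neq0 (nvz' k)))/submx_trans->.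
case/negP: w12; apply: (@no_perps_in_rank5 U z' (fun k => v0 + k *: z')) => // [|k|k k' kk'||k].
- exact: rank_line_perp.
- split=> //; first exact: submx_trans (line_perp Ll z'0 z'l).
  exact: perp_sub_span (notsub_neq0 (nvz' k)) (vl k).
- exact: affine_line_notsub.
- by move=> k; apply: nvs.
- exact: nvs.
Qed.

Lemma isolated_add_side : isolated l (x + w + u).
Proof. exact: (isolated_no_dir Ll far_add_side add_side_not_dist2). Qed.

End Shift.

Definition side_line u := <<(perp (x + w + u)%R :&: U)%MS>>%MS.
Definition side_solid u := (l + side_line u)%MS.
Local Notation off_z := (vset l :\: vset z).

Let off_zP u : u \in off_z -> (u <= l)%MS /\ ~~ (u <= z)%MS.
Proof. by rewrite !inE => /andP[]. Qed.

Lemma side_line_thru u : u \in off_z -> side_line u \in lines_thru (x + w + u).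
Proof.
move=> /off_zP[ul nuz]; have Pru := covered_add_side ul nuz.
apply: cap_line_thru; rewrite ?capmxSl ?rank_add_side_cap //.
rewrite sub_capmx mem_perp //=; have xx := mem_perp Px.
by have uU := submx_trans ul (addsmxSl l (perp x)); in_span.
Qed.

Lemma rank_side_solid u : u \in off_z -> \rank (side_solid u) = 4%N.
Proof.
move=> zu; have [ul nuz] := off_zP zu.
exact: (rank_line_far_line Ll (far_add_side ul nuz) (side_line_thru zu)).
Qed.

Lemma side_solid_sub u : (side_solid u <= U)%MS.
Proof. by rewrite addsmx_sub addsmxSl genmxE capmxSr. Qed.

Lemma plane_sub_side_solid u : u \in off_z -> (l + (x + w)%R <= side_solid u)%MS.
Proof.
move=> zu; have [ul _] := off_zP zu; have [_ ru] := lines_thruP _ _ (side_line_thru zu).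
rewrite addsmx_sub addsmxSl /= -(addmx_subl (x + w) (submx_trans ul (addsmxSl _ _))).
by rewrite addrC; apply: submx_trans ru (addsmxSr _ _).
Qed.

Lemma perp_notsub_side_solid u z' : u \in off_z -> z' != 0 -> (z' <= l)%MS ->
  ~~ (perp z' <= side_solid u)%MS.
Proof.
move=> zu z'0 z'l; have [ul nuz] := off_zP zu; apply: contra (add_side_not_dist2 ul nuz z'0 z'l) => z'S.
have [|t [t0 tn tz']] := cap_nonzero_vec (addsmxSr l (side_line u)) z'S.
  have [Ln _] := lines_thruP _ _ (side_line_thru zu).
  by rewrite -/(side_solid u) rank_side_solid // rank_line // rank_perp // (line_covered Ll).
apply: dist2I (midpointI t0 tz' _); apply: perp_sym (covered_add_side ul nuz) _ t0.
by apply: submx_trans tn _; rewrite genmxE capmxSl.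
Qed.

Lemma card_side_fibre u : u \in off_z ->
  (#|[set v in off_z | <<side_solid v>>%MS == <<side_solid u>>%MS]| <= q)%N.
Proof.
move=> zu; have [ul nuz] := off_zP zu.
rewrite -(isolated_card_touching Ll (far_add_side ul nuz) (isolated_add_side ul nuz) (side_line_thru zu)).
rewrite -(card_imset _ (addrI (x + w))); apply: subset_leq_card; apply/subsetP => _ /imsetP[v + ->].
rewrite inE => /andP[zv /eqP/genmxP/andP[vu _]]; have [vl nvz] := off_zP zv.
rewrite mem_touching covered_add_side // inE opprD addrACA subrr add0r addmx_sub ?eqmx_opp //=.
rewrite -(rank_add_side_cap vl nvz); apply: mxrankS; rewrite sub_capmx capmxSl /=.
by apply: submx_trans vu; apply: submx_trans (addsmxSr l _); rewrite genmxE.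
Qed.

Lemma card_side_solids : (q.-1 <= #|[set <<side_solid u>>%MS | u in off_z]|)%N.
Proof.
rewrite -(leq_pmul2r (ltnW q_gt1)); apply: leq_trans (leq_card_fibres card_side_fibre).
by rewrite card_vsetD // (rank_line Ll) rank_rV1 // expnS_subn expn1 mulnC.
Qed.

Local Notation perp_solid z' := (perp z' + (x + w)%R)%MS.

Lemma rank_perp_solid z' : z' != 0 -> (z' <= l)%MS -> \rank (perp_solid z') = 4%N.
Proof.
move=> z'0 z'l; have nr := far_perp_notin Ll far_add_midpoint z'0 z'l.
by rewrite rank_adds_notin ?rank_perp // (line_covered Ll z'0 z'l).
Qed.

Lemma perp_solid_between z' : z' != 0 -> (z' <= l)%MS ->
  (l + (x + w)%R <= perp_solid z')%MS /\ (perp_solid z' <= U)%MS.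
Proof.
move=> z'0 z'l; have lz' := line_perp Ll z'0 z'l; have z'U := perp_sub_span z'0 z'l.
by have xx := mem_perp Px; split; in_span.
Qed.

Lemma perp_midpoint_sub_perp_solid : (perp w <= perp_solid z)%MS.
Proof.
have wD : (w <= perp_solid z)%MS by apply: submx_trans wz (addsmxSl _ _).
apply: (perp_sub3 Pw zw xw) => //.
- by apply: contra nwl => /(submx_vec_sym z0)/submx_trans->.
- by apply: contra nxz => /submx_trans->; have zz := mem_perp Pz; in_span.
- by have zz := mem_perp Pz; in_span.
by rewrite -(addmx_subl x wD) addrC addsmxSr.
Qed.

Lemma perp_notsub_perp_solid z' : (z' <= l)%MS -> ~~ (z' <= z)%MS -> ~~ (perp z' <= perp_solid z)%MS.
Proof.
move=> z'l nz'z; have Pz' := line_covered Ll (notsub_neq0 nz'z) z'l; apply/negP => z'D.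
have := solid_two_perps (rank_perp_solid z0 zl) Pz' Pz Pw z'D (addsmxSl _ _) perp_midpoint_sub_perp_solid.
rewrite (negbTE nz'z) /= => /orP[] /submx_vec_sym wz'; case/negP: nwl.
  by apply: submx_trans z'l; apply: wz'.
by apply: submx_trans zl; apply: wz'.
Qed.

(* Otherwise the q - 1 solids [side_solid u], together with [perp_solid z], [perp_solid z1] and
   [perp_solid z2], would exceed the q + 1 solids of U through the plane of l and x + w. *)
Lemma perp_solid_const z1 z2 : z1 \in off_z -> z2 \in off_z -> (perp z2 <= perp_solid z1)%MS.
Proof.
move=> /off_zP[z1l nz1] /off_zP[z2l nz2]; apply: contraT => nz12.
have [z10 z20] := (notsub_neq0 nz1, notsub_neq0 nz2); have fr := far_add_midpoint.
pose sides := [set <<side_solid u>>%MS | u in off_z].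
pose solid z' := <<perp_solid z'>>%MS.
have solid_neq z' S : ~~ (perp z' <= S)%MS -> solid z' != <<S>>%MS.
  by apply: contraNneq => /genmxP/andP[DS _]; apply: submx_trans DS; apply: addsmxSl.
have solid_notin z' : z' != 0 -> (z' <= l)%MS -> solid z' \notin sides.
  move=> z'0 z'l; apply/imsetP => -[u zu /eqP]; apply/negP; apply: solid_neq.
  exact: perp_notsub_side_solid.
pose D := solid z1 |: (solid z2 |: (solid z |: sides)).
have card_D : #|D| = (3 + #|sides|)%N.
  rewrite /D !cardsU1 !inE (negbTE (solid_notin _ z0 zl)) (negbTE (solid_notin _ z10 z1l)).
  rewrite (negbTE (solid_notin _ z20 z2l)) eq_sym.
  by rewrite !(negbTE (solid_neq _ _ _)) ?perp_notsub_perp_solid.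
have : (#|D| <= q.+1)%N.
  have xx := mem_perp Px; have lrU : (l + (x + w)%R <= U)%MS by in_span.
  have [rE rU] := (rank_line_far Ll fr, rank_line_perp Ll fx).
  have solidP z' : z' != 0 -> (z' <= l)%MS -> [/\ <<solid z'>>%MS = solid z',
      (l + (x + w)%R <= solid z')%MS, (solid z' <= U)%MS & \rank (solid z') = 4%N].
    by move=> z'0 z'l; rewrite genmx_id !genmxE rank_perp_solid //; have [-> ->] := perp_solid_between z'0 z'l.
  apply: (card_intermediate_spaces lrU); rewrite ?rE ?rU // => S; rewrite !inE.
  case/or4P => [/eqP->|/eqP->|/eqP->|/imsetP[u zu ->]]; [exact: solidP..|].
  by rewrite genmx_id !genmxE rank_side_solid // plane_sub_side_solid // side_solid_sub.
by rewrite card_D; have := card_side_solids; rewrite -/sides; move: #|sides| q_gt1; clear; lia.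
Qed.

End Side.

Lemma all_directions_small_field : (q <= 2)%N.
Proof.
have [|z [z0 zl]] := @exists_nonzero _ _ _ l; first by rewrite (rank_line Ll).
have /existsP[w mid] := all_dir z0 zl; have [v [vl nvz]] := line_other Ll z0.
rewrite leqNgt; apply/negP => /card_gt2P[k1 [k2 [k3 [_ [k12 k23 k31]]]]].
pose p k := v + k *: z; have p_par k k' : k != k' -> ~~ (p k <= p k')%MS by apply: affine_line_notsub.
have pl k : (p k <= l)%MS by rewrite /p; in_span.
have npz k : ~~ (p k <= z)%MS by rewrite /p addmx_subr ?scalemx_sub.
have offP k : p k \in vset l :\: vset z by rewrite !inE npz pl.
have Pp k : covered (p k) := line_covered Ll (notsub_neq0 (npz k)) (pl k).
have sub k : (perp (p k) <= perp (p k1) + (x + w)%R)%MS by apply: (perp_solid_const z0 zl mid).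
have := solid_two_perps (rank_perp_solid z0 zl mid (notsub_neq0 (npz k1)) (pl k1)) (Pp k1) (Pp k2) (Pp k3)
  (sub k1) (sub k2) (sub k3).
by rewrite !(negbTE (p_par _ _ _)) // eq_sym.
Qed.

End AllDirections.

Section LineIsolated.
Variables (l : 'M[F]_N) (Ll : l \in L).

Section NoOther.
Variables x z1 z2 : 'rV[F]_N.
Hypotheses (fx : far l x) (z10 : z1 != 0) (z20 : z2 != 0) (z1l : (z1 <= l)%MS) (z2l : (z2 <= l)%MS).
Hypotheses (nz12 : ~~ (z1 <= z2)%MS) (dz1 : dist2 z1 x) (dz2 : dist2 z2 x).
Hypothesis no_other : forall v, (v <= l)%MS -> v != 0 -> ~~ isolated l (x + v).
Let ix : isolated l x := isolated_two_dirs Ll fx z10 z20 z1l z2l nz12 dz1 dz2.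
Let fxv v (vl : (v <= l)%MS) : far l (x + v) := isolated_far Ll fx ix vl.

Lemma no_other_dir_uniq v z z' : (v <= l)%MS -> v != 0 -> z != 0 -> (z <= l)%MS -> z' != 0 -> (z' <= l)%MS ->
  dist2 z (x + v) -> dist2 z' (x + v) -> (z <= z')%MS.
Proof.
move=> vl v0 z0 zl z'0 z'l dz dz'; apply: contraT => nzz'; case/negP: (no_other vl v0).
exact: (isolated_two_dirs Ll (fxv vl) z0 z'0).
Qed.

Lemma no_other_all_dir z : z != 0 -> (z <= l)%MS -> dist2 z x.
Proof.
move=> z0 zl; have Pz := line_covered Ll z0 zl.
have [z' /and3P[z'0 z'l dz']|none] := pickP (fun z' => [&& z' != 0, (z' <= l)%MS & dist2 z' (x + z)]); last first.
  case/negP: (no_other zl z0); apply: (isolated_no_dir Ll (fxv zl)) => z' z'0 z'l.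
  by move: (none z'); rewrite z'0 z'l /= => ->.
have [z'z|nz'z] := boolP (z' <= z)%MS.
  by have := dist2_shift (-1) Pz (dist2_par z'0 z'z dz'); rewrite scaleN1r addrK.
have [t [t0 tl nz't dt]] : exists t, [/\ t != 0, (t <= l)%MS, ~~ (z' <= t)%MS & dist2 t x].
  have [z'z1|nz'z1] := boolP (z' <= z1)%MS; last by exists z1.
  by exists z2; split=> //; apply: contra nz12; apply: submx_trans; apply: submx_vec_sym z'z1.
have [k [dtk dz'k zk]] := dist2_common Ll zl t0 tl z'0 z'l nz't dt dz'.
have [k0|k0] := eqVneq k 0.
  by case/negP: nz'z; apply: (submx_vec_sym z0); rewrite k0 scale0r subr0 in zk.
have kt0 : k *: t != 0 by rewrite scaler_eq0 negb_or k0.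
by case/negP: nz't; apply: (no_other_dir_uniq (scalemx_sub k tl) kt0).
Qed.

(* Over the field with two elements v = z1, and the planes of x and x + z1 span the same space with l. *)
Lemma no_other_isolated_false : False.
Proof.
have q2 := all_directions_small_field Ll fx no_other_all_dir.
have [v [vl v0 Pv perp_sub]] := not_isolatedP (no_other z1l z10).
have dz1' : dist2 z1 (x + z1) by have := dist2_shift 1 (line_covered Ll z10 z1l) dz1; rewrite scale1r.
have dv := dist2_of_perp_sub Ll (fxv z1l) vl v0 Pv perp_sub.
have /sub_rVP[k ev] := no_other_dir_uniq z1l z10 v0 vl z10 z1l dv dz1'.
have k0 : k != 0 by apply: contraNneq v0 => k0; rewrite ev k0 scale0r.
have k1 : k = -1.
  apply/eqP; apply: contraTT q2 => k1; rewrite -ltnNge.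
  by rewrite (cardD1 0) (cardD1 (-1)) (cardD1 k) !inE oppr_eq0 oner_eq0 k0 k1.
rewrite ev k1 scaleN1r addrK in perp_sub.
case/negP: (isolatedP _ _ ix z1 z1l z10 (far_covered (fxv z1l))).
apply: submx_trans (addsmxSr l _) _; apply: submx_rank_eq; first by in_span.
by rewrite !(rank_line_perp Ll) // fxv.
Qed.

End NoOther.

Lemma isolated_other x z1 z2 : far l x -> z1 != 0 -> z2 != 0 -> (z1 <= l)%MS -> (z2 <= l)%MS ->
  ~~ (z1 <= z2)%MS -> dist2 z1 x -> dist2 z2 x ->
  exists v, [/\ (v <= l)%MS, v != 0 & isolated l (x + v)].
Proof.
move=> fx z10 z20 z1l z2l nz12 dz1 dz2.
have [v /and3P[]|none] := pickP (fun v => [&& (v <= l)%MS, v != 0 & isolated l (x + v)]); first by exists v.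
case: (no_other_isolated_false fx z10 z20 z1l z2l nz12 dz1 dz2) => v vl v0.
by move: (none v); rewrite /= vl v0 => /negbT.
Qed.

Section IsolatedCoset.
Variable x : 'rV[F]_N.
Hypotheses (fx : far l x) (ix : isolated l x).
Let fxv v (vl : (v <= l)%MS) : far l (x + v) := isolated_far Ll fx ix vl.

Lemma exists_isolated_pair :
  exists a v, [/\ (a <= l)%MS, (v <= l)%MS, v != 0, isolated l (x + a) & isolated l (x + a + v)].
Proof.
pose direction z a := [&& z != 0, (z <= l)%MS & dist2 z (x + a)].
have [[a [z1 z2]] /and4P[/= al nz12 /and3P[z10 z1l dz1] /and3P[z20 z2l dz2]]|two_dirs] :=
    pickP (fun p : 'rV[F]_N * ('rV[F]_N * 'rV[F]_N) =>
      [&& (p.1 <= l)%MS, ~~ (p.2.1 <= p.2.2)%MS, direction p.2.1 p.1 & direction p.2.2 p.1]).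
  have [v [vl v0 iv]] := isolated_other (fxv al) z10 z20 z1l z2l nz12 dz1 dz2.
  by exists a, v; split=> //; apply: (isolated_two_dirs Ll (fxv al) z10 z20).
have [[a z] /andP[/= al dir_z]|no_dir] := pickP (fun p : 'rV[F]_N * 'rV[F]_N => (p.1 <= l)%MS && direction p.2 p.1); last first.
  have iso t : (t <= l)%MS -> isolated l (x + t).
    move=> tl; apply: (isolated_no_dir Ll (fxv tl)) => z z0 zl; apply/negP => dz.
    by move: (no_dir (t, z)); rewrite /direction /= tl z0 zl dz.
  have [|v [v0 vl]] := @exists_nonzero _ _ _ l; first by rewrite (rank_line Ll).
  by exists 0, v; split; rewrite ?sub0mx ?addr0 // iso.
case/and3P: (dir_z) => z0 zl dz; have [v [vl nvz]] := line_other Ll z0.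
have iso t : (t <= l)%MS -> ~~ (t <= z)%MS -> isolated l (x + a + t).
  move=> tl ntz; have fat : far l (x + a + t) by rewrite -addrA; apply: fxv; in_span.
  apply: (isolated_no_dir Ll fat) => z' z'0 z'l; apply/negP => dz'.
  have [z'z|nz'z] := boolP (z' <= z)%MS.
    case/negP: ntz; apply: (dist2_coset Ll (fxv al) z0 zl tl (far_covered fat) dz).
    exact: dist2_par z'0 z'z dz'.
  have [k [dzk dz'k _]] := dist2_common Ll tl z0 zl z'0 z'l nz'z dz dz'.
  move: (two_dirs (a + k *: z, (z', z))); rewrite /direction /= addrA z0 zl z'0 z'l dzk dz'k nz'z.
  by rewrite addmx_sub ?scalemx_sub.
exists (a + v), z; split; rewrite ?addmx_sub //; first by rewrite addrA iso.
by rewrite addrA -(addrA _ v) iso //; [apply: addmx_sub | rewrite addmx_subr].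
Qed.

Lemma isolated_hyperplane :
  exists H : 'M[F]_N, [/\ \rank H = 6%N, (l + perp x <= H)%MS &
     forall v, (v <= l)%MS -> covered (x + v) /\ (perp (x + v)%R <= H)%MS].
Proof.
have [a [v [al vl v0 ia iv]]] := exists_isolated_pair; exists (l + perp (x + a)%R + perp (x + a + v)%R)%MS.
have perp_sub t : (t <= l)%MS -> (perp (x + t)%R <= l + perp (x + a)%R + perp (x + a + v)%R)%MS.
  move=> tl; have -> : x + t = x + a + (t - a) by rewrite addrACA subrr addr0.
  by apply: (isolated_pair_perp_sub Ll (fxv al) ia vl v0 iv); rewrite addmx_subl ?eqmx_opp.
split=> [||t tl]; first exact: (rank_isolated_pair Ll (fxv al) ia vl v0).
  by have := perp_sub 0 (sub0mx _ _); rewrite addr0 => xH; in_span.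
by split; [apply: (isolated_covered Ll fx ix tl) | apply: perp_sub].
Qed.

End IsolatedCoset.

Lemma rank_solid_perp_shift y z w v : far l y -> z != 0 -> (z <= l)%MS -> midpoint z w y ->
  (v <= l)%MS -> ~~ (v <= z)%MS -> covered (y + v) -> (5 < \rank (l + y + w + perp (y + v)%R)%MS)%N.
Proof.
move=> fy z0 zl mid vl nvz Pyv; have fyv := far_shift Ll fy vl Pyv.
rewrite -(rank_line_perp Ll fyv) ltnNge; apply: contra nvz => rank_le.
apply: (touching_direction Ll fy z0 zl mid vl Pyv).
have SU : (l + y + w <= l + perp (y + v)%R)%MS.
  by apply: submx_trans (addsmxSl _ _) (submx_rank_leq _ rank_le); in_span.
have := leq_rank_cap (addsmxSr l (perp (y + v)%R)) SU.
by rewrite rank_perp // (rank_midpoint_solid Ll fy z0 zl mid) (rank_line_perp Ll fyv); clear; lia.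
Qed.

Lemma exists_isolated_shift y z v : far l y -> z != 0 -> (z <= l)%MS -> dist2 z y ->
  (v <= l)%MS -> ~~ (v <= z)%MS -> covered (y + v) ->
  exists a, [/\ (a <= l)%MS, far l (y + a) & isolated l (y + a)].
Proof.
move=> fy z0 zl dz vl nvz Pyv; have Pz := line_covered Ll z0 zl; have fyv := far_shift Ll fy vl Pyv.
have [z' /and3P[z'0 z'l dz']|none] := pickP (fun z' => [&& z' != 0, (z' <= l)%MS & dist2 z' (y + v)]); last first.
  exists v; split=> //; apply: (isolated_no_dir Ll fyv) => z' z'0 z'l.
  by move: (none z'); rewrite z'0 z'l /= => ->.
have nz'z : ~~ (z' <= z)%MS.
  apply: contra nvz => z'z; apply: (dist2_coset Ll fy z0 zl vl Pyv dz); exact: dist2_par z'0 z'z dz'.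
have [k [dzk dz'k _]] := dist2_common Ll vl z0 zl z'0 z'l nz'z dz dz'.
have kl : (k *: z <= l)%MS by in_span.
have fk : far l (y + k *: z).
  apply: (far_shift Ll fy kl); apply: dist2_covered Pz _ dzk.
  by apply: contraNneq (far_notin fy) => yz0; rewrite -(addmx_subr y kl) yz0 sub0mx.
by exists (k *: z); split=> //; apply: (isolated_two_dirs Ll fk z'0 z0).
Qed.

Lemma perp_shift_sub y z w v t : far l y -> z != 0 -> (z <= l)%MS -> midpoint z w y ->
  (v <= l)%MS -> ~~ (v <= z)%MS -> covered (y + v) -> (t <= l)%MS ->
  covered (y + t) /\ (perp (y + t)%R <= l + y + w + perp (y + v)%R)%MS.
Proof.
move=> fy z0 zl mid vl nvz Pyv tl.
have [a [al fya ia]] := exists_isolated_shift fy z0 zl (dist2I mid) vl nvz Pyv.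
have [H [rH lH coset_H]] := isolated_hyperplane fya ia.
have shift_H s : (s <= l)%MS -> covered (y + s) /\ (perp (y + s)%R <= H)%MS.
  move=> sl; have -> : y + s = y + a + (s - a) by rewrite addrACA subrr addr0.
  by apply: coset_H; rewrite addmx_subl ?eqmx_opp.
have [Pyt ytH] := shift_H t tl; have [_ yvH] := shift_H v vl.
split=> //; apply: submx_trans ytH _; apply: submx_rank_leq; last first.
  by rewrite rH (rank_solid_perp_shift fy z0 zl mid vl nvz Pyv).
have [_] := shift_H 0 (sub0mx _ _); rewrite addr0 => yH.
have wH := submx_trans (midpoint_perp Ll fy z0 zl mid) yH.
have yyH := submx_trans (mem_perp (far_covered fy)) yH; have lH' := submx_trans (addsmxSl _ _) lH.
by in_span.
Qed.

End LineIsolated.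

(** * Pentagons *)

Definition pentagon e1 e2 e3 e4 e5 := [/\ [/\ covered e1, covered e2, covered e3, covered e4 & covered e5],
  [/\ (e2 <= perp e1)%MS, (e3 <= perp e2)%MS, (e4 <= perp e3)%MS, (e5 <= perp e4)%MS & (e1 <= perp e5)%MS] &
  \rank (e1 + e2 + e3 + e4 + e5)%MS = 5%N].

Definition pentagon_hyper e1 e2 e3 e4 e5 := (e1 + e2 + e3 + e4 + e5 + perp (e4 + e1)%R)%MS.

Lemma pentagon_rot e1 e2 e3 e4 e5 : pentagon e1 e2 e3 e4 e5 -> pentagon e2 e3 e4 e5 e1.
Proof.
case=> -[P1 P2 P3 P4 P5] [e21 e32 e43 e54 e15] rU; split=> //.
by rewrite -rU; apply/eqmx_rank/andP; split; in_span.
Qed.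

Lemma pentagon_rev e1 e2 e3 e4 e5 : pentagon e1 e2 e3 e4 e5 -> pentagon e5 e4 e3 e2 e1.
Proof.
case=> -[P1 P2 P3 P4 P5] [e21 e32 e43 e54 e15] rU; split; first by split.
  by split; apply: perp_sym.
by rewrite -rU; apply/eqmx_rank/andP; split; in_span.
Qed.

Lemma pentagon_indep e1 e2 e3 e4 e5 : pentagon e1 e2 e3 e4 e5 ->
  [/\ ~~ (e2 <= e1)%MS, ~~ (e3 <= e1 + e2)%MS, ~~ (e4 <= e1 + e2 + e3)%MS & ~~ (e5 <= e1 + e2 + e3 + e4)%MS].
Proof.
case=> -[P1 _ _ _ _] _.
have notsub k (A : 'M[F]_(k, N)) v : (\rank A < \rank (A + v)%MS)%N -> ~~ (v <= A)%MS.
  by apply: contraL => vA; rewrite -leqNgt; apply: mxrankS; in_span.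
have := rank_rV1 (covered_neq0 P1); have := rank_adds_vec e1 e2; have := rank_adds_vec (e1 + e2)%MS e3.
have := rank_adds_vec (e1 + e2 + e3)%MS e4; have := rank_adds_vec (e1 + e2 + e3 + e4)%MS e5.
by move=> *; split; apply: notsub; lia.
Qed.

Section Pentagon.
Variables e1 e2 e3 e4 e5 : 'rV[F]_N.
Hypothesis pent : pentagon e1 e2 e3 e4 e5.
Local Notation l := <<(e1 + e2)%MS>>%MS.

Let P1 : covered e1. Proof. by case: pent => -[]. Qed.
Let P2 : covered e2. Proof. by case: pent => -[]. Qed.
Let P3 : covered e3. Proof. by case: pent => -[]. Qed.
Let P4 : covered e4. Proof. by case: pent => -[]. Qed.
Let P5 : covered e5. Proof. by case: pent => -[]. Qed.
Let e21 : (e2 <= perp e1)%MS. Proof. by case: pent => _ []. Qed.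
Let e32 : (e3 <= perp e2)%MS. Proof. by case: pent => _ []. Qed.
Let e43 : (e4 <= perp e3)%MS. Proof. by case: pent => _ []. Qed.
Let e54 : (e5 <= perp e4)%MS. Proof. by case: pent => _ []. Qed.
Let e15 : (e1 <= perp e5)%MS. Proof. by case: pent => _ []. Qed.
Let ne21 : ~~ (e2 <= e1)%MS. Proof. by case: (pentagon_indep pent). Qed.
Let e1l : (e1 <= l)%MS. Proof. by rewrite genmxE addsmxSl. Qed.
Let e2l : (e2 <= l)%MS. Proof. by rewrite genmxE addsmxSr. Qed.

Lemma pentagon_line : l \in L.
Proof. exact: perp_line. Qed.

Lemma pentagon_perp4 : (perp e4 <= e3 + e4 + e5)%MS.
Proof.
have [ne43 ne5 _ _] := pentagon_indep (pentagon_rot (pentagon_rot pent)).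
apply: (perp_sub3 P4 (perp_sym P3 e43 _) e54); rewrite 1?addsmxC ?covered_neq0 //; try by in_span.
by apply: notsub_vec_sym ne43.
Qed.

Lemma pentagon_span : (l + perp e4 :=: e1 + e2 + e3 + e4 + e5)%MS.
Proof.
have e34 := perp_sym P3 e43 (covered_neq0 P4); have e44 := mem_perp P4; have p4 := pentagon_perp4.
have e345 : (perp e4 <= e1 + e2 + e3 + e4 + e5)%MS by apply: submx_trans p4 _; in_span.
apply/eqmxP/andP; split; last by move: e1l e2l => ? ?; in_span.
by rewrite addsmx_sub genmxE e345 andbT; in_span.
Qed.

Lemma pentagon_far : far l e4.
Proof.
apply: farI => // v v0; rewrite genmxE => v12; apply/negP => v4.
have [_ _ rank_U] := pent; have v345 := submx_trans v4 pentagon_perp4.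
have := mxrank_sum_cap (e1 + e2)%MS (e3 + e4 + e5)%MS.
have -> : \rank (e1 + e2 + (e3 + e4 + e5))%MS = 5%N.
  by rewrite -rank_U; apply/eqmx_rank/andP; split; in_span.
have : (1 <= \rank ((e1 + e2) :&: (e3 + e4 + e5))%MS)%N.
  by rewrite lt0n mxrank_eq0; apply: contraNneq v0 => cap0; rewrite -submx0 -cap0 sub_capmx v12.
have := rank_adds_vec e1 e2; have := rank_adds_vec e3 e4; have := rank_adds_vec (e3 + e4)%MS e5.
by rewrite !rank_rV1 //; clear; lia.
Qed.

Let mid3 : midpoint e2 e3 e4 := midpointI (covered_neq0 P3) e32 e43.

Lemma pentagon_isolated : isolated l e4.
Proof.
have mid5 : midpoint e1 e5 e4 by apply: midpointI => //; apply: perp_sym.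
apply: (isolated_two_dirs pentagon_line pentagon_far (z1 := e2) (z2 := e1)); rewrite ?covered_neq0 //.
  exact: dist2I mid3.
exact: dist2I mid5.
Qed.

Lemma rank_pentagon_hyper : \rank (pentagon_hyper e1 e2 e3 e4 e5) = 6%N.
Proof.
have e10 := covered_neq0 P1; have P41 := isolated_covered pentagon_line pentagon_far pentagon_isolated e1l.
have := mxrank_sum_cap (perp (e4 + e1)%R) (l + perp e4)%MS; rewrite rank_perp //.
rewrite (isolated_rank_cap pentagon_line pentagon_far pentagon_isolated e1l e10).
rewrite (rank_line_perp pentagon_line pentagon_far) /pentagon_hyper.
suff -> : \rank (perp (e4 + e1)%R + (l + perp e4))%MS = \rank (e1 + e2 + e3 + e4 + e5 + perp (e4 + e1)%R)%MS.
  by clear; lia.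
apply/eqmx_rank/andP; split; rewrite addsmx_sub; apply/andP; split; try by in_span.
  by rewrite pentagon_span; in_span.
by rewrite -pentagon_span; in_span.
Qed.

Lemma pentagon_hyper_perp v : (v <= e1 + e2)%MS ->
  covered (e4 + v) /\ (perp (e4 + v)%R <= pentagon_hyper e1 e2 e3 e4 e5)%MS.
Proof.
move=> v12; have vl : (v <= l)%MS by rewrite genmxE.
have P41 := isolated_covered pentagon_line pentagon_far pentagon_isolated e1l.
have ne12 := notsub_vec_sym (covered_neq0 P1) ne21.
have [Pv /submx_trans vH] := perp_shift_sub pentagon_line pentagon_far (covered_neq0 P2) e2l mid3 e1l ne12 P41 vl.
split=> //; apply: vH; have lU : (l <= e1 + e2)%MS by rewrite genmxE.
by rewrite /pentagon_hyper; in_span.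
Qed.

End Pentagon.

Lemma pentagon_hyper_diag e1 e2 e3 e4 e5 : pentagon e1 e2 e3 e4 e5 ->
  (perp (e4 + e2)%R <= pentagon_hyper e1 e2 e3 e4 e5)%MS.
Proof. by move=> pent; have [] := pentagon_hyper_perp pent (addsmxSr e1 e2). Qed.

Lemma pentagon_hyper_subI e1 e2 e3 e4 e5 H : (e1 + e2 + e3 + e4 + e5 <= H)%MS -> (perp (e4 + e1)%R <= H)%MS ->
  (pentagon_hyper e1 e2 e3 e4 e5 <= H)%MS.
Proof. by move=> UH perpH; rewrite addsmx_sub UH. Qed.

(* Going round the diagonals of the pentagon shows that they all give the same hyperplane. *)
Lemma pentagon_hyper_rot e1 e2 e3 e4 e5 : pentagon e1 e2 e3 e4 e5 ->
  (pentagon_hyper e2 e3 e4 e5 e1 <= pentagon_hyper e1 e2 e3 e4 e5)%MS.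
Proof.
move=> pent; have skip a b c d e : pentagon a b c d e ->
    (pentagon_hyper a b c d e <= pentagon_hyper c d e a b)%MS.
  move=> p; apply: pentagon_hyper_subI; first by rewrite /pentagon_hyper; in_span.
  by rewrite addrC; exact: pentagon_hyper_diag (pentagon_rot (pentagon_rot p)).
apply: submx_trans (skip _ _ _ _ _ (pentagon_rot pent)) _; apply: pentagon_hyper_subI.
  by rewrite /pentagon_hyper; in_span.
by rewrite addrC; exact: pentagon_hyper_diag pent.
Qed.

Lemma pentagon_hyper_rev e1 e2 e3 e4 e5 : pentagon e1 e2 e3 e4 e5 ->
  (pentagon_hyper e5 e4 e3 e2 e1 <= pentagon_hyper e1 e2 e3 e4 e5)%MS.
Proof.
move=> pent; apply: pentagon_hyper_subI; first by rewrite /pentagon_hyper; in_span.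
by apply: submx_trans (pentagon_hyper_rot pent); rewrite addrC addsmxSr.
Qed.

Lemma pentagon_hyper_shift e1 e2 e3 e4 e5 (k : F) v : pentagon e1 e2 e3 e4 e5 -> (v <= e1 + e2)%MS ->
  covered (e4 + k *: e3 + v) /\ (perp (e4 + k *: e3 + v)%R <= pentagon_hyper e1 e2 e3 e4 e5)%MS.
Proof.
move=> pent v12; have [k0|k0] := eqVneq k 0.
  by rewrite k0 scale0r addr0; apply: pentagon_hyper_perp.
have [[P1 P2 P3 P4 _] [_ e32 e43 _ _] _] := pent; have [ne21 _ _ _] := pentagon_indep pent.
have [Ll fe4] := (pentagon_line pent, pentagon_far pent); set l := <<(e1 + e2)%MS>>%MS in Ll fe4.
have [e1l e2l vl] : [/\ (e1 <= l)%MS, (e2 <= l)%MS & (v <= l)%MS].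
  by rewrite !genmxE addsmxSl addsmxSr.
have ke3 : midpoint e2 (k *: e3) e4.
  by apply: midpointI; rewrite ?scaler_eq0 ?negb_or ?k0 ?covered_neq0 ?scalemx_sub // perp_scale.
have fr : far l (e4 + k *: e3) := far_add_midpoint Ll fe4 (covered_neq0 P2) e2l ke3.
have mid : midpoint e2 e3 (e4 + k *: e3).
  by apply: midpointI => //; have e33 := mem_perp P3; in_span.
have r34 : ((e4 + k *: e3)%R <= e3 + e4)%MS by in_span.
have pent3 := pentagon_rot (pentagon_rot pent).
have [Pe1 e1H] : covered (e4 + k *: e3 + e1) /\
    (perp (e4 + k *: e3 + e1)%R <= pentagon_hyper e1 e2 e3 e4 e5)%MS.
  rewrite addrC; have [-> rH] := pentagon_hyper_perp pent3 r34; split=> //; apply: submx_trans rH _.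
  exact: submx_trans (pentagon_hyper_rot (pentagon_rot pent)) (pentagon_hyper_rot pent).
have ne12 := notsub_vec_sym (covered_neq0 P1) ne21.
have [Pv /submx_trans vH] := perp_shift_sub Ll fr (covered_neq0 P2) e2l mid e1l ne12 Pe1 vl.
split=> //; apply: vH; rewrite addsmx_sub e1H andbT.
by rewrite /pentagon_hyper !addsmx_sub genmxE; apply/andP; split; [apply/andP; split|]; in_span.
Qed.

Lemma pentagon_hyper_solid e1 e2 e3 e4 e5 u : pentagon e1 e2 e3 e4 e5 ->
  (u <= e1 + e2 + e3 + e4)%MS -> ~~ (u <= e1 + e2 + e3)%MS ->
  covered u /\ (perp u <= pentagon_hyper e1 e2 e3 e4 e5)%MS.
Proof.
move=> pent /sub_adds_vecP[_ [c [/sub_adds_vecP[a [d [a12 ->]]] eu]]] nu.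
have c0 : c != 0 by apply: contraNneq nu => c0; rewrite eu c0 scale0r addr0; in_span.
have {}eu : u = c *: (e4 + (d / c) *: e3 + c^-1 *: a).
  by rewrite !scalerDr !scalerA mulrCA divff // mulr1 scale1r eu addrC addrA addrAC.
rewrite eu covered_scale // perp_scale //; apply: pentagon_hyper_shift => //.
exact: scalemx_sub.
Qed.

Lemma pentagon_hyper_rotr e1 e2 e3 e4 e5 : pentagon e1 e2 e3 e4 e5 ->
  (pentagon_hyper e5 e1 e2 e3 e4 <= pentagon_hyper e1 e2 e3 e4 e5)%MS.
Proof.
move=> p1; have p2 := pentagon_rot p1; have p3 := pentagon_rot p2; have p4 := pentagon_rot p3.
apply: submx_trans (pentagon_hyper_rot p4) (submx_trans (pentagon_hyper_rot p3) _).
exact: submx_trans (pentagon_hyper_rot p2) (pentagon_hyper_rot p1).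
Qed.

Lemma pentagon_hyper_face e1 e2 e3 e4 e5 u : pentagon e1 e2 e3 e4 e5 -> u != 0 ->
  (u <= e1 + e2 + e3 + e4)%MS -> covered u /\ (perp u <= pentagon_hyper e1 e2 e3 e4 e5)%MS.
Proof.
move=> p1 u0 u1234.
have [u123|nu123] := boolP (u <= e1 + e2 + e3)%MS; last exact: pentagon_hyper_solid.
have p5 := pentagon_rot (pentagon_rot (pentagon_rot (pentagon_rot p1))).
have [u512|nu512] := boolP (u <= e5 + e1 + e2)%MS; last first.
  have [|-> uH] := pentagon_hyper_solid p5 _ nu512; first by apply: submx_trans u123 _; in_span.
  by split=> //; apply: submx_trans uH (pentagon_hyper_rotr p1).
have p4r := pentagon_rot (pentagon_rev p1).
have [u432|nu432] := boolP (u <= e4 + e3 + e2)%MS; last first.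
  have [|-> uH] := pentagon_hyper_solid p4r _ nu432; first by apply: submx_trans u123 _; in_span.
  split=> //; apply: submx_trans uH _.
  exact: submx_trans (pentagon_hyper_rot (pentagon_rev p1)) (pentagon_hyper_rev p1).
have [[_ P2 _ _ _] _ _] := p1.
have /sub_rVP[k eu] : (u <= e2)%MS.
  have [_ _ ne3 _] := pentagon_indep p5; have [_ _ ne1 _] := pentagon_indep p4r.
  have u12 : (u <= e1 + e2)%MS.
    apply: (sub_adds_vec_cap u123 u512); apply: contra ne3 => /submx_trans; apply; in_span.
  rewrite addsmxC in u12; apply: (sub_adds_vec_cap u12 u432).
  by apply: contra ne1 => /submx_trans; apply; in_span.
have k0 : k != 0 by apply: contraNneq u0 => k0; rewrite eu k0 scale0r.
rewrite eu covered_scale // perp_scale //; split=> //.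
apply: submx_trans (pentagon_perp4 (pentagon_rot (pentagon_rot (pentagon_rot p1)))) _.
by rewrite /pentagon_hyper; in_span.
Qed.

(** * Counting points *)

Hypothesis line_bound : (#|L| <= q ^ 5 + q ^ 4 + q ^ 3 + q ^ 2 + q + 1)%N.

Hypothesis hyperplane_bound :
  forall H, \rank H = 6%N -> (nb_in L H <= q ^ 4 - q ^ 3 + 3 * q ^ 2 + 2 * q)%N.

Lemma card_points_line l : l \in L -> #|[set x : 'rV[F]_N | (x <= l)%MS && (x != 0)]| = (q.-1 * q.+1)%N.
Proof. by move=> Ll; rewrite card_nonzero_vset rank_line // sqrn_sub1 // ltnW. Qed.

Lemma card_covered : (#|[set x | covered x]| = #|L| * q.-1)%N.
Proof.
apply/eqP; rewrite -(eqn_pmul2r (ltn0Sn q)) -mulnA; apply/eqP.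
apply: (eq_double_counting (r := fun x l => (x <= l)%MS)) => [x|l Ll].
  by rewrite inE => /card_lines_thru.
rewrite -(card_points_line Ll); apply: eq_card => x; rewrite !inE andbC.
by have [xl|//] := boolP (x <= l)%MS; apply/idP/idP => [/covered_neq0|x0]; last exact: line_covered xl.
Qed.

Lemma card_perp_sub H : (#|[set x | covered x && (perp x <= H)%MS]| <= nb_in L H * q.-1)%N.
Proof.
rewrite -(leq_pmul2r (ltn0Sn q)) -mulnA.
apply: (leq_double_counting (r := fun x l => (x <= l)%MS) (B := lines_in H)) => [x|l].
  rewrite inE => /andP[Px xH]; rewrite -(card_lines_thru Px); apply: subset_leq_card; apply/subsetP => l lx.
  by have [Ll xl] := lines_thruP _ _ lx; rewrite !inE Ll xl (submx_trans (lines_thru_perp lx)).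
rewrite inE => /andP[Ll _]; rewrite -(card_points_line Ll); apply: subset_leq_card; apply/subsetP => x.
by rewrite !inE => /andP[/andP[/covered_neq0-> _] ->].
Qed.

Section LineCounting.
Variables (l : 'M[F]_N) (Ll : l \in L).
Let rank_l : \rank l = 2%N := rank_line Ll.
Let p_gt0 : (0 < q.-1)%N := card_field_pred_gt0 F.

Definition line_points := [set z : 'rV[F]_N | (z <= l)%MS && (z != 0)].
Definition far_points := [set y | far l y].
Definition near_points := [set y | covered y && ~~ far l y].
Definition directions y := [set z in line_points | dist2 z y].

Lemma line_pointsP z : reflect ((z <= l)%MS /\ z != 0) (z \in line_points).
Proof. by rewrite inE; apply: andP. Qed.

Lemma pentagon_of_midpoints x z1 z2 w1 w2 : far l x -> z1 != 0 -> z2 != 0 ->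
  (z1 <= l)%MS -> (z2 <= l)%MS -> ~~ (z1 <= z2)%MS ->
  midpoint z1 w1 x -> midpoint z2 w2 x -> pentagon z2 z1 w1 x w2.
Proof.
move=> fx z10 z20 z1l z2l nz12 mid1 mid2; have Px := far_covered fx.
have [P1 P2] := (line_covered Ll z10 z1l, line_covered Ll z20 z2l).
have [Q1 Q2] := (midpoint_covered P1 mid1, midpoint_covered P2 mid2).
have [w1x w2x] := (midpoint_perp Ll fx z10 z1l mid1, midpoint_perp Ll fx z20 z2l mid2).
have [nw1l nw2l] := (midpoint_notin_line Ll fx mid1, midpoint_notin_line Ll fx mid2).
have nz1w2 := line_notin_perp_midpoint Ll fx z20 z2l mid2 z1l nz12.
have [z1z2 z2z1] := (submx_trans z1l (line_perp Ll z20 z2l), submx_trans z2l (line_perp Ll z10 z1l)).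
case/and3P: mid1 mid2 => w10 w1z1 xw1 /and3P[w20 w2z2 xw2].
have z2w2 : (z2 <= perp w2)%MS by apply: perp_sym.
have perp_x : (perp x <= x + w1 + w2)%MS.
  apply: perp_span3 => //.
    apply: contra (far_perp_notin Ll fx z10 z1l) => w1x1.
    exact: submx_trans (submx_vec_sym w10 w1x1) w1z1.
  apply: contra nw1l => w2xw1; apply: submx_trans z2l; apply: (midpoint_uniq Q2 P1) => //.
  by apply: perp_sym => //; have w11 := mem_perp Q1; apply: submx_trans w2xw1 _; in_span.
split; [by split | by split | rewrite -(rank_line_perp Ll fx); apply/eqmx_rank/andP; split].
  by have xx := mem_perp Px; in_span.
rewrite addsmx_sub (line_span Ll z20 nz12 z2l z1l); apply/andP; split; first by in_span.
by apply: submx_trans perp_x _; in_span.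
Qed.

Lemma far_path z w y : z \in line_points -> (w <= perp z)%MS -> ~~ (w <= l)%MS -> (y <= perp w)%MS ->
  ~~ (y <= z + w)%MS -> far l y.
Proof.
move=> /line_pointsP[zl z0] wz nwl yw nyzw; have [w0 y0] := (notsub_neq0 nwl, notsub_neq0 nyzw).
have Pz := line_covered Ll z0 zl; have Pw := perp_covered Pz wz w0.
have Py := perp_covered Pw yw y0; have zw := perp_sym Pz wz w0; have wy := perp_sym Pw yw y0.
have nzw : ~~ (z <= w)%MS by apply: contra nwl => /(submx_vec_sym z0)/submx_trans->.
have nyz : ~~ (y <= perp z)%MS.
  by apply: contra nyzw => yz; rewrite addsmxC; apply: no_triangle Pw zw yw z0 yz nzw.
apply: farI => // v v0 vl; apply/negP => vy.
have [vz|nvz] := boolP (v <= z)%MS.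
  by case/negP: nyz; rewrite -(perp_eq_vec v0 vz); apply: perp_sym.
have vz := submx_trans vl (line_perp Ll z0 zl); case/negP: nwl; apply: submx_trans vl.
exact: (midpoint_uniq Pz Py nyz w0 v0 wz wy vz vy).
Qed.

Lemma card_dist2 z : z \in line_points -> (q ^ 4 * q.-1 <= #|[set y in far_points | dist2 z y]|)%N.
Proof.
move=> zin; have [zl z0] := line_pointsP _ zin; have Pz := line_covered Ll z0 zl.
pose W := vset (perp z) :\: vset l; pose D := [set y in far_points | dist2 z y].
have card_W : #|W| = (q ^ 2 * q.-1)%N.
  by rewrite card_vsetD ?(line_perp Ll) // rank_l rank_perp // expnS_subn.
have WP w : w \in W -> [/\ (w <= perp z)%MS, ~~ (w <= l)%MS, w != 0 & covered w].
  rewrite !inE => /andP[nwl wz]; have w0 := notsub_neq0 nwl.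
  by split=> //; apply: perp_covered wz w0.
rewrite -/D -(leq_pmul2r p_gt0) -mulnA (_ : (q ^ 4 * (q.-1 * q.-1) = #|W| * (q ^ 2 * q.-1))%N); last first.
  by rewrite card_W mulnACA -expnD.
apply: (leq_double_counting (r := fun w y => (y <= perp w)%MS)) => [w /WP[wz nwl w0 Pw]|y].
  have nwz : ~~ (w <= z)%MS by apply: contra nwl => /submx_trans->.
  have zwS : (z + w <= perp w)%MS by have ww := mem_perp Pw; have zw := perp_sym Pz wz w0; in_span.
  rewrite -expnS_subn -(rank_perp Pw) -(rank_span2 z0 nwz) -card_vsetD //.
  apply: subset_leq_card; apply/subsetP => y; rewrite !inE => /andP[nyzw yw].
  by rewrite yw (far_path zin wz nwl yw nyzw) (dist2I (midpointI w0 wz yw)).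
rewrite !inE => /andP[fy /existsP[w mid]]; have Py := far_covered fy.
have wy := midpoint_perp Ll fy z0 zl mid; case/and3P: mid => w0 wz yw.
rewrite -(card_nonzero_rV w0); apply: subset_leq_card; apply/subsetP => w'.
rewrite inE => /andP[/WP[w'z _ w'0 Pw'] yw']; rewrite inE w'0 andbT.
apply: (midpoint_uniq Pz Py (far_perp_notin Ll fy z0 zl)) => //; exact: perp_sym.
Qed.

Lemma card_near_geq : (q.-1 * q.+1 + q.+1 * (q ^ 2 * q.-1) <= #|near_points|)%N.
Proof.
pose adjacent := [set y : 'rV[F]_N | ~~ (y <= l)%MS && [exists z in line_points, (y <= perp z)%MS]].
have card_adj : (q.+1 * (q ^ 2 * q.-1) <= #|adjacent|)%N.
  rewrite -(leq_pmul2r p_gt0) mulnC mulnA -(card_points_line Ll) -/line_points.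
  apply: (leq_double_counting (r := fun z y => (y <= perp z)%MS)) => [z /line_pointsP[zl z0]|y].
    have Pz := line_covered Ll z0 zl.
    rewrite -expnS_subn -(rank_perp Pz) -rank_l -card_vsetD ?(line_perp Ll) //.
    apply: subset_leq_card; apply/subsetP => y; rewrite !inE => /andP[-> yz]; rewrite yz andbT.
    by apply/exists_inP; exists z => //; apply/line_pointsP.
  rewrite inE => /andP[nyl /exists_inP[z /line_pointsP[zl z0] yz]].
  have y0 := notsub_neq0 nyl; have Pz := line_covered Ll z0 zl; have Py := perp_covered Pz yz y0.
  rewrite -(card_nonzero_rV z0); apply: subset_leq_card; apply/subsetP => z'.
  rewrite inE => /andP[/line_pointsP[z'l z'0] yz']; rewrite inE z'0 andbT.
  apply: contraT => nz'z; case/negP: nyl; apply: (mem_line_perp Py Ll).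
  rewrite (line_span Ll z0 nz'z zl z'l) addsmx_sub perp_sym //=.
  exact: perp_sym (line_covered Ll z'0 z'l) yz' y0.
rewrite -(card_points_line Ll) -/line_points; apply: leq_trans (leq_add (leqnn _) card_adj) _.
have /eqP <- : #|line_points :|: adjacent| == (#|line_points| + #|adjacent|)%N.
  by rewrite leq_card_setU disjoint_subset; apply/subsetP => z; rewrite !inE => /andP[->].
apply: subset_leq_card; apply/subsetP => y; rewrite !inE => /orP[/andP[yl y0]|/andP[nyl]].
  by rewrite (line_covered Ll y0 yl) /=; apply: contraL yl; apply: far_notin.
case/exists_inP => z /line_pointsP[zl z0] yz.
rewrite (perp_covered (line_covered Ll z0 zl) yz (notsub_neq0 nyl)) /=.
by apply: contraL yz => fy; apply: far_perp_notin fy z0 zl.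
Qed.

Lemma card_far_near : (#|L| * q.-1 = #|far_points| + #|near_points|)%N.
Proof.
rewrite -card_covered -(cardsID far_points); congr (_ + _)%N; apply: eq_card => y; rewrite !inE.
  by have [/far_covered->|] := boolP (far l y); rewrite ?andbF.
by rewrite andbC.
Qed.

Lemma sum_directions_geq : (q.-1 * (q ^ 6 - q ^ 4) <= \sum_(y in far_points) #|directions y|)%N.
Proof.
rewrite (double_counting far_points line_points (fun y z => dist2 z y)).
apply: (@leq_trans (\sum_(z in line_points) (q ^ 4 * q.-1))%N); last by apply: leq_sum => z; apply: card_dist2.
have -> : (q ^ 6 - q ^ 4 = q ^ 4 * (q.-1 * q.+1))%N.
  by rewrite -sqrn_sub1 ?(ltnW q_gt1) // mulnBr -expnD muln1.
by rewrite sum_nat_const (card_points_line Ll) mulnC [(q ^ 4 * _)%N]mulnC -mulnA.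
Qed.

Definition coset_class y := y *m cokermx l.

Lemma coset_class_eq y y' : (coset_class y == coset_class y') = ((y - y')%R <= l)%MS.
Proof. by rewrite submxE mulmxBl subr_eq0. Qed.

Definition far_coset y0 := [set y in far_points | coset_class y == coset_class y0].
Definition coset_dirs y0 := [set z in line_points | [exists y in far_coset y0, dist2 z y]].

Lemma far_cosetP y0 y : reflect (far l y /\ ((y - y0)%R <= l)%MS) (y \in far_coset y0).
Proof. by rewrite !inE coset_class_eq; apply: andP. Qed.

Lemma far_coset_self y : far l y -> y \in far_coset y.
Proof. by move=> fy; apply/far_cosetP; rewrite subrr sub0mx. Qed.

Lemma far_coset_sub y0 y y' : y \in far_coset y0 -> y' \in far_coset y0 -> ((y' - y)%R <= l)%MS.
Proof.
move=> /far_cosetP[_ yl] /far_cosetP[_ y'l].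
have -> : y' - y = (y' - y0) - (y - y0) by rewrite opprB addrA subrK.
by in_span.
Qed.

Lemma coset_dirsP y0 z : reflect [/\ (z <= l)%MS, z != 0 & exists2 y, y \in far_coset y0 & dist2 z y]
  (z \in coset_dirs y0).
Proof.
rewrite inE; apply: (iffP andP) => [[/line_pointsP[zl z0] /exists_inP[y yC dz]]|[zl z0 [y yC dz]]].
  by split=> //; exists y.
by split; [apply/line_pointsP | apply/exists_inP; exists y].
Qed.

Lemma far_dist2_shift y z (k : F) : far l y -> z != 0 -> (z <= l)%MS -> dist2 z y -> far l (y + k *: z).
Proof.
move=> fy z0 zl dz; have kzl := scalemx_sub k zl; apply: (far_shift Ll fy kzl).
apply: dist2_covered (line_covered Ll z0 zl) _ (dist2_shift k (line_covered Ll z0 zl) dz).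
by apply: contraNneq (far_notin fy) => yz0; rewrite -(addmx_subr y kzl) yz0 sub0mx.
Qed.

Lemma far_coset_shift y0 y z (k : F) : y \in far_coset y0 -> z != 0 -> (z <= l)%MS -> dist2 z y ->
  y + k *: z \in far_coset y0.
Proof.
move=> /far_cosetP[fy yl] z0 zl dz; apply/far_cosetP; split; first exact: far_dist2_shift.
by rewrite addrAC; in_span.
Qed.

Lemma sum_directions_coset y0 : (\sum_(y in far_coset y0) #|directions y| <= q * #|coset_dirs y0|)%N.
Proof.
rewrite (double_counting (far_coset y0) line_points (fun y z => dist2 z y)) (bigID (mem (coset_dirs y0))) /=.
rewrite [X in (_ + X)%N]big1 ?addn0 => [|z /andP[zin nz]]; last first.
  apply: eq_card0 => y; rewrite inE; apply: contraNF nz => /andP[yC dz].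
  by rewrite inE zin; apply/exists_inP; exists y.
rewrite mulnC -sum_nat_const [X in (_ <= X)%N](eq_bigl (fun z => (z \in line_points) && (z \in coset_dirs y0))).
  apply: leq_sum => z /andP[_ /coset_dirsP[zl z0 [y yC dz]]]; have [fy _] := far_cosetP _ _ yC.
  rewrite -(card_imset _ (affine_line_inj (y := y) z0)); apply: subset_leq_card; apply/subsetP => y'.
  rewrite inE => /andP[y'C dz']; have [/far_covered Py' _] := far_cosetP _ _ y'C.
  have ey' : y' = y + (y' - y) by rewrite addrC subrK.
  have /sub_rVP[k ek] : ((y' - y)%R <= z)%MS.
    by apply: (dist2_coset Ll fy z0 zl (far_coset_sub yC y'C) _ dz); rewrite -ey'.
  by apply/imsetP; exists k; rewrite // -ek.
by move=> z; rewrite [z \in coset_dirs _]inE andbA andbb.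
Qed.

Lemma card_far_coset_geq y0 : (0 < #|coset_dirs y0|)%N -> (q <= #|far_coset y0|)%N.
Proof.
case/card_gt0P => z /coset_dirsP[zl z0 [y yC dz]].
rewrite -(card_imset _ (affine_line_inj (y := y) z0)); apply: subset_leq_card.
by apply/subsetP => _ /imsetP[k _ ->]; apply: far_coset_shift.
Qed.

Lemma exists_coset_dir_off y0 z : z != 0 -> (q.-1 < #|coset_dirs y0|)%N ->
  exists2 z', z' \in coset_dirs y0 & ~~ (z' <= z)%MS.
Proof.
move=> z0 many; apply/exists_inP; apply: contraTT many; rewrite negb_exists_in => /forall_inP par.
rewrite -leqNgt -(card_nonzero_rV z0); apply: subset_leq_card; apply/subsetP => z' z'dir.
by have [_ z'0 _] := coset_dirsP _ _ z'dir; rewrite inE z'0 andbT; move: (par z' z'dir); rewrite negbK.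
Qed.

Lemma coset_dirs_common y0 z1 z2 : z1 \in coset_dirs y0 -> z2 \in coset_dirs y0 -> ~~ (z2 <= z1)%MS ->
  exists x, [/\ x \in far_coset y0, dist2 z1 x & dist2 z2 x].
Proof.
move=> /coset_dirsP[z1l z10 [y1 y1C dz1]] /coset_dirsP[z2l z20 [y2 y2C dz2]] nz21.
have dz2' : dist2 z2 (y1 + (y2 - y1)) by rewrite addrC subrK.
have [k [d1 d2 _]] := dist2_common Ll (far_coset_sub y1C y2C) z10 z1l z20 z2l nz21 dz1 dz2'.
by exists (y1 + k *: z1); split=> //; apply: far_coset_shift.
Qed.

(* A point with two directions is isolated. *)
Lemma many_coset_dirs_isolated y0 : (q.-1 < #|coset_dirs y0|)%N ->
  exists2 x, x \in far_coset y0 & isolated l x.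
Proof.
move=> many; have /card_gt0P[z1 z1dir] := leq_ltn_trans (leq0n _) many.
have [z1l z10 _] := coset_dirsP _ _ z1dir; have [z2 z2dir nz21] := exists_coset_dir_off z10 many.
have [z2l z20 _] := coset_dirsP _ _ z2dir; have [x [xC d1 d2]] := coset_dirs_common z1dir z2dir nz21.
by have [fx _] := far_cosetP _ _ xC; exists x; rewrite ?(isolated_two_dirs Ll fx z20 z10).
Qed.

Lemma card_far_coset_isolated y0 x : x \in far_coset y0 -> isolated l x -> (q ^ 2 <= #|far_coset y0|)%N.
Proof.
move=> /far_cosetP[fx xl] ix; rewrite -(card_coset Ll x); apply: subset_leq_card.
apply/subsetP => _ /cosetP[v vl ->]; apply/far_cosetP; split; first exact: (isolated_far Ll fx ix vl).
by rewrite addrAC; in_span.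
Qed.

Lemma sum_directions_coset_leq y0 : (#|coset_dirs y0| <= q * q.-1)%N ->
  (\sum_(y in far_coset y0) #|directions y| <= #|far_coset y0| * q.-1)%N.
Proof.
move=> few; apply: leq_trans (sum_directions_coset y0) _.
have [many|le_p] := ltnP q.-1 #|coset_dirs y0|.
  have [x xC ix] := many_coset_dirs_isolated many.
  by apply: leq_trans (leq_mul (leqnn q) few) _; rewrite mulnA leq_mul // mulnn (card_far_coset_isolated xC ix).
have [->|dirs_gt0] := posnP #|coset_dirs y0|; first by rewrite muln0.
by apply: leq_mul le_p; apply: card_far_coset_geq.
Qed.

Lemma card_far_leq : (#|far_points| <= q ^ 6 - q ^ 4)%N.
Proof.
have := card_near_geq; have := card_far_near; have := leq_mul line_bound (leqnn q.-1); move: p_gt0.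
move: #|far_points| #|near_points| #|L| => f n m; clear; case: #|F| => // k; rewrite /= !expnS expn0; nia.
Qed.

Lemma exists_many_dirs x z1 z2 : far l x -> z1 != 0 -> z2 != 0 -> (z1 <= l)%MS -> (z2 <= l)%MS ->
  ~~ (z2 <= z1)%MS -> dist2 z1 x -> dist2 z2 x ->
  exists2 y0, far l y0 & (q * q.-1 <= #|coset_dirs y0|)%N.
Proof.
move=> fx z10 z20 z1l z2l nz21 d1 d2; apply/exists_inP; apply: contraT; rewrite negb_exists_in => /forall_inP few.
have {}few y : far l y -> (#|coset_dirs y| < q * q.-1)%N by move=> /few; rewrite -ltnNge.
have sum_coset (f : 'rV[F]_N -> nat) y :
    (\sum_(t in far_points | coset_class t == coset_class y) f t = \sum_(t in far_coset y) f t)%N.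
  by apply: eq_bigl => t; rewrite [t \in far_coset y]inE.
have ix := isolated_two_dirs Ll fx z20 z10 z2l z1l nz21 d2 d1.
suff : (\sum_(y in far_coset x) #|directions y| = \sum_(y in far_coset x) q.-1)%N.
  rewrite sum_nat_const; apply: contra_eqT => _; rewrite ltn_eqF //.
  apply: leq_ltn_trans (sum_directions_coset x) _.
  apply: (@leq_trans (q * (q * q.-1))%N); first by rewrite ltn_pmul2l ?few // ltnW.
  by rewrite mulnA mulnn leq_mul // (card_far_coset_isolated (far_coset_self fx) ix).
rewrite -!sum_coset; apply: eq_of_leq_sum_fibres => [y||]; last by rewrite inE.
  rewrite inE !sum_coset sum_nat_const => fy; apply: sum_directions_coset_leq; exact: ltnW (few y fy).
apply: leq_trans sum_directions_geq; rewrite sum_nat_const mulnC.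
by rewrite leq_mul // card_far_leq.
Qed.

Definition covered_perp_in H := [set x | covered x && (perp x <= H)%MS].

Lemma pentagon_hyper_zero_coord e1 e2 e3 e4 e5 (c1 c2 c3 c4 c5 : F) u : pentagon e1 e2 e3 e4 e5 ->
  c1 * c2 * c3 * c4 * c5 = 0 -> u != 0 -> u = c1 *: e1 + c2 *: e2 + c3 *: e3 + c4 *: e4 + c5 *: e5 ->
  u \in covered_perp_in (pentagon_hyper e1 e2 e3 e4 e5).
Proof.
move=> p1 /eqP c0 u0 eu; have p2 := pentagon_rot p1; have p3 := pentagon_rot p2.
have p4 := pentagon_rot p3; have p5 := pentagon_rot p4.
have hyper21 := pentagon_hyper_rot p1; have hyper31 := submx_trans (pentagon_hyper_rot p2) hyper21.
have hyper41 := submx_trans (pentagon_hyper_rot p3) hyper31; have hyper51 := submx_trans (pentagon_hyper_rot p4) hyper41.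
have in_face a b c d e : pentagon a b c d e -> (u <= a + b + c + d)%MS ->
    (pentagon_hyper a b c d e <= pentagon_hyper e1 e2 e3 e4 e5)%MS ->
    u \in covered_perp_in (pentagon_hyper e1 e2 e3 e4 e5).
  move=> p uf /(submx_trans _) sub; have [Pu uH] := pentagon_hyper_face p u0 uf.
  by rewrite inE Pu sub.
move: c0; rewrite !mulf_eq0 -!orbA => /or4P[/eqP z|/eqP z|/eqP z|/orP[]/eqP z].
- by apply: (in_face _ _ _ _ _ p2); rewrite // eu z scale0r add0r; in_span.
- by apply: (in_face _ _ _ _ _ p3); rewrite // eu z scale0r addr0; in_span.
- by apply: (in_face _ _ _ _ _ p4); rewrite // eu z scale0r addr0; in_span.
- by apply: (in_face _ _ _ _ _ p5); rewrite // eu z scale0r addr0; in_span.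
- by apply: (in_face _ _ _ _ _ p1); rewrite // eu z scale0r addr0; in_span.
Qed.

(* Over the field with two elements only one vector of the span has no zero coordinate, so a
   pentagon forces at least 30 lines into its hyperplane, which contains at most 24. *)
Lemma no_pentagon_card2 e1 e2 e3 e4 e5 : q = 2%N -> ~ pentagon e1 e2 e3 e4 e5.
Proof.
move=> q2 pent; have bool_of (k : F) : k = 0 \/ k = 1.
  have : [set: F] = [set 0; 1].
    by apply/eqP; rewrite eq_sym eqEcard subsetT cards2 eq_sym oner_eq0 cardsT q2.
  by move/setP/(_ k); rewrite !inE => /esym/orP[]/eqP; [left|right].
have := leq_trans (card_perp_sub _) (leq_mul (hyperplane_bound (rank_pentagon_hyper pent)) (leqnn q.-1)).
rewrite -/(covered_perp_in _) q2 /= leqNgt => /negP; apply; have [_ _ rank_U] := pent.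
pose U := vset (e1 + e2 + e3 + e4 + e5)%MS; pose s := e1 + e2 + e3 + e4 + e5.
have card_U : #|U| = 32 by rewrite card_vset rank_U q2.
have lt_card : (24 < #|U :\ 0%R :\ s|)%N.
  move: card_U; rewrite (cardsD1 0) (cardsD1 s); move: #|U :\ 0 :\ s| => k.
  by do 2!case: (_ \in _) => /=; clear; lia.
apply: leq_trans lt_card _; apply: subset_leq_card; apply/subsetP => u; rewrite !inE => /and3P[us u0].
case/sub_adds_vecP => _ [c5 [/sub_adds_vecP[_ [c4 [/sub_span3P[c1 [c2 [c3 ->]]] ->]]] eu]].
have := pentagon_hyper_zero_coord pent _ u0 eu; rewrite inE; apply; move: us; rewrite eu /s.
case: (bool_of c1) => ->; rewrite ?mul0r //; case: (bool_of c2) => ->; rewrite ?(mulr0, mul0r) //.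
case: (bool_of c3) => ->; rewrite ?(mulr0, mul0r) //; case: (bool_of c4) => ->; rewrite ?(mulr0, mul0r) //.
by case: (bool_of c5) => ->; rewrite ?(mulr0, mul0r) // !scale1r eqxx.
Qed.

Section ManyDirections.
Variables y0 : 'rV[F]_N.
Hypotheses (fy0 : far l y0) (many : (q * q.-1 <= #|coset_dirs y0|)%N).
Local Notation E := (l + y0)%MS.

Let many_dirs : (q.-1 < #|coset_dirs y0|)%N.
Proof. by apply: leq_trans many; rewrite -[X in (X < _)%N]mul1n ltn_pmul2r. Qed.

Lemma many_dirs_hyperplane : exists H : 'M[F]_N, [/\ \rank H = 6%N, (l <= H)%MS &
  forall y v, y \in far_coset y0 -> (v <= l)%MS -> (perp (y + v)%R <= H)%MS].
Proof.
have [x xC ix] := many_coset_dirs_isolated many_dirs; have [fx _] := far_cosetP _ _ xC.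
have [H [rH lH xH]] := isolated_hyperplane Ll fx ix; exists H; split=> // [|y v yC vl].
  exact: submx_trans (addsmxSl _ _) lH.
have -> : y + v = x + ((y - x) + v) by rewrite [RHS]addrA subrKC.
by have [] := xH (y - x + v) (addmx_sub (far_coset_sub xC yC) vl).
Qed.

Definition dir_solid z := (E + perp z)%MS.

Lemma dir_solid_span z w x : z != 0 -> (z <= l)%MS -> x \in far_coset y0 -> midpoint z w x ->
  (dir_solid z :=: l + x + w)%MS.
Proof.
move=> z0 zl xC mid; have [fx xy] := far_cosetP _ _ xC.
have y0_lx : (y0 <= l + x)%MS by rewrite -(subKr x y0); in_span.
have x_ly0 : (x <= l + y0)%MS by rewrite -(subrK y0 x); in_span.
have zS := perp_end_sub_solid Ll fx z0 zl mid; case/and3P: mid => _ wz _.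
by apply/eqmxP/andP; split; rewrite /dir_solid; in_span.
Qed.

Lemma rank_dir_solid z : z \in coset_dirs y0 -> \rank (dir_solid z) = 4%N.
Proof.
case/coset_dirsP => zl z0 [x xC /existsP[w mid]]; have [fx _] := far_cosetP _ _ xC.
by rewrite (dir_solid_span z0 zl xC mid) (rank_midpoint_solid Ll fx z0 zl mid).
Qed.

Lemma dir_pentagon z z' : z \in coset_dirs y0 -> z' \in coset_dirs y0 -> ~~ (z' <= z)%MS ->
  exists x w w', [/\ pentagon z' z w x w', x \in far_coset y0, (dir_solid z <= z' + z + w + x)%MS &
    (w' <= dir_solid z')%MS].
Proof.
move=> zdir z'dir nz'z; have [zl z0 _] := coset_dirsP _ _ zdir; have [z'l z'0 _] := coset_dirsP _ _ z'dir.
have [x [xC /existsP[w mid] /existsP[w' mid']]] := coset_dirs_common zdir z'dir nz'z.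
have [fx _] := far_cosetP _ _ xC; have nzz' := notsub_vec_sym z0 nz'z.
have := line_span Ll z0 nz'z zl z'l => span_l; exists x, w, w'; split=> //.
- exact: pentagon_of_midpoints.
- rewrite (dir_solid_span z0 zl xC mid).
  by have lS : (l <= z' + z + w + x)%MS; [rewrite span_l; in_span | in_span].
- by case/and3P: mid' => _ wz' _; apply: submx_trans wz' (addsmxSr _ _).
Qed.

Lemma dir_solid_cap z z' : z \in coset_dirs y0 -> z' \in coset_dirs y0 -> ~~ (z' <= z)%MS ->
  (dir_solid z :&: dir_solid z' <= E)%MS.
Proof.
move=> zdir z'dir nz'z; have [x [w [w' [pent _ zS w'S]]]] := dir_pentagon zdir z'dir nz'z.
apply: submx_rank_leq; first by rewrite sub_capmx !addsmxSl.
rewrite (rank_line_far Ll fy0) -ltnS -(rank_dir_solid z'dir) capmxC; apply: ltn_rank_cap.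
have [_ _ _] := pentagon_indep pent; apply: contra => z'S.
have [zl z0 _] := coset_dirsP _ _ zdir.
exact: submx_trans w'S (submx_trans z'S zS).
Qed.

Section Hyperplane.
Variable H : 'M[F]_N.
Hypotheses (rank_H : \rank H = 6%N) (lH : (l <= H)%MS).
Hypothesis coset_H : forall y v, y \in far_coset y0 -> (v <= l)%MS -> (perp (y + v)%R <= H)%MS.

Lemma dir_solid_full z u : z \in coset_dirs y0 -> (u <= dir_solid z)%MS -> u != 0 ->
  u \in covered_perp_in H.
Proof.
move=> zdir uS u0; have [zl z0 _] := coset_dirsP _ _ zdir.
have [z' z'dir nz'z] := exists_coset_dir_off z0 many_dirs; have [z'l _ _] := coset_dirsP _ _ z'dir.
have [x [w [w' [pent xC zS _]]]] := dir_pentagon zdir z'dir nz'z.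
have [Pu uH] := pentagon_hyper_face pent u0 (submx_trans uS zS).
rewrite inE Pu; apply: submx_trans uH _; apply: pentagon_hyper_subI; last exact: coset_H.
have := coset_H xC (sub0mx _ l); rewrite addr0 -(pentagon_span pent) => xH.
by rewrite addsmx_sub xH andbT genmxE addsmx_sub !(submx_trans _ lH).
Qed.

Lemma card_dir_solids : (q ^ 4 * q.-1 <= #|covered_perp_in H :\: vset E|)%N.
Proof.
rewrite -(leq_pmul2r p_gt0); apply: leq_trans (_ : #|coset_dirs y0| * (q ^ 3 * q.-1) <= _)%N.
  by rewrite [X in (_ <= X)%N]mulnA leq_mul // expnS mulnAC leq_mul.
apply: (leq_double_counting (r := fun z u => (u <= dir_solid z)%MS)) => [z zdir|u].
  rewrite -expnS_subn -(rank_dir_solid zdir) -(rank_line_far Ll fy0) -card_vsetD ?addsmxSl //.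
  apply: subset_leq_card; apply/subsetP => u; rewrite !in_setD ![_ \in vset _]inE => /andP[nuE uS].
  by rewrite in_set in_setD [_ \in vset _]inE nuE uS (dir_solid_full zdir uS (notsub_neq0 nuE)).
rewrite in_setD [_ \in vset _]inE => /andP[nuE _].
have [->|[z]] := set_0Vmem [set z in coset_dirs y0 | (u <= dir_solid z)%MS]; first by rewrite cards0.
case/setIdP => zdir uz; have [zl z0 _] := coset_dirsP _ _ zdir.
rewrite -(card_nonzero_rV z0); apply: subset_leq_card; apply/subsetP => z' /setIdP[z'dir uz'].
have [_ z'0 _] := coset_dirsP _ _ z'dir; rewrite inE z'0 andbT; apply: contraR nuE => nz'z.
by apply: submx_trans (dir_solid_cap zdir z'dir nz'z); rewrite sub_capmx uz.
Qed.

Lemma card_dir_solids_plane : (q ^ 3 - 1 <= #|covered_perp_in H :&: vset E|)%N.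
Proof.
have /card_gt0P[z zdir] := leq_ltn_trans (leq0n _) many_dirs.
rewrite -(rank_line_far Ll fy0) -card_nonzero_vset; apply: subset_leq_card; apply/subsetP => u.
rewrite inE => /andP[uE u0]; rewrite in_setI [u \in vset _]inE uE andbT.
by apply: (dir_solid_full zdir) => //; apply: submx_trans uE (addsmxSl _ _).
Qed.

Lemma many_dirs_hyperplane_small_field : (q <= 2)%N.
Proof.
have := leq_trans (card_perp_sub H) (leq_mul (hyperplane_bound rank_H) (leqnn q.-1)).
rewrite -/(covered_perp_in H) -(cardsID (vset E)); have := card_dir_solids; have := card_dir_solids_plane.
move: #|_ :&: _| #|_ :\: _|; clear => a b; rewrite leqNgt => ha hb hab; apply/negP => q_gt2.
move: q_gt2 ha hb hab; case: #|F| => [|[|[|k]]] // _; rewrite /= !expnS expn0; nia.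
Qed.

End Hyperplane.

Lemma many_dirs_small_field : (q <= 2)%N.
Proof.
by have [H [rH lH coset_H]] := many_dirs_hyperplane; apply: many_dirs_hyperplane_small_field rH lH coset_H.
Qed.

End ManyDirections.

Lemma uniq_direction x z1 z2 : far l x -> z1 != 0 -> z2 != 0 -> (z1 <= l)%MS -> (z2 <= l)%MS ->
  dist2 z1 x -> dist2 z2 x -> (z2 <= z1)%MS.
Proof.
move=> fx z10 z20 z1l z2l dz1 dz2; apply: contraT => nz21.
have [y fy many] := exists_many_dirs fx z10 z20 z1l z2l nz21 dz1 dz2.
have q2 : q = 2%N by apply/eqP; rewrite eqn_leq (many_dirs_small_field fy many) q_gt1.
case/existsP: dz1 => w1 mid1; case/existsP: dz2 => w2 mid2.
case: (no_pentagon_card2 q2 (pentagon_of_midpoints fx z20 z10 z2l z1l nz21 mid2 mid1)).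
Qed.

Lemma card_directions_leq y : far l y -> (#|directions y| <= q.-1)%N.
Proof.
move=> fy; have [->|[z]] := set_0Vmem (directions y); first by rewrite cards0.
case/setIdP => /line_pointsP[zl z0] dz; rewrite -(card_nonzero_rV z0).
apply: subset_leq_card; apply/subsetP => z' /setIdP[/line_pointsP[z'l z'0] dz'].
by rewrite inE z'0 (uniq_direction fy z0 z'0).
Qed.

Lemma card_directions y : far l y -> #|directions y| = q.-1.
Proof.
move=> fy; apply: (eq_of_leq_sum (A := far_points) (f := fun t => #|directions t|) (g := fun=> q.-1)).
- by move=> t; rewrite inE; apply: card_directions_leq.
- by apply: leq_trans sum_directions_geq; rewrite sum_nat_const mulnC leq_mul // card_far_leq.
- by rewrite inE.
Qed.

Lemma exists_direction y : far l y -> exists z, [/\ z != 0, (z <= l)%MS & dist2 z y].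
Proof.
move=> fy; have /card_gt0P[z] : (0 < #|directions y|)%N by rewrite card_directions.
by case/setIdP => /line_pointsP[zl z0] dz; exists z.
Qed.

Lemma far_shift_direction y z v : far l y -> z != 0 -> (z <= l)%MS -> dist2 z y -> (v <= l)%MS ->
  covered (y + v) -> (v <= z)%MS.
Proof.
move=> fy z0 zl dz vl Pyv; have [z' [z'0 z'l dz']] := exists_direction (far_shift Ll fy vl Pyv).
have [z'z|nz'z] := boolP (z' <= z)%MS.
  by apply: (dist2_coset Ll fy z0 zl vl Pyv dz); apply: dist2_par dz'.
have [k [dzk dz'k _]] := dist2_common Ll vl z0 zl z'0 z'l nz'z dz dz'.
by case/negP: nz'z; apply: (uniq_direction (far_dist2_shift k fy z0 zl dz)).
Qed.

Lemma card_far_geq : (q ^ 6 - q ^ 4 <= #|far_points|)%N.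
Proof.
rewrite -(leq_pmul2l p_gt0); apply: leq_trans sum_directions_geq _.
by rewrite mulnC -sum_nat_const; apply: leq_sum => y; rewrite inE; apply: card_directions_leq.
Qed.

Lemma card_lines_geq : (q ^ 5 + q ^ 4 + q ^ 3 + q ^ 2 + q + 1 <= #|L|)%N.
Proof.
rewrite -(leq_pmul2r p_gt0) card_far_near; apply: leq_trans (leq_add card_far_geq card_near_geq).
by clear; case: #|F| => // k; rewrite /= !expnS expn0; nia.
Qed.

End LineCounting.

(** * The hexagon *)

Lemma path3_opposite a b c d : covered b -> (a <= perp b)%MS -> ~~ (a <= b)%MS -> (c <= perp b)%MS ->
  ~~ (c <= a + b)%MS -> (d <= perp c)%MS -> ~~ (d <= b + c)%MS -> ~~ dist2 a d.
Proof.
move=> Pb ab nab cb ncab dc ndbc; apply/negP => dad.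
have Ll := perp_line Pb ab nab; have b0 := covered_neq0 Pb; have a0 := notsub_neq0 nab.
set l := <<(b + a)%MS>>%MS in Ll; have [al bl] : (a <= l)%MS /\ (b <= l)%MS by rewrite !genmxE; split; in_span.
have fd : far l d.
  by apply: (far_path Ll _ cb _ dc ndbc); [apply/line_pointsP | rewrite genmxE addsmxC].
case/negP: nab; apply: (uniq_direction Ll fd b0 a0 bl al _ dad).
exact: dist2I (midpointI (notsub_neq0 ncab) cb dc).
Qed.

Section Opposite.
Variables w p : 'rV[F]_N.
Hypotheses (Pw : covered w) (Pp : covered p) (opp : ~~ dist2 w p).

Section Line.
Variable p' : 'rV[F]_N.
Hypotheses (p'p : (p' <= perp p)%MS) (np' : ~~ (p' <= p)%MS).
Local Notation l := <<(p + p')%MS>>%MS.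
Let Ll : l \in L := perp_line Pp p'p np'.

Lemma opposite_far : far l w.
Proof.
apply: farI => // z z0; rewrite genmxE => zl; apply: contra opp => zw.
apply: dist2I (midpointI z0 zw _); apply: perp_sym => //.
by have pp := mem_perp Pp; apply: submx_trans zl _; in_span.
Qed.

Lemma exists_projection : exists k : F, dist2 w (p' + k *: p).
Proof.
have [z [z0 zl dz]] := exists_direction Ll opposite_far; rewrite genmxE in zl.
have Pz : covered z.
  by apply: (perp_covered Pp) => //; have pp := mem_perp Pp; apply: submx_trans zl _; in_span.
have [a [b ez]] := sub_span2P zl; have b0 : b != 0.
  apply: contraNneq opp => b0; have zp : (z <= p)%MS by rewrite ez b0 scale0r addr0; in_span.
  exact: dist2_sym Pp (covered_neq0 Pw) (dist2_par z0 zp dz).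
have /existsP[u mid] := dist2_sym Pz (covered_neq0 Pw) dz; case/and3P: mid => u0 uw zu.
exists (a / b); apply: dist2I (midpointI u0 uw _).
have -> : p' + (a / b) *: p = b^-1 *: z by rewrite ez scalerDr !scalerA mulVf // scale1r mulrC addrC.
exact: scalemx_sub.
Qed.

Lemma projection_uniq y z : y != 0 -> z != 0 -> (y <= p + p')%MS -> (z <= p + p')%MS ->
  dist2 w y -> dist2 w z -> (z <= y)%MS.
Proof.
move=> y0 z0 yl zl dy dz.
by apply: (uniq_direction Ll opposite_far y0 z0); rewrite ?genmxE //; apply: dist2_sym.
Qed.

End Line.

Section Projection.
Variables s u : 'rV[F]_N.
Hypotheses (s0 : s != 0) (sp : (s <= perp p)%MS) (mid : midpoint w u s).
Let Ps : covered s := perp_covered Pp sp s0.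
Let ps : (p <= perp s)%MS := perp_sym Pp sp s0.

Lemma opposite_notin_projection : ~~ (p <= s)%MS.
Proof.
apply: contra opp => p_s; case/and3P: mid => u0 uw su.
exact: dist2I (midpointI u0 uw (submx_trans p_s su)).
Qed.

Let nsp : ~~ (s <= p)%MS := notsub_vec_sym s0 opposite_notin_projection.

Lemma opposite_add_projection : [/\ covered (p + s), ((p + s)%R <= perp p)%MS & ~~ dist2 w (p + s)].
Proof.
have psp : ((p + s)%R <= perp p)%MS by have pp := mem_perp Pp; in_span.
have ps0 : p + s != 0.
  by apply: contraNneq nsp => /eqP; rewrite addr_eq0 -eqr_oppLR => /eqP<-; rewrite eqmx_opp.
split=> //; first exact: perp_covered Pp psp ps0.
apply/negP => dps; case/negP: opposite_notin_projection; rewrite -(addmx_subl p (submx_refl s)) addrC.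
by apply: (projection_uniq sp nsp s0 ps0 _ _ (dist2I mid) dps); in_span.
Qed.

Lemma projection_midpoint_uniq u2 : u2 != 0 -> (u2 <= perp w)%MS -> dist2 u2 p -> dist2 u2 (p + s) ->
  (u <= u2)%MS.
Proof.
move=> u20 u2w dp dps; have Pu2 := perp_covered Pw u2w u20.
have [Pps _ _] := opposite_add_projection.
have Ll := perp_line Pp sp nsp; set l := <<(p + s)%MS>>%MS in Ll.
have [pl psl] : (p <= l)%MS /\ ((p + s)%R <= l)%MS by rewrite !genmxE; split; in_span.
have [f2|] := boolP (far l u2).
  have := uniq_direction Ll f2 (covered_neq0 Pp) (covered_neq0 Pps) pl psl
    (dist2_sym Pu2 (covered_neq0 Pp) dp) (dist2_sym Pu2 (covered_neq0 Pps) dps).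
  by rewrite addmx_subl // (negbTE nsp).
rewrite /far Pu2 /= => /rowV0Pn[v]; rewrite sub_capmx genmxE => /andP[vu2 vl] v0.
have sv : (s <= v)%MS.
  apply: (projection_uniq sp nsp v0 s0 vl _ _ (dist2I mid)); first by in_span.
  exact: dist2I (midpointI u20 u2w vu2).
case/and3P: mid => u0 uw su; have Pu := perp_covered Pw uw u0.
have nsw : ~~ (s <= perp w)%MS by apply: contra opp => sw; apply: dist2I (midpointI s0 sw ps).
apply: (midpoint_uniq Pw Ps nsw) => //; apply: perp_sym => //.
exact: submx_trans sv vu2.
Qed.

End Projection.
End Opposite.

Definition tspace w : 'M[F]_N := (\sum_(p | (p <= perp w)%MS && (p != 0)) perp p)%MS.

Lemma perp_tspace w p : (p <= perp w)%MS -> p != 0 -> (perp p <= tspace w)%MS.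
Proof. by move=> pw p0; apply: (@sumsmx_sup _ _ p) => //; rewrite pw. Qed.

Lemma dist2_tspace w p : dist2 w p -> (p <= tspace w)%MS.
Proof. by case/existsP => u /and3P[u0 uw pu]; apply: submx_trans pu (perp_tspace uw u0). Qed.

Section ClosedSpace.
Variables (S : 'M[F]_N) (w : 'rV[F]_N).
Hypotheses (Pw : covered w) (tS : (tspace w <= S)%MS).

Lemma opposite_perp_sub p : covered p -> ~~ dist2 w p -> (p <= S)%MS -> (perp p <= S)%MS.
Proof.
move=> Pp opp pS; have in_S y : (y <= perp p)%MS -> ~~ (y <= p)%MS -> (y <= S)%MS.
  move=> yp nyp; have [k dk] := exists_projection Pw Pp opp yp nyp.
  by have yS := submx_trans (dist2_tspace dk) tS; rewrite -(addrK (k *: p) y); in_span.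
have [y [z [yp zp nyp nzpy]]] := exists_perp_basis Pp.
apply: (perp_sub3 Pp yp zp nyp nzpy) => //; apply: in_S => //.
by apply: contra nzpy => zp1; in_span.
Qed.

Lemma opposite_perp_perp_sub p s : covered p -> ~~ dist2 w p -> (p <= S)%MS -> (s <= perp p)%MS -> s != 0 ->
  (perp s <= S)%MS.
Proof.
move=> Pp opp pS sp s0; have Ps := perp_covered Pp sp s0; have sS := submx_trans sp (opposite_perp_sub Pp opp pS).
have [/existsP[u mid]|ns] := boolP (dist2 w s); last exact: opposite_perp_sub.
have Pu := midpoint_covered Pw mid; case/and3P: (mid) => u0 uw su.
have us := perp_sym Pu su s0; have ps := perp_sym Pp sp s0.
apply: (perp_sub3 Ps ps us (opposite_notin_projection opp mid)) => //.
  apply: contra opp => usp; apply: dist2I (midpointI u0 uw _); apply: perp_sym => //.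
  by have pp := mem_perp Pp; apply: submx_trans usp _; in_span.
exact: submx_trans (mem_perp Pu) (submx_trans (perp_tspace uw u0) tS).
Qed.

Lemma opposite_dist2_sub p x : covered p -> ~~ dist2 w p -> (p <= S)%MS -> dist2 p x -> (x <= S)%MS.
Proof.
move=> Pp opp pS /existsP[s /and3P[s0 sp xs]]; exact: submx_trans xs (opposite_perp_perp_sub Pp opp pS sp s0).
Qed.

Lemma opposite_sub_or_dist2 p x x1 (k : F) u : covered p -> ~~ dist2 w p -> (p <= S)%MS ->
  covered x -> ~~ dist2 w x -> (x1 <= perp x)%MS -> ~~ (x1 <= x)%MS -> midpoint w u (x1 + k *: x) ->
  (x <= S)%MS \/ dist2 p u.
Proof.
move=> Pp opp pS Px oppx x1x nx1 mid; set y := x1 + k *: x in mid.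
have Pu := midpoint_covered Pw mid; case/and3P: mid => u0 uw yu; have wu := perp_sym Pw uw u0.
have [/opposite_dist2_sub xS|ndx] := boolP (dist2 p x); first by left; apply: xS.
have [k' dk'] := exists_projection Pp Px ndx x1x nx1.
have [ek|nek] := eqVneq k k'; last first.
  have y'S := opposite_dist2_sub Pp opp pS dk'; left.
  have yS : (y <= S)%MS by apply: submx_trans yu (submx_trans (perp_tspace uw u0) tS).
  rewrite -(@scalemx_sub_eq _ _ (k - k') x) ?subr_eq0 //.
  have -> : (k - k') *: x = y - (x1 + k' *: x) by rewrite /y scalerBl opprD addrACA subrr add0r.
  by in_span.
rewrite -ek -/y in dk'; case/existsP: dk' => s mids; have Ps := midpoint_covered Pp mids.
case/and3P: mids => s0 sp ys.
have xx := mem_perp Px; have y0 : y != 0.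
  by apply: contraNneq nx1 => /eqP; rewrite addr_eq0 => /eqP->; rewrite eqmx_opp scalemx_sub.
have yx : (y <= perp x)%MS by rewrite /y; in_span.
have Py := perp_covered Px yx y0; have xy := perp_sym Px yx y0; have sy := perp_sym Ps ys y0.
have nyw : ~~ (y <= perp w)%MS by apply: contra oppx => yw; apply: dist2I (midpointI y0 yw xy).
have [suy|nsuy] := boolP (s <= u + y)%MS.
  right; apply: dist2I (midpointI s0 sp _); apply: perp_sym => //.
  by have uu := mem_perp Pu; apply: submx_trans suy _; in_span.
have opps : ~~ dist2 w s.
  apply: (path3_opposite Pu wu _ yu _ sy nsuy).
    by apply: contra nyw => w_u; rewrite (perp_eq_vec (covered_neq0 Pw) w_u).
  by apply: contra nyw => ywu; have ww := mem_perp Pw; apply: submx_trans ywu _; in_span.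
left; have sS := submx_trans sp (opposite_perp_sub Pp opp pS).
exact: submx_trans xy (opposite_perp_perp_sub Ps opps sS ys y0).
Qed.

(* If x is opposite to w but outside S, the projections y1, y2 of w on two lines of x have
   midpoints u1, u2 with w that are both at distance at most 2 from p and from p + s. *)
Lemma opposite_sub_all p x : covered p -> ~~ dist2 w p -> (p <= S)%MS -> covered x -> (x <= S)%MS.
Proof.
move=> Pp opp pS Px.
have [/dist2_tspace xt|oppx] := boolP (dist2 w x); first exact: submx_trans xt tS.
have [x1 [x2 [x1x x2x nx1 nx2]]] := exists_perp_basis Px.
have nx2x : ~~ (x2 <= x)%MS by apply: contra nx2 => x2x'; in_span.
have [k1 /existsP[u1 mid1]] := exists_projection Pw Px oppx x1x nx1.
have [k2 /existsP[u2 mid2]] := exists_projection Pw Px oppx x2x nx2x.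
have [//|/existsP[s /and3P[s0 sp u1s]]] := opposite_sub_or_dist2 Pp opp pS Px oppx x1x nx1 mid1.
have [//|du2p] := opposite_sub_or_dist2 Pp opp pS Px oppx x2x nx2x mid2.
have [Pu1 Pu2] := (midpoint_covered Pw mid1, midpoint_covered Pw mid2).
case/and3P: mid1 mid2 => u10 u1w y1u1 mid2; case/and3P: (mid2) => u20 u2w y2u2.
have mids : midpoint w u1 s by apply: midpointI => //; apply: perp_sym (perp_covered Pp sp s0) _ _.
have [Pps psp opps] := opposite_add_projection Pw Pp opp s0 sp mids.
have psS := submx_trans psp (opposite_perp_sub Pp opp pS).
have [//|du2ps] := opposite_sub_or_dist2 Pps opps psS Px oppx x2x nx2x mid2.
have u12 := projection_midpoint_uniq Pw Pp opp s0 sp mids u20 u2w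
  (dist2_sym Pp u20 du2p) (dist2_sym Pps u20 du2ps).
have xx := mem_perp Px; have nxu2 : ~~ (x <= perp u2)%MS.
  by apply: contra oppx => xu2; apply: dist2I (midpointI u20 u2w xu2).
have y_neq0 v (k : F) : ~~ (v <= x)%MS -> v + k *: x != 0.
  by apply: contraNneq => /eqP; rewrite addr_eq0 => /eqP->; rewrite eqmx_opp scalemx_sub.
rewrite (perp_eq_vec u10 u12) in y1u1.
have y21 : ((x2 + k2 *: x)%R <= (x1 + k1 *: x)%R)%MS.
  by apply: (midpoint_uniq Pu2 Px nxu2 (y_neq0 _ _ nx2x) (y_neq0 _ _ nx1) y2u2 _ y1u1); in_span.
case/negP: nx2; rewrite -(addrK (k2 *: x) x2); apply: addmx_sub; last by in_span.
by apply: submx_trans y21 _; in_span.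
Qed.

End ClosedSpace.

(* The covered points of y + l are the y + k z by [far_shift_direction], so all of them touch m. *)
Lemma touching_direction_line l y z m : l \in L -> far l y -> z != 0 -> (z <= l)%MS -> dist2 z y ->
  m \in lines_thru y -> touching l y m = [set y + k *: z | k : F].
Proof.
move=> Ll fy z0 zl dz ym; apply/eqP.
rewrite eqEcard (card_imset _ (affine_line_inj z0)) (card_touching_geq Ll fy ym) andbT.
apply/subsetP => x; rewrite mem_touching => /and3P[/cosetP[v vl ->] Pyv _].
by have /sub_rVP[k ->] := far_shift_direction Ll fy z0 zl dz vl Pyv; apply/imsetP; exists k.
Qed.

Lemma perp_comb w y z (k : F) : covered w -> (y <= perp w)%MS -> (z <= perp w)%MS -> ~~ (y <= w)%MS ->
  ~~ (z <= w + y)%MS -> (perp (y + k *: z)%R <= perp y + perp z)%MS.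
Proof.
move=> Pw yw zw nyw nzwy; have [z0 y0] := (notsub_neq0 nzwy, notsub_neq0 nyw).
have [Pz Py] := (perp_covered Pw zw z0, perp_covered Pw yw y0).
have [wz wy] := (perp_sym Pw zw z0, perp_sym Pw yw y0); have w0 := covered_neq0 Pw.
have nwz : ~~ (w <= z)%MS by apply: contra nzwy => /(submx_vec_sym w0)/submx_trans; apply; in_span.
have nyzw : ~~ (y <= z + w)%MS by apply: contra nzwy; rewrite addsmxC => /adds_vec_exchange; apply.
have [l zl nwl] := exists_line_thru_off Pz nwz; have lz := lines_thru_perp zl.
have [m ym nwm] := exists_line_thru_off Py (notsub_vec_sym w0 nyw); have my := lines_thru_perp ym.
have [[Ll z_l] [Lm y_m]] := (lines_thruP _ _ zl, lines_thruP _ _ ym).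
have fy : far l y by apply: (far_path Ll _ wz nwl yw nyzw); apply/line_pointsP.
have : y + k *: z \in touching l y m.
  rewrite (touching_direction_line Ll fy z0 z_l (dist2I (midpointI w0 wz yw)) ym).
  by apply/imsetP; exists k.
rewrite mem_touching => /and3P[_ Py' rank_cap].
have y'w : ((y + k *: z)%R <= perp w)%MS by in_span.
have wy' := perp_sym Pw y'w (covered_neq0 Py').
have nwS : ~~ (w <= l + m)%MS.
  apply: contra (far_perp_notsub_solid Ll fy (rank_line_far_line Ll fy ym) (addsmxSl l m)) => wS.
  apply: submx_trans (_ : (m + w <= _)%MS); last by in_span.
  by apply: submx_rank_eq; [in_span | rewrite rank_adds_notin // (rank_line Lm) rank_perp].
have [t [/andP[ty' tS] nty']] : exists t : 'rV[F]_N,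
    ((t <= perp (y + k *: z)%R)%MS && (t <= l + m)%MS) /\ ~~ (t <= (y + k *: z)%R)%MS.
  have [|t [tc nt]] := @exists_notin _ _ _ _ (y + k *: z) (perp (y + k *: z)%R :&: (l + m))%MS.
    by rewrite rank_rV1.
  by exists t; rewrite -sub_capmx.
have [yy zz] := (mem_perp Py, mem_perp Pz).
have lmU : (l + m <= perp y + perp z)%MS by in_span.
have tU := submx_trans tS lmU.
apply: (perp_sub3 Py' ty' wy' nty') => //; try by in_span.
by apply: contra nwS => /submx_trans; apply; have zS := submx_trans z_l (addsmxSl l m); in_span.
Qed.

Lemma perp_line_sub w y z p (S : 'M[F]_N) : covered w -> (y <= perp w)%MS -> (z <= perp w)%MS ->
  ~~ (y <= w)%MS -> ~~ (z <= w + y)%MS -> (perp y <= S)%MS -> (perp z <= S)%MS ->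
  (p <= y + z)%MS -> p != 0 -> (perp p <= S)%MS.
Proof.
move=> Pw yw zw nyw nzwy yS zS /sub_span2P[k [m ->]].
have [->|k0] := eqVneq k 0.
  by rewrite scale0r add0r scaler_eq0 negb_or => /andP[m0 _]; rewrite perp_scale.
have -> : k *: y + m *: z = k *: (y + (m / k) *: z) by rewrite scalerDr scalerA mulrC divfK.
move=> _; rewrite perp_scale //; apply: submx_trans (perp_comb _ Pw yw zw nyw nzwy) _.
by in_span.
Qed.

(* The lines through p and a and through b and c meet in the projective plane [perp w]. *)
Lemma perp_triangle_sub w a b c p (S : 'M[F]_N) : covered w ->
  [/\ (a <= perp w)%MS, (b <= perp w)%MS, (c <= perp w)%MS & (p <= perp w)%MS] ->
  ~~ (a <= w)%MS -> ~~ (b <= w)%MS -> ~~ (c <= w + b)%MS -> (perp w <= a + b + c)%MS ->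
  ~~ (p <= w + a)%MS -> (perp a <= S)%MS -> (perp b <= S)%MS -> (perp c <= S)%MS -> (perp p <= S)%MS.
Proof.
move=> Pw [aw bw cw pw] naw nbw ncwb wabc npwa aS bS cS.
have [a0 b0] := (notsub_neq0 naw, notsub_neq0 nbw).
have npa : ~~ (p <= a)%MS by apply: contra npwa => /submx_trans; apply; in_span.
have ncb : ~~ (c <= b)%MS by apply: contra ncwb => /submx_trans; apply; in_span.
have [apw bcw] : (a + p <= perp w)%MS /\ (b + c <= perp w)%MS by split; in_span.
have [|t [t0 tap tbc]] := cap_nonzero_vec apw bcw; first by rewrite rank_perp // !rank_span2.
have nta : ~~ (t <= a)%MS.
  apply/negP => /(submx_vec_sym t0) a_t; have abc : (a <= b + c)%MS := submx_trans a_t tbc.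
  have /mxrankS : (perp w <= b + c)%MS by apply: submx_trans wabc _; in_span.
  by rewrite rank_perp // rank_span2.
have ntwa : ~~ (t <= w + a)%MS.
  apply: contra nta => twa; apply: (sub_adds_vec_cap tap twa).
  by apply: contra npwa => /submx_trans; apply; in_span.
apply: (perp_line_sub Pw aw (submx_trans tap apw) naw ntwa aS) (adds_vec_exchange tap nta) (notsub_neq0 npwa).
exact: (perp_line_sub Pw bw cw nbw ncwb bS cS tbc t0).
Qed.

Section PerpBasis.
Variables w y z : 'rV[F]_N.
Hypotheses (Pw : covered w) (yw : (y <= perp w)%MS) (zw : (z <= perp w)%MS).
Hypotheses (nyw : ~~ (y <= w)%MS) (nzwy : ~~ (z <= w + y)%MS).
Local Notation s := (w + y + z).
Let w0 : w != 0 := covered_neq0 Pw.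
Let y0 : y != 0 := notsub_neq0 nyw.
Let z0 : z != 0 := notsub_neq0 nzwy.
Let Py : covered y := perp_covered Pw yw y0.
Let Pz : covered z := perp_covered Pw zw z0.
Let wy : (w <= perp y)%MS := perp_sym Pw yw y0.
Let wz : (w <= perp z)%MS := perp_sym Pw zw z0.
Let sw : (s <= perp w)%MS. Proof. by have ww := mem_perp Pw; in_span. Qed.

Let nzw : ~~ (z <= w)%MS. Proof. by apply: contra nzwy => zw1; in_span. Qed.
Let nywz : ~~ (y <= w + z)%MS.
Proof. by apply: contra nzwy => ywz; apply: adds_vec_exchange ywz nyw. Qed.
Let nwyz : ~~ (w <= y + z)%MS.
Proof.
apply: contra nzwy => wyz; rewrite addsmxC; apply: adds_vec_exchange wyz _.
exact: notsub_vec_sym nyw.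
Qed.
Let nswy : ~~ (s <= w + y)%MS. Proof. by rewrite addmx_subl //; in_span. Qed.
Let nswz : ~~ (s <= w + z)%MS. Proof. by rewrite addmx_subr ?addmx_subl // ?addsmxSl ?addsmxSr. Qed.
Let nsw : ~~ (s <= w)%MS. Proof. by apply: contra nswy => sw1; in_span. Qed.
Let Ps : covered s := perp_covered Pw sw (notsub_neq0 nsw).
Let w_yzs : (perp w <= y + z + s)%MS.
Proof.
have w_s : (w <= y + z + s)%MS.
  by rewrite {1}(_ : w = s - (y + z)); [in_span | rV_ring].
by apply: submx_trans (perp_span3 Pw yw zw nyw nzwy) _; in_span.
Qed.

Lemma tspace_span : (tspace w <= perp y + perp z + perp s)%MS.
Proof.
set S := (perp y + perp z + perp s)%MS.
have [yS zS sS] : [/\ (perp y <= S)%MS, (perp z <= S)%MS & (perp s <= S)%MS] by split; rewrite /S; in_span.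
apply/sumsmx_subP => p /andP[pw p0].
have [p_w|npw] := boolP (p <= w)%MS.
  have yy := submx_trans (mem_perp Py) yS; have zz := submx_trans (mem_perp Pz) zS.
  have ss := submx_trans (mem_perp Ps) sS; rewrite (perp_eq_vec p0 p_w).
  by apply: submx_trans w_yzs _; in_span.
have [pwy|npwy] := boolP (p <= w + y)%MS; last first.
  by apply: (perp_triangle_sub Pw _ nyw nzw nswz w_yzs npwy yS zS sS).
have npwz : ~~ (p <= w + z)%MS.
  apply: contra npw => pwz; apply: (sub_adds_vec_cap pwy pwz); apply: contra nywz => /submx_trans; apply.
  by in_span.
have w_zys : (perp w <= z + y + s)%MS by rewrite (addsmxC z y).
by apply: (perp_triangle_sub Pw _ nzw nyw nswy w_zys npwz zS yS sS).
Qed.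

Lemma rank_add_perps_opposite : \rank (perp y + perp z)%MS = 5%N.
Proof.
have := mxrank_sum_cap (perp y) (perp z); rewrite !rank_perp //.
suff -> : \rank (perp y :&: perp z)%MS = 1%N by clear; lia.
rewrite -(rank_rV1 w0); apply/eqmx_rank/andP; split; last by rewrite sub_capmx wy.
have nzy : ~~ (z <= perp y)%MS by apply: contra nzwy => zy; apply: (no_triangle Pw yw zw y0 zy nyw).
apply/row_subP => i; set v := row i _; have [->|v0] := eqVneq v 0; first exact: sub0mx.
have := row_sub i (perp y :&: perp z)%MS; rewrite -/v sub_capmx => /andP[vy vz].
by apply: (midpoint_uniq Py Pz nzy v0 w0) => //; apply: perp_sym.
Qed.

Let perp_yz_sub : (perp y + perp z <= tspace w)%MS.
Proof. by rewrite addsmx_sub !perp_tspace. Qed.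

Lemma rank_tspace_leq : (\rank (tspace w) <= 6)%N.
Proof.
have ws : (w <= perp s)%MS := perp_sym Pw sw (notsub_neq0 nsw).
have nws : ~~ (w <= s)%MS := notsub_vec_sym w0 nsw.
have [t [ts ntsw]] : exists t : 'rV[F]_N, (t <= perp s)%MS /\ ~~ (t <= s + w)%MS.
  by apply: exists_notin; rewrite rank_perp // rank_span2 // (covered_neq0 Ps).
have tsub : (tspace w <= perp y + perp z + t)%MS.
  apply: submx_trans tspace_span _; rewrite addsmx_sub; apply/andP; split; first by in_span.
  have yy := mem_perp Py; have zz := mem_perp Pz.
  by apply: submx_trans (perp_span3 Ps ws ts nws ntsw) _; in_span.
by rewrite -(rank_add_perps_opposite) (leq_trans (mxrankS tsub)) ?rank_adds_vec.
Qed.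

(* In rank 5 the planes of y + k z, of z and of w + y + z would be too many. *)
Lemma rank_tspace_geq : (5 < \rank (tspace w))%N.
Proof.
rewrite -rank_add_perps_opposite ltnNge; apply/negP => rank_le.
have rT : \rank (tspace w) = 5%N.
  by apply/eqP; rewrite eqn_leq -{1}rank_add_perps_opposite rank_le -rank_add_perps_opposite mxrankS.
have nzy : ~~ (z <= y)%MS by apply: contra nzwy => zy; in_span.
have nyz : ~~ (y <= z)%MS := notsub_vec_sym y0 nzy.
have nyzw (k : F) : ~~ ((y + k *: z)%R <= w)%MS.
  apply: contra nwyz => /(submx_vec_sym _)/submx_trans-> //; last by in_span.
  by apply: contraNneq nyz => /eqP; rewrite addr_eq0 => /eqP->; rewrite eqmx_opp scalemx_sub.
have nv_s v : v != 0 -> (v <= y + z)%MS -> ~~ (v <= s)%MS.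
  move=> v0 vyz; apply: contra nwyz => /(submx_vec_sym v0) sv; have syz := submx_trans sv vyz.
  have es : w = s - (y + z) by rV_ring.
  by rewrite {1}es; in_span.
have nk0 (k : F) : y + k *: z != 0 := notsub_neq0 (nyzw k).
case/negP: (nv_s z z0 (addsmxSr y z)).
apply: (@no_perps_in_rank5 (tspace w) w (fun k : F => y + k *: z)) => // [|k|||k k'|k|k].
- have yy := mem_perp Py; have zz := mem_perp Pz.
  by apply: submx_trans (perp_span3 Pw yw zw nyw nzwy) (submx_trans _ perp_yz_sub); in_span.
- by split=> //; [in_span | apply: perp_tspace; [in_span | exact: nk0]].
- exact: perp_tspace.
- by apply: perp_tspace; rewrite ?(notsub_neq0 nsw).
- by apply: affine_line_notsub.
- by rewrite addmx_subr ?scalemx_sub.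
- by apply: nv_s => //; in_span.
Qed.

End PerpBasis.

Lemma rank_tspace w : covered w -> \rank (tspace w) = 6%N.
Proof.
move=> Pw; have [y [z [yw zw nyw nzwy]]] := exists_perp_basis Pw; apply/eqP; rewrite eqn_leq.
by rewrite (rank_tspace_leq Pw yw zw nyw nzwy) (rank_tspace_geq Pw yw zw nyw nzwy).
Qed.

Lemma lines_sub k (S : 'M[F]_(k, N)) : (forall x, covered x -> (x <= S)%MS) -> forall l, l \in L -> (l <= S)%MS.
Proof.
move=> covS l Ll; apply/row_subP => i; have [->|r0] := eqVneq (row i l) 0; first exact: sub0mx.
by apply: covS; apply: (line_covered Ll r0); apply: row_sub.
Qed.

(* A hyperplane containing a point opposite to w contains all lines, which are too many. *)
Lemma in_tspace w p : covered w -> covered p -> (p <= tspace w)%MS = dist2 w p.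
Proof.
move=> Pw Pp; apply/idP/idP => [pT|]; last exact: dist2_tspace.
apply: contraT => opp; have := hyperplane_bound (rank_tspace Pw).
have -> : nb_in L (tspace w) = #|L|.
  apply: eq_card => l; rewrite inE; have [Ll|//] := boolP (l \in L).
  by apply: lines_sub Ll => x Px; apply: (opposite_sub_all Pw (submx_refl _) Pp opp pT).
have [l [_ [/lines_thruP[Ll _] _ _]]] := two_lines_thru Pw.
move/(leq_trans (card_lines_geq Ll)); move: q_gt1; clear; case: #|F| => // k _; rewrite !expnS expn0; nia.
Qed.

Lemma covered_sub_tspace w p x : covered w -> covered p -> ~~ dist2 w p -> covered x -> (x <= tspace w + p)%MS.
Proof.
move=> Pw Pp opp Px; apply: (opposite_sub_all Pw (addsmxSl _ _) Pp opp _ Px); exact: addsmxSr.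
Qed.

(** * Apartments *)

Definition opposite x y := [/\ covered x, covered y & ~~ dist2 x y].

Lemma opposite_sym x y : opposite x y -> opposite y x.
Proof. by case=> Px Py nd; split=> //; apply: contra nd; apply: dist2_sym. Qed.

Lemma opposite_notin_perp x y : opposite x y -> ~~ (x <= perp y)%MS.
Proof. by case/opposite_sym=> Py _; apply: contra; apply: perp_dist2. Qed.

Lemma opposite_scale (k : F) x y : k != 0 -> opposite x y -> opposite x (k *: y).
Proof.
move=> k0 [Px Py nd]; split; rewrite ?covered_scale //; apply: contra nd => /existsP[w /and3P[w0 wx kyw]].
by apply: dist2I (midpointI w0 wx _); rewrite -(scalemx_sub_eq _ _ k0).
Qed.

Lemma perp_add x y v : covered x -> covered y -> v != 0 -> (v <= perp x)%MS -> (v <= perp y)%MS ->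
  x + y != 0 -> covered (x + y) /\ (v <= perp (x + y)%R)%MS.
Proof.
move=> Px Py v0 vx vy xy0; have [xv yv] := (perp_sym Px vx v0, perp_sym Py vy v0).
have Pv := perp_covered Px vx v0; have xyv : ((x + y)%R <= perp v)%MS by in_span.
by split; [apply: perp_covered Pv xyv xy0 | apply: perp_sym Pv xyv xy0].
Qed.

(* The hexagon a1, b2, a3, b1, a2, b3. *)
Definition apartment a1 a2 a3 b1 b2 b3 := [/\ opposite a1 b1, opposite a2 b2, opposite a3 b3,
  [/\ (b2 <= perp a1)%MS, (b3 <= perp a2)%MS & (b1 <= perp a3)%MS] &
  [/\ (b3 <= perp a1)%MS, (b1 <= perp a2)%MS & (b2 <= perp a3)%MS]].

Lemma apartment_rot a1 a2 a3 b1 b2 b3 : apartment a1 a2 a3 b1 b2 b3 -> apartment a2 a3 a1 b2 b3 b1.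
Proof. by case=> o1 o2 o3 [b2a1 b3a2 b1a3] [b3a1 b1a2 b2a3]; split. Qed.

Lemma apartment_swap a1 a2 a3 b1 b2 b3 : apartment a1 a2 a3 b1 b2 b3 -> apartment a1 a3 a2 b1 b3 b2.
Proof. by case=> o1 o2 o3 [b2a1 b3a2 b1a3] [b3a1 b1a2 b2a3]; split. Qed.

Lemma apartment_dual a1 a2 a3 b1 b2 b3 : apartment a1 a2 a3 b1 b2 b3 -> apartment b1 b2 b3 a1 a2 a3.
Proof.
case=> o1 o2 o3 [b2a1 b3a2 b1a3] [b3a1 b1a2 b2a3]; split; try exact: opposite_sym.
- by case: o1 o2 o3 => A1 B1 _ [A2 B2 _] [A3 B3 _]; split; apply: perp_sym.
- by case: o1 o2 o3 => A1 B1 _ [A2 B2 _] [A3 B3 _]; split; apply: perp_sym.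
Qed.

Lemma apartment_scale (k1 k2 k3 : F) a1 a2 a3 b1 b2 b3 : k1 != 0 -> k2 != 0 -> k3 != 0 ->
  apartment a1 a2 a3 b1 b2 b3 -> apartment a1 a2 a3 (k1 *: b1) (k2 *: b2) (k3 *: b3).
Proof.
move=> k10 k20 k30 [o1 o2 o3 [b2a1 b3a2 b1a3] [b3a1 b1a2 b2a3]].
by split; [exact: opposite_scale.. | split; in_span | split; in_span].
Qed.

Lemma exists_apartment x : covered x -> exists a1 a2 a3 b1 b2 b3, apartment a1 a2 a3 b1 b2 b3.
Proof.
move=> Px; have [b2 [b3 [b2x b3x nb2 nb3]]] := exists_perp_basis Px; have x0 := covered_neq0 Px.
have [b20 b30] := (notsub_neq0 nb2, notsub_neq0 nb3).
have [B2 B3] := (perp_covered Px b2x b20, perp_covered Px b3x b30).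
have [xb2 xb3] := (perp_sym Px b2x b20, perp_sym Px b3x b30).
have nb3x : ~~ (b3 <= x)%MS by apply: contra nb3 => b3_x; in_span.
have nb23 : ~~ (b2 <= x + b3)%MS.
  by apply: contra nb3 => b2xb3; apply: adds_vec_exchange b2xb3 nb2.
have [a3 [a3b2 na3]] : exists a : 'rV[F]_N, (a <= perp b2)%MS /\ ~~ (a <= x + b2)%MS.
  by apply: exists_notin; rewrite rank_perp // rank_span2.
have [v [vb3 nv]] : exists v, (v <= perp b3)%MS /\ ~~ (v <= x + b3)%MS.
  by apply: exists_notin; rewrite rank_perp // rank_span2.
have A3 := perp_covered B2 a3b2 (notsub_neq0 na3).
have opp3 : opposite a3 b3.
  apply: opposite_sym; split=> //; rewrite (addsmxC x b3) in nb23.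
  exact: (path3_opposite Px b3x nb3x b2x nb23 a3b2 na3).
have nvb3 : ~~ (v <= b3)%MS by apply: contra nv => vb3'; in_span.
have [_ _ nd3] := opp3; have [k /existsP[b1 mid]] := exists_projection A3 B3 nd3 vb3 nvb3.
set a2 := v + k *: b3 in mid; have b33 := mem_perp B3.
have a2b3 : (a2 <= perp b3)%MS by rewrite /a2; in_span.
have na2 : ~~ (a2 <= x + b3)%MS by rewrite /a2 addmx_subr //; in_span.
have a20 := notsub_neq0 na2; have A2 := perp_covered B3 a2b3 a20.
have opp2 : opposite a2 b2.
  apply: opposite_sym; split=> //; rewrite (addsmxC x b2) in nb3.
  exact: (path3_opposite Px b2x nb2 b3x nb3 a2b3 na2).
have B1 := midpoint_covered A3 mid; case/and3P: mid => b10 b1a3 a2b1.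
have [b1a2 b3a2 b2a3] := And3 (perp_sym B1 a2b1 a20) (perp_sym B3 a2b3 a20) (perp_sym B2 a3b2 (covered_neq0 A3)).
have nxb2 := notsub_vec_sym x0 nb2.
exists x, a2, a3, b1, b2, b3; split=> //; split=> //.
apply: (path3_opposite B2 xb2 nxb2 a3b2 na3 b1a3); have [_ _] := opp2; apply: contra => b1ba.
apply: dist2I (midpointI b10 b1a2 _); apply: perp_sym => //.
by have b22 := mem_perp B2; apply: submx_trans b1ba _; in_span.
Qed.

Section Apartment.
Variables a1 a2 a3 b1 b2 b3 : 'rV[F]_N.
Hypothesis apt : apartment a1 a2 a3 b1 b2 b3.

Let A1 : covered a1. Proof. by case: apt => -[]. Qed.
Let A2 : covered a2. Proof. by case: apt => _ []. Qed.
Let A3 : covered a3. Proof. by case: apt => _ _ []. Qed.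
Let B1 : covered b1. Proof. by case: apt => -[]. Qed.
Let B2 : covered b2. Proof. by case: apt => _ []. Qed.
Let B3 : covered b3. Proof. by case: apt => _ _ []. Qed.
Let b2a1 : (b2 <= perp a1)%MS. Proof. by case: apt => _ _ _ []. Qed.
Let b3a2 : (b3 <= perp a2)%MS. Proof. by case: apt => _ _ _ []. Qed.
Let b1a3 : (b1 <= perp a3)%MS. Proof. by case: apt => _ _ _ []. Qed.
Let b3a1 : (b3 <= perp a1)%MS. Proof. by case: apt => _ _ _ _ []. Qed.
Let b1a2 : (b1 <= perp a2)%MS. Proof. by case: apt => _ _ _ _ []. Qed.
Let b2a3 : (b2 <= perp a3)%MS. Proof. by case: apt => _ _ _ _ []. Qed.
Let a1b2 : (a1 <= perp b2)%MS := perp_sym A1 b2a1 (covered_neq0 B2).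
Let a1b3 : (a1 <= perp b3)%MS := perp_sym A1 b3a1 (covered_neq0 B3).
Let a2b1 : (a2 <= perp b1)%MS := perp_sym A2 b1a2 (covered_neq0 B1).
Let a2b3 : (a2 <= perp b3)%MS := perp_sym A2 b3a2 (covered_neq0 B3).
Let a3b1 : (a3 <= perp b1)%MS := perp_sym A3 b1a3 (covered_neq0 B1).
Let a3b2 : (a3 <= perp b2)%MS := perp_sym A3 b2a3 (covered_neq0 B2).
Let na2b2 : ~~ (a2 <= perp b2)%MS. Proof. by case: apt => _ /opposite_notin_perp. Qed.
Let na3b3 : ~~ (a3 <= perp b3)%MS. Proof. by case: apt => _ _ /opposite_notin_perp. Qed.

Lemma apartment_tspace : (a1 + a2 + a3 + b2 + b3 <= tspace a1)%MS /\ ~~ (b1 <= tspace a1)%MS.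
Proof.
have [[_ _ nd] _ _ _ _] := apt; split; last by rewrite in_tspace.
have a11 := mem_perp A1; in_span; apply: dist2_tspace.
- exact: perp_dist2.
- exact: dist2I (midpointI (covered_neq0 B3) b3a1 a2b3).
- exact: dist2I (midpointI (covered_neq0 B2) b2a1 a3b2).
- exact: perp_dist2.
- exact: perp_dist2.
Qed.

Lemma apartment_indep : ~~ (b2 <= a1)%MS /\ ~~ (b3 <= a1 + b2)%MS.
Proof.
have [_ [_ _ nd2] [_ _ nd3] _ _] := apt; have b22 := mem_perp B2.
have nb3 : ~~ (b3 <= a1 + b2)%MS.
  apply: contra nd3 => b3a1b2; apply: dist2I (midpointI (covered_neq0 B2) b2a3 _).
  by apply: submx_trans b3a1b2 _; in_span.
split=> //; apply: contra nd2 => b2a1'; apply: dist2I (midpointI (covered_neq0 B3) b3a2 _).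
exact: submx_trans b2a1' a1b3.
Qed.

Lemma apartment_coef (e : 'rV[F]_N) (x1 x2 x3 t y1 y2 y3 : F) : (e <= tspace a1)%MS ->
  x1 *: a1 + x2 *: a2 + x3 *: a3 + t *: e + y1 *: b1 + y2 *: b2 + y3 *: b3 = 0 -> y1 = 0.
Proof.
move=> eT sum0; have [] := apartment_tspace; rewrite !addsmx_sub -!andbA => /and5P[? ? ? ? ?].
apply: contraNeq => y10; rewrite -(scalemx_sub_eq _ _ y10) -eqmx_opp.
have -> : - (y1 *: b1) = x1 *: a1 + x2 *: a2 + x3 *: a3 + t *: e + y2 *: b2 + y3 *: b3.
  by apply/eqP; rewrite eq_sym -subr_eq0 -sum0; apply/eqP; rV_ring.
by in_span.
Qed.

Lemma apartment_side_notin (k : F) : ~~ ((a3 + k *: a2)%R <= perp b3)%MS.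
Proof. by rewrite addmx_subr ?scalemx_sub. Qed.

Lemma apartment_side_covered (k : F) : covered (a3 + k *: a2).
Proof. by apply: perp_covered B1 _ (notsub_neq0 (apartment_side_notin k)); in_span. Qed.

Lemma exists_apartment_neighbour (k : F) : k != 0 ->
  exists2 r : F, r != 0 & ((b2 + r *: b3)%R <= perp (a3 + k *: a2)%R)%MS.
Proof.
move=> k0; set u := a3 + k *: a2; have Pu : covered u := apartment_side_covered k; have u0 := covered_neq0 Pu.
have [nb2 nb3] := apartment_indep; have ub1 : (u <= perp b1)%MS by rewrite /u; in_span.
have [] := apartment_tspace; rewrite !addsmx_sub -!andbA => /and5P[_ a2T a3T _ _] _.
have /existsP[v mid] : dist2 a1 u by rewrite -(in_tspace A1 Pu) /u; in_span.
have Pv := midpoint_covered A1 mid; case/and3P: mid => v0 va1 uv.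
have /sub_span3P[k1 [k2 [k3 ev]]] : (v <= a1 + b2 + b3)%MS.
  exact: submx_trans va1 (perp_span3 A1 b2a1 b3a1 nb2 nb3).
have {ev} ev : v = k2 *: b2 + k3 *: b3.
  have vT : (v <= tspace b1)%MS by apply: dist2_tspace; apply: dist2I (midpointI u0 ub1 (perp_sym Pv uv u0)).
  have nT : ~~ (a1 <= tspace b1)%MS.
    by rewrite in_tspace //; have [[_ _]] := apartment_dual apt.
  have [b2T b3T] : (b2 <= tspace b1)%MS /\ (b3 <= tspace b1)%MS.
    have [] := apartment_tspace; split; apply: dist2_tspace.
      exact: dist2I (midpointI (covered_neq0 A3) a3b1 b2a3).
    exact: dist2I (midpointI (covered_neq0 A2) a2b1 b3a2).
  suff k10 : k1 = 0 by rewrite ev k10 scale0r add0r.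
  apply: contraNeq nT => k10; apply: (@submx_of_lincomb _ _ k1 a1 (k2 *: b2 + k3 *: b3) v) => //.
    by rewrite ev addrA.
  by in_span.
have k20 : k2 != 0.
  apply: contraNneq (apartment_side_notin k) => k20; rewrite -/u.
  have k30 : k3 != 0 by apply: contraNneq v0 => k30; rewrite ev k20 k30 !scale0r addr0.
  by move: uv; rewrite ev k20 scale0r add0r perp_scale.
have k30 : k3 != 0.
  apply: contraNneq na2b2 => k30; rewrite -(scalemx_sub_eq _ _ k0) -(addmx_subl _ a3b2) -/u.
  by move: uv; rewrite ev k30 scale0r addr0 perp_scale.
exists (k3 / k2); first by rewrite mulf_neq0 ?invr_eq0.
by rewrite -(scalemx_sub_eq _ _ k20) scalerDr scalerA mulrC divfK // -ev; apply: perp_sym.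
Qed.

Let na2b3 : ~~ (a2 <= b3)%MS.
Proof.
have [_ [_ _ nd2] _ _ _] := apt; apply: contra nd2 => a2b3'; apply: dist2_sym => //.
exact: dist2I (midpointI (covered_neq0 A1) a1b2 (submx_trans a2b3' b3a1)).
Qed.

Lemma apartment_far : far <<(b3 + a2)%MS>>%MS (a3 + b2).
Proof.
have [_ [_ _ nd2] /opposite_sym[_ _ nd3] _ _] := apt.
have nb2a3 : ~~ (b2 <= a3)%MS.
  apply: contra nd2 => b2a3'; apply: dist2I (midpointI (covered_neq0 B1) b1a2 _).
  exact: submx_trans b2a3' a3b1.
have ya3 : ((a3 + b2)%R <= perp a3)%MS by have a33 := mem_perp A3; in_span.
have ny : ~~ ((a3 + b2)%R <= a3)%MS by rewrite addmx_subl.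
have Py := perp_covered A3 ya3 (notsub_neq0 ny).
have oppy : ~~ dist2 b3 (a3 + b2).
  have db : dist2 b3 b2 := dist2I (midpointI (covered_neq0 A1) a1b3 b2a1).
  apply/negP => dy; have [b2s ys] : (b2 <= a3 + b2)%MS /\ ((a3 + b2)%R <= a3 + b2)%MS by split; in_span.
  have := projection_uniq B3 A3 nd3 b2a3 nb2a3 (covered_neq0 B2) (covered_neq0 Py) b2s ys db dy.
  by rewrite addmx_subr // => a3b2'; case/negP: nb2a3; apply: submx_vec_sym a3b2'; apply: covered_neq0.
apply: (opposite_far Py B3 _ a2b3); apply: contra oppy; exact: (dist2_sym Py (covered_neq0 B3)).
Qed.

(* All b2 + r b3 in perp (a3 + k a2) put k a2 + r b3 in the direction of a3 + b2 on the line a2 b3. *)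
Lemma apartment_neighbour_slope : exists2 c : F, c != 0 &
  forall k r : F, ((b2 + r *: b3)%R <= perp (a3 + k *: a2)%R)%MS -> r = k * c.
Proof.
have Ll := perp_line B3 a2b3 na2b3; have [z [z0 zl dz]] := exists_direction Ll apartment_far.
have in_dir (k r : F) : ((b2 + r *: b3)%R <= perp (a3 + k *: a2)%R)%MS -> ((k *: a2 + r *: b3)%R <= z)%MS.
  move=> adj; have vl : ((k *: a2 + r *: b3)%R <= <<(b3 + a2)%MS>>)%MS by rewrite genmxE; in_span.
  apply: (far_shift_direction Ll apartment_far z0 zl dz vl).
  have Pu := apartment_side_covered k.
  have e : a3 + b2 + (k *: a2 + r *: b3) = (a3 + k *: a2) + (b2 + r *: b3) by rV_ring.
  rewrite e; apply: (perp_covered Pu); first by have uu := mem_perp Pu; in_span.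
  rewrite -e; apply: contraNneq (far_notin apartment_far) => y0.
  by rewrite -(addmx_subr _ vl) y0 sub0mx.
have [c c0 adj_c] := exists_apartment_neighbour (oner_neq0 F); exists c => // k r /in_dir kr_z.
apply: (sub_affine_line_slope (covered_neq0 B3) na2b3); apply: submx_trans kr_z _.
have := in_dir 1 c adj_c; rewrite scale1r; apply: submx_vec_sym.
apply: contraNneq na2b3 => /eqP; rewrite addr_eq0 => /eqP->; by rewrite eqmx_opp scalemx_sub.
Qed.

Lemma apartment_neighbour : exists2 c : F, c != 0 & forall k m : F, k *: a3 + m *: a2 != 0 ->
  ((k *: b2 + (m * c) *: b3)%R <= perp (k *: a3 + m *: a2)%R)%MS.
Proof.
have [c c0 slope] := apartment_neighbour_slope; exists c => // k m.
have [->|k0] := eqVneq k 0.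
  by rewrite !scale0r !add0r scaler_eq0 negb_or => /andP[m0 _]; rewrite perp_scale //; in_span.
have -> : k *: a3 + m *: a2 = k *: (a3 + (m / k) *: a2) by rewrite scalerDr scalerA mulrC divfK.
move=> _; rewrite perp_scale //; have [->|m0] := eqVneq m 0.
  by rewrite !mul0r !scale0r !addr0; in_span.
have mk0 : m / k != 0 by rewrite mulf_neq0 ?invr_eq0.
have [r _ adj] := exists_apartment_neighbour mk0; have er := slope _ _ adj.
have -> : k *: b2 + (m * c) *: b3 = k *: (b2 + r *: b3).
  by rewrite scalerDr scalerA er mulrA [k * _]mulrC divfK.
exact: scalemx_sub.
Qed.

Lemma apartment_sum_perp v : v != 0 -> (v <= perp a1)%MS -> (v <= perp (a3 + a2)%R)%MS ->
  covered (a1 + a2 + a3) /\ (v <= perp (a1 + a2 + a3)%R)%MS.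
Proof.
move=> v0 va1 va32; have Pa32 := apartment_side_covered 1; rewrite scale1r in Pa32.
rewrite -addrA (addrC a2); apply: perp_add => //.
apply: contraNneq na2b2 => /eqP; rewrite addr_eq0 => /eqP e.
by rewrite -(addmx_subl a2 a3b2) -eqmx_opp -e.
Qed.

Lemma apartment_pair_notin : ~~ (b2 <= b3)%MS.
Proof.
apply: contra na2b2 => b2b3; by rewrite (perp_eq_vec (covered_neq0 B2) b2b3).
Qed.

End Apartment.

(* b2 would be perpendicular to a1 + a2 + a3 otherwise. *)
Lemma apartment_sign a1 a2 a3 b1 b2 b3 (k : F) : apartment a1 a2 a3 b1 b2 b3 ->
  ((b2 - b3)%R <= perp (a3 + a2)%R)%MS -> ((b1 - b3)%R <= perp (a3 + a1)%R)%MS ->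
  ((b1 + k *: b2)%R <= perp (a2 + a1)%R)%MS -> k = -1.
Proof.
move=> apt adj1 adj2 adj3; have apt2 := apartment_rot apt; have apt3 := apartment_rot apt2.
have [[A1 B1 _] [A2 B2 _] [A3 B3 _] [b2a1 b3a2 b1a3] [b3a1 b1a2 b2a3]] := apt.
pose u := a1 + a2 + a3.
have add_neq0 v w (m : F) : ~~ (v <= w)%MS -> v + m *: w != 0.
  by apply: contraNneq => /eqP; rewrite addr_eq0 => /eqP->; rewrite eqmx_opp scalemx_sub.
have n23 := apartment_pair_notin apt; have n31 := apartment_pair_notin apt2; have n12 := apartment_pair_notin apt3.
have n13 := notsub_vec_sym (covered_neq0 B1) n31.
have [Pu s1] : covered u /\ ((b2 - b3)%R <= perp u)%MS.
  apply: (apartment_sum_perp apt _ _ adj1); last by in_span.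
  by rewrite -scaleN1r add_neq0.
have [_ s2] : covered u /\ ((b1 - b3)%R <= perp u)%MS.
  have -> : u = a2 + a3 + a1 by rewrite /u -addrA addrC.
  apply: (apartment_sum_perp apt2); [by rewrite -scaleN1r add_neq0 | by in_span | by rewrite (addrC a1)].
have [_ s3] : covered u /\ ((b1 + k *: b2)%R <= perp u)%MS.
  have -> : u = a3 + a1 + a2 by rewrite /u addrC addrA.
  by apply: (apartment_sum_perp apt3 _ _ adj3); [exact: add_neq0 | in_span].
apply/eqP; rewrite -addr_eq0; apply: contraT => k10.
have b2u : (b2 <= perp u)%MS.
  rewrite -(scalemx_sub_eq _ _ k10).
  have -> : (k + 1) *: b2 = (b1 + k *: b2) - ((b1 - b3) - (b2 - b3)) by rV_ring.
  by in_span.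
have [_ opp2 _ _ _] := apt; case/negP: (opposite_notin_perp opp2).
have ub2 := perp_sym Pu b2u (covered_neq0 B2).
have [a1b2 a3b2] := (perp_sym A1 b2a1 (covered_neq0 B2), perp_sym A3 b2a3 (covered_neq0 B2)).
have -> : a2 = u - a1 - a3 by rewrite /u; rV_ring.
by in_span.
Qed.

Definition normal_apartment (a1 a2 a3 b1 b2 b3 : 'rV[F]_N) := forall k m : F,
  [/\ k *: a3 + m *: a2 != 0 -> ((k *: b2 - m *: b3)%R <= perp (k *: a3 + m *: a2)%R)%MS,
      k *: a3 + m *: a1 != 0 -> ((k *: b1 - m *: b3)%R <= perp (k *: a3 + m *: a1)%R)%MS &
      k *: a2 + m *: a1 != 0 -> ((k *: b1 - m *: b2)%R <= perp (k *: a2 + m *: a1)%R)%MS].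

Lemma exists_normal_apartment x : covered x -> exists a1 a2 a3 b1 b2 b3,
  apartment a1 a2 a3 b1 b2 b3 /\ normal_apartment a1 a2 a3 b1 b2 b3.
Proof.
move=> Px; have [a1 [a2 [a3 [b1 [b2 [b3 apt]]]]]] := exists_apartment Px.
have [c c0 adj_c] := apartment_neighbour apt.
have [d d0 adj_d] := apartment_neighbour (apartment_swap (apartment_rot apt)).
have cd0 : c / d != 0 by rewrite mulf_neq0 ?invr_eq0.
have nc0 : - c != 0 by rewrite oppr_eq0.
have apt' := apartment_scale cd0 (oner_neq0 _) nc0 apt; rewrite scale1r in apt'.
exists a1, a2, a3, ((c / d) *: b1), b2, ((- c) *: b3); split=> //.
have [e _ adj3] := apartment_neighbour (apartment_rot (apartment_rot apt')).
have adj1 (k m : F) : k *: a3 + m *: a2 != 0 ->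
    ((k *: b2 - m *: (- c *: b3))%R <= perp (k *: a3 + m *: a2)%R)%MS.
  move=> /adj_c; have -> // : k *: b2 + (m * c) *: b3 = k *: b2 - m *: (- c *: b3) by rV_ring.
have adj2 (k m : F) : k *: a3 + m *: a1 != 0 ->
    ((k *: ((c / d) *: b1) - m *: (- c *: b3))%R <= perp (k *: a3 + m *: a1)%R)%MS.
  move=> /adj_d; rewrite -(scalemx_sub_eq _ _ cd0).
  have -> // : (c / d) *: (k *: b1 + (m * d) *: b3) = k *: ((c / d) *: b1) - m *: (- c *: b3).
  by apply/rowP => i; rewrite !mxE; field.
have sum_neq0 v w u : opposite v u -> (u <= perp w)%MS -> covered w -> v + w != 0.
  move=> opp uw Pw; apply: contraNneq (opposite_notin_perp opp) => /eqP; rewrite addr_eq0 => /eqP->.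
  by rewrite eqmx_opp; apply: perp_sym => //; case: opp => _ /covered_neq0.
have [[A1 _ _] o2 o3 [b2a1 b3a2 _] [b3a1 _ _]] := apt'; have [[A2 _ _] [A3 _ _]] := (o2, o3).
have := adj1 1 1; have := adj2 1 1; have := adj3 1 1; rewrite !scale1r mul1r.
move=> /(_ (sum_neq0 _ _ _ o2 b2a1 A1)) s3 /(_ (sum_neq0 _ _ _ o3 b3a1 A1)) s2 /(_ (sum_neq0 _ _ _ o3 b3a2 A2)) s1.
have ee := apartment_sign apt' s1 s2 s3.
by move=> k m; split; [exact: adj1 | exact: adj2 | move=> /adj3; rewrite ee mulrN1 scaleNr].
Qed.

(** * Coordinate frames *)
Implicit Types (a b c d : 'rV[F]_3) (t k : F).

Record frame (A B : 'M[F]_(3, N)) e : Prop := Frame {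
  frame_inj : forall a t b, hcoord A B e a t b = 0 -> [/\ a = 0, t = 0 & b = 0];
  frame_hcoord : forall x, covered x -> exists a t b, x = hcoord A B e a t b;
  frame_coveredA : forall a, a != 0 -> covered (a *m A);
  frame_coveredB : forall b, b != 0 -> covered (b *m B);
  frame_perp : forall a b, a != 0 -> dot a b = 0 -> (b *m B <= perp (a *m A))%MS;
  frame_tspaceA : forall i, (e <= tspace (row i A))%MS;
  frame_tspaceB : forall i, (e <= tspace (row i B))%MS }.

Lemma frame_swap A B e : frame A B e -> frame B A e.
Proof.
case=> inj all coveredA coveredB adj eA eB; split=> //.
- by move=> a t b; rewrite hcoord_swap => /inj[].
- by move=> x /all[a [t [b ->]]]; exists b, t, a; rewrite hcoord_swap.
- move=> b a b0 ba; have [->|a0] := eqVneq a 0; first by rewrite mul0mx sub0mx.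
  have [Pa Pb] := (coveredA a a0, coveredB b b0).
  by apply: perp_sym => //; apply: adj => //; rewrite dotC.
Qed.

Lemma tspace_sub S w : (forall x, covered x -> (x <= S)%MS) -> (tspace w <= S)%MS.
Proof.
move=> covS; apply/sumsmx_subP => p _; apply/sumsmx_subP => l /lines_thruP[Ll _]; exact: lines_sub Ll.
Qed.

Section ApartmentFrame.
Variables a1 a2 a3 b1 b2 b3 : 'rV[F]_N.
Hypothesis apt : apartment a1 a2 a3 b1 b2 b3.
Local Notation A := (mat3 a1 a2 a3).
Local Notation B := (mat3 b1 b2 b3).
Local Notation V := (tspace a1 + b1)%MS.

Lemma apartment_span_covered x : covered x -> (x <= V)%MS.
Proof. by have [[A1 B1 nd] _ _ _ _] := apt; apply: covered_sub_tspace. Qed.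

Lemma rank_apartment_span : \rank V = 7%N.
Proof. by have [[A1 B1 nd] _ _ _ _] := apt; rewrite rank_adds_notin ?rank_tspace // in_tspace. Qed.

(* Six hyperplanes of a space of rank 7 have a common point. *)
Lemma exists_apartment_center : exists2 e : 'rV[F]_N, e != 0 &
  [/\ [/\ (e <= tspace a1)%MS, (e <= tspace a2)%MS & (e <= tspace a3)%MS] &
      [/\ (e <= tspace b1)%MS, (e <= tspace b2)%MS & (e <= tspace b3)%MS]].
Proof.
have [[A1 B1 _] [A2 B2 _] [A3 B3 _] _ _] := apt.
have tV w : (tspace w <= V)%MS := tspace_sub w apartment_span_covered.
have cap_tspace (X : 'M[F]_N) w : (X <= V)%MS -> covered w -> (\rank X <= (\rank (X :&: tspace w)%MS).+1)%N.
  move=> XV Pw; have := leq_rank_cap XV (tV w); rewrite rank_tspace // rank_apartment_span.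
  by clear; lia.
have V1 := tV a1; have V2 := submx_trans (capmxSl _ (tspace a2)) V1.
have V3 := submx_trans (capmxSl _ (tspace a3)) V2; have V4 := submx_trans (capmxSl _ (tspace b1)) V3.
have V5 := submx_trans (capmxSl _ (tspace b2)) V4.
have /exists_nonzero[e [e0]] :
    (0 < \rank (tspace a1 :&: tspace a2 :&: tspace a3 :&: tspace b1 :&: tspace b2 :&: tspace b3)%MS)%N.
  have := cap_tspace _ _ V1 A2; have := cap_tspace _ _ V2 A3; have := cap_tspace _ _ V3 B1.
  have := cap_tspace _ _ V4 B2; have := cap_tspace _ _ V5 B3; rewrite rank_tspace //.
  by do 5!move: (\rank (_ :&: _)%MS) => ?; clear; lia.
by rewrite !sub_capmx -!andbA => /and5P[? ? ? ? /andP[? ?]]; exists e.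
Qed.

Section Center.
Variable e : 'rV[F]_N.
Hypotheses (e0 : e != 0) (ea1 : (e <= tspace a1)%MS) (ea2 : (e <= tspace a2)%MS) (ea3 : (e <= tspace a3)%MS).
Hypotheses (eb1 : (e <= tspace b1)%MS) (eb2 : (e <= tspace b2)%MS) (eb3 : (e <= tspace b3)%MS).

Lemma apartment_hcoord_inj a t b : hcoord A B e a t b = 0 -> [/\ a = 0, t = 0 & b = 0].
Proof.
rewrite /hcoord !mul_mat3; set x1 := a 0 i0; set x2 := a 0 i1; set x3 := a 0 i2.
set y1 := b 0 i0; set y2 := b 0 i1; set y3 := b 0 i2 => sum0.
have apt2 := apartment_rot apt; have apt3 := apartment_rot apt2.
have apt4 := apartment_dual apt; have apt5 := apartment_rot apt4; have apt6 := apartment_rot apt5.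
have y10 : y1 = 0.
  by apply: (apartment_coef apt (x1 := x1) (x2 := x2) (x3 := x3) (t := t) (y2 := y2) (y3 := y3) ea1); rewrite -sum0; rV_ring.
have y20 : y2 = 0.
  by apply: (apartment_coef apt2 (x1 := x2) (x2 := x3) (x3 := x1) (t := t) (y2 := y3) (y3 := y1) ea2); rewrite -sum0; rV_ring.
have y30 : y3 = 0.
  by apply: (apartment_coef apt3 (x1 := x3) (x2 := x1) (x3 := x2) (t := t) (y2 := y1) (y3 := y2) ea3); rewrite -sum0; rV_ring.
have x10 : x1 = 0.
  by apply: (apartment_coef apt4 (x1 := y1) (x2 := y2) (x3 := y3) (t := t) (y2 := x2) (y3 := x3) eb1); rewrite -sum0; rV_ring.
have x20 : x2 = 0.
  by apply: (apartment_coef apt5 (x1 := y2) (x2 := y3) (x3 := y1) (t := t) (y2 := x3) (y3 := x1) eb2); rewrite -sum0; rV_ring.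
have x30 : x3 = 0.
  by apply: (apartment_coef apt6 (x1 := y3) (x2 := y1) (x3 := y2) (t := t) (y2 := x1) (y3 := x2) eb3); rewrite -sum0; rV_ring.
split; try by apply: rV3_eq; rewrite mxE.
move/eqP: sum0; rewrite x10 x20 x30 y10 y20 y30 !scale0r !add0r !addr0.
by rewrite scaler_eq0 (negbTE e0) orbF => /eqP.
Qed.

Lemma apartment_hcoord x : covered x -> exists a t b, x = hcoord A B e a t b.
Proof.
move=> Px; have [[A1 B1 _] [A2 B2 _] [A3 B3 _] _ _] := apt.
have mat3V u v w : covered u -> covered v -> covered w -> (mat3 u v w <= V)%MS.
  by move=> Pu Pv Pw; apply/row_subP => -[[|[|[|//]]] i]; rewrite rowK; apply: apartment_span_covered.
have MV : (mat7 A B e <= V)%MS.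
  by apply: mat7_sub; rewrite ?mat3V //; apply: submx_trans ea1 (addsmxSl _ _).
have /submxP[v ->] : (x <= mat7 A B e)%MS.
  apply: submx_trans (apartment_span_covered Px) (submx_rank_leq MV _).
  by have /eqP-> := mat7_free apartment_hcoord_inj; rewrite rank_apartment_span.
by rewrite -[v]mk7K mul_mat7; do 3!eexists.
Qed.

Lemma apartment_mulB_eq0 b : b *m B = 0 -> b = 0.
Proof. by rewrite -(hcoordB A B e) => /apartment_hcoord_inj[]. Qed.

Lemma apartment_mulA_eq0 a : a *m A = 0 -> a = 0.
Proof. by rewrite -(hcoordA A B e) => /apartment_hcoord_inj[]. Qed.

End Center.
End ApartmentFrame.

Lemma apartment_comb_perp (a1 a2 a3 b1 b2 b3 : 'rV[F]_N) (k1 k2 k3 : F) : apartment a1 a2 a3 b1 b2 b3 ->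
  (k3 *: a3 + k2 *: a2 != 0 -> ((k3 *: b2 - k2 *: b3)%R <= perp (k3 *: a3 + k2 *: a2)%R)%MS) ->
  let p := k1 *: a1 + (k3 *: a3 + k2 *: a2) in let v := k3 *: b2 - k2 *: b3 in
  p != 0 -> v != 0 -> covered p /\ (v <= perp p)%MS.
Proof.
move=> [[A1 B1 _] [A2 B2 _] [A3 B3 _] [b2a1 b3a2 b1a3] [b3a1 b1a2 b2a3]] adj p v p0 v0.
have va1 : (v <= perp a1)%MS by rewrite /v; in_span.
have [q0|q0] := eqVneq (k3 *: a3 + k2 *: a2) 0.
  rewrite /p q0 addr0 in p0 *; have k10 : k1 != 0 by apply: contraNneq p0 => ->; rewrite scale0r.
  by rewrite covered_scale // perp_scale.
have [a2b1 a3b1] := (perp_sym A2 b1a2 (covered_neq0 B1), perp_sym A3 b1a3 (covered_neq0 B1)).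
have Pq : covered (k3 *: a3 + k2 *: a2) by apply: perp_covered B1 _ q0; in_span.
have [k10|k10] := eqVneq k1 0; first by rewrite /p k10 scale0r add0r adj.
by apply: perp_add; rewrite ?covered_scale ?perp_scale ?adj.
Qed.

Section NormalFrame.
Variables a1 a2 a3 b1 b2 b3 : 'rV[F]_N.
Hypotheses (apt : apartment a1 a2 a3 b1 b2 b3) (nor : normal_apartment a1 a2 a3 b1 b2 b3).
Local Notation A := (mat3 a1 a2 a3).
Local Notation B := (mat3 b1 b2 b3).
Hypothesis mulA_eq0 : forall a, a *m A = 0 -> a = 0.
Hypothesis mulB_eq0 : forall b, b *m B = 0 -> b = 0.

Lemma normal_apartment_cross a : a != 0 ->
  covered (a *m A) /\ forall b, (cross a b *m B <= perp (a *m A))%MS.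
Proof.
move=> a0; have {a0} : a *m A != 0 by apply: contraNneq a0 => /mulA_eq0->.
rewrite mul_mat3; set x1 := a 0 i0; set x2 := a 0 i1; set x3 := a 0 i2; set p := _ + _ => p0.
have [adj1 _ _] := nor x3 x2; have [_ adj2 _] := nor x3 x1; have [_ _ adj3] := nor x2 x1.
have [apt2 apt3] := (apartment_swap (apartment_rot apt), apartment_rot (apartment_rot apt)).
have e1 : p = x1 *: a1 + (x3 *: a3 + x2 *: a2) by rewrite /p; rV_ring.
have e2 : p = x2 *: a2 + (x3 *: a3 + x1 *: a1) by rewrite /p; rV_ring.
have e3 : p = x3 *: a3 + (x2 *: a2 + x1 *: a1) by rewrite /p; rV_ring.
pose d1 := x3 *: b2 - x2 *: b3; pose d2 := x3 *: b1 - x1 *: b3; pose d3 := x2 *: b1 - x1 *: b2.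
have perp1 : d1 != 0 -> covered p /\ (d1 <= perp p)%MS.
  by rewrite e1 in p0 *; apply: apartment_comb_perp apt adj1 p0.
have perp2 : d2 != 0 -> covered p /\ (d2 <= perp p)%MS.
  by rewrite e2 in p0 *; apply: apartment_comb_perp apt2 adj2 p0.
have perp3 : d3 != 0 -> covered p /\ (d3 <= perp p)%MS.
  by rewrite e3 in p0 *; apply: apartment_comb_perp apt3 adj3 p0.
have sub (v : 'rV[F]_N) : (v != 0 -> covered p /\ (v <= perp p)%MS) -> (v <= perp p)%MS.
  by have [->|v0 /(_ isT)[]] := eqVneq v 0; first by rewrite sub0mx.
split=> [|b].
  have [d10|/perp1[]//] := eqVneq d1 0; have : v3 0 x3 (- x2) *m B = 0.
    by rewrite mul_mat3 !mxE /= scale0r add0r scaleNr.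
  move=> /mulB_eq0/rowP x_eq0; move: (x_eq0 i1) (x_eq0 i2); rewrite !mxE /= => x30 /eqP.
  rewrite oppr_eq0 => /eqP x20; have [[A1 _ _] _ _ _ _] := apt.
  rewrite /p x20 x30 !scale0r !addr0 in p0 *; rewrite covered_scale //.
  by apply: contraNneq p0 => ->; rewrite scale0r.
have [d1p d2p d3p] := And3 (sub _ perp1) (sub _ perp2) (sub _ perp3).
have -> : cross a b *m B = b 0 i0 *: d1 - b 0 i1 *: d2 + b 0 i2 *: d3.
  by rewrite mul_mat3 !mxE /= -/x1 -/x2 -/x3; rV_ring.
by in_span.
Qed.

End NormalFrame.

Lemma exists_frame x : covered x -> exists A B e, frame A B e.
Proof.
move=> Px; have [a1 [a2 [a3 [b1 [b2 [b3 [apt nor]]]]]]] := exists_normal_apartment Px.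
have [e e0 [[ea1 ea2 ea3] [eb1 eb2 eb3]]] := exists_apartment_center apt.
have inj := apartment_hcoord_inj apt e0 ea1 ea2 ea3 eb1 eb2 eb3.
have mulA := apartment_mulA_eq0 apt e0 ea1 ea2 ea3 eb1 eb2 eb3.
have mulB := apartment_mulB_eq0 apt e0 ea1 ea2 ea3 eb1 eb2 eb3.
have cross_perp := normal_apartment_cross apt nor mulA mulB.
exists (mat3 a1 a2 a3), (mat3 b1 b2 b3), e; split=> //.
- exact: (apartment_hcoord apt e0 ea1 ea2 ea3 eb1 eb2 eb3).
- by move=> a /cross_perp[].
- move=> b b0; have [a a0 /(dot_eq0_cross a0)[w eb]] := exists_dot0 b; have [Pa perp_a] := cross_perp a a0.
  by apply: (perp_covered Pa); [rewrite eb | apply: contraNneq b0 => /mulB->].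
- by move=> a b a0 /(dot_eq0_cross a0)[w ->]; have [_] := cross_perp a a0; apply.
- by case=> [[|[|[|//]]] i]; rewrite rowK.
- by case=> [[|[|[|//]]] i]; rewrite rowK.
Qed.

Section FrameCoordinates.
Variables (A B : 'M[F]_(3, N)) (e : 'rV[F]_N).
Hypothesis fr : frame A B e.
Local Notation P := (hcoord A B e).

Lemma hcoord_inj a t b a' t' b' : P a t b = P a' t' b' -> [/\ a = a', t = t' & b = b'].
Proof.
move/eqP; rewrite -subr_eq0 hcoordN hcoordD => /eqP/(frame_inj fr)[aa' tt' bb'].
by split; apply/eqP; rewrite -subr_eq0; apply/eqP.
Qed.

Lemma hcoord_neq0 a t b : (P a t b != 0) = [|| a != 0, t != 0 | b != 0].
Proof.
have [/(frame_inj fr)[-> -> ->]|P0] := eqVneq (P a t b) 0; first by rewrite !eqxx.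
symmetry; apply: contraNT P0; rewrite !negb_or !negbK => /and3P[/eqP -> /eqP -> /eqP ->].
by rewrite hcoord0.
Qed.

Lemma hcoord_split a b : P a 0 b = P a 0 0 + P 0 0 b. Proof. by hcoord_eq. Qed.

Lemma hcoordA_notin a t b t' b' : a != 0 -> ~~ (P a t b <= P 0 t' b')%MS.
Proof. by apply: contra => /sub_rVP[k]; rewrite hcoordZ => /hcoord_inj[-> _ _]; rewrite scaler0. Qed.

Lemma hcoordB_notin a t b a' t' : b != 0 -> ~~ (P a t b <= P a' t' 0)%MS.
Proof. by apply: contra => /sub_rVP[k]; rewrite hcoordZ => /hcoord_inj[_ _ ->]; rewrite scaler0. Qed.

Lemma hcoordE_notin a b c d a' t b' : t != 0 -> ~~ (P a' t b' <= P a 0 b + P c 0 d)%MS.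
Proof.
by apply: contra => /sub_span2P[k [m]]; rewrite !hcoordZ hcoordD => /hcoord_inj[_ -> _]; rewrite !mulr0 addr0.
Qed.

Lemma hcoordA_notin_span a c d t t' t'' b b' : cross a c != 0 -> ~~ (P c t b <= P a t' b' + P 0 t'' d)%MS.
Proof.
apply: contra => /sub_span2P[k [m]]; rewrite !hcoordZ hcoordD => /hcoord_inj[-> _ _].
by rewrite scaler0 addr0 crossZr crossvv scaler0.
Qed.

Lemma hcoordB_notin_span a a' c t t' t'' b d : cross b d != 0 -> ~~ (P a t d <= P c t'' 0 + P a' t' b)%MS.
Proof.
apply: contra => /sub_span2P[k [m]]; rewrite !hcoordZ hcoordD => /hcoord_inj[_ _ ->].
by rewrite scaler0 add0r crossZr crossvv scaler0.
Qed.

Lemma coveredA a : a != 0 -> covered (P a 0 0). Proof. by rewrite hcoordA; apply: (frame_coveredA fr). Qed.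
Lemma coveredB b : b != 0 -> covered (P 0 0 b). Proof. by rewrite hcoordB; apply: (frame_coveredB fr). Qed.

Lemma perpAB a b : a != 0 -> dot a b = 0 -> (P 0 0 b <= perp (P a 0 0))%MS.
Proof. by rewrite hcoordA hcoordB; apply: (frame_perp fr). Qed.

Lemma perpBA a b : b != 0 -> dot a b = 0 -> (P a 0 0 <= perp (P 0 0 b))%MS.
Proof. by rewrite hcoordA hcoordB dotC; apply: (frame_perp (frame_swap fr)). Qed.

Lemma perp_hcoord v p : covered p -> (v <= perp p)%MS -> exists a t b, v = P a t b.
Proof.
move=> Pp vp; have [->|v0] := eqVneq v 0; first by exists 0, 0, 0; rewrite hcoord0.
exact: (frame_hcoord fr (perp_covered Pp vp v0)).
Qed.

Lemma perpA a c t d : a != 0 -> (P c t d <= perp (P a 0 0))%MS ->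
  [/\ t = 0, dot a d = 0 & exists k, c = k *: a].
Proof.
move=> a0 Pa; have [b b0 ba] := exists_dot0 a; rewrite dotC in ba.
have [b' ab' bb'] := exists_dot0_cross a0 b0 ba.
have := submx_trans Pa (perp_span3 (coveredA a0) (perpAB a0 ba) (perpAB a0 ab')
  (hcoordB_notin _ _ _ _ b0) (hcoordB_notin_span _ _ _ _ _ _ bb')).
case/sub_span3P => k [m [n]]; rewrite !hcoordZ !hcoordD => /hcoord_inj[-> -> ->].
split; first by rewrite !mulr0 !addr0.
  by rewrite !dotDr !dotZr dot0r ba ab' !mulr0 !addr0.
by exists k; rewrite !scaler0 !addr0.
Qed.

Lemma not_dist2AB a b : dot a b != 0 -> ~~ dist2 (P a 0 0) (P 0 0 b).
Proof.
move=> ab; have a0 : a != 0 by apply: contraNneq ab => ->; rewrite dot0l.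
have [a' a'0 a'b] := exists_dot0 b; have aa' : cross a a' != 0.
  apply: contraNneq ab => /(cross_eq0P a0)[k ea']; rewrite ea' dotZl in a'b.
  by move/eqP: a'b; rewrite mulf_eq0 => /predU1P[k0|//]; rewrite ea' k0 scale0r eqxx in a'0.
have [d1 d2] := (dot_crossl a a', dot_crossr a a').
apply: (path3_opposite (coveredB aa') (perpBA aa' d1) _ (perpBA aa' d2) _ (perpAB a'0 a'b)).
- exact: hcoordA_notin.
- exact: hcoordA_notin_span.
- apply: contra ab => /sub_span2P[k [m]]; rewrite !hcoordZ hcoordD => /hcoord_inj[_ _ ->].
  by rewrite scaler0 addr0 dotZr d1 mulr0.
Qed.

Lemma tspaceAA a c : a != 0 -> (P c 0 0 <= tspace (P a 0 0))%MS.
Proof.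
move=> a0; have Pa := coveredA a0; apply: dist2_tspace; have [/(cross_eq0P a0)[k ->]|ac] := eqVneq (cross a c) 0.
  apply: (perp_dist2 Pa); have -> : P (k *: a) 0 0 = k *: P a 0 0 by hcoord_eq.
  exact: scalemx_sub (mem_perp Pa).
have Pac := coveredB ac.
exact: dist2I (midpointI (covered_neq0 Pac) (perpAB a0 (dot_crossl a c)) (perpBA ac (dot_crossr a c))).
Qed.

Definition tspace_slope a k := forall c t d, (P c t d <= tspace (P a 0 0))%MS = (dot a d + k * t == 0).

Lemma exists_tspace_slope a : a != 0 -> exists k, tspace_slope a k.
Proof.
move=> a0; have Pa := coveredA a0; have [b ab] := exists_dot1 a0.
have b0 : b != 0 by apply: contra_eq_neq ab => ->; rewrite dot0r eq_sym oner_neq0.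
have Pb := coveredB b0; have nd : ~~ dist2 (P a 0 0) (P 0 0 b) by rewrite not_dist2AB // ab oner_neq0.
have nT : ~~ (P 0 0 b <= tspace (P a 0 0))%MS by rewrite in_tspace.
have : (P 0 1 0 <= tspace (P a 0 0) + P 0 0 b)%MS.
  rewrite hcoordE -(genmxE (tspace (P a 0 0) + P 0 0 b)%MS); apply: submx_trans (frame_tspaceA fr i0) _.
  by apply: tspace_sub => x Px; rewrite genmxE; apply: covered_sub_tspace.
case/sub_adds_vecP => s [k [sT es]]; exists k => c t d.
have ekT : (P 0 1 (- k *: b) <= tspace (P a 0 0))%MS.
  by rewrite (_ : P 0 1 (- k *: b) = s) // -(addrK (k *: P 0 0 b) s) -es; hcoord_eq.
have bT : (P 0 0 (d - dot a d *: b) <= tspace (P a 0 0))%MS.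
  by apply: (submx_trans _ (perp_tspace _ _)) => //; apply: perpAB => //; rewrite dotBr dotZr ab mulr1 subrr.
have cT := tspaceAA c a0.
have -> : P c t d = P c 0 0 + t *: P 0 1 (- k *: b) + P 0 0 (d - dot a d *: b) + (dot a d + k * t) *: P 0 0 b.
  by hcoord_eq.
rewrite addmx_subl; last by in_span.
have [->|slope0] := eqVneq (dot a d + k * t) 0; first by rewrite scale0r sub0mx.
by rewrite scalemx_sub_eq // (negbTE nT).
Qed.

Lemma tspace_slope_scale a k (m : F) : m != 0 -> tspace_slope a k -> tspace_slope (m *: a) (m * k).
Proof.
move=> m0 slope c t d; have -> : tspace (P (m *: a) 0 0) = tspace (P a 0 0).
  by rewrite /tspace (_ : P (m *: a) 0 0 = m *: P a 0 0) ?perp_scale //; hcoord_eq.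
by rewrite slope dotZl -mulrA -mulrDr mulf_eq0 (negbTE m0).
Qed.

Lemma tspace_sym x y : covered x -> covered y -> (x <= tspace y)%MS -> (y <= tspace x)%MS.
Proof. by move=> Px Py; rewrite !in_tspace //; exact: (dist2_sym Py (covered_neq0 Px)). Qed.

Section Flag.
Variables a b : 'rV[F]_3.
Hypotheses (a0 : a != 0) (b0 : b != 0) (ab : dot a b = 0).
Local Notation x := (P a 0 b).
Local Notation l := (P a 0 0 + P 0 0 b)%MS.
Let Pa : covered (P a 0 0) := coveredA a0.
Let Pb : covered (P 0 0 b) := coveredB b0.
Let aa := mem_perp Pa.
Let bb := mem_perp Pb.
Let ba := perpAB a0 ab.
Let a_b := perpBA b0 ab.

Lemma perpA_flag : (x <= perp (P a 0 0))%MS. Proof. by rewrite hcoord_split; in_span. Qed.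
Lemma perpB_flag : (x <= perp (P 0 0 b))%MS. Proof. by rewrite hcoord_split; in_span. Qed.

Lemma flag_covered : covered x.
Proof. by apply: (perp_covered Pa perpA_flag); rewrite hcoord_neq0 a0. Qed.

Lemma perp_flagA : (P a 0 0 <= perp x)%MS. Proof. by apply: perp_sym perpA_flag _ => //; rewrite hcoord_neq0 a0. Qed.
Lemma perp_flagB : (P 0 0 b <= perp x)%MS. Proof. by apply: perp_sym perpB_flag _ => //; rewrite hcoord_neq0 a0. Qed.

Lemma perp_flag_tspace y : (y <= perp x)%MS -> (y <= tspace (P a 0 0))%MS /\ (y <= tspace (P 0 0 b))%MS.
Proof.
have x0 : x != 0 by rewrite hcoord_neq0 a0.
by move=> yx; split; apply: dist2_tspace; apply: dist2I (midpointI x0 _ yx); [exact: perpA_flag | exact: perpB_flag].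
Qed.

Lemma perp_flag_sub y : (y <= perp x)%MS -> ~~ (y <= l)%MS -> (perp x <= l + y)%MS.
Proof.
move=> yx nyl; have [? ?] := (perp_flagA, perp_flagB); apply: submx_rank_leq; first by in_span.
by rewrite (rank_perp flag_covered) rank_adds_notin // rank_span2 // ?(covered_neq0 Pa) // hcoordB_notin.
Qed.

(* Otherwise perp x would lie in the solid perp (P a 0 0) + perp (P 0 0 b). *)
Lemma perp_flag_line c d : (P c 0 d <= perp x)%MS -> dot a d = 0 -> dot b c = 0 -> (P c 0 d <= l)%MS.
Proof.
move=> yx ad bc; apply: contraT => nyl; have Px := flag_covered.
have rS := rank_add_perps Pa ba (hcoordB_notin _ _ _ _ b0).
have dcb : dot c b = 0 by rewrite dotC.
have sS : (perp x <= perp (P a 0 0) + perp (P 0 0 b))%MS.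
  apply: submx_trans (perp_flag_sub yx nyl) _; rewrite (hcoord_split c).
  by have := perpAB a0 ad; have := perpBA b0 dcb => ? ?; in_span.
have := solid_two_perps rS Pa Pb Px (addsmxSl _ _) (addsmxSr _ _) sS.
case/or3P => [|/(submx_vec_sym (covered_neq0 Pa))|/(submx_vec_sym (covered_neq0 Pb))]; apply: contraTT => _.
- exact: hcoordA_notin.
- exact: hcoordB_notin.
- exact: hcoordA_notin.
Qed.

End Flag.
End FrameCoordinates.

Section FrameTspace.
Variables (A B : 'M[F]_(3, N)) (e : 'rV[F]_N).
Hypothesis fr : frame A B e.
Local Notation P := (hcoord A B e).
Let fr_swap := frame_swap fr.

Lemma perpB b c t d : b != 0 -> (P c t d <= perp (P 0 0 b))%MS ->
  [/\ t = 0, dot b c = 0 & exists k, d = k *: b].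
Proof. by move=> b0; rewrite -!(hcoord_swap A B e) => /(perpA fr_swap b0). Qed.

Lemma exists_tspaceB_slope b : b != 0 ->
  exists k, forall c t d, (P c t d <= tspace (P 0 0 b))%MS = (dot b c + k * t == 0).
Proof. by move=> /(exists_tspace_slope fr_swap)[k slope]; exists k => c t d; rewrite -!(hcoord_swap A B e) slope. Qed.

Lemma flag_affine a b : a != 0 -> b != 0 -> dot a b = 0 -> exists c d, (P c 1 d <= perp (P a 0 b))%MS.
Proof.
move=> a0 b0 ab; have Px := flag_covered fr a0 ab.
have [|y [yx nyl]] := @exists_notin _ _ _ _ (P a 0 0 + P 0 0 b)%MS (perp (P a 0 b)).
  by rewrite (rank_perp Px) rank_span2 ?(hcoord_neq0 fr) ?a0 // (hcoordB_notin fr).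
have [c [t [d ey]]] := perp_hcoord fr Px yx; rewrite {y}ey in yx nyl.
have [yA yB] := perp_flag_tspace fr a0 b0 ab yx; have t0 : t != 0.
  apply: contraNneq nyl => t0; rewrite t0 in yx yA yB *.
  have [k slopeA] := exists_tspace_slope fr a0; have [m slopeB] := exists_tspaceB_slope b0.
  move: yA yB; rewrite slopeA slopeB !mulr0 !addr0 => /eqP ad /eqP bc.
  exact: (perp_flag_line fr a0 b0 ab yx ad bc).
exists (t^-1 *: c), (t^-1 *: d).
by rewrite (_ : P _ _ _ = t^-1 *: P c t d) ?scalemx_sub // hcoordZ mulVf.
Qed.

(* A point (c, 1, d) with dot a d = dot a' d = 0 lies in both hyperplanes, hence in that of a + a'. *)
Lemma tspace_slope0_add a a' : cross a a' != 0 ->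
  tspace_slope A B e a 0 -> tspace_slope A B e a' 0 -> tspace_slope A B e (a + a') 0.
Proof.
move=> aa' slope slope'; have [a0 a'0] := (cross_neq0l aa', cross_neq0r aa').
have s0 := cross_neq0_add aa'; have [w aa'w] := exists_dot_neq0 aa'; pose b := cross a' w.
have ab : dot a b != 0 by rewrite /b dot_cross_rot dotC.
have [b0 a'b] : b != 0 /\ dot a' b = 0.
  by split; [apply: contraNneq ab => ->; rewrite dot0r | apply: dot_crossl].
have [c [d yx]] := flag_affine a'0 b0 a'b; pose k := - dot a d / dot a b.
have {}yx : (P c 1 (d + k *: b) <= perp (P a' 0 b))%MS.
  rewrite (_ : P c 1 _ = P c 1 d + k *: P 0 0 b); last by hcoord_eq.
  by have := perp_flagB fr a'0 b0 a'b => bx; in_span.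
set y := P _ _ _ in yx; have Py : covered y.
  by apply: (perp_covered (flag_covered fr a'0 a'b) yx); rewrite (hcoord_neq0 fr) oner_neq0 orbT.
have ya : (y <= tspace (P a 0 0))%MS by rewrite slope mul0r addr0 dotDr dotZr /k divfK // subrr.
have [ya' _] := perp_flag_tspace fr a'0 b0 a'b yx.
have ay := tspace_sym Py (coveredA fr a0) ya; have a'y := tspace_sym Py (coveredA fr a'0) ya'.
have sy : (P (a + a') 0 0 <= tspace y)%MS.
  by rewrite (_ : P _ _ _ = P a 0 0 + P a' 0 0); [in_span | hcoord_eq].
have [m slope_s] := exists_tspace_slope fr s0; have := tspace_sym (coveredA fr s0) Py sy.
move: ya ya'; rewrite slope slope' slope_s dotDl !mul0r !addr0 mulr1 => /eqP-> /eqP->.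
by rewrite !add0r => /eqP m0; rewrite m0 in slope_s.
Qed.

Lemma tspace_slope0 a : a != 0 -> tspace_slope A B e a 0.
Proof.
pose slope0 b := b != 0 -> tspace_slope A B e b 0.
have slope0Z k b : slope0 b -> slope0 (k *: b).
  move=> slope; rewrite /slope0 scaler_eq0 negb_or => /andP[k0 b0].
  by rewrite -(mulr0 k); apply: tspace_slope_scale (slope b0).
have slope0D b c : slope0 b -> slope0 c -> slope0 (b + c).
  move=> sb sc; have [->|b0] := eqVneq b 0; first by rewrite add0r.
  have [/(cross_eq0P b0)[k ->]|bc] := eqVneq (cross b c) 0.
    by rewrite -{1}[b]scale1r -scalerDl; apply: slope0Z.
  by move=> _; apply: tspace_slope0_add => //; [apply: sb | apply: sc (cross_neq0r bc)].
have slope0_delta (i : 'I_3) : slope0 (delta_mx 0 i).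
  move=> i0; have [k slope] := exists_tspace_slope fr i0.
  have := frame_tspaceA fr i; rewrite rowE -(hcoordA A B e) -{1}(hcoordE A B e) slope dot0r add0r mulr1.
  by move/eqP=> k0; rewrite k0 in slope.
rewrite [a]row_sum_delta sum_ord3.
by apply: (slope0D _ _ (slope0D _ _ _ _)); apply: slope0Z.
Qed.

Lemma tspaceA a c t d : a != 0 -> (P c t d <= tspace (P a 0 0))%MS = (dot a d == 0).
Proof. by move=> /tspace_slope0->; rewrite mul0r addr0. Qed.

End FrameTspace.

Section FrameFlags.
Variables (A B : 'M[F]_(3, N)) (e : 'rV[F]_N).
Hypothesis fr : frame A B e.
Local Notation P := (hcoord A B e).

Lemma tspaceB b c t d : b != 0 -> (P c t d <= tspace (P 0 0 b))%MS = (dot b c == 0).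
Proof. by move=> b0; rewrite -!(hcoord_swap A B e) (tspaceA (frame_swap fr)). Qed.

Lemma covered_dot0 a b : a != 0 -> b != 0 -> covered (P a 0 b) -> dot a b = 0.
Proof.
move=> a0 b0 Px; apply/eqP; apply: contraT => ab; have [Pa Pb] := (coveredA fr a0, coveredB fr b0).
have nd : ~~ dist2 (P 0 0 b) (P a 0 0) by apply: contra (not_dist2AB fr ab); apply: dist2_sym.
have [d d0 da] := exists_dot0 a; rewrite dotC in da; have da_perp := perpAB fr a0 da.
have Ll := perp_line Pa da_perp (hcoordB_notin fr _ _ _ _ d0); set l := <<_>>%MS in Ll.
have [dl al] : (P 0 0 d <= l)%MS /\ (P a 0 0 <= l)%MS by rewrite !genmxE; split; in_span.
have dd : dist2 (P 0 0 d) (P 0 0 b).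
  by rewrite -in_tspace ?(coveredB fr) // tspaceB // dot0r.
have /negP[] := hcoordA_notin fr 0 0 0 d a0.
apply: (far_shift_direction Ll (opposite_far Pb Pa nd da_perp) (covered_neq0 (coveredB fr d0)) dl dd al).
by rewrite addrC -hcoord_split.
Qed.

Lemma affine_notin_flag a b d : a != 0 -> b != 0 -> dot a b = 0 -> ~~ (P 0 1 d <= perp (P a 0 b))%MS.
Proof.
move=> a0 b0 ab; apply/negP => yx; have Px := flag_covered fr a0 ab; have Pa := coveredA fr a0.
have [b' ab' bb'] := exists_dot0_cross a0 b0 ab; have b'0 := cross_neq0r bb'.
have nb'a := hcoordB_notin fr 0 0 a 0 b'0; have Ln := perp_line Pa (perpAB fr a0 ab') nb'a.
set n := <<_>>%MS in Ln; have [an b'n] : (P a 0 0 <= n)%MS /\ (P 0 0 b' <= n)%MS.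
  by rewrite !genmxE; split; in_span.
have xa := perpA_flag fr a0 ab; have fy : far n (P 0 1 d).
  apply: (far_path Ln _ xa _ yx); first by apply/line_pointsP; split.
    by rewrite genmxE; apply: (hcoordB_notin_span fr); rewrite crossC oppr_eq0.
  exact: (hcoordE_notin fr _ _ _ _ _ _ (oner_neq0 F)).
have Py : covered (P 0 1 d) := far_covered fy.
have d1 : dist2 (P a 0 0) (P 0 1 d) := dist2I (midpointI (covered_neq0 Px) xa yx).
have d2 : dist2 (P 0 0 b') (P 0 1 d).
  by rewrite -in_tspace ?(coveredB fr) // tspaceB // dot0r.
case/negP: nb'a.
exact: (uniq_direction Ln fy (covered_neq0 Pa) (covered_neq0 (coveredB fr b'0)) an b'n d1 d2).
Qed.

End FrameFlags.

Definition flag_coef (A B : 'M[F]_(3, N)) e a b k := forall c t d,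
  (hcoord A B e c t d <= perp (hcoord A B e a 0 b))%MS -> cross a c = (k * t) *: b.

Section FlagCoefficient.
Variables (A B : 'M[F]_(3, N)) (e : 'rV[F]_N).
Hypothesis fr : frame A B e.
Local Notation P := (hcoord A B e).
Local Notation flag_coef := (flag_coef A B e).

Lemma perp_flag_dot0 a b c t d : a != 0 -> b != 0 -> dot a b = 0 ->
  (P c t d <= perp (P a 0 b))%MS -> dot a d = 0 /\ dot b c = 0.
Proof.
move=> a0 b0 ab /(perp_flag_tspace fr a0 b0 ab)[].
by rewrite (tspaceA fr) // (tspaceB fr) // => /eqP ad /eqP bc.
Qed.

Lemma exists_flag_coef a b : a != 0 -> b != 0 -> dot a b = 0 -> exists k, flag_coef a b k.
Proof.
move=> a0 b0 ab; have [c [d yx]] := flag_affine fr a0 b0 ab.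
have [_] := perp_flag_dot0 a0 b0 ab yx; rewrite dotC => cb.
have [k ac] := cross_dot0 b0 ab cb; exists k => c' t d' y'x.
have := submx_trans y'x (perp_flag_sub fr a0 b0 ab yx (hcoordE_notin fr _ _ _ _ _ _ (oner_neq0 F))).
case/sub_span3P => m [m' [t']]; rewrite !hcoordZ !hcoordD => /(hcoord_inj fr)[-> -> _].
by rewrite !mulr0 !add0r mulr1 scaler0 addr0 crossDr !crossZr crossvv scaler0 add0r ac scalerA mulrC.
Qed.

Lemma flag_coef_neq0 a b k : a != 0 -> b != 0 -> dot a b = 0 -> flag_coef a b k -> k != 0.
Proof.
move=> a0 b0 ab coef; apply/eqP => k0; have [c [d yx]] := flag_affine fr a0 b0 ab.
have := coef _ _ _ yx; rewrite k0 mul0r scale0r => /(cross_eq0P a0)[m em].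
have /negP[] := affine_notin_flag fr d a0 b0 ab.
rewrite (_ : P 0 1 d = P c 1 d - m *: P a 0 0); last by rewrite em; hcoord_eq.
by have := perp_flagA fr a0 ab => ax; in_span.
Qed.

(* The planes of (a, 0, b) and (0, 0, b') span a solid that contains the plane of (a, 0, b + b'). *)
Lemma flag_coef_add a b b' k k' : a != 0 -> dot a b = 0 -> dot a b' = 0 -> cross b b' != 0 ->
  flag_coef a b k -> flag_coef a (b + b') k' -> k = k'.
Proof.
move=> a0 ab ab' bb' coef coef_add; have [b0 b'0] := (cross_neq0l bb', cross_neq0r bb').
have ab_add : dot a (b + b') = 0 by rewrite dotDr ab ab' addr0.
have [Pa Pb'] := (coveredA fr a0, coveredB fr b'0); have Px := flag_covered fr a0 ab.
have [c [d yx]] := flag_affine fr a0 (cross_neq0_add bb') ab_add.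
have := perp_comb 1 Pa (perpA_flag fr a0 ab) (perpAB fr a0 ab') (hcoordB_notin fr _ _ _ _ b0)
  (hcoordB_notin_span fr _ _ _ _ _ _ bb').
rewrite (_ : P a 0 b + 1 *: P 0 0 b' = P a 0 (b + b')); last by hcoord_eq.
move/(submx_trans yx)/sub_adds_rVP => [u [v [ux vb']]].
have [c1 [t1 [d1 eu]]] := perp_hcoord fr Px ux; have [c2 [t2 [d2 ev]]] := perp_hcoord fr Pb' vb'.
rewrite {u}eu in ux *; rewrite {v}ev in vb' *; have [-> b'c2 _] := perpB fr b'0 vb'.
rewrite hcoordD addr0 => /(hcoord_inj fr)[ec et _].
have := coef_add _ _ _ yx; rewrite ec crossDr (coef _ _ _ ux) -et !mulr1.
rewrite dotC in b'c2; have [s ->] := cross_dot0 b'0 ab' b'c2.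
by rewrite scalerDr => /(lincomb2_inj bb')[].
Qed.

Lemma flag_coef_const_right a b b' k : a != 0 -> b != 0 -> b' != 0 -> dot a b = 0 -> dot a b' = 0 ->
  flag_coef a b k -> flag_coef a b' k.
Proof.
move=> a0 b0 b'0 ab ab'.
have indep c d : dot a c = 0 -> dot a d = 0 -> cross c d != 0 -> flag_coef a c k -> flag_coef a d k.
  move=> ac ad cd coef; have [m coef_m] := exists_flag_coef a0 (cross_neq0r cd) ad.
  suff -> : k = m by []; apply: (@flag_coef_add a c (d - c)) => //.
  - by rewrite dotBr ac ad subrr.
  - by rewrite crossBr crossvv subr0.
  - by rewrite addrC subrK.
have [/(cross_eq0P b0)[m em]|bb'] := eqVneq (cross b b') 0; last exact: indep.
have [d ad bd] := exists_dot0_cross a0 b0 ab => coef; apply: (indep d) => //; last exact: (indep b).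
by rewrite em crossZr crossC scaler_eq0 oppr_eq0 negb_or bd andbT; apply: contraNneq b'0 => m0; rewrite em m0 scale0r.
Qed.

Section AffinePoint.
Variables c d : 'rV[F]_3.
Local Notation y := (P c 1 d).
Hypothesis Py : covered y.

Lemma affine_perpA a : a != 0 -> ~~ (P a 0 0 <= perp y)%MS.
Proof.
move=> a0; apply/negP => ay; have := perp_sym Py ay (covered_neq0 (coveredA fr a0)).
by case/(perpA fr a0) => /eqP; rewrite oner_eq0.
Qed.

Lemma affine_perpB b : b != 0 -> ~~ (P 0 0 b <= perp y)%MS.
Proof.
move=> b0; apply/negP => b_y; have := perp_sym Py b_y (covered_neq0 (coveredB fr b0)).
by case/(perpB fr b0) => /eqP; rewrite oner_eq0.
Qed.

Lemma affine_perp_flag a b : a != 0 -> b != 0 -> (P a 0 b <= perp y)%MS ->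
  exists k, [/\ flag_coef a b k, dot a b = 0, cross a c = k *: b & dot a d = 0].
Proof.
move=> a0 b0 xy; have x0 : P a 0 b != 0 by rewrite (hcoord_neq0 fr) a0.
have ab := covered_dot0 fr a0 b0 (perp_covered Py xy x0); have [k coef] := exists_flag_coef a0 b0 ab.
have yx := perp_sym Py xy x0; have [ad _] := perp_flag_dot0 a0 b0 ab yx.
by exists k; split=> //; rewrite (coef _ _ _ yx) mulr1.
Qed.

Lemma exists_affine_perp_indep a b : a != 0 -> b != 0 -> (P a 0 b <= perp y)%MS ->
  exists a' b', [/\ (P a' 0 b' <= perp y)%MS, cross a a' != 0 & cross b b' != 0].
Proof.
move=> a0 b0 xy; have yy := mem_perp Py.
have nxy : ~~ (P a 0 b <= y)%MS.
  apply/negP => /sub_rVP[k]; rewrite hcoordZ mulr1 => /(hcoord_inj fr)[ea k0 _].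
  by rewrite ea -k0 scale0r eqxx in a0.
have [|z [zy nz]] := @exists_notin _ _ _ _ (y + P a 0 b)%MS (perp y).
  by rewrite (rank_perp Py) rank_span2.
have [u [t [v ez]]] := perp_hcoord fr Py zy.
pose a' := u - t *: c; pose b' := v - t *: d.
have ez' : P a' 0 b' = z - t *: y by rewrite ez; hcoord_eq.
have x'y : (P a' 0 b' <= perp y)%MS by rewrite ez'; in_span.
have neq k : P a' 0 b' != k *: P a 0 b.
  apply: contra nz => /eqP ea'; rewrite -(subrK (t *: y) z) -ez' ea'; in_span.
have sub k : ((P a' 0 b' - k *: P a 0 b)%R <= perp y)%MS by in_span.
exists a', b'; split=> //.
- apply/negP => /eqP/(cross_eq0P a0)[k ea']; have := sub k; have := neq k.
  rewrite -subr_eq0 (_ : _ - _ = P 0 0 (b' - k *: b)); last by rewrite ea'; hcoord_eq.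
  by rewrite (hcoord_neq0 fr) !eqxx => /affine_perpB/negP.
- apply/negP => /eqP/(cross_eq0P b0)[k eb']; have := sub k; have := neq k.
  rewrite -subr_eq0 (_ : _ - _ = P (a' - k *: a) 0 0); last by rewrite eb'; hcoord_eq.
  by rewrite (hcoord_neq0 fr) !eqxx !orbF => /affine_perpA/negP.
Qed.

Lemma affine_perp_cross a b a' b' k : (P a 0 b <= perp y)%MS -> (P a' 0 b' <= perp y)%MS ->
  cross a a' != 0 -> cross b b' != 0 -> cross a c = k *: b -> cross a' c = k *: b'.
Proof.
move=> xy x'y aa' bb' ac; have [a'0 b'0] := (cross_neq0r aa', cross_neq0r bb').
have [k' [_ _ a'c _]] := affine_perp_flag a'0 b'0 x'y.
have sum_y : (P (a + a') 0 (b + b') <= perp y)%MS.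
  by rewrite (_ : P _ _ _ = P a 0 b + P a' 0 b'); [in_span | hcoord_eq].
have [m [_ _ sum_c _]] := affine_perp_flag (cross_neq0_add aa') (cross_neq0_add bb') sum_y.
move: sum_c; rewrite crossDl ac a'c scalerDr => /(lincomb2_inj bb')[-> ->] //.
Qed.

End AffinePoint.

(* Both coefficients are read off at a point y = (c, 1, m d) with d = cross a a': the points (u, 0, v) of
   perp y have u orthogonal to d, and hence a' occurs among these u. *)
Lemma exists_affine_perp a d : a != 0 -> d != 0 -> dot a d = 0 ->
  exists b c t, [/\ b != 0, dot a b = 0, t != 0 & (P c 1 (t *: d) <= perp (P a 0 b))%MS].
Proof.
move=> a0 d0 ad; have [b ab db] := exists_dot0_cross a0 d0 ad; have b0 := cross_neq0r db.
have [c [d' yx]] := flag_affine fr a0 b0 ab; have [ad' bc] := perp_flag_dot0 a0 b0 ab yx.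
have [k db_a] : exists k, cross d b = k *: a by apply: cross_dot0; rewrite // dotC.
have [|m [n ed']] := dot_cross_eq0_span db (_ : dot d' _ = 0); first by rewrite db_a dotZr dotC ad' mulr0.
have {}yx : (P c 1 (m *: d) <= perp (P a 0 b))%MS.
  rewrite (_ : P c 1 _ = P c 1 d' - n *: P 0 0 b); last by rewrite ed'; hcoord_eq.
  by have := perp_flagB fr a0 b0 ab => bx; in_span.
exists b, c, m; split=> //; apply: contraTneq yx => ->; rewrite scale0r -!(hcoord_swap A B e).
by apply: (affine_notin_flag (frame_swap fr)); rewrite // dotC.
Qed.

Lemma flag_coef_const_left a a' b b' k : cross a a' != 0 -> b != 0 -> b' != 0 ->
  dot a b = 0 -> dot a' b' = 0 -> flag_coef a b k -> flag_coef a' b' k.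
Proof.
move=> aa' b0 b'0 ab a'b' coef; have [a0 a'0] := (cross_neq0l aa', cross_neq0r aa').
have [b1 [c [m [b10 ab1 m0 yx]]]] := exists_affine_perp a0 aa' (dot_crossl a a').
have {}coef : flag_coef a b1 k by apply: flag_coef_const_right coef.
have Px := flag_covered fr a0 ab1; set y := P c 1 _ in yx.
have y0 : y != 0 by rewrite (hcoord_neq0 fr) oner_neq0 orbT.
have Py := perp_covered Px yx y0; have xy := perp_sym Px yx y0.
have ac : cross a c = k *: b1 by rewrite (coef _ _ _ yx) mulr1.
have [a2 [b2 [x2y aa2 b1b2]]] := exists_affine_perp_indep Py a0 b10 xy.
have a2c := affine_perp_cross Py xy x2y aa2 b1b2 ac.
have [_ [_ _ _ a2d]] := affine_perp_flag Py (cross_neq0r aa2) (cross_neq0r b1b2) x2y.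
have {}a2d : dot a2 (cross a a') = 0.
  by apply/eqP; move/eqP: a2d; rewrite dotZr mulf_eq0 (negbTE m0).
have [n aa2_d] : exists t, cross a a2 = t *: cross a a' by apply: cross_dot0; rewrite ?dot_crossl.
have [|r [s ea']] := dot_cross_eq0_span aa2 (_ : dot a' _ = 0); first by rewrite aa2_d dotZr dot_crossr mulr0.
pose b3 := r *: b1 + s *: b2; have x3y : (P a' 0 b3 <= perp y)%MS.
  by rewrite (_ : P _ _ _ = r *: P a 0 b1 + s *: P a2 0 b2); [in_span | rewrite ea'; hcoord_eq].
have b30 : b3 != 0.
  apply: contraNneq a'0 => b30; have : b3 = 0 *: b1 + 0 *: b2 by rewrite b30 !scale0r addr0.
  by case/(lincomb2_inj b1b2) => r0 s0; rewrite ea' r0 s0 !scale0r addr0.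
have [k3 [coef3 a'b3 a'c _]] := affine_perp_flag Py a'0 b30 x3y.
suff -> : k = k3 by apply: flag_coef_const_right coef3.
apply: (scale_injl b30); rewrite -a'c ea' crossDl !crossZl ac a2c /b3; rV_ring.
Qed.

Lemma flag_coef_const : exists2 k, k != 0 & forall a b, a != 0 -> b != 0 -> dot a b = 0 -> flag_coef a b k.
Proof.
have indep : cross (v3 1 0 0) (v3 0 1 0) != 0 :> 'rV[F]_3.
  by apply/eqP => /rowP/(_ i2); rewrite !mxE /= => /eqP; rewrite mulr1 mulr0 subr0 oner_eq0.
set a := v3 1 0 0 in indep; set b := v3 0 1 0 in indep; have [a0 b0] := (cross_neq0l indep, cross_neq0r indep).
have ab : dot a b = 0 by rewrite /dot !mxE /=; ring.
have [k coef] := exists_flag_coef a0 b0 ab; exists k; first exact: flag_coef_neq0 coef.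
move=> c d c0 d0 cd; have [/(cross_eq0P a0)[m ec]|ac] := eqVneq (cross a c) 0; last first.
  exact: (flag_coef_const_left ac b0 d0 ab cd coef).
have [b' b'0] := exists_dot0 b; rewrite dotC => bb'.
apply: (flag_coef_const_left _ b'0 d0 bb' cd (flag_coef_const_left indep b0 b'0 ab bb' coef)).
rewrite ec crossZr crossC scaler_eq0 oppr_eq0 negb_or indep andbT.
by apply: contraNneq c0 => m0; rewrite ec m0 scale0r.
Qed.

End FlagCoefficient.

Section FrameLines.
Variables (A B : 'M[F]_(3, N)) (e : 'rV[F]_N).
Hypothesis fr : frame A B e.
Local Notation P := (hcoord A B e).

Definition line_relations (k1 k2 : F) a b c t d :=
  [/\ [/\ dot a b = 0, dot a d = 0, dot b c = 0 & dot c d = - (k1 * k2) * t ^+ 2],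
      cross a c = (k1 * t) *: b & cross b d = (k2 * t) *: a].

Lemma perp_line_relations k1 k2 a b c t d :
  (forall a b, a != 0 -> b != 0 -> dot a b = 0 -> flag_coef A B e a b k1) ->
  (forall b a, b != 0 -> a != 0 -> dot b a = 0 -> flag_coef B A e b a k2) ->
  covered (P a 0 b) -> (P c t d <= perp (P a 0 b))%MS -> line_relations k1 k2 a b c t d.
Proof.
move=> coefA coefB Px yx; rewrite /line_relations; have [a0|a0] := eqVneq a 0.
  have b0 : b != 0 by have := covered_neq0 Px; rewrite a0 (hcoord_neq0 fr) !eqxx.
  rewrite a0 in yx *; have [-> bc [m ->]] := perpB fr b0 yx.
  rewrite !dotZr [dot c b]dotC bc !dot0l cross0l crossZr crossvv expr0n !mulr0 !scaler0 scale0r.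
  by split=> //; split.
have [b0|b0] := eqVneq b 0.
  rewrite b0 in yx *; have [-> ad [m ->]] := perpA fr a0 yx.
  rewrite !dotZl ad !dot0l !dot0r cross0l crossZr crossvv expr0n !mulr0 !scaler0 scale0r.
  by split=> //; split.
have ab := covered_dot0 fr a0 b0 Px; have ba : dot b a = 0 by rewrite dotC.
have [ad bc] := perp_flag_dot0 fr a0 b0 ab yx; have ac := coefA _ _ a0 b0 ab _ _ _ yx.
have bd : cross b d = (k2 * t) *: a by apply: (coefB _ _ b0 a0 ba d t c); rewrite !(hcoord_swap A B).
split=> //; split=> //; have := cross_crossl a c d; rewrite ac crossZl bd scalerA ad scale0r sub0r.
by rewrite -scaleNr => /(scale_injl a0) e_cd; rewrite -[LHS]opprK -e_cd; ring.
Qed.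

Lemma exists_line_hyperplane_point l : l \in L -> exists a b, P a 0 b != 0 /\ (P a 0 b <= l)%MS.
Proof.
move=> Ll; have [u [v [u0 nvu el]]] := exists_span2 (rank_line Ll).
have [ul vl] : (u <= l)%MS /\ (v <= l)%MS by rewrite !el; split; in_span.
have [a [t [b eu]]] := frame_hcoord fr (line_covered Ll u0 ul).
have [c [t' [d ev]]] := frame_hcoord fr (line_covered Ll (notsub_neq0 nvu) vl).
have [t0|t0] := eqVneq t 0; first by exists a, b; rewrite -t0 -eu.
pose k := t' / t; exists (c - k *: a), (d - k *: b).
have -> : P (c - k *: a) 0 (d - k *: b) = v - k *: u.
  by rewrite eu ev hcoordZ hcoordN hcoordD divfK // subrr.
by split; [apply: contraNneq nvu => /subr0_eq->; in_span | in_span].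
Qed.

Lemma exists_line_relations : exists k1 k2, [/\ k1 != 0, k2 != 0 & forall l, l \in L ->
  exists a b c t d, (l :=: P a 0 b + P c t d)%MS /\ line_relations k1 k2 a b c t d].
Proof.
have [k1 k10 coefA] := flag_coef_const fr; have [k2 k20 coefB] := flag_coef_const (frame_swap fr).
exists k1, k2; split=> // l Ll; have [a [b [x0 xl]]] := exists_line_hyperplane_point Ll.
have Px := line_covered Ll x0 xl.
have [|y [yl nyx]] := @exists_notin _ _ _ _ (P a 0 b) l; first by rewrite rank_rV1 // (rank_line Ll).
have [c [t [d ey]]] := frame_hcoord fr (line_covered Ll (notsub_neq0 nyx) yl); rewrite {y}ey in yl nyx.
exists a, b, c, t, d; split; first exact: line_span.
by apply: perp_line_relations => //; apply: submx_trans yl (line_perp Ll x0 xl).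
Qed.

Lemma rank_sum_lines : \rank (\sum_(l in L) l)%MS = 7%N.
Proof.
set V := (\sum_(l in L) l)%MS; have /eqP<- := mat7_free (frame_inj fr); apply/eqmx_rank/andP; split.
  apply/sumsmx_subP; apply: lines_sub => x /(frame_hcoord fr)[a [t [b ->]]].
  by rewrite -mul_mat7 submxMl.
have covV x : covered x -> (x <= V)%MS.
  case/andP=> _ /set0Pn[l /lines_thruP[Ll xl]]; exact: submx_trans xl (sumsmx_sup l Ll (submx_refl l)).
have delta0 (i : 'I_3) : delta_mx 0 i != 0 :> 'rV[F]_3.
  by apply/eqP => /rowP/(_ i)/eqP; rewrite !mxE !eqxx oner_eq0.
apply: mat7_sub.
- by apply/row_subP => i; rewrite rowE; apply: covV (frame_coveredA fr (delta0 i)).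
- exact: submx_trans (frame_tspaceA fr i0) (tspace_sub _ covV).
- by apply/row_subP => i; rewrite rowE; apply: covV (frame_coveredB fr (delta0 i)).
Qed.

End FrameLines.

Section Rescale.
Variables k1 k2 : F.
Hypotheses (k10 : k1 != 0) (k20 : k2 != 0).

(* Any linear map of determinant 1 / (k1 ^ 2 k2) would do for [rescaleA]; [rescaleB] is then its inverse
   transpose divided by - k1 k2. *)
Definition rescaleA a := v3 (a 0 i0 / (k1 ^+ 2 * k2)) (a 0 i1) (a 0 i2).
Definition rescaleB b := v3 (b 0 i0 / - k1^-1) (b 0 i1 / - (k1 * k2)) (b 0 i2 / - (k1 * k2)).

Let units := (oppr_eq0, mulf_eq0, negbTE k10, negbTE k20, oner_eq0 F).

Lemma rescaleA_scale k a : rescaleA (k *: a) = k *: rescaleA a.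
Proof. by apply: rV3_eq; rewrite !mxE /= ?mulrA. Qed.

Lemma rescaleB_scale k b : rescaleB (k *: b) = k *: rescaleB b.
Proof. by apply: rV3_eq; rewrite !mxE /= ?mulrA. Qed.

Lemma dot_rescale a b : dot (rescaleA a) (rescaleB b) = - dot a b / (k1 * k2).
Proof. by rewrite /dot !mxE /=; field; rewrite !units. Qed.

Lemma cross_rescaleA a c : cross (rescaleA a) (rescaleA c) = - k1^-1 *: rescaleB (cross a c).
Proof. by apply: rV3_eq; rewrite !mxE /=; field; rewrite !units. Qed.

Lemma cross_rescaleB b d : cross (rescaleB b) (rescaleB d) = k2^-1 *: rescaleA (cross b d).
Proof. by apply: rV3_eq; rewrite !mxE /=; field; rewrite !units. Qed.

Lemma hex_line_of_relations a b c t d :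
  let l := (mk7 (rescaleA a) 0 (rescaleB b) + mk7 (rescaleA c) t (rescaleB d))%MS in
  \rank l = 2%N -> line_relations k1 k2 a b c t d -> hex_line <<l>>%MS.
Proof.
move=> l rl [[ab ad bc cd] ac bd]; split.
- by rewrite /proj_sub mxrank_gen rl genmx_id !eqxx.
- move=> v; rewrite genmxE => /sub_span2P[m [n ->]].
  rewrite !mk7Z mk7D Q6_mk7 !(dotDl, dotDr, dotZl, dotZr) !dot_rescale ab ad cd [dot c b]dotC bc.
  by field; rewrite k10 k20.
- exists (mk7 (rescaleA a) 0 (rescaleB b)), (mk7 (rescaleA c) t (rescaleB d)).
  split; first by apply/andP; split; rewrite genmxE addsmxE.
  apply/hex_grassmann_mk7; rewrite cross_rescaleA cross_rescaleB ac bd rescaleA_scale rescaleB_scale !scalerA.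
  by rewrite mulNr !mulKf // !scale0r subr0 sub0r scaleNr.
Qed.

End Rescale.

Lemma hexagon_embedding A B e : frame A B e -> exists M : 'M[F]_(7, N), row_free M /\
  forall l, l \in L -> exists h, hex_line h /\ l = <<h *m M>>%MS.
Proof.
move=> fr; have [k1 [k2 [k10 k20 relations]]] := exists_line_relations fr.
pose A' := mat3 ((k1 ^+ 2 * k2) *: row i0 A) (row i1 A) (row i2 A).
pose B' := mat3 ((- k1^-1) *: row i0 B) (- (k1 * k2) *: row i1 B) (- (k1 * k2) *: row i2 B).
pose M := mat7 A' B' e.
have hcoordM a t b : hcoord A B e a t b = mk7 (rescaleA k1 k2 a) t (rescaleB k1 k2 b) *m M.
  rewrite mul_mat7 /hcoord !mul_mat3 !mul_row3 !mxE /= !scalerA.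
  by rewrite !divfK // ?oppr_eq0 ?invr_eq0 ?mulf_neq0 ?expf_neq0.
have freeM : row_free M.
  rewrite /row_free eqn_leq rank_leq_row; have /eqP {1}<- := mat7_free (frame_inj fr); apply: mxrankS.
  by apply/row_subP => i; rewrite rowE -(mk7K (delta_mx 0 i)) mul_mat7 hcoordM submxMl.
exists M; split=> // l Ll; have [a [b [c [t [d [el rel]]]]]] := relations l Ll.
set h := (mk7 (rescaleA k1 k2 a) 0 (rescaleB k1 k2 b) + mk7 (rescaleA k1 k2 c) t (rescaleB k1 k2 d))%MS.
have elM : (l :=: h *m M)%MS.
  by apply: eqmx_trans el _; rewrite !hcoordM; apply: eqmx_sym; apply: addsmxMr.
exists <<h>>%MS; split.
  by apply: hex_line_of_relations rel; rewrite // -(mxrankMfree _ freeM) -elM (rank_line Ll).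
by rewrite -(genmx_line Ll); apply/eq_genmx; apply: eqmx_trans elM (eqmxMr _ (eqmx_sym (genmxE h))).
Qed.

End LineSet.

(** * Split octonions *)

Local Notation zorn F := ((F * 'rV[F]_3) * ('rV[F]_3 * F))%type.

Section Collinear.
Variable F : fieldType.
Implicit Types (x y z : 'rV[F]_7) (k : F).

Definition collinear x y :=
  [&& dot (partA x) (partB y) == cd x 3 * cd y 3, dot (partA y) (partB x) == cd x 3 * cd y 3,
      cross (partA x) (partA y) == cd x 3 *: partB y - cd y 3 *: partB x &
      cross (partB x) (partB y) == cd y 3 *: partA x - cd x 3 *: partA y].

Lemma collinearP x y : reflect
  [/\ dot (partA x) (partB y) = cd x 3 * cd y 3, dot (partA y) (partB x) = cd x 3 * cd y 3,
      cross (partA x) (partA y) = cd x 3 *: partB y - cd y 3 *: partB x &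
      cross (partB x) (partB y) = cd y 3 *: partA x - cd x 3 *: partA y] (collinear x y).
Proof. by apply: (iffP and4P) => -[/eqP ? /eqP ? /eqP ? /eqP ?]; split=> //; apply/eqP. Qed.

Lemma collinear_sym x y : collinear x y = collinear y x.
Proof.
suff sym (u v : 'rV[F]_7) : collinear u v -> collinear v u by apply/idP/idP; apply: sym.
case/collinearP => AB BA AA BB; apply/collinearP; split; rewrite ?AB ?BA 1?mulrC //.
  by rewrite crossC AA opprB.
by rewrite crossC BB opprB.
Qed.

Lemma collinearxx x : collinear x x = (Q6 x == 0).
Proof. by rewrite Q6E subr_eq0 expr2; apply/collinearP/eqP => [[]//|Qx]; split=> //; rewrite crossvv subrr. Qed.

Lemma collinearD x y z : collinear x y -> collinear x z -> collinear x (y + z).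
Proof.
case/collinearP => AB BA AA BB /collinearP[AB' BA' AA' BB']; apply/collinearP.
rewrite !(partsD, dotDl, dotDr, crossDr) AB BA AA BB AB' BA' AA' BB'.
by split; [ring | ring | rV_ring | rV_ring].
Qed.

Lemma collinearZ k x y : collinear x y -> collinear x (k *: y).
Proof.
case/collinearP => AB BA AA BB; apply/collinearP.
rewrite !(partsZ, dotZl, dotZr, crossZr) AB BA AA BB.
by split; [ring | ring | rV_ring | rV_ring].
Qed.

Lemma collinear_comb k x y z : collinear x y -> collinear x z -> collinear x (y - k *: z).
Proof. by move=> xy xz; rewrite -scaleNr collinearD ?collinearZ. Qed.

Lemma collinear0 x : collinear x 0.
Proof. by have := collinearZ 0; rewrite /collinear !parts0 dot0l dot0r !cross0r !mulr0 !scaler0 !scale0r subrr !eqxx. Qed.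

Definition polar x y := dot (partA x) (partB y) + dot (partA y) (partB x) - cd x 3 * cd y 3 *+ 2.

Lemma Q6D x y : Q6 (x + y) = Q6 x + Q6 y + polar x y.
Proof. by rewrite /polar !Q6E !partsD !(dotDl, dotDr); ring. Qed.
Lemma Q6Z k x : Q6 (k *: x) = k ^+ 2 * Q6 x.
Proof. by rewrite !Q6E !partsZ dotZl dotZr; ring. Qed.
Lemma polarC x y : polar x y = polar y x.
Proof. by rewrite /polar; ring. Qed.
Lemma polarDl x y z : polar (x + y) z = polar x z + polar y z.
Proof. by rewrite /polar !partsD !(dotDl, dotDr); ring. Qed.
Lemma polarZl k x z : polar (k *: x) z = k * polar x z.
Proof. by rewrite /polar !partsZ !(dotZl, dotZr); ring. Qed.
Lemma polarDr x y z : polar z (x + y) = polar z x + polar z y.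
Proof. by rewrite !(polarC z) polarDl. Qed.
Lemma polarZr k x z : polar z (k *: x) = k * polar z x.
Proof. by rewrite !(polarC z) polarZl. Qed.

Definition polarE := (Q6D, Q6Z, polarDl, polarDr, polarZl, polarZr).

Lemma collinear_polar x y : collinear x y -> polar x y = 0.
Proof. by case/collinearP => AB BA _ _; rewrite /polar AB BA; ring. Qed.

End Collinear.

Section Zorn.
Variable F : fieldType.
Implicit Types (x y z w : 'rV[F]_7) (k : F) (X Y Z C : zorn F).

Definition zmul X Y : zorn F :=
  ((X.1.1 * Y.1.1 + dot X.1.2 Y.2.1, X.1.1 *: Y.1.2 + Y.2.2 *: X.1.2 - cross X.2.1 Y.2.1),
   (Y.1.1 *: X.2.1 + X.2.2 *: Y.2.1 + cross X.1.2 Y.1.2, X.2.2 * Y.2.2 + dot X.2.1 Y.1.2)).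
Definition zone : zorn F := ((1, 0), (0, 1)).
Definition zscale k X : zorn F := ((k * X.1.1, k *: X.1.2), (k *: X.2.1, k * X.2.2)).
Definition ztrace X := X.1.1 + X.2.2.
Definition znorm X := X.1.1 * X.2.2 - dot X.1.2 X.2.1.

Lemma zorn_eq X Y : X.1.1 = Y.1.1 -> X.1.2 = Y.1.2 -> X.2.1 = Y.2.1 -> X.2.2 = Y.2.2 -> X = Y.
Proof. by case: X Y => [[s a] [b r]] [[s' a'] [b' r']] /= -> -> -> ->. Qed.

Ltac zorn_ring :=
  apply: zorn_eq; rewrite /= ?/ztrace ?/znorm ?/dot /=;
  [rewrite ?mxE /=; ring | rV3_ring | rV3_ring | rewrite ?mxE /=; ring].

Lemma zscale0l X : zscale 0 X = 0. Proof. by zorn_ring. Qed.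
Lemma zscale0r k : zscale k 0 = 0. Proof. by zorn_ring. Qed.
Lemma zscaleDl k m X : zscale (k + m) X = zscale k X + zscale m X. Proof. by zorn_ring. Qed.
Lemma zscaleDr k X Y : zscale k (X + Y) = zscale k X + zscale k Y. Proof. by zorn_ring. Qed.
Lemma zscaleA k m X : zscale k (zscale m X) = zscale (k * m) X. Proof. by zorn_ring. Qed.
Lemma zscale1 X : zscale 1 X = X. Proof. by zorn_ring. Qed.
Lemma zscaleN k X : zscale (- k) X = - zscale k X. Proof. by zorn_ring. Qed.
Lemma zmulDl X Y Z : zmul (X + Y) Z = zmul X Z + zmul Y Z. Proof. by zorn_ring. Qed.
Lemma zmulDr X Y Z : zmul Z (X + Y) = zmul Z X + zmul Z Y. Proof. by zorn_ring. Qed.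
Lemma zmulZl k X Y : zmul (zscale k X) Y = zscale k (zmul X Y). Proof. by zorn_ring. Qed.
Lemma zmulZr k X Y : zmul X (zscale k Y) = zscale k (zmul X Y). Proof. by zorn_ring. Qed.
Lemma zmul0l X : zmul 0 X = 0. Proof. by zorn_ring. Qed.
Lemma zmul0r X : zmul X 0 = 0. Proof. by zorn_ring. Qed.
Lemma zmul1l X : zmul zone X = X. Proof. by zorn_ring. Qed.
Lemma ztraceD X Y : ztrace (X + Y) = ztrace X + ztrace Y. Proof. by rewrite /ztrace /=; ring. Qed.
Lemma ztraceZ k X : ztrace (zscale k X) = k * ztrace X. Proof. by rewrite /ztrace /=; ring. Qed.

Lemma zscale_eq0 k X : zscale k X = 0 -> X != 0 -> k = 0.
Proof.
move=> kX0 X0; apply/eqP; apply: contraNT X0 => k0.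
by rewrite -[X]zscale1 -(mulVf k0) -zscaleA kX0 zscale0r.
Qed.

Lemma zmul_altl C X : zmul C (zmul C X) = zscale (ztrace C) (zmul C X) - zscale (znorm C) X.
Proof. by zorn_ring. Qed.

Lemma zmul_altr C X : zmul (zmul X C) C = zscale (ztrace C) (zmul X C) - zscale (znorm C) X.
Proof. by zorn_ring. Qed.

Lemma ztrace_mulA X Y Z : ztrace (zmul (zmul X Y) Z) = ztrace (zmul X (zmul Y Z)).
Proof. by rewrite /ztrace /= /dot !mxE /=; ring. Qed.

Lemma exists_ztrace_mul X : X != 0 -> exists Z, ztrace (zmul X Z) != 0.
Proof.
case: X => [[s a] [b t]] X0; have [s0|s0] := eqVneq s 0; last first.
  by exists ((1, 0), (0, 0)); rewrite /ztrace /= !dot0r mulr1 mulr0 !addr0.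
have [a0|/exists_dot_neq0[w aw]] := eqVneq a 0; last first.
  by exists ((0, 0), (w, 0)); rewrite /ztrace /= !dot0r !mulr0 add0r !addr0.
have [b0|/exists_dot_neq0[w bw]] := eqVneq b 0; last first.
  by exists ((0, w), (0, 0)); rewrite /ztrace /= !dot0r !mulr0 !add0r.
exists ((0, 0), (0, 1)); rewrite /ztrace /= !dot0r mulr0 mulr1 !addr0 add0r.
by apply: contraNneq X0 => t0; rewrite s0 a0 b0 t0.
Qed.

Lemma ztrace_mul_eq0 X : (forall Z, ztrace (zmul X Z) = 0) -> X = 0.
Proof. by move=> X0; apply/eqP; apply: contraT => /exists_ztrace_mul[Z]; rewrite X0 eqxx. Qed.

(* Traceless elements; by [zmul_zemb_eq0] collinearity says that a product of two of them vanishes. *)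
Definition zemb x : zorn F := ((- cd x 3, partA x), (- partB x, cd x 3)).

Lemma zembD x y : zemb (x + y) = zemb x + zemb y.
Proof. by rewrite /zemb !partsD; zorn_ring. Qed.
Lemma zembZ k x : zemb (k *: x) = zscale k (zemb x).
Proof. by rewrite /zemb !partsZ; zorn_ring. Qed.
Lemma zemb0 : zemb 0 = 0. Proof. by rewrite -(scale0r 0) zembZ zscale0l. Qed.

Lemma zemb_neq0 x : x != 0 -> zemb x != 0.
Proof.
apply: contraNneq => x0; have [[A0 B0] t0] :=
  (congr1 (fun Y => Y.1.2) x0, congr1 (fun Y => Y.2.1) x0, congr1 (fun Y => Y.2.2) x0).
by apply/eqP; apply: rV7_eq; rewrite !parts0 // -[LHS]opprK [X in - X]B0 oppr0.
Qed.

Lemma ztrace_zemb x : ztrace (zemb x) = 0. Proof. exact: addNr. Qed.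
Lemma znorm_zemb x : znorm (zemb x) = Q6 x. Proof. by rewrite /znorm Q6E /dot !mxE /=; ring. Qed.

Lemma exists_zemb Z : ztrace Z = 0 -> exists w, Z = zemb w.
Proof.
move=> trZ; exists (mk7 Z.1.2 Z.2.2 (- Z.2.1)).
by apply: zorn_eq; rewrite /= !parts_mk7 ?opprK //; apply/eqP; rewrite -addr_eq0; apply/eqP.
Qed.

Lemma zemb_altl x Z : zmul (zemb x) (zmul (zemb x) Z) = zscale (- Q6 x) Z.
Proof. by rewrite zmul_altl ztrace_zemb zscale0l znorm_zemb sub0r zscaleN. Qed.

Lemma zemb_altr x Z : zmul (zmul Z (zemb x)) (zemb x) = zscale (- Q6 x) Z.
Proof. by rewrite zmul_altr ztrace_zemb zscale0l znorm_zemb sub0r zscaleN. Qed.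

Let Q6D_opp x y : - Q6 (x + y) = - Q6 x + (- Q6 y + - polar x y). Proof. by rewrite Q6D; ring. Qed.

Lemma zemb_polarl x y Z :
  zmul (zemb x) (zmul (zemb y) Z) + zmul (zemb y) (zmul (zemb x) Z) = zscale (- polar x y) Z.
Proof.
have alt_sum := zemb_altl (x + y) Z.
rewrite Q6D_opp zscaleDl zscaleDl zembD !(zmulDl, zmulDr) !zemb_altl -!addrA in alt_sum.
apply: (addrI (zscale (- Q6 x) Z)); apply: (addIr (zscale (- Q6 y) Z)).
by rewrite -!addrA alt_sum [zscale (- Q6 y) _ + _]addrC.
Qed.

Lemma zemb_polarr x y Z :
  zmul (zmul Z (zemb x)) (zemb y) + zmul (zmul Z (zemb y)) (zemb x) = zscale (- polar x y) Z.
Proof.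
rewrite addrC; have alt_sum := zemb_altr (x + y) Z.
rewrite Q6D_opp zscaleDl zscaleDl zembD !(zmulDl, zmulDr) !zemb_altr -!addrA in alt_sum.
apply: (addrI (zscale (- Q6 x) Z)); apply: (addIr (zscale (- Q6 y) Z)).
by rewrite -!addrA alt_sum [zscale (- Q6 y) _ + _]addrC.
Qed.

Lemma zmul_zemb_eq0 x y : (zmul (zemb x) (zemb y) == 0) = collinear x y.
Proof.
have -> : zmul (zemb x) (zemb y) =
    ((cd x 3 * cd y 3 - dot (partA x) (partB y), cd y 3 *: partA x - cd x 3 *: partA y - cross (partB x) (partB y)),
     (cross (partA x) (partA y) - (cd x 3 *: partB y - cd y 3 *: partB x), cd x 3 * cd y 3 - dot (partA y) (partB x))).
  by zorn_ring.
rewrite /collinear -[0]/((0, 0), (0, 0)) !xpair_eqE !subr_eq0 [_ * _ == dot (partA x) _]eq_sym.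
rewrite [_ == cross (partB x) _]eq_sym [_ * _ == dot (partA y) _]eq_sym.
by do 4!case: (_ == _).
Qed.

Lemma ztrace_mul_zemb x y : ztrace (zmul (zemb x) (zemb y)) = - polar x y.
Proof. by rewrite /ztrace /= /polar /dot !mxE; ring. Qed.

Lemma collinear_singular x y : x != 0 -> collinear x y -> Q6 y = 0.
Proof.
move=> x0 xy; have := zemb_altr y (zemb x); move: xy; rewrite -zmul_zemb_eq0 => /eqP->.
by rewrite zmul0l => /esym/zscale_eq0/(_ (zemb_neq0 x0))/eqP; rewrite oppr_eq0 => /eqP.
Qed.

Lemma collinear_polar2 x y z : x != 0 -> collinear x y -> collinear x z -> polar y z = 0.
Proof.
move=> x0 xy xz; have := collinear_singular x0 (collinearD xy xz).
by rewrite Q6D !(collinear_singular x0) // !add0r.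
Qed.

Lemma collinear_midpoint x y : Q6 x = 0 -> Q6 y = 0 -> polar x y = 0 -> ~~ collinear x y ->
  exists w, [/\ w != 0, collinear x w & collinear w y].
Proof.
move=> Qx Qy xy0; rewrite -zmul_zemb_eq0 => xy.
have [w ew] : exists w, zmul (zemb x) (zemb y) = zemb w.
  by apply: exists_zemb; rewrite ztrace_mul_zemb xy0 oppr0.
exists w; split.
- by apply: contraNneq xy => w0; rewrite ew w0 zemb0.
- by rewrite -zmul_zemb_eq0 -ew zemb_altl Qx oppr0 zscale0l.
- by rewrite -zmul_zemb_eq0 -ew zemb_altr Qy oppr0 zscale0l.
Qed.

(* The traceless multiples x Z of x are collinear with x, so y |-> ztrace (C y) and Z |-> ztrace (x Z)
   are proportional on all octonions Z once the first vanishes on the points collinear with x. *)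
Lemma eigen_of_collinear_annihilator C x : x != 0 -> Q6 x = 0 ->
  (forall y, collinear x y -> ztrace (zmul C (zemb y)) = 0) -> exists k, zmul C (zemb x) = zscale k (zemb x).
Proof.
move=> x0 Qx annih; set X := zemb x.
have annihZ Z : ztrace (zmul X Z) = 0 -> ztrace (zmul (zmul C X) Z) = 0.
  move=> /exists_zemb[y ey]; rewrite ztrace_mulA ey; apply: annih.
  by rewrite -zmul_zemb_eq0 -ey zemb_altl Qx oppr0 zscale0l.
have [Z0 trZ0] : exists Z, ztrace (zmul X Z) = 1.
  have [Z trZ] := exists_ztrace_mul (zemb_neq0 x0).
  by exists (zscale (ztrace (zmul X Z))^-1 Z); rewrite zmulZr ztraceZ mulVf.
exists (ztrace (zmul (zmul C X) Z0)); apply/eqP; rewrite -subr_eq0 -zscaleN; apply/eqP.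
apply: ztrace_mul_eq0 => Z; have := annihZ (Z + zscale (- ztrace (zmul X Z)) Z0).
rewrite !zmulDr !zmulZr !ztraceD !ztraceZ trZ0 mulr1 subrr => /(_ erefl).
by rewrite zmulDl zmulZl ztraceD ztraceZ !mulNr mulrC.
Qed.

Lemma eigen_root C k X : X != 0 -> zmul C X = zscale k X -> k ^+ 2 - ztrace C * k + znorm C = 0.
Proof.
move=> X0 CX; apply: (zscale_eq0 (X := X)) => //.
have := zmul_altl C X; rewrite CX zmulZr CX !zscaleA -zscaleN -zscaleDl => e.
by rewrite expr2 zscaleDl zscaleDl e -!zscaleDl -(zscale0l X); congr (zscale _ X); ring.
Qed.

Lemma eigen_singular C k x : C != zscale k zone -> zmul C (zemb x) = zscale k (zemb x) -> Q6 x = 0.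
Proof.
rewrite -subr_eq0 -zscaleN => Ck0 Cx; have := zemb_altr x (C + zscale (- k) zone).
rewrite zmulDl zmulZl zmul1l Cx -zscaleDl subrr zscale0l zmul0l => /esym/zscale_eq0/(_ Ck0)/eqP.
by rewrite oppr_eq0 => /eqP.
Qed.

End Zorn.

(** * The plane of points collinear with a point of H(q) *)

Section Chart.
Variables (F : fieldType) (x : 'rV[F]_7) (w : 'rV[F]_3).
Local Notation a := (partA x).
Local Notation b := (partB x).
Local Notation t := (cd x 3).
Hypotheses (aw : dot a w = 1) (Qx : dot a b = t ^+ 2).
Implicit Types (p : 'rV[F]_3) (s k : F) (y z : 'rV[F]_7).

(* The solutions y of [collinear x y] in terms of s = dot w (partA y) and p = partB y, where p matters
   only modulo w; [chart_cd3] is the resulting third coordinate. *)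
Definition chart_cd3 s p := dot w (cross b p) + t * s.
Definition chart s p := mk7 (s *: a + chart_cd3 s p *: cross w b - t *: cross w p) (chart_cd3 s p)
  (p + (t * chart_cd3 s p - dot a p) *: w).

Lemma chart_collinear s p : collinear x (chart s p).
Proof.
apply/collinearP; rewrite /chart !parts_mk7; set t' := chart_cd3 s p; split.
- by rewrite dotDr dotZr aw; ring.
- rewrite !dotDl -scaleNr !dotZl Qx [dot (cross w b) _]dotC dot_crossr [dot (cross w p) b]dotC.
  rewrite (dot_cross_rot b w p) (dot_cross_rot p b w) (crossC p b) -scaleN1r dotZr.
  by rewrite /t' /chart_cd3; ring.
- by rewrite !crossDr -scaleNr !crossZr crossvv !cross_crossr aw Qx; rV_ring.
- rewrite crossDr crossZr; have := dot_cross4 a b w p; rewrite aw Qx => bp.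
  have {bp}-> : cross b p = dot w (cross b p) *: a - t ^+ 2 *: cross p w - dot a p *: cross w b.
    by rewrite bp; rV_ring.
  by rewrite (crossC b w) (crossC p w) {2}/t' /chart_cd3; rV_ring.
Qed.

Lemma chart_shift s p k : chart s (p + k *: w) = chart s p.
Proof.
rewrite /chart; have -> : chart_cd3 s (p + k *: w) = chart_cd3 s p.
  by rewrite /chart_cd3 crossDr crossZr dotDr dotZr dot_crossr mulr0 addr0.
congr mk7; first by rewrite crossDr crossZr crossvv scaler0 addr0.
by rewrite dotDr dotZr aw; rV_ring.
Qed.

Lemma collinear_chart y : collinear x y -> y = chart (dot w (partA y)) (partB y).
Proof.
case/collinearP => AB BA AA BB; have cd3 : chart_cd3 (dot w (partA y)) (partB y) = cd y 3.
  by rewrite /chart_cd3 BB dotBr !dotZr [dot w a]dotC aw; ring.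
apply: rV7_eq; rewrite /chart !parts_mk7 cd3 //; last by rewrite AB; rV_ring.
have := cross_crossr w a (partA y); rewrite AA [dot w a]dotC aw crossBr !crossZr => e.
apply/eqP; rewrite eq_sym -subr_eq0 -(subrr (cross w (cross a (partA y)))) AA crossBr !crossZr {1}e.
by apply/eqP; rV_ring.
Qed.

Lemma chart_normal y : collinear x y -> exists2 p, dot a p = 0 & y = chart (dot w (partA y)) p.
Proof.
move=> xy; exists (partB y - dot a (partB y) *: w); first by rewrite dotBr dotZr aw mulr1 subrr.
by rewrite {1}(collinear_chart xy) -scaleNr chart_shift.
Qed.

Lemma chart_inj s p s' p' : dot a p = 0 -> dot a p' = 0 -> chart s p = chart s' p' -> s = s' /\ p = p'.
Proof.
move=> ap ap' /mk7_inj[eA e3 eB]; have epp' : p = p' by move: eB; rewrite ap ap' e3 => /addIr.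
split=> //; move: eA; rewrite e3 epp' => /addIr/addIr/(congr1 (dot w)).
by rewrite !dotZr [dot w a]dotC aw !mulr1.
Qed.

Lemma collinear_chart_eq0 y : collinear x y -> dot w (partA y) = 0 -> cross w (partB y) = 0 -> y = 0.
Proof.
move=> xy wA wB; have w0 : w != 0 by apply: contra_eq_neq aw => ->; rewrite dot0r eq_sym oner_neq0.
have [k eB] := cross_eq0P w0 wB; rewrite (collinear_chart xy) wA eB -[k *: w]add0r chart_shift.
have c0 : chart_cd3 0 0 = 0 by rewrite /chart_cd3 cross0r dot0r mulr0 addr0.
by rewrite /chart c0 cross0r dot0r mulr0 scaler0 !subr0 !scale0r !addr0 mk70.
Qed.

(* The product with w of the last relation between y and z vanishes. *)
Lemma chart_no_triangle y z : collinear x y -> collinear x z -> collinear y z ->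
  dot w (partA y) = 0 -> dot w (partA z) = 0 -> y != 0 -> (z <= y)%MS.
Proof.
move=> xy xz yz wy wz y0; have wBy : cross w (partB y) != 0.
  by apply: contraNneq y0 => wBy; apply/eqP; apply: collinear_chart_eq0.
have [|m [n eB]] := dot_cross_eq0_span wBy (_ : dot (partB z) _ = 0).
  have [_ _ _ BB] := collinearP _ _ yz; rewrite dot_cross_rot dot_cross_rot BB dotBr !dotZr wy wz.
  by rewrite !mulr0 subrr.
rewrite -(subrK (n *: y) z) (@collinear_chart_eq0 (z - n *: y)) ?add0r ?scalemx_sub //.
- exact: collinear_comb.
- by rewrite -scaleNr !partsD !partsZ dotDr dotZr wy wz mulr0 addr0.
- by rewrite -scaleNr !partsD !partsZ eB !(crossDr, crossZr) crossvv; rV_ring.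
Qed.

End Chart.

Section Swap.
Variable F : fieldType.
Implicit Types (x y z : 'rV[F]_7) (k : F).

Definition swap x := mk7 (partB x) (- cd x 3) (partA x).

Lemma parts_swap x : (partA (swap x) = partB x) * (partB (swap x) = partA x) * (cd (swap x) 3 = - cd x 3).
Proof. by rewrite /swap !parts_mk7. Qed.

Lemma swapK : involutive swap. Proof. by move=> x; apply: rV7_eq; rewrite !parts_swap ?opprK. Qed.
Lemma swapD x y : swap (x + y) = swap x + swap y.
Proof. by rewrite /swap !partsD opprD mk7D. Qed.
Lemma swapZ k x : swap (k *: x) = k *: swap x.
Proof. by rewrite /swap !partsZ -mulrN mk7Z. Qed.
Lemma swap_neq0 x : x != 0 -> swap x != 0.
Proof. by apply: contraNneq => x0; rewrite -(swapK x) x0 -(scale0r x) swapZ !scale0r. Qed.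

Lemma collinear_swap x y : collinear (swap x) (swap y) = collinear x y.
Proof.
suff swap_collinear u v : collinear u v -> collinear (swap u) (swap v).
  by apply/idP/idP => /swap_collinear; rewrite ?swapK.
case/collinearP => AB BA AA BB; apply/collinearP; rewrite !parts_swap; split.
- by rewrite dotC BA; ring.
- by rewrite dotC AB; ring.
- by rewrite BB; rV_ring.
- by rewrite AA; rV_ring.
Qed.

Lemma Q6_swap x : Q6 (swap x) = Q6 x.
Proof. by rewrite !Q6E !parts_swap dotC sqrrN. Qed.

(* Up to [swap] a singular point has a nonzero A-part, so that there is a chart at it. *)
Lemma singular_swap_ind (P : 'rV[F]_7 -> Prop) :
  (forall x, x != 0 -> Q6 x = 0 -> P (swap x) -> P x) ->
  (forall x w, x != 0 -> Q6 x = 0 -> dot (partA x) w = 1 -> dot (partA x) (partB x) = cd x 3 ^+ 2 -> P x) ->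
  forall x, x != 0 -> Q6 x = 0 -> P x.
Proof.
move=> Pswap Pchart; have PA x : x != 0 -> partA x != 0 -> Q6 x = 0 -> P x.
  by move=> x0 /exists_dot1[w aw] Qx; apply: Pchart aw _ => //; move: Qx; rewrite Q6E => /subr0_eq.
move=> x x0 Qx; have [A0|a0] := eqVneq (partA x) 0; last exact: PA.
apply: Pswap => //; apply: PA; rewrite ?Q6_swap ?swap_neq0 // parts_swap; apply: contraNneq x0 => B0.
move: Qx; rewrite Q6E A0 dot0l sub0r => /eqP; rewrite oppr_eq0 expf_eq0 /= => /eqP t0.
by apply/eqP; apply: rV7_eq; rewrite ?A0 ?B0 ?t0 ?parts0.
Qed.

Lemma collinear_no_triangle x y z : x != 0 -> Q6 x = 0 -> collinear x y -> collinear x z -> collinear y z ->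
  ~~ (y <= x)%MS -> (z <= x + y)%MS.
Proof.
move=> x0 Qx; move: y z.
pattern x; apply: (singular_swap_ind _ _ x0 Qx) => [{}x {}x0 {}Qx ind|{}x w {}x0 {}Qx aw Q] y z xy xz yz nyx.
  have : (swap z <= swap x + swap y)%MS.
    apply: ind; rewrite ?collinear_swap //.
    by apply: contra nyx => /sub_rVP[k]; rewrite -swapZ => /(can_inj swapK)->; in_span.
  by case/sub_span2P => k [m]; rewrite -!swapZ -swapD => /(can_inj swapK)->; in_span.
pose reduce u := u - dot w (partA u) *: x.
have xx : collinear x x by rewrite collinearxx Qx.
have xred u : collinear x u -> collinear x (reduce u) by move=> xu; apply: collinear_comb.
have wred u : dot w (partA (reduce u)) = 0.
  by rewrite /reduce -scaleNr !partsD !partsZ dotDr dotZr [dot w (partA x)]dotC aw; ring.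
have redyz : collinear (reduce y) (reduce z).
  rewrite collinear_sym; apply: collinear_comb; last by rewrite collinear_sym xred.
  by rewrite collinear_sym; apply: collinear_comb; rewrite // collinear_sym.
have red_y0 : reduce y != 0 by apply: contra nyx; rewrite subr_eq0 => /eqP->; in_span.
have /sub_rVP[k ez] := chart_no_triangle aw (xred y xy) (xred z xz) redyz (wred y) (wred z) red_y0.
rewrite -(subrK (dot w (partA z) *: x) z) -/(reduce z) ez /reduce; in_span.
Qed.

End Swap.

Section CollinearPlane.
Variable F : finFieldType.
Local Notation q := #|F|.
Implicit Types (x y z v : 'rV[F]_7).

Definition collinear_plane x : 'M[F]_7 := (\sum_(y | collinear x y) <<y>>)%MS.

Lemma in_collinear_plane x v : (v <= collinear_plane x)%MS = collinear x v.
Proof. by apply: sub_sums_closed => [|y z|c y]; [exact: collinear0 | exact: collinearD | exact: collinearZ]. Qed.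

Lemma card_dot_eq (a : 'rV[F]_3) (k : F) : a != 0 -> #|[set p : 'rV[F]_3 | dot a p == k]| = (q ^ 2)%N.
Proof.
move=> a0; have [w aw] := exists_dot1 a0; have addI := addIr (k *: w).
have -> : [set p : 'rV[F]_3 | dot a p == k] = [set p + k *: w | p in vset (kermx a^T)].
  have kerE p : (p \in vset (kermx a^T)) = (dot a p == 0).
    rewrite inE dotC dotE; apply/sub_kermxP/eqP => [->|pa]; first by rewrite mxE.
    by rewrite [p *m _]mx11_scalar pa scalar_mx_is_0 || rewrite [p *m _]mx11_scalar pa; apply/matrixP => i j; rewrite !mxE mul0rn.
  apply/setP => p; rewrite inE; apply/eqP/imsetP => [ap|[p']].
    by exists (p - k *: w); rewrite ?subrK // kerE dotBr dotZr aw ap mulr1 subrr.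
  by rewrite kerE => /eqP ap' ->; rewrite dotDr dotZr aw ap' add0r mulr1.
by rewrite card_imset // card_vset mxrank_ker mxrank_tr rank_rV1.
Qed.

Lemma card_collinear x : x != 0 -> Q6 x = 0 -> #|[set y | collinear x y]| = (q ^ 3)%N.
Proof.
move=> x0 Qx; pattern x; apply: (singular_swap_ind _ _ x0 Qx) => [{}x {}x0 {}Qx <-|{}x w {}x0 {}Qx aw Q].
  rewrite -(card_imset [set y | collinear x y] (can_inj (@swapK F))).
  apply: eq_card => y; rewrite [in RHS]inE -{1}(swapK y) mem_imset; last exact: (can_inj (@swapK F)).
  by rewrite inE -collinear_swap swapK.
have a0 : partA x != 0 by apply: contra_eq_neq aw => ->; rewrite dot0l eq_sym oner_neq0.
pose D := setX [set: F] [set p : 'rV[F]_3 | dot (partA x) p == 0].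
have -> : [set y | collinear x y] = [set chart x w sp.1 sp.2 | sp in D].
  apply/setP => y; rewrite inE; apply/idP/imsetP => [xy|[sp _ ->]]; last exact: chart_collinear.
  have [p ap ey] := chart_normal aw xy; exists (dot w (partA y), p) => //.
  by rewrite !inE ap eqxx.
rewrite card_in_imset ?cardsX ?cardsT ?card_dot_eq // => -[s p] [s' p'].
by rewrite !inE /= => /eqP ap /eqP ap' /(chart_inj aw ap ap')[-> ->].
Qed.

Lemma rank_collinear_plane x : x != 0 -> Q6 x = 0 -> \rank (collinear_plane x) = 3%N.
Proof.
move=> x0 Qx; have := card_collinear x0 Qx.
have -> : [set y | collinear x y] = vset (collinear_plane x) by apply/setP => y; rewrite !inE in_collinear_plane.
by rewrite card_vset => /eqP; rewrite eqn_exp2l ?card_field_gt1 // => /eqP.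
Qed.

End CollinearPlane.

(** * Lines of H(q) in small subspaces *)

Section Singular.
Variable F : fieldType.
Implicit Types (u v w x y z : 'rV[F]_7) (k : F).

Lemma singular_rank m (W : 'M[F]_(m, 7)) : (forall v : 'rV[F]_7, (v <= W)%MS -> Q6 v = 0) -> (\rank W <= 3)%N.
Proof.
move=> singular; pose Pa := \matrix_i partA (delta_mx 0 i : 'rV[F]_7); pose Pb := \matrix_i partB (delta_mx 0 i : 'rV[F]_7).
have PaE v : v *m Pa = partA v by apply: mul_rV_additive_fun; [exact: partAD | exact: partAZ].
have PbE v : v *m Pb = partB v by apply: mul_rV_additive_fun; [exact: partBD | exact: partBZ].
pose K := (W :&: kermx Pa)%MS.
have inK v : (v <= K)%MS -> [/\ (v <= W)%MS, partA v = 0 & cd v 3 = 0].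
  rewrite sub_capmx => /andP[vW /sub_kermxP]; rewrite PaE => A0; split=> //.
  by have := singular v vW; rewrite Q6E A0 dot0l sub0r => /eqP; rewrite oppr_eq0 expf_eq0 /= => /eqP.
have kerKb : \rank (K :&: kermx Pb)%MS = 0%N.
  apply/eqP; rewrite mxrank_eq0 -submx0; apply/row_subP => i.
  have := row_sub i (K :&: kermx Pb)%MS; rewrite sub_capmx => /andP[/inK[_ A0 t0] /sub_kermxP].
  by rewrite PbE => B0; rewrite submx0; apply/eqP; apply: rV7_eq; rewrite ?A0 ?B0 ?t0 ?parts0.
rewrite -(mxrank_mul_ker W Pa) -/K -(mxrank_mul_ker K Pb) kerKb addn0 -(mxrank_tr (K *m Pb)).
apply: mulmx0_rank_max; apply/matrixP => i j; rewrite [RHS]mxE.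
have [Kj A0 t0] := inK _ (row_sub j K); have Wi := row_sub i W.
have := singular _ (addmx_sub Wi Kj); rewrite Q6D !singular // /polar A0 t0 mulr0 mul0rn dot0l subr0 !addr0 add0r.
by rewrite -PaE -PbE -!row_mul dotE => <-; rewrite tr_row -row_mul !mxE; apply: eq_bigr => c _; rewrite !mxE.
Qed.

(* The traceless octonion u1 v2 + v1 u2 is collinear with both lines, so it vanishes. *)
Lemma regulus u1 u2 v1 v2 : u1 != 0 -> v1 != 0 -> Q6 u1 = 0 -> Q6 v1 = 0 -> collinear u1 u2 -> collinear v1 v2 ->
  ~~ (u2 <= u1)%MS -> ~~ (v2 <= v1)%MS -> ((u1 + u2) :&: (v1 + v2))%MS = 0 ->
  polar u1 v1 = 0 -> polar u2 v2 = 0 -> polar u1 v2 + polar v1 u2 = 0 ->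
  forall k, collinear (u1 + k *: v1) (u2 + k *: v2).
Proof.
move=> u10 v10 Qu1 Qv1 uu vv nu nv cap0 uv1 uv2 uv12 k.
have [Qu2 Qv2] := (collinear_singular u10 uu, collinear_singular v10 vv).
have [zu zv] : zmul (zemb u1) (zemb u2) = 0 /\ zmul (zemb v1) (zemb v2) = 0.
  by split; apply/eqP; rewrite zmul_zemb_eq0.
pose D := zmul (zemb u1) (zemb v2) + zmul (zemb v1) (zemb u2).
have [d eD] : exists d, D = zemb d.
  by apply: exists_zemb; rewrite ztraceD !ztrace_mul_zemb -opprD uv12 oppr0.
have u1d : collinear u1 d.
  rewrite -zmul_zemb_eq0 -eD zmulDr zemb_altl Qu1 oppr0 zscale0l add0r.
  by have := zemb_polarl u1 v1 (zemb u2); rewrite zu zmul0r addr0 uv1 oppr0 zscale0l => ->.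
have v1d : collinear v1 d.
  rewrite -zmul_zemb_eq0 -eD zmulDr zemb_altl Qv1 oppr0 zscale0l addr0.
  by have := zemb_polarl v1 u1 (zemb v2); rewrite zv zmul0r addr0 polarC uv1 oppr0 zscale0l => ->.
have u2d : collinear u2 d.
  rewrite collinear_sym -zmul_zemb_eq0 -eD zmulDl zemb_altr Qu2 oppr0 zscale0l addr0.
  by have := zemb_polarr v2 u2 (zemb u1); rewrite zu zmul0l addr0 polarC uv2 oppr0 zscale0l => ->.
have v2d : collinear v2 d.
  rewrite collinear_sym -zmul_zemb_eq0 -eD zmulDl zemb_altr Qv2 oppr0 zscale0l add0r.
  by have := zemb_polarr u2 v2 (zemb v1); rewrite zv zmul0l addr0 uv2 oppr0 zscale0l => ->.
have d0 : d = 0.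
  apply/eqP; rewrite -submx0 -cap0 sub_capmx (collinear_no_triangle u10 Qu1 uu u1d u2d nu).
  exact: (collinear_no_triangle v10 Qv1 vv v1d v2d nv).
rewrite -zmul_zemb_eq0 !zembD !zembZ !(zmulDl, zmulDr, zmulZl, zmulZr) zu zv !zscale0r addr0 add0r.
by rewrite -zscaleDr -/D eD d0 zemb0 zscale0r.
Qed.

Lemma singular_perp_line u v1 v2 : u != 0 -> v1 != 0 -> Q6 u = 0 -> Q6 v1 = 0 -> collinear v1 v2 ->
  ~~ (v2 <= v1)%MS -> ~~ (u <= v1 + v2)%MS -> polar u v1 = 0 -> polar u v2 = 0 ->
  exists z, [/\ z != 0, (z <= v1 + v2)%MS & collinear u z].
Proof.
move=> u0 v10 Qu Qv1 vv nv nu uv1 uv2.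
have [u_v1|nuv1] := boolP (collinear u v1); first by exists v1; split=> //; in_span.
have [w [w0 uw wv1]] := collinear_midpoint Qu Qv1 uv1 nuv1.
have [Qv2 Qw] := (collinear_singular v10 vv, collinear_singular u0 uw).
have v1w : collinear v1 w by rewrite collinear_sym.
have wv2_0 := collinear_polar2 v10 v1w vv.
have [vv0 uw0 wv1_0] := And3 (collinear_polar vv) (collinear_polar uw) (collinear_polar wv1).
have rank3 : \rank (v1 + v2 + u)%MS = 3%N by rewrite rank_adds_notin // rank_span2.
have : (w <= v1 + v2 + u)%MS.
  apply: contraT => nw; have := @singular_rank _ (v1 + v2 + u + w)%MS; rewrite rank_adds_notin // rank3.
  apply=> v /sub_adds_vecP[_ [k [/sub_span3P[k1 [k2 [k3 ->]]] ->]]].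
  rewrite !polarE Qu Qv1 Qv2 Qw vv0 [polar v1 u]polarC [polar v2 u]polarC [polar v1 w]polarC [polar v2 w]polarC.
  by rewrite uv1 uv2 uw0 wv1_0 wv2_0; ring.
case/sub_adds_vecP => z [k [zl ew]].
have uz : collinear u z.
  by rewrite -[z](addrK (k *: u)) -ew; apply: collinear_comb => //; rewrite collinearxx Qu.
have [z0|z0] := eqVneq z 0; last by exists z.
have k0 : k != 0 by apply: contraNneq w0 => k0; rewrite ew z0 k0 scale0r addr0.
case/negP: nuv1; move: v1w; rewrite ew z0 add0r => /(collinearZ k^-1).
by rewrite scalerA mulVf // scale1r collinear_sym.
Qed.

End Singular.

Section HexLines.
Variable F : finFieldType.
Local Notation q := #|F|.
Implicit Types (u v w x y z : 'rV[F]_7) (l m n S : 'M[F]_7) (k : F).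

Definition hexagon_lines : {set 'M[F]_7} := locked [set l | proj_sub 1 l &
  [forall x : 'rV[F]_7, forall y : 'rV[F]_7, [==> (x <= l)%MS, (y <= l)%MS => collinear x y]]].

Lemma hexagon_linesP l :
  reflect (proj_sub 1 l /\ forall x y, (x <= l)%MS -> (y <= l)%MS -> collinear x y) (l \in hexagon_lines).
Proof.
rewrite /hexagon_lines -lock inE; apply: (iffP andP) => -[rl coll]; split=> //.
  by move=> x y xl yl; move/forallP/(_ x)/forallP/(_ y): coll; rewrite xl yl.
by apply/forallP => x; apply/forallP => y; apply/implyP => xl; apply/implyP => yl; apply: coll.
Qed.

Lemma rank_hline l : l \in hexagon_lines -> \rank l = 2%N.
Proof. by case/hexagon_linesP => /andP[/eqP]. Qed.

Lemma genmx_hline l : l \in hexagon_lines -> <<l>>%MS = l.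
Proof. by case/hexagon_linesP => /andP[_ /eqP]. Qed.

Lemma hline_collinear l x y : l \in hexagon_lines -> (x <= l)%MS -> (y <= l)%MS -> collinear x y.
Proof. by case/hexagon_linesP => _; apply. Qed.

Lemma hline_singular l x : l \in hexagon_lines -> (x <= l)%MS -> Q6 x = 0.
Proof. by move=> Ll xl; apply/eqP; rewrite -collinearxx; apply: (hline_collinear Ll). Qed.

Lemma hline_eq l m : l \in hexagon_lines -> m \in hexagon_lines -> (l <= m)%MS -> l = m.
Proof.
move=> Ll Lm lm; rewrite -(genmx_hline Ll) -(genmx_hline Lm); apply: eq_genmx; apply/eqmxP; rewrite lm /=.
by apply: submx_rank_leq lm _; rewrite !rank_hline.
Qed.

Lemma hline_span l x y : l \in hexagon_lines -> x != 0 -> ~~ (y <= x)%MS -> (x <= l)%MS -> (y <= l)%MS ->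
  (l :=: x + y)%MS.
Proof. by move=> Ll x0 nyx xl yl; apply: eqmx_span2 => //; rewrite rank_hline. Qed.

Lemma hline_genmx_span l x y : l \in hexagon_lines -> x != 0 -> ~~ (y <= x)%MS -> (x <= l)%MS -> (y <= l)%MS ->
  l = <<(x + y)%MS>>%MS.
Proof.
by move=> Ll x0 nyx xl yl; rewrite -(genmx_hline Ll); apply: eq_genmx; apply: hline_span.
Qed.

Lemma collinear_span2 x y u v : Q6 x = 0 -> Q6 y = 0 -> collinear x y ->
  (u <= x + y)%MS -> (v <= x + y)%MS -> collinear u v.
Proof.
move=> Qx Qy xy /sub_span2P[c [d ->]] /sub_span2P[c' [d' ->]].
have comb z s r : collinear z x -> collinear z y -> collinear z (s *: x + r *: y).
  by move=> zx zy; apply: collinearD; apply: collinearZ.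
by apply: (comb); rewrite collinear_sym; apply: (comb); rewrite ?collinearxx ?Qx ?Qy // collinear_sym.
Qed.

Lemma hline_of_collinear x y : x != 0 -> ~~ (y <= x)%MS -> Q6 x = 0 -> collinear x y ->
  <<(x + y)%MS>>%MS \in hexagon_lines.
Proof.
move=> x0 nyx Qx xy; apply/hexagon_linesP; split.
  by rewrite /proj_sub mxrank_gen rank_span2 // genmx_id !eqxx.
by move=> u v; rewrite !genmxE; apply: collinear_span2 => //; apply: collinear_singular xy.
Qed.

(* The Grassmann relations give two of the four conditions for collinearity; their dot products with the A-parts
   give the others, except that t = t' = 0 needs a separate argument. *)
Lemma grassmann_collinear x y : Q6 x = 0 -> Q6 y = 0 -> polar x y = 0 -> hex_grassmann x y -> collinear x y.
Proof.
move=> Qx Qy xy0; rewrite -{1}(mk7K x) -{1}(mk7K y) => /hex_grassmann_mk7[AA BB].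
move: Qx Qy xy0; rewrite !Q6E /polar => /subr0_eq Qx /subr0_eq Qy /subr0_eq xy0.
have x_AA := congr1 (dot (partA x)) AA; have y_AA := congr1 (dot (partA y)) AA.
move: x_AA y_AA; rewrite dot_crossl dot_crossr !dotBr !dotZr Qx Qy => x_AA y_AA.
suff AB : dot (partA x) (partB y) = cd x 3 * cd y 3.
  apply/collinearP; split=> //; apply: (addrI (dot (partA x) (partB y))); rewrite xy0 AB; ring.
have [t0|t0] := eqVneq (cd x 3) 0; last first.
  by apply: (mulfI t0); apply/eqP; rewrite -subr_eq0 [X in _ == X]x_AA; apply/eqP; ring.
have [t'0|t'0] := eqVneq (cd y 3) 0; last first.
  have BA : dot (partA y) (partB x) = 0.
    by apply: (mulfI t'0); move: y_AA; rewrite t0 mul0r sub0r mulr0 => /esym/eqP; rewrite oppr_eq0 => /eqP.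
  by move: xy0; rewrite BA t0 mul0r addr0 mul0rn.
rewrite t0 mul0r; move: AA; rewrite t0 t'0 !scale0r subrr => AA.
have [->|a0] := eqVneq (partA x) 0; first by rewrite dot0l.
have [k ek] := cross_eq0P a0 AA.
by move: xy0; rewrite ek dotZl Qx t0 mul0r mul0rn expr0n /= mulr0 addr0.
Qed.

Lemma hexagon_linesE l : l \in hexagon_lines <-> hex_line l.
Proof.
split=> [Ll|[rl Ql [x [y [/andP[xy_l l_xy] grass]]]]].
  split; [by case/hexagon_linesP: Ll | by move=> v; apply: hline_singular | ].
  have [x [y [x0 nyx el]]] := exists_span2 (rank_hline Ll); exists x, y.
  have [xl yl] : (x <= l)%MS /\ (y <= l)%MS by rewrite !el; split; in_span.
  split; first by apply/andP; split; rewrite el addsmxE.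
  by rewrite -(mk7K x) -(mk7K y); apply/hex_grassmann_mk7; case/collinearP: (hline_collinear Ll xl yl).
rewrite -addsmxE in xy_l; rewrite -addsmxE in l_xy.
have [xl yl] : (x <= l)%MS /\ (y <= l)%MS by split; apply: submx_trans xy_l; in_span.
have [Qx Qy] := (Ql _ xl, Ql _ yl).
have xy0 : polar x y = 0 by have := Ql _ (addmx_sub xl yl); rewrite Q6D Qx Qy !add0r.
have xy := grassmann_collinear Qx Qy xy0 grass.
apply/hexagon_linesP; split=> // u v ul vl.
exact: collinear_span2 Qx Qy xy (submx_trans ul l_xy) (submx_trans vl l_xy).
Qed.

Lemma hline_sub_collinear_plane l x : l \in hexagon_lines -> (x <= l)%MS -> (l <= collinear_plane x)%MS.
Proof. by move=> Ll xl; apply/row_subP => i; rewrite in_collinear_plane (hline_collinear Ll) // row_sub. Qed.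

Lemma mem_hline l x : x != 0 -> Q6 x = 0 -> l \in hexagon_lines -> (l <= collinear_plane x)%MS -> (x <= l)%MS.
Proof.
move=> x0 Qx Ll lx; have [y [z [y0 nz el]]] := exists_span2 (rank_hline Ll).
have [yl zl] : (y <= l)%MS /\ (z <= l)%MS by rewrite !el; split; in_span.
have [xy xz] : collinear x y /\ collinear x z by rewrite -!in_collinear_plane !(submx_trans _ lx).
have [yx|nyx] := boolP (y <= x)%MS; first by apply: submx_trans yl; apply: submx_vec_sym yx.
have zxy := collinear_no_triangle x0 Qx xy xz (hline_collinear Ll yl zl) nyx.
apply: (@submx_trans _ _ _ _ _ _ (x + y)%MS); first by in_span.
by apply: submx_rank_leq; [rewrite el; in_span | rewrite (rank_hline Ll) rank_span2].
Qed.

Lemma card_hlines_thru x : x != 0 -> Q6 x = 0 -> #|[set l in hexagon_lines | (x <= l)%MS]| = q.+1.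
Proof.
move=> x0 Qx; have q_gt1 := card_field_gt1 F.
pose W := [set l in hexagon_lines | (x <= l)%MS]; pose B := vset (collinear_plane x) :\: vset x.
have xx : (x <= collinear_plane x)%MS by rewrite in_collinear_plane collinearxx Qx.
have cB : #|B| = (q ^ 3 - q)%N by rewrite card_vsetD // rank_collinear_plane // rank_rV1 // expn1.
have W_B l : l \in W -> #|[set y in B | (y <= l)%MS]| = (q ^ 2 - q)%N.
  rewrite inE => /andP[Ll xl]; have := card_vsetD xl; rewrite (rank_hline Ll) rank_rV1 // expn1 => <-.
  apply: eq_card => y; rewrite !inE -andbA; congr (_ && _); rewrite andb_idl // => yl.
  exact: submx_trans yl (hline_sub_collinear_plane Ll xl).
have B_W y : y \in B -> #|[set l in W | (y <= l)%MS]| = 1%N.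
  rewrite !inE in_collinear_plane => /andP[nyx xy].
  transitivity #|[set <<(x + y)%MS>>%MS]|; last exact: cards1.
  have Lxy := hline_of_collinear x0 nyx Qx xy; apply: eq_card => l; rewrite !inE.
  apply/andP/eqP => [[/andP[Ll xl] yl]|->]; first exact: hline_genmx_span.
  by rewrite Lxy !genmxE; split=> /=; in_span.
have := eq_double_counting W_B B_W; rewrite -/W cB muln1 => count.
have qq : (0 < q ^ 2 - q)%N by rewrite subn_gt0 -{1}(expn1 q) ltn_exp2l.
apply/eqP; rewrite -(eqn_pmul2r qq) count; move: q_gt1; clear; case: #|F| => // k _.
by apply/eqP; rewrite !expnS expn0; nia.
Qed.

Lemma nb_in_collinear_plane x S : x != 0 -> Q6 x = 0 -> (S :=: collinear_plane x)%MS -> nb_in hexagon_lines S = q.+1.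
Proof.
move=> x0 Qx eS; rewrite -(card_hlines_thru x0 Qx) /nb_in; apply: eq_card => l; rewrite !inE.
have [Ll|//] := boolP (l \in hexagon_lines); rewrite /= eS.
by apply/idP/idP => [lx|xl]; [exact: mem_hline | exact: hline_sub_collinear_plane].
Qed.

Lemma collinear_plane_sub_meet l m x : l \in hexagon_lines -> m \in hexagon_lines -> l != m ->
  x != 0 -> (x <= l)%MS -> (x <= m)%MS -> (collinear_plane x <= l + m)%MS.
Proof.
move=> Ll Lm nlm x0 xl xm; have Qx := hline_singular Ll xl.
have lm_x : (l + m <= collinear_plane x)%MS by rewrite addsmx_sub !hline_sub_collinear_plane.
apply: submx_rank_leq lm_x _; rewrite rank_collinear_plane // ltnNge; apply: contra nlm => rank_lm.
apply/eqP; apply: (hline_eq Ll Lm); apply: submx_trans (addsmxSl l m) _.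
by apply: submx_rank_leq; [exact: addsmxSr | rewrite (rank_hline Lm)].
Qed.

Lemma nb_in_hlines_plane S : (\rank S <= 3)%N -> nb_in hexagon_lines S \in [:: 0%N; 1%N; q.+1].
Proof.
move=> rS; have [nb1|] := leqP (nb_in hexagon_lines S) 1.
  by move: nb1; rewrite !inE; case: (nb_in _ _) => [|[|//]].
case/card_gt1P => l [m []]; rewrite !inE => /andP[Ll lS] /andP[Lm mS] nlm.
have [|x [x0 xl xm]] := cap_nonzero_vec lS mS; first by rewrite (rank_hline Ll) (rank_hline Lm).
have Qx := hline_singular Ll xl; rewrite (@nb_in_collinear_plane x) // ?eqxx ?orbT //; apply/eqmx_sym/eqmxP.
have xS : (collinear_plane x <= S)%MS.
  by apply: submx_trans (collinear_plane_sub_meet Ll Lm nlm x0 xl xm) _; rewrite addsmx_sub lS.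
by rewrite xS; apply: submx_rank_leq xS _; rewrite rank_collinear_plane.
Qed.

Section MeetingLines.
Variables (S : 'M[F]_7) (x z : 'rV[F]_7).
Hypotheses (rank_S : \rank S = 4%N) (x0 : x != 0) (z0 : z != 0) (Qx : Q6 x = 0) (nzx : ~~ (z <= x)%MS).
Hypotheses (xz : collinear x z) (xS : (collinear_plane x <= S)%MS) (zS : (collinear_plane z <= S)%MS).
Let Qz : Q6 z = 0 := collinear_singular x0 xz.
Let zx : collinear z x. Proof. by rewrite collinear_sym. Qed.

(* S is spanned by x, z and points u, v of the planes of x and of z, and Q6 restricted to S is k3 k4 polar u v. *)
Lemma singular_sub_collinear_planes y : (y <= S)%MS -> Q6 y = 0 -> collinear x y || collinear z y.
Proof.
have r2 : \rank (x + z)%MS = 2%N by rewrite rank_span2.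
have [|u [ux nu]] := @exists_notin _ _ _ _ (x + z)%MS (collinear_plane x); first by rewrite r2 rank_collinear_plane.
have [|v [vz nv]] := @exists_notin _ _ _ _ (x + z)%MS (collinear_plane z); first by rewrite r2 rank_collinear_plane.
have [uS vS] := (submx_trans ux xS, submx_trans vz zS); rewrite !in_collinear_plane in ux vz.
have [xx zz] : collinear x x /\ collinear z z by rewrite !collinearxx Qx Qz.
have xzu : (collinear_plane x <= x + z + u)%MS.
  apply: submx_rank_leq; last by rewrite rank_collinear_plane // rank_adds_notin // r2.
  by rewrite !addsmx_sub !in_collinear_plane xx xz ux.
have nv4 : ~~ (v <= x + z + u)%MS.
  apply: contra nv => v_xzu; apply: (collinear_no_triangle x0 Qx xz _ vz nzx).
  rewrite -in_collinear_plane; apply: submx_trans v_xzu _; rewrite !addsmx_sub !in_collinear_plane xx xz; exact: ux.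
have S_span : (S <= x + z + u + v)%MS.
  apply: submx_rank_leq; last by rewrite rank_S (rank_adds_notin nv4) (rank_adds_notin nu) r2.
  by rewrite !addsmx_sub uS vS !(submx_trans _ xS) ?in_collinear_plane.
have [Qu Qv] := (collinear_singular x0 ux, collinear_singular z0 vz).
have [xz0 xu0 zv0] := And3 (collinear_polar xz) (collinear_polar ux) (collinear_polar vz).
have [zu0 xv0] := (collinear_polar2 x0 xz ux, collinear_polar2 z0 zx vz).
have QS k1 k2 k3 k4 : Q6 (k1 *: x + k2 *: z + k3 *: u + k4 *: v) = k3 * k4 * polar u v.
  by rewrite !polarE Qu Qv Qx Qz xz0 xu0 zv0 zu0 xv0; ring.
have uv0 : polar u v != 0.
  apply/eqP => uv0; suff : (4 <= 3)%N by []; rewrite -rank_S; apply: singular_rank => w wS.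
  case/sub_adds_vecP: (submx_trans wS S_span) => _ [k4 [/sub_span3P[k1 [k2 [k3 ->]]] ->]].
  by rewrite QS uv0 mulr0.
move=> yS; case/sub_adds_vecP: (submx_trans yS S_span) => _ [k4 [/sub_span3P[k1 [k2 [k3 ->]]] ->]].
rewrite QS => /eqP; rewrite !mulf_eq0 (negbTE uv0) orbF => /orP[]/eqP->; rewrite scale0r addr0.
  by apply/orP; right; rewrite !collinearD ?collinearZ.
by apply/orP; left; rewrite !collinearD ?collinearZ.
Qed.

Lemma hline_thru_either p : p \in hexagon_lines -> (p <= S)%MS -> (x <= p)%MS || (z <= p)%MS.
Proof.
move=> Lp pS; have [px|] := boolP (p <= collinear_plane x)%MS; first by rewrite (mem_hline x0 Qx Lp px).
case/row_subPn => i nix; have [pz|] := boolP (p <= collinear_plane z)%MS; first by rewrite (mem_hline z0 Qz Lp pz) orbT.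
case/row_subPn => j njz; have [ip jp] := (row_sub i p, row_sub j p).
have either w : (w <= p)%MS -> (w <= collinear_plane x)%MS || (w <= collinear_plane z)%MS.
  move=> wp; rewrite !in_collinear_plane.
  exact: singular_sub_collinear_planes (submx_trans wp pS) (hline_singular Lp wp).
have iz : (row i p <= collinear_plane z)%MS by have := either _ ip; rewrite (negbTE nix).
have jx : (row j p <= collinear_plane x)%MS by have := either _ jp; rewrite (negbTE njz) orbF.
have := either _ (addmx_sub ip jp); rewrite (addmx_subl _ iz) (negbTE njz) orbF.
by rewrite (addmx_subr _ jx) (negbTE nix).
Qed.

Lemma nb_in_meeting_solid : nb_in hexagon_lines S = (2 * q).+1.
Proof.
pose X := [set p in hexagon_lines | (x <= p)%MS]; pose Z := [set p in hexagon_lines | (z <= p)%MS].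
have S_XZ : [set p in hexagon_lines | (p <= S)%MS] = X :|: Z.
  apply/setP => p; rewrite !inE; have [Lp|//] := boolP (p \in hexagon_lines); rewrite /=.
  apply/idP/orP => [/(hline_thru_either Lp)/orP//|[xp|zp]].
    exact: submx_trans (hline_sub_collinear_plane Lp xp) xS.
  exact: submx_trans (hline_sub_collinear_plane Lp zp) zS.
have XZ : X :&: Z = [set <<(x + z)%MS>>%MS].
  apply/setP => p; rewrite !inE; apply/idP/eqP => [/andP[/andP[Lp xp] /andP[_ zp]]|->]; first exact: hline_genmx_span.
  by rewrite (hline_of_collinear x0 nzx Qx xz) !genmxE /=; apply/andP; split; in_span.
rewrite /nb_in S_XZ cardsU XZ cards1 (card_hlines_thru x0 Qx) (card_hlines_thru z0 Qz).
by clear; lia.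
Qed.

End MeetingLines.

Lemma nb_in_solid_meet S x l m : \rank S = 4%N -> l \in hexagon_lines -> m \in hexagon_lines -> l != m ->
  (l <= S)%MS -> (m <= S)%MS -> x != 0 -> (x <= l)%MS -> (x <= m)%MS ->
  nb_in hexagon_lines S \in [:: q.+1; (2 * q).+1].
Proof.
move=> rS Ll Lm nlm lS mS x0 xl xm; have Qx := hline_singular Ll xl.
have xS : (collinear_plane x <= S)%MS.
  by apply: submx_trans (collinear_plane_sub_meet Ll Lm nlm x0 xl xm) _; rewrite addsmx_sub lS.
have [/forall_inP thru_x|] := boolP [forall (n | (n \in hexagon_lines) && (n <= S)%MS), (x <= n)%MS].
  rewrite inE; apply/orP; left; apply/eqP; rewrite -(card_hlines_thru x0 Qx); apply: eq_card => n; rewrite !inE.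
  have [Ln|//] := boolP (n \in hexagon_lines); rewrite /=.
  apply/idP/idP => [nS|xn]; first by apply: thru_x; rewrite Ln.
  exact: submx_trans (hline_sub_collinear_plane Ln xn) xS.
rewrite negb_forall_in => /exists_inP[n /andP[Ln nS] nxn].
have [|z [z0 zx zn]] := cap_nonzero_vec xS nS; first by rewrite rank_collinear_plane // (rank_hline Ln) rS.
rewrite in_collinear_plane in zx; have Qz := hline_singular Ln zn.
have nzx : ~~ (z <= x)%MS by apply: contra nxn => /(submx_vec_sym z0) xz; apply: submx_trans zn.
have zS : (collinear_plane z <= S)%MS.
  have nx_z : (n + x <= collinear_plane z)%MS.
    by rewrite addsmx_sub (hline_sub_collinear_plane Ln zn) in_collinear_plane collinear_sym.
  apply: submx_trans (submx_rank_leq nx_z _) _.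
    by rewrite rank_collinear_plane // rank_adds_notin // (rank_hline Ln).
  by rewrite addsmx_sub nS (submx_trans xl lS).
by rewrite (nb_in_meeting_solid rS x0 z0 Qx nzx zx xS zS) !inE eqxx orbT.
Qed.

End HexLines.

Section DisjointLines.
Variables (F : finFieldType) (S : 'M[F]_7).
Local Notation q := #|F|.
Local Notation hlines := (hexagon_lines F).
Local Notation linesS := [set m in hlines | (m <= S)%MS].
Implicit Types (u v w x y z p : 'rV[F]_7) (l m n : 'M[F]_7) (k : F).
Hypothesis rank_S : \rank S = 4%N.
Hypothesis disjoint : forall m n x,
  m \in linesS -> n \in linesS -> x != 0 -> (x <= m)%MS -> (x <= n)%MS -> m = n.

Let linesSP m : m \in linesS -> m \in hlines /\ (m <= S)%MS. Proof. by rewrite inE => /andP. Qed.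

Lemma disjoint_notin m n x : m \in linesS -> n \in linesS -> m != n -> x != 0 -> (x <= m)%MS -> ~~ (x <= n)%MS.
Proof. by move=> mS nS nmn x0 xm; apply: contra nmn => xn; apply/eqP; apply: disjoint xn. Qed.

Lemma disjoint_cap m n : m \in linesS -> n \in linesS -> m != n -> (m :&: n)%MS = 0.
Proof.
move=> mS nS nmn; apply/eqP; rewrite -submx0; apply/row_subP => i; rewrite submx0.
have := row_sub i (m :&: n)%MS; rewrite sub_capmx => /andP[im in_n].
by apply: contraT => r0; rewrite (negbTE (disjoint_notin mS nS nmn r0 im)) in in_n.
Qed.

Lemma disjoint_span m n : m \in linesS -> n \in linesS -> m != n -> (S <= m + n)%MS.
Proof.
move=> mS nS nmn; have [[Lm mS'] [Ln nS']] := (linesSP mS, linesSP nS).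
apply: submx_rank_leq; first by rewrite addsmx_sub mS'.
have := mxrank_sum_cap m n; rewrite (disjoint_cap mS nS nmn) mxrank0 addn0 => ->.
by rewrite rank_S !rank_hline.
Qed.

Lemma disjoint_not_collinear m n u v : m \in linesS -> n \in linesS -> m != n ->
  u != 0 -> v != 0 -> (u <= m)%MS -> (v <= n)%MS -> ~~ collinear u v.
Proof.
move=> mS nS nmn u0 v0 um vn; have [[Lm mS'] [Ln nS']] := (linesSP mS, linesSP nS); apply/negP => uv.
have nvu : ~~ (v <= u)%MS.
  apply: contraNN (disjoint_notin mS nS nmn u0 um) => vu; apply: submx_trans vn; exact: submx_vec_sym vu.
have uvS : <<(u + v)%MS>>%MS \in linesS.
  rewrite inE hline_of_collinear ?(hline_singular Lm um) // genmxE addsmx_sub.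
  by rewrite (submx_trans um mS') (submx_trans vn nS').
have [u_uv v_uv] : (u <= <<(u + v)%MS>>)%MS /\ (v <= <<(u + v)%MS>>)%MS by rewrite !genmxE; split; in_span.
case/eqP: nmn; transitivity <<(u + v)%MS>>%MS; first exact: disjoint u_uv.
exact: disjoint vn.
Qed.

Lemma disjoint_polar m n u x y : m \in linesS -> n \in linesS -> m != n -> u != 0 -> (u <= m)%MS ->
  x != 0 -> ~~ (y <= x)%MS -> (x <= n)%MS -> (y <= n)%MS -> ~~ ((polar u x == 0) && (polar u y == 0)).
Proof.
move=> mS nS nmn u0 um x0 nyx xn yn; have [[Lm _] [Ln _]] := (linesSP mS, linesSP nS).
apply/negP => /andP[/eqP ux /eqP uy]; have en := hline_span Ln x0 nyx xn yn.
have nu : ~~ (u <= x + y)%MS by rewrite -en; apply: disjoint_notin um.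
have [z [z0 zn uz]] := singular_perp_line u0 x0 (hline_singular Lm um) (hline_singular Ln xn)
  (hline_collinear Ln xn yn) nyx nu ux uy.
by rewrite -en in zn; have /negP := disjoint_not_collinear mS nS nmn u0 z0 um zn.
Qed.

Lemma exists_polar0 u n : n \in hlines -> exists v, [/\ v != 0, (v <= n)%MS & polar u v = 0].
Proof.
move=> Ln; have [x [y [x0 nyx en]]] := exists_span2 (rank_hline Ln).
have [xn yn] : (x <= n)%MS /\ (y <= n)%MS by rewrite !en; split; in_span.
have [ux0|ux0] := eqVneq (polar u x) 0; first by exists x.
exists (polar u x *: y - polar u y *: x); split; last 2 first.
- by in_span.
- by rewrite -scaleNr polarDr !polarZr; ring.
by apply: contraNneq nyx => /subr0_eq e; rewrite -(scalemx_sub_eq _ _ ux0) e; in_span.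
Qed.

Lemma exists_regulus_basis l n : l \in linesS -> n \in linesS -> l != n -> exists u1 u2 v1 v2,
  [/\ [/\ u1 != 0, ~~ (u2 <= u1)%MS, (u1 <= l)%MS & (u2 <= l)%MS],
      [/\ v1 != 0, ~~ (v2 <= v1)%MS, (v1 <= n)%MS & (v2 <= n)%MS],
      [/\ polar u1 v1 = 0, polar u2 v2 = 0 & polar u1 v2 + polar v1 u2 = 0] & polar u1 v2 != 0].
Proof.
move=> lS nS nln; have nnl : n != l by rewrite eq_sym.
have [[Ll _] [Ln _]] := (linesSP lS, linesSP nS).
have [u1 [u2 [u10 nu el]]] := exists_span2 (rank_hline Ll).
have [u1l u2l] : (u1 <= l)%MS /\ (u2 <= l)%MS by rewrite !el; split; in_span.
have [v1 [v10 v1n uv1]] := exists_polar0 u1 Ln; have [v2 [v20 v2n uv2]] := exists_polar0 u2 Ln.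
have nv : ~~ (v2 <= v1)%MS.
  apply/negP => /sub_rVP[k ev2]; have k0 : k != 0 by apply: contraNneq v20 => k0; rewrite ev2 k0 scale0r.
  have := disjoint_polar nS lS nnl v10 v1n u10 nu u1l u2l; rewrite polarC uv1 eqxx /= polarC.
  by move: uv2; rewrite ev2 polarZr => /eqP; rewrite mulf_eq0 (negbTE k0) /= => ->.
have uv12 : polar u1 v2 != 0.
  by have := disjoint_polar lS nS nln u10 u1l v10 nv v1n v2n; rewrite uv1 eqxx.
have uv21 : polar u2 v1 != 0.
  by have := disjoint_polar lS nS nln (notsub_neq0 nu) u2l v10 nv v1n v2n; rewrite uv2 eqxx andbT.
pose k := - (polar u2 v1 / polar u1 v2); have k0 : k != 0 by rewrite oppr_eq0 mulf_neq0 ?invr_eq0.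
exists u1, u2, v1, (k *: v2); split; last by rewrite polarZr mulf_neq0.
- by [].
- by split=> //; [rewrite (scalemx_sub_eq _ _ k0) | apply: scalemx_sub].
- by rewrite !polarZr uv2 mulr0 mulNr divfK // [polar v1 u2]polarC addNr.
Qed.

Section RegulusLines.
Variables (l n : 'M[F]_7) (u1 u2 v1 v2 : 'rV[F]_7).
Hypotheses (lS : l \in linesS) (nS : n \in linesS) (nln : l != n).
Hypotheses (u10 : u1 != 0) (nu : ~~ (u2 <= u1)%MS) (u1l : (u1 <= l)%MS) (u2l : (u2 <= l)%MS).
Hypotheses (v10 : v1 != 0) (nv : ~~ (v2 <= v1)%MS) (v1n : (v1 <= n)%MS) (v2n : (v2 <= n)%MS).
Hypotheses (uv1 : polar u1 v1 = 0) (uv2 : polar u2 v2 = 0) (uv12 : polar u1 v2 + polar v1 u2 = 0).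
Hypothesis uv0 : polar u1 v2 != 0.

Definition regulus_line k := <<((u1 + k *: v1)%R + (u2 + k *: v2)%R)%MS>>%MS.

Let Ll : l \in hlines. Proof. by have [] := linesSP lS. Qed.
Let Ln : n \in hlines. Proof. by have [] := linesSP nS. Qed.
Let l_S : (l <= S)%MS. Proof. by have [] := linesSP lS. Qed.
Let n_S : (n <= S)%MS. Proof. by have [] := linesSP nS. Qed.
Let el := hline_span Ll u10 nu u1l u2l.
Let en := hline_span Ln v10 nv v1n v2n.
Let uu : collinear u1 u2 := hline_collinear Ll u1l u2l.
Let vv : collinear v1 v2 := hline_collinear Ln v1n v2n.

Let cap0 p : (p <= l)%MS -> (p <= n)%MS -> p = 0.
Proof. by move=> pl pn; apply/eqP; apply: contraTT pn => p0; apply: disjoint_notin pl. Qed.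

Lemma regulus_line_basis k : u1 + k *: v1 != 0 /\ ~~ ((u2 + k *: v2)%R <= (u1 + k *: v1)%R)%MS.
Proof.
split.
  by apply: contraNneq u10 => /eqP; rewrite addr_eq0 => /eqP eu; apply/eqP; apply: cap0; rewrite // eu; in_span.
apply/negP => /sub_rVP[c e]; case/negP: nu; rewrite (_ : u2 = c *: u1) ?scalemx_sub //.
apply/eqP; rewrite -subr_eq0; apply/eqP; apply: cap0; first by in_span.
rewrite (_ : u2 - c *: u1 = c * k *: v1 - k *: v2); first by in_span.
by transitivity (u2 + k *: v2 - k *: v2 - c *: u1); [rV_ring | rewrite e; rV_ring].
Qed.

Lemma regulus_line_in k : regulus_line k \in linesS.
Proof.
have [Qu1 Qv1] := (hline_singular Ll u1l, hline_singular Ln v1n); have [x0 nyx] := regulus_line_basis k.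
have cap_uv : ((u1 + u2) :&: (v1 + v2))%MS = 0.
  by apply/eqP; rewrite -submx0 -(disjoint_cap lS nS nln); apply: capmxS; rewrite ?el ?en.
rewrite inE; apply/andP; split.
  apply: hline_of_collinear => //; first by rewrite !polarE Qu1 Qv1 uv1; ring.
  exact: regulus.
have [u1S u2S] := (submx_trans u1l l_S, submx_trans u2l l_S).
have [v1S v2S] := (submx_trans v1n n_S, submx_trans v2n n_S).
by rewrite genmxE; in_span.
Qed.

Lemma regulus_line_neq k : regulus_line k != n.
Proof.
apply/eqP => e_n; case/eqP: u10; apply: cap0 => //; rewrite -(addrK (k *: v1) u1).
have k_n : ((u1 + k *: v1)%R <= n)%MS by rewrite -e_n genmxE; in_span.
by in_span.
Qed.

Lemma regulus_line_inj : injective regulus_line.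
Proof.
move=> k k' e; apply/eqP; apply: contraT => nkk'; case/eqP: (regulus_line_neq k).
apply: (disjoint (regulus_line_in k) nS v10) => //; rewrite -subr_eq0 in nkk'.
rewrite -(scalemx_sub_eq _ _ nkk') (_ : _ *: v1 = (u1 + k *: v1) - (u1 + k' *: v1)); last by rV_ring.
have k_k : ((u1 + k *: v1)%R <= regulus_line k)%MS by rewrite genmxE; in_span.
have k'_k : ((u1 + k' *: v1)%R <= regulus_line k)%MS by rewrite e genmxE; in_span.
by in_span.
Qed.

(* A further line m meets u1 + n and u2 + n in points u1 + a v1 + b v2 and u2 + c v1 + d v2; these are singular
   and orthogonal only for b = c = 0 and a = d. *)
Lemma regulus_line_onto m : m \in linesS -> m != n -> exists k, m = regulus_line k.
Proof.
move=> mS nmn; have [Lm _] := linesSP mS; have Sm := disjoint_span mS nS nmn.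
have meet u : (u <= l)%MS -> exists a b : F, ((u + a *: v1 + b *: v2)%R <= m)%MS.
  move=> ul; have [y [p [ym pn eu]]] := sub_adds_rVP (submx_trans (submx_trans ul l_S) Sm).
  move: pn; rewrite en => /sub_span2P[a [b ep]]; exists (- a), (- b).
  by rewrite (_ : _ + _ = y) // eu ep; rV_ring.
have [[a [b y1m]] [c [d y2m]]] := (meet u1 u1l, meet u2 u2l).
have [Qu1 Qu2] := (hline_singular Ll u1l, hline_singular Ll u2l).
have [Qv1 Qv2] := (hline_singular Ln v1n, hline_singular Ln v2n).
have [uu0 vv0] := (collinear_polar uu, collinear_polar vv).
have uv21 : polar v1 u2 = - polar u1 v2 by apply/eqP; rewrite -addr_eq0 addrC uv12.
have uv21' : polar u2 v1 = - polar u1 v2 by rewrite polarC.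
have b0 : b = 0.
  have /eqP := hline_singular Lm y1m; rewrite !polarE Qu1 Qv1 Qv2 uv1 vv0 !(mulr0, addr0, add0r).
  by rewrite mulf_eq0 (negbTE uv0) orbF => /eqP.
have c0 : c = 0.
  have /eqP := hline_singular Lm y2m; rewrite !polarE Qu2 Qv1 Qv2 uv2 vv0 uv21' !(mulr0, addr0, add0r).
  by rewrite mulf_eq0 oppr_eq0 (negbTE uv0) orbF => /eqP.
rewrite b0 c0 !scale0r !addr0 in y1m y2m.
have ad : a = d.
  have /eqP := collinear_polar (hline_collinear Lm y1m y2m); rewrite !polarE uu0 vv0 uv21.
  rewrite (_ : _ + _ = (d - a) * polar u1 v2); last by ring.
  by rewrite mulf_eq0 (negbTE uv0) orbF subr_eq0 => /eqP.
exists a; have [x0 nyx] := regulus_line_basis a; rewrite -ad in y2m.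
exact: hline_genmx_span.
Qed.

Lemma card_regulus_lines : #|linesS| = q.+1.
Proof.
have -> : linesS = n |: [set regulus_line k | k in [set: F]].
  apply/setP => m; apply/idP/setU1P => [mS|[->|/imsetP[k _ ->]]] //; last exact: regulus_line_in.
  have [->|nmn] := eqVneq m n; first by left.
  by have [k ->] := regulus_line_onto mS nmn; right; rewrite imset_f.
rewrite cardsU1 card_imset ?cardsT; last exact: regulus_line_inj.
have -> : n \notin [set regulus_line k | k in [set: F]]; last by rewrite add1n.
by apply/imsetP => -[k _ /esym/eqP]; rewrite (negbTE (regulus_line_neq k)).
Qed.

End RegulusLines.

Lemma nb_in_disjoint_solid l n : l \in linesS -> n \in linesS -> l != n -> nb_in hlines S = q.+1.
Proof.
move=> lS nS nln; have [u1 [u2 [v1 [v2 [[u10 nu u1l u2l] [v10 nv v1n v2n] [uv1 uv2 uv12] uv0]]]]] :=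
  exists_regulus_basis lS nS nln.
exact: (card_regulus_lines lS nS nln u10 nu u1l u2l v10 nv v1n v2n uv1 uv2 uv12 uv0).
Qed.

End DisjointLines.

Lemma nb_in_hlines_solid (F : finFieldType) (S : 'M[F]_7) : (\rank S <= 4)%N ->
  nb_in (hexagon_lines F) S \in [:: 0%N; 1%N; #|F|.+1; (2 * #|F|).+1].
Proof.
rewrite leq_eqVlt => /orP[/eqP rS|rS]; last first.
  by have := nb_in_hlines_plane rS; rewrite !inE => /or3P[]/eqP->; rewrite eqxx ?orbT.
have [nb1|] := leqP (nb_in (hexagon_lines F) S) 1.
  by move: nb1; rewrite !inE; case: (nb_in _ _) => [|[|//]].
case/card_gt1P => l [n [lS nS nln]].
have [/exists_inP[m mS /exists_inP[m' m'S /existsP[x /and4P[nmm' x0 xm xm']]]]|none] := boolP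
  [exists m in [set m in hexagon_lines F | (m <= S)%MS], exists m' in [set m in hexagon_lines F | (m <= S)%MS],
   exists x : 'rV[F]_7, [&& m != m', x != 0, (x <= m)%MS & (x <= m')%MS]].
  move: mS m'S; rewrite !inE => /andP[Lm mS] /andP[Lm' m'S].
  have := nb_in_solid_meet rS Lm Lm' nmm' mS m'S x0 xm xm'.
  by rewrite !inE => /orP[]/eqP->; rewrite eqxx ?orbT.
rewrite (nb_in_disjoint_solid rS _ lS nS nln) ?inE ?eqxx ?orbT // => m m' x mS m'S x0 xm xm'.
apply/eqP; apply: contraNT none => nmm'; apply/exists_inP; exists m => //; apply/exists_inP; exists m' => //.
by apply/existsP; exists x; rewrite nmm' x0 xm.
Qed.

(** * Counting lines of H(q) *)

Section HexCount.
Variable F : finFieldType.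
Local Notation q := #|F|.
Local Notation hlines := (hexagon_lines F).
Implicit Types (x y z c v : 'rV[F]_7) (l m n S : 'M[F]_7) (k : F) (C : zorn F).
Let q_gt1 := card_field_gt1 F.

Lemma card_partA0_singular (t : F) :
  #|[set b : 'rV[F]_3 | dot 0 b == t ^+ 2]| = if t == 0 then (q ^ 3)%N else 0%N.
Proof.
have [->|t0] := eqVneq t 0.
  by rewrite (_ : [set b | _] = setT) ?cardsT ?card_mx ?mul1n //; apply/setP => b; rewrite !inE dot0l expr0n eqxx.
by apply/eqP; rewrite cards_eq0; apply/eqP/setP => b; rewrite !inE dot0l eq_sym expf_eq0 (negbTE t0).
Qed.

Lemma card_singular_leq_fibres : (#|[set x : 'rV[F]_7 | Q6 x == 0%R]| <=
  \sum_(p : 'rV[F]_3 * F) #|[set b : 'rV[F]_3 | dot p.1 b == (p.2 ^+ 2)%R]|)%N.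
Proof.
pose A := [set x : 'rV[F]_7 | Q6 x == 0]; pose at_p x (p : 'rV[F]_3 * F) := (partA x, cd x 3) == p.
have := double_counting A [set: 'rV[F]_3 * F] at_p; rewrite (eq_bigr (fun=> 1%N)) => [|x _]; last first.
  transitivity #|[set (partA x, cd x 3)]|; last exact: cards1.
  by apply: eq_card => p; rewrite !inE eq_sym.
rewrite sum1_card -/A => ->; rewrite (eq_bigl predT) => [|p]; last by rewrite inE.
apply: leq_sum => p _; have inj : {in [set x in A | at_p x p] &, injective (@partB F)}.
  by move=> x y; rewrite !inE => /andP[_ /eqP<-] /andP[_ /eqP[eA e3]] eB; apply: rV7_eq.
rewrite -(card_in_imset inj); apply: subset_leq_card; apply/subsetP => b /imsetP[x].
by rewrite !inE => /andP[Qx /eqP<-] -> /=; move: Qx; rewrite Q6E subr_eq0.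
Qed.

Lemma card_singular_leq : (#|[set x : 'rV[F]_7 | Q6 x == 0%R]| <= q ^ 6)%N.
Proof.
apply: leq_trans card_singular_leq_fibres _; pose fibre (p : 'rV[F]_3 * F) := #|[set b | dot p.1 b == (p.2 ^+ 2)%R]|.
rewrite -/(\sum_p fibre p)%N.
rewrite (bigID (fun p => p.1 == 0)) /= addnC.
rewrite (eq_bigr (fun=> (q ^ 2)%N)) => [|p p0]; last exact: card_dot_eq.
have -> : (\sum_(p : 'rV[F]_3 * F | p.1 == 0%R) fibre p = q ^ 3)%N.
  rewrite (bigD1 (0, 0)) //= {1}/fibre card_partA0_singular eqxx big1 ?addn0 // => -[a t] /= /andP[/eqP-> n0].
  by rewrite /fibre card_partA0_singular /=; case: ifP => // /eqP t0; rewrite t0 eqxx in n0.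
rewrite sum_nat_const (_ : #|_| = (q ^ 3 - 1) * q)%N.
  by move: q_gt1; clear; case: #|F| => // j _; rewrite !expnS expn0; nia.
have -> : #|[pred p : 'rV[F]_3 * F | p.1 != 0]| = #|setX [set~ 0 : 'rV[F]_3] [set: F]|.
  by apply: eq_card => p; rewrite !inE andbT.
by rewrite cardsX cardsT cardsC1 card_mx mul1n subn1.
Qed.

Definition singular_points := [set x : 'rV[F]_7 | (x != 0) && (Q6 x == 0)].

Lemma singular_pointsP x : reflect (x != 0 /\ Q6 x = 0) (x \in singular_points).
Proof. by rewrite inE; apply: (iffP andP) => -[x0 /eqP]. Qed.

Lemma card_singular_points_leq : (#|singular_points| <= q ^ 6 - 1)%N.
Proof.
have : (#|singular_points| < #|[set x : 'rV[F]_7 | Q6 x == 0%R]|)%N.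
  rewrite [X in (_ < X)%N](cardsD1 0) inE Q6E !parts0 dot0l expr0n subrr eqxx add1n ltnS.
  by apply: subset_leq_card; apply/subsetP => x; rewrite !inE.
by move/leq_trans/(_ card_singular_leq); case: (q ^ 6)%N => // k; rewrite subn1.
Qed.

Lemma card_hline_points l : l \in hlines -> #|[set x in singular_points | (x <= l)%MS]| = (q ^ 2 - 1)%N.
Proof.
move=> Ll; have := card_nonzero_vset l; rewrite (rank_hline Ll) => <-; apply: eq_card => x; rewrite !inE.
have [xl|] := boolP (x <= l)%MS; rewrite ?andbF ?andbT //.
by rewrite (hline_singular Ll xl) eqxx andbT.
Qed.

Lemma card_hlines_leq : (#|hlines| <= q ^ 5 + q ^ 4 + q ^ 3 + q ^ 2 + q + 1)%N.
Proof.
have := @eq_double_counting _ _ singular_points hlines (fun x l => (x <= l)%MS) q.+1 (q ^ 2 - 1).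
move=> /(_ _ card_hline_points) count.
have {}count : (#|singular_points| * q.+1 = #|hlines| * (q ^ 2 - 1))%N.
  by apply: count => x /singular_pointsP[x0 Qx]; apply: card_hlines_thru.
have qq : (0 < q ^ 2 - 1)%N by rewrite subn_gt0 -{1}(expn0 q) ltn_exp2l.
rewrite -(leq_pmul2r qq) -count; apply: leq_trans (leq_mul card_singular_points_leq (leqnn _)) _.
by move: q_gt1; clear; case: #|F| => // j _; apply: eq_leq; rewrite !expnS expn0; nia.
Qed.

(* A linear functional of y is ztrace (C y) for some octonion C; scalar C give the zero functional. *)
Lemma exists_annihilator S : (\rank S < 7)%N -> exists2 C, forall k, C != zscale k (zone F) &
  forall v, (v <= S)%MS -> ztrace (zmul C (zemb v)) = 0.
Proof.
move=> rS; have : (cokermx S)^T != 0 by rewrite -mxrank_eq0 mxrank_tr mxrank_coker subn_eq0 -ltnNge.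
case/rowV0Pn => c /submxP[D cS] c0; exists ((0, - partB c), (partA c, cd c 3)) => [k|v vS].
  apply: contra c0; rewrite /zscale !xpair_eqE mulr1 !scaler0 eq_sym oppr_eq0.
  move=> /andP[/andP[/eqP k0 /eqP B0] /andP[/eqP A0 /eqP t0]].
  by apply/eqP; apply: rV7_eq; rewrite ?A0 ?B0 ?t0 ?k0 ?mul0r ?parts0.
transitivity ((v *m c^T) 0 0).
  rewrite -[in RHS](mk7K v) -[in RHS](mk7K c) mxE !big_ord_recl big_ord0 !mxE /ztrace /= /dot !mxE.
  by rewrite /=; ring.
by rewrite cS trmx_mul trmxK mulmxA; move: vS; rewrite submxE => /eqP->; rewrite mul0mx mxE.
Qed.

Definition eigen C k x := zmul C (zemb x) == zscale k (zemb x).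

Lemma card_eigen C k : C != zscale k (zone F) -> (#|[set x | (x != 0%R) && eigen C k x]| <= q ^ 3 - 1)%N.
Proof.
move=> Ck; pose V := (\sum_(y | eigen C k y) <<y>>)%MS.
have inV v : (v <= V)%MS = eigen C k v.
  apply: sub_sums_closed => [|x y /eqP Cx /eqP Cy|s x /eqP Cx]; apply/eqP.
  - by rewrite zemb0 zscale0r zmul0r.
  - by rewrite zembD zmulDr Cx Cy zscaleDr.
  - by rewrite zembZ zmulZr Cx !zscaleA mulrC.
have rV : (\rank V <= 3)%N.
  by apply: singular_rank => v; rewrite inV => /eqP; apply: eigen_singular.
apply: (@leq_trans (q ^ \rank V - 1)%N); last by rewrite leq_sub2r // leq_pexp2l // ltnW.
rewrite -card_nonzero_vset; apply: subset_leq_card; apply/subsetP => x; rewrite !inE inV.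
by rewrite andbC.
Qed.

Lemma card_collinear_plane_sub S : (\rank S < 7)%N ->
  (#|[set x in singular_points | (collinear_plane x <= S)%MS]| <= 2 * (q ^ 3 - 1))%N.
Proof.
move=> rS; have [C Ck annih] := exists_annihilator rS; set Phi := [set x in _ | _].
have PhiP x : x \in Phi -> x != 0 /\ exists k, eigen C k x.
  rewrite inE => /andP[/singular_pointsP[x0 Qx] xS]; split=> //.
  have [y xy|k] := eigen_of_collinear_annihilator (C := C) x0 Qx; last by exists k; apply/eqP.
  by apply: annih; apply: submx_trans xS; rewrite in_collinear_plane.
have [->|[x /PhiP[x0 [k xk]]]] := set_0Vmem Phi; first by rewrite cards0.
have sub : Phi \subset [set x | (x != 0) && eigen C k x] :|: [set x | (x != 0) && eigen C (ztrace C - k) x].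
  apply/subsetP => y /PhiP[y0 [k' yk']]; rewrite !inE y0 /=.
  have root_k := eigen_root (zemb_neq0 x0) (eqP xk); have root_k' := eigen_root (zemb_neq0 y0) (eqP yk').
  have : (k' - k) * (k' - (ztrace C - k)) == 0.
    by apply/eqP; rewrite -[RHS](subrr 0) -{1}root_k' -root_k; ring.
  by rewrite mulf_eq0 !subr_eq0 => /orP[]/eqP<-; rewrite yk' ?orbT.
apply: leq_trans (subset_leq_card sub) _; apply: leq_trans (leq_card_setU _ _) _.
by rewrite mul2n -addnn leq_add // card_eigen.
Qed.

Section Hyperplane.
Variable S : 'M[F]_7.
Local Notation B := [set l in hlines | (l <= S)%MS].
Local Notation W := [set x in singular_points | (x <= S)%MS].
Local Notation Phi := [set x in singular_points | (collinear_plane x <= S)%MS].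

(* A point of W lies on one line of B, or on q + 1 if it belongs to Phi. *)
Lemma card_lines_in_hyperplane : (#|B| * (q ^ 2 - 1) <= #|W| + q * #|Phi|)%N.
Proof.
have -> : (#|B| * (q ^ 2 - 1) = \sum_(x in W) #|[set l in B | (x <= l)%MS]|)%N.
  rewrite (double_counting W B (fun x l => (x <= l)%MS)) -sum_nat_const; apply: eq_bigr => l.
  rewrite inE => /andP[Ll lS]; rewrite -(card_hline_points Ll); apply: eq_card => x; rewrite !inE.
  by have [xl|] := boolP (x <= l)%MS; rewrite ?andbF ?(submx_trans xl lS) ?andbT.
apply: (@leq_trans (\sum_(x in W) (1 + q * (x \in Phi)))%N).
  apply: leq_sum => x; rewrite [x \in W]inE => /andP[Wx xS]; have /singular_pointsP[x0 Qx] := Wx.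
  have [one|] := leqP #|[set l in B | (x <= l)%MS]| 1; first by apply: leq_trans one _; rewrite leq_addr.
  case/card_gt1P => l [m []]; rewrite !inE => /andP[/andP[Ll lS] xl] /andP[/andP[Lm mS] xm] nlm.
  have xPhi : (collinear_plane x <= S)%MS.
    by apply: submx_trans (collinear_plane_sub_meet Ll Lm nlm x0 xl xm) _; rewrite addsmx_sub lS.
  rewrite x0 Qx eqxx xPhi /= muln1 add1n -(card_hlines_thru x0 Qx); apply: subset_leq_card.
  by apply/subsetP => p; rewrite !inE => /andP[/andP[-> _] ->].
rewrite big_split /= sum1_card leq_add2l -big_distrr /= leq_mul2l; apply/orP; right.
rewrite -big_mkcondr /= sum1_card; apply: subset_leq_card; apply/subsetP => x.
by rewrite unfold_in /= => /andP[].
Qed.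

Lemma card_points_in_hyperplane : (#|W| * q.+1 <= #|B| * (q ^ 2 - 1) + (#|hlines| - #|B|) * q.-1)%N.
Proof.
have -> : (#|W| * q.+1 = \sum_(l in hlines) #|[set x in W | (x <= l)%MS]|)%N.
  rewrite -(double_counting W hlines (fun x l => (x <= l)%MS)) -sum_nat_const; apply: eq_bigr => x.
  by rewrite inE => /andP[/singular_pointsP[x0 Qx] _]; rewrite card_hlines_thru.
have -> : (#|hlines| - #|B| = #|[set l in hlines | ~~ (l <= S)%MS]|)%N.
  rewrite -(cardsID [set l | (l <= S)%MS] hlines) (_ : hlines :&: _ = B) ?addKn; last by apply/setP => l; rewrite !inE.
  by apply: eq_card => l; rewrite !inE andbC.
rewrite (bigID (fun l => (l <= S)%MS)) /= -!sum_nat_const; apply: leq_add.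
  rewrite (eq_bigl (fun l => l \in B)) => [|l]; last by rewrite inE.
  apply: leq_sum => l; rewrite inE => /andP[Ll _]; rewrite -(card_hline_points Ll).
  by apply: subset_leq_card; apply/subsetP => x; rewrite !inE => /andP[/andP[-> _] ->].
rewrite (eq_bigl (fun l => l \in [set l in hlines | ~~ (l <= S)%MS])) => [|l]; last by rewrite inE.
apply: leq_sum => l; rewrite inE => /andP[Ll nlS]; have rank_cap : (\rank (l :&: S)%MS <= 1)%N.
  rewrite leqNgt; apply: contra nlS => r2; apply: submx_trans (capmxSr l S).
  by apply: submx_rank_leq (capmxSl _ _) _; rewrite (rank_hline Ll).
apply: (@leq_trans (q ^ \rank (l :&: S)%MS - 1)%N).
  rewrite -card_nonzero_vset; apply: subset_leq_card; apply/subsetP => x.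
  by rewrite !inE sub_capmx => /andP[/andP[/andP[-> _] ->] ->].
by rewrite -subn1 leq_sub2r // -[X in (_ <= X)%N]expn1 leq_pexp2l // ltnW.
Qed.

End Hyperplane.

Lemma hyperplane_bound_arith (j s f h b : nat) :
  (0 < j -> b <= h -> b * (j.+1 ^ 2 - 1) <= s + j.+1 * f -> s * j.+2 <= b * (j.+1 ^ 2 - 1) + (h - b) * j ->
  f <= 2 * (j.+1 ^ 3 - 1) -> h <= j.+1 ^ 5 + j.+1 ^ 4 + j.+1 ^ 3 + j.+1 ^ 2 + j.+1 + 1 ->
  b <= j.+1 ^ 4 - j.+1 ^ 3 + 3 * j.+1 ^ 2 + 2 * j.+1)%N.
Proof.
move=> j0 bh lines_leq points_leq f_leq h_leq.
have weighted : (b * (j * (j.+1 ^ 2 + j.+1 + 1)) <= h * j + j.+1 * j.+2 * f)%N.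
  have e : (j.+1 ^ 2 - 1 = j * j.+2)%N by clear; rewrite expnS expn1; nia.
  rewrite e in lines_leq points_leq; have [d ed] : exists d, (h = b + d)%N by exists (h - b)%N; rewrite subnKC.
  have : (b * (j * j.+2) * j.+2 <= (s + j.+1 * f) * j.+2)%N by rewrite leq_mul.
  by move: points_leq; rewrite ed addKn mulnDl expnS expn1; clear; lia.
have scaled : (b * (j * (j.+1 ^ 2 + j.+1 + 1)) <= (j.+1 ^ 3 + 1 + 2 * (j.+1 * j.+2)) * (j * (j.+1 ^ 2 + j.+1 + 1)))%N.
  apply: leq_trans weighted _.
  apply: leq_trans (leq_add (leq_mul h_leq (leqnn j)) (leq_mul (leqnn (j.+1 * j.+2)) f_leq)) _.
  by apply: eq_leq; rewrite !expnS expn0; clear; nia.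
have {scaled} : (b <= j.+1 ^ 3 + 1 + 2 * (j.+1 * j.+2))%N.
  by move: scaled; rewrite leq_pmul2r // muln_gt0 j0 addn1.
move/leq_trans; apply; move: j0; clear; case: j => // j _.
have -> : (j.+2 ^ 4 - j.+2 ^ 3 = j.+2 ^ 3 * j.+1)%N by rewrite [(j.+2 ^ 4)%N]expnS; move: (j.+2 ^ 3)%N => i; nia.
by rewrite !expnS expn0; nia.
Qed.

Lemma nb_in_hlines_hyperplane S : (\rank S < 7)%N -> (nb_in hlines S <= q ^ 4 - q ^ 3 + 3 * q ^ 2 + 2 * q)%N.
Proof.
move=> rS; have B_leq : (nb_in hlines S <= #|hlines|)%N.
  by apply: subset_leq_card; apply/subsetP => l; rewrite inE => /andP[].
move: q_gt1 (card_lines_in_hyperplane S) (card_points_in_hyperplane S) (card_collinear_plane_sub rS) card_hlines_leq.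
case: #|F| => // j; rewrite ltnS => j0 lines_leq points_leq planes_leq hlines_leq.
exact: (hyperplane_bound_arith j0 B_leq lines_leq points_leq planes_leq hlines_leq).
Qed.

End HexCount.

(** * Transfer along an embedding *)

Section Transfer.
Variables (F : finFieldType) (N : nat) (M : 'M[F]_(7, N)) (L : {set 'M[F]_N}).
Local Notation q := #|F|.
Local Notation hlines := (hexagon_lines F).
Hypothesis freeM : row_free M.

Definition mx_image (h : 'M[F]_7) : 'M[F]_N := <<h *m M>>%MS.
Definition mx_preimage (S : 'M[F]_N) : 'M[F]_7 := kermx (M *m cokermx S).

Lemma mx_image_inj : {in hlines &, injective mx_image}.
Proof.
move=> h h' Lh Lh' e; apply: (hline_eq Lh Lh').
by rewrite -(submxMfree _ _ freeM) -(genmxE (h' *m M)) -/(mx_image h') -e genmxE.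
Qed.

Lemma sub_mx_preimage m (A : 'M[F]_(m, 7)) S : (A *m M <= S)%MS = (A <= mx_preimage S)%MS.
Proof. by rewrite submxE -mulmxA; apply/eqP/sub_kermxP. Qed.

Lemma rank_mx_preimage S : (\rank (mx_preimage S) <= \rank S)%N.
Proof. by rewrite -(mxrankMfree _ freeM) mxrankS // sub_mx_preimage. Qed.

Hypothesis L_image : L = [set mx_image h | h in hlines].

Lemma card_image_lines (PN : pred 'M[F]_N) (P7 : pred 'M[F]_7) :
  (forall h, h \in hlines -> PN (mx_image h) = P7 h) -> #|[set l in L | PN l]| = #|[set h in hlines | P7 h]|.
Proof.
move=> PE; rewrite -(@card_in_imset _ _ mx_image [set h in hlines | P7 h]); last first.
  by move=> h h'; rewrite !inE => /andP[Lh _] /andP[Lh' _]; apply: mx_image_inj.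
apply: eq_card => l; rewrite inE L_image; apply/andP/imsetP => [[/imsetP[h Lh ->] Ph]|[h]].
  by exists h; rewrite // inE Lh -PE.
by rewrite inE => /andP[Lh Ph] ->; rewrite imset_f // PE.
Qed.

Lemma nb_in_image S : nb_in L S = nb_in hlines (mx_preimage S).
Proof. by apply: card_image_lines => h _; rewrite genmxE sub_mx_preimage. Qed.

Lemma card_image_lines_thru (p : 'M[F]_N) : \rank p = 1%N -> #|[set l in L | (p <= l)%MS]| \in [:: 0%N; q.+1].
Proof.
move=> rp; have [|v [v0 vp]] := @exists_nonzero _ _ _ p; first by rewrite rp.
have pv : (p <= v)%MS by apply: submx_rank_leq vp _; rewrite rp rank_rV1.
have p_v (l : 'M[F]_N) : (p <= l)%MS = (v <= l)%MS by apply/idP/idP; apply: submx_trans.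
have [/existsP[x /andP[/eqP ev /eqP Qx]]|none] := boolP [exists x : 'rV[F]_7, (v == x *m M) && (Q6 x == 0%R)].
  have x0 : x != 0%R by apply: contraNneq v0 => x0; rewrite ev x0 mul0mx.
  rewrite (card_image_lines (P7 := fun h => (x <= h)%MS)) => [|h _].
    by rewrite card_hlines_thru // !inE eqxx orbT.
  by rewrite p_v ev genmxE submxMfree.
rewrite (card_image_lines (P7 := pred0)) => [|h Lh].
  by rewrite (eq_card0 (fun h => _)) // => h; rewrite inE andbF.
apply: contraNF none; rewrite p_v genmxE => /submxP[D eD]; apply/existsP; exists (D *m h)%R.
by rewrite -mulmxA -eD eqxx /=; apply/eqP/(hline_singular Lh)/submxMl.
Qed.

End Transfer.

Lemma hexagon_linesetP (F : finFieldType) n (L : {set 'M[F]_n.+1}) (M : 'M[F]_(7, n.+1)) :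
  (forall l, l \in L <-> exists h, hex_line h /\ l = <<h *m M>>%MS) <->
  L = [set mx_image M h | h in hexagon_lines F].
Proof.
split=> [LE|-> l].
  apply/setP => l; apply/idP/imsetP => [/LE[h [Lh ->]]|[h Lh ->]].
    by exists h => //; apply/hexagon_linesE.
  by apply/LE; exists h; split=> //; apply/hexagon_linesE.
split=> [/imsetP[h Lh ->]|[h [/hexagon_linesE Lh ->]]]; last exact: imset_f.
by exists h; split=> //; apply/hexagon_linesE.
Qed.

Lemma proj_sub_genmx (F : fieldType) m N k (S : 'M[F]_(m, N)) : \rank S = k.+1 -> proj_sub k <<S>>%MS.
Proof. by move=> rS; rewrite /proj_sub mxrank_gen rS genmx_id !eqxx. Qed.

Lemma nb_in_genmx (F : finFieldType) N (L : {set 'M[F]_N}) S : nb_in L <<S>>%MS = nb_in L S.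
Proof. by apply: eq_card => l; rewrite !inE genmxE. Qed.

Lemma flat_of_conditions (F : finFieldType) n (L : {set 'M[F]_n.+1}) :
  (forall l, l \in L -> proj_sub 1 l) ->
  (forall p : 'M[F]_n.+1, proj_sub 0 p -> #|[set l in L | (p <= l)%MS]| \in [:: 0%N; #|F|.+1]) ->
  (forall P : 'M[F]_n.+1, proj_sub 2 P -> nb_in L P \in [:: 0%N; 1%N; #|F|.+1]) ->
  (forall S : 'M[F]_n.+1, proj_sub 3 S -> nb_in L S \in [:: 0%N; 1%N; #|F|.+1; (2 * #|F|).+1]) ->
  flat L.
Proof.
move=> lines Pt Pl Sd; split.
- by move=> l /lines/andP[/eqP].
- by move=> l /lines/andP[_ /eqP].
- move=> x /andP[x0 nx]; have := Pt <<x>>%MS (proj_sub_genmx (rank_rV1 x0)).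
  have -> : [set l in L | (<<x>> <= l)%MS] = lines_thru L x by apply/setP => l; rewrite !inE genmxE.
  by rewrite !inE cards_eq0 (negbTE nx) => /eqP.
- by move=> S rS; rewrite -nb_in_genmx; apply/Pl/proj_sub_genmx.
- by move=> S rS; rewrite -nb_in_genmx; apply/Sd/proj_sub_genmx.
Qed.

Lemma hexagon_lineset_of_bounds (F : finFieldType) n (L : {set 'M[F]_n.+1}) : L != set0 -> flat L ->
  (#|L| <= #|F| ^ 5 + #|F| ^ 4 + #|F| ^ 3 + #|F| ^ 2 + #|F| + 1)%N ->
  (forall H : 'M[F]_n.+1, \rank H = 6%N -> (nb_in L H <= #|F| ^ 4 - #|F| ^ 3 + 3 * #|F| ^ 2 + 2 * #|F|)%N) ->
  is_hexagon_lineset L.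
Proof.
case/set0Pn => l Ll flatL line_bound hyperplane_bound.
have [|x [x0 xl]] := @exists_nonzero _ _ _ l; first by rewrite (rank_line flatL Ll).
have Px : covered L x := line_covered Ll x0 xl.
have [A [B [e fr]]] := exists_frame flatL line_bound hyperplane_bound Px.
have [M [freeM emb]] := hexagon_embedding flatL line_bound hyperplane_bound fr.
split; first exact: (rank_sum_lines fr).
exists M; split=> //; apply/hexagon_linesetP/eqP; rewrite eqEcard; apply/andP; split.
  by apply/subsetP => p /emb[h [/hexagon_linesE Lh ->]]; apply: imset_f.
rewrite card_in_imset; last exact: mx_image_inj.
exact: leq_trans (card_hlines_leq F) (card_lines_geq flatL line_bound hyperplane_bound Ll).
Qed.

Local Close Scope ring_scope.

Theorem theorem2 (F : finFieldType) (n : nat) (L : {set 'M[F]_n.+1}) :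
  (2 <= n)%N ->
  (forall l, l \in L -> proj_sub 1 l) ->
  L != set0 ->
  is_hexagon_lineset L <->
  [/\ (* (Pt) *)
      (forall p : 'M[F]_n.+1, proj_sub 0 p ->
         #|[set l in L | (p <= l)%MS]| \in [:: 0%N; #|F|.+1]),
      (* (Pl) *)
      (forall P : 'M[F]_n.+1, proj_sub 2 P -> nb_in L P \in [:: 0%N; 1%N; #|F|.+1]),
      (* (Sd) *)
      (forall S : 'M[F]_n.+1, proj_sub 3 S ->
         nb_in L S \in [:: 0%N; 1%N; #|F|.+1; (2 * #|F|).+1]),
      (* (Hp') *)
      (forall H : 'M[F]_n.+1, proj_sub 5 H ->
         (nb_in L H <= #|F| ^ 4 - #|F| ^ 3 + 3 * #|F| ^ 2 + 2 * #|F|)%N)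
    & (* (To) *)
      (#|L| <= #|F| ^ 5 + #|F| ^ 4 + #|F| ^ 3 + #|F| ^ 2 + #|F| + 1)%N].
Proof.
move=> _ lines L0; split=> [[_ [M [freeM /hexagon_linesetP L_image]]]|[Pt Pl Sd Hp To]].
  split.
  - by move=> p /andP[/eqP rp _]; apply: card_image_lines_thru freeM L_image _ rp.
  - move=> P /andP[/eqP rP _]; rewrite (nb_in_image freeM L_image); apply: nb_in_hlines_plane.
    by rewrite (leq_trans (rank_mx_preimage freeM _)) // rP.
  - move=> S /andP[/eqP rS _]; rewrite (nb_in_image freeM L_image); apply: nb_in_hlines_solid.
    by rewrite (leq_trans (rank_mx_preimage freeM _)) // rS.
  - move=> H /andP[/eqP rH _]; rewrite (nb_in_image freeM L_image); apply: nb_in_hlines_hyperplane.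
    by rewrite (leq_ltn_trans (rank_mx_preimage freeM _)) // rH.
  - by rewrite L_image card_in_imset ?card_hlines_leq //; apply: mx_image_inj.
apply: hexagon_lineset_of_bounds (flat_of_conditions lines Pt Pl Sd) To _ => // H rH.
by rewrite -nb_in_genmx; apply/Hp/proj_sub_genmx.
Qed.
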